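(* Let $n\geq 3$ and let $M^n \subset S^{n-1+\frac12 n(n+1)}$ be an $n$-dimensional homogeneous submanifold of the unit sphere of $\mathbb{R}^{n+\frac12 n(n+1)}$. Then $M$ is a (full) Veronese submanifold if and only if the restricted normal holonomy group of $M$ (as a submanifold of the sphere) acts irreducibly on the normal space to $M$ in the sphere and does not act transitively on the unit sphere of that normal space.
   Context: Homogeneous submanifold: an orbit $M=H.v$ of a connected Lie group $H$ of linear isometries of the ambient Euclidean space. Normal holonomy: for a submanifold $M$ of the unit sphere $S^{N-1}\subset\mathbb{R}^N$ and $p\in M$, let $\bar\nu_p(M)=\{p\}^\perp\cap\nu_p(M)$ be the normal space of $M$ in the sphere ($\nu_p(M)$ is the normal space in $\mathbb{R}^N$). The restricted normal holonomy group at $p$ is the group of $\nabla^\perp$-parallel transports along null-homotopic piecewise smooth loops based at $p$, acting on $\bar\nu_p(M)$. It is called transitive if it is transitive on the unit sphere of $\bar\nu_p(M)$. Veronese submanifold: let $\mathrm{SO}(n+1)$ act by conjugation on the Euclidean space $Sim_0(n+1)$ of traceless real symmetric $(n+1)\times(n+1)$ matrices (inner product proportional to $\mathrm{trace}(AB)$). A Veronese-type orbit is the orbit $\mathrm{SO}(n+1).S$ of a matrix $S\in Sim_0(n+1)$ with exactly two eigenvalues, one of multiplicity $1$ and the other of multiplicity $n$. A Euclidean submanifold is a Veronese submanifold if it is extrinsically isometric (congruent) to a Veronese-type orbit. Full means not contained in a proper affine subspace of the ambient Euclidean space. *)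

(* Defs.v *)
From HB Require Import structures.
From mathcomp Require Import all_boot all_order all_algebra.
From mathcomp Require Import all_classical all_reals all_analysis.
Set Implicit Arguments.
Unset Strict Implicit.
Unset Printing Implicit Defensive.
Import Order.TTheory GRing.Theory Num.Theory.
Import numFieldNormedType.Exports.
Local Open Scope classical_set_scope.
Local Open Scope ring_scope.

(* Points and vectors of R^N are column vectors with the standard inner
   product; a submanifold of R^N is represented by its underlying set. *)
Definition dotp (R : realType) (N : nat) (u v : 'cV[R]_N) : R :=
  (u^T *m v) 0 0.

Definition expmx (R : realType) (N : nat) (A : 'M[R]_N) : 'M[R]_N :=
  limn (series (fun k : nat => k`!%:R^-1 *: A ^+ k)).

(* H is the connected Lie subgroup of O(N) whose Lie algebra is some
   subalgebra h of so(N), i.e. the subgroup generated by exp(h), which is not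
   required to be closed in O(N). No inverses are needed in the products since
   exp(A)^-1 = exp(-A). *)
Definition connected_isometry_group (R : realType) (N : nat)
    (H : set 'M[R]_N) : Prop :=
  exists h : {vspace 'M[R]_N},
    [/\ forall A, A \in h -> A^T = - A,
        forall A B, A \in h -> B \in h -> A *m B - B *m A \in h &
        H = [set g | exists2 s : seq 'M[R]_N,
               {subset s <= h} & g = \prod_(A <- s) expmx A]].

Definition homogeneous (R : realType) (N : nat) (M : set 'cV[R]_N) : Prop :=
  exists (H : set 'M[R]_N) (v : 'cV[R]_N),
    connected_isometry_group H /\ M = [set g *m v | g in H].

Definition smooth_curve (R : realType) (N : nat) (c : R -> 'cV[R]_N) : Prop :=
  forall (k : nat) (t : R), derivable (derive1n k c) t 1.

(* An orbit M is an initial submanifold of R^N (a leaf of a foliation of the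
   compact orbit of the closure of H). Hence a curve, or a homotopy, with
   values in M is smooth, or continuous, for the manifold structure of M as
   soon as it is so as a map into R^N; this is what makes the descriptions
   below, in terms of maps into R^N with values in M, correct even when the
   orbit is not closed. *)
Definition tangent (R : realType) (N : nat) (M : set 'cV[R]_N)
    (p : 'cV[R]_N) : set 'cV[R]_N :=
  [set u | exists c : R -> 'cV[R]_N,
     [/\ smooth_curve c, forall t, M (c t), c 0 = p & derive1 c 0 = u]].

Definition has_dim (R : realType) (N : nat) (M : set 'cV[R]_N) (n : nat) :
    Prop :=
  forall p, M p -> exists T : {vspace 'cV[R]_N},
    \dim T = n /\ forall u, tangent M p u <-> u \in T.

Definition normal (R : realType) (N : nat) (M : set 'cV[R]_N)
    (p : 'cV[R]_N) : set 'cV[R]_N :=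
  [set x | forall u, tangent M p u -> dotp u x = 0].

Definition sphere_normal (R : realType) (N : nat) (M : set 'cV[R]_N)
    (p : 'cV[R]_N) : set 'cV[R]_N :=
  [set x | dotp p x = 0] `&` normal M p.

(* On each closed piece the curve extends to a smooth curve of R^N;
   continuity on [0, 1] follows, as consecutive pieces share an endpoint. *)
Definition piecewise_smooth (R : realType) (N : nat) (c : R -> 'cV[R]_N) :
    Prop :=
  exists2 s : seq R, itv_partition 0 1 s &
    forall i, (i < size s)%N -> exists2 g : R -> 'cV[R]_N, smooth_curve g &
      forall t : R, t \in `[nth 0 (0 :: s) i, nth 0 s i] -> c t = g t.

(* xi is a piecewise smooth normal field along c|[0, 1] which is parallel for
   the normal connection of M in the sphere: the orthogonal projection of its
   derivative to the normal space in the sphere vanishes (at a break point,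
   both one-sided derivatives are considered). *)
Definition parallel_normal (R : realType) (N : nat) (M : set 'cV[R]_N)
    (c xi : R -> 'cV[R]_N) : Prop :=
  (forall t : R, t \in `[0, 1] -> sphere_normal M (c t) (xi t)) /\
  exists2 s : seq R, itv_partition 0 1 s &
    forall i, (i < size s)%N -> exists2 zeta : R -> 'cV[R]_N,
      smooth_curve zeta &
      forall t : R, t \in `[nth 0 (0 :: s) i, nth 0 s i] ->
        xi t = zeta t /\
        forall eta, sphere_normal M (c t) eta -> dotp eta (derive1 zeta t) = 0.

Definition null_homotopic (R : realType) (N : nat) (M : set 'cV[R]_N)
    (p : 'cV[R]_N) (c : R -> 'cV[R]_N) : Prop :=
  exists F : R * R -> 'cV[R]_N,
    [/\ {within `[0, 1] `*` `[0, 1], continuous F},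
        forall s t : R, s \in `[0, 1] -> t \in `[0, 1] -> M (F (s, t)),
        forall t : R, t \in `[0, 1] -> F (0, t) = c t /\ F (1, t) = p &
        forall s : R, s \in `[0, 1] -> F (s, 0) = p /\ F (s, 1) = p].

Definition null_homotopic_loop (R : realType) (N : nat) (M : set 'cV[R]_N)
    (p : 'cV[R]_N) (c : R -> 'cV[R]_N) : Prop :=
  [/\ piecewise_smooth c, forall t : R, t \in `[0, 1] -> M (c t),
      c 0 = p, c 1 = p & null_homotopic M p c].

(* The elements are functions on R^N of which only the restriction to
   sphere_normal M p, where they are the parallel transport along a loop, is
   relevant. *)
Definition restricted_holonomy (R : realType) (N : nat) (M : set 'cV[R]_N)
    (p : 'cV[R]_N) : set ('cV[R]_N -> 'cV[R]_N) :=
  [set tau | exists2 c : R -> 'cV[R]_N, null_homotopic_loop M p c &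
     forall x, sphere_normal M p x -> exists xi : R -> 'cV[R]_N,
       [/\ parallel_normal M c xi, xi 0 = x & xi 1 = tau x]].

Definition acts_irreducibly (R : realType) (N : nat)
    (G : set ('cV[R]_N -> 'cV[R]_N)) (V : set 'cV[R]_N) : Prop :=
  (exists2 x, V x & x != 0) /\
  forall W : {vspace 'cV[R]_N},
    (forall x, x \in W -> V x) ->
    (forall tau x, G tau -> x \in W -> tau x \in W) ->
    W = 0%VS \/ (forall x, V x -> x \in W).

Definition acts_transitively_on_unit_sphere (R : realType) (N : nat)
    (G : set ('cV[R]_N -> 'cV[R]_N)) (V : set 'cV[R]_N) : Prop :=
  forall x y, V x -> V y -> dotp x x = 1 -> dotp y y = 1 ->
    exists2 tau, G tau & tau x = y.

Definition Sim0 (R : realType) (m : nat) : set 'M[R]_m :=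
  [set A | A^T = A /\ \tr A = 0].

Definition SO_orbit (R : realType) (m : nat) (S : 'M[R]_m) : set 'M[R]_m :=
  [set Q *m S *m Q^T | Q in [set Q | Q *m Q^T = 1%:M /\ \det Q = 1]].

(* The multiplicity of an eigenvalue of the symmetric matrix S is the dimension
   of its eigenspace. *)
Definition veronese_type (R : realType) (n : nat) (S : 'M[R]_n.+1) : Prop :=
  Sim0 S /\
  exists a b : R,
    [/\ a != b, forall x, eigenvalue S x = (x == a) || (x == b),
        \rank (eigenspace S a) = 1%N & \rank (eigenspace S b) = n].

(* The congruence is A |-> phi A + b, where phi restricts to a linear isometry
   of Sim0, with inner product k * trace(A B), into R^N; the values of phi
   outside Sim0 are irrelevant. *)
Definition veronese (R : realType) (n N : nat) (M : set 'cV[R]_N) : Prop :=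
  exists (S : 'M[R]_n.+1) (k : R) (phi : {linear 'M[R]_n.+1 -> 'cV[R]_N})
         (b : 'cV[R]_N),
    [/\ veronese_type S, 0 < k,
        forall A B, Sim0 A -> Sim0 B ->
          dotp (phi A) (phi B) = k * \tr (A *m B) &
        M = [set phi A + b | A in SO_orbit S]].

Definition full (R : realType) (N : nat) (M : set 'cV[R]_N) : Prop :=
  forall (W : {vspace 'cV[R]_N}) (a : 'cV[R]_N),
    (forall x, M x -> x - a \in W) -> W = fullv.

(* Main.v *)
Require Import Defs.
From HB Require Import structures.
From mathcomp Require Import all_boot all_order all_algebra.
From mathcomp Require Import all_classical all_reals all_analysis.
From mathcomp Require Import ring lra zify.
Set Implicit Arguments.
Unset Strict Implicit.
Unset Printing Implicit Defensive.
Import Order.TTheory GRing.Theory Num.Theory.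
Import numFieldNormedType.Exports.
Local Open Scope classical_set_scope.
Local Open Scope ring_scope.

(* Words of exponentials with letters in the Lie algebra [h] act transitively
   on [M], and normal parallel transport along a word is a word in the
   compressions [nu X] of its letters to the normal space. Lassos around small
   parallelograms show that the holonomy contains curves tangent to all
   conjugates of the normal curvatures [ncurv X Y]; conversely, subdividing a
   null homotopy shows that it preserves every subspace stable under the Lie
   algebra [g] generated by these conjugates.

   If [g] is irreducible and the holonomy is not transitive, every nonzero
   normal vector [v] admits some [eta], not a multiple of [v], orthogonal to
   [g v]. By the Ricci equation [g] contains the curvature operators built from
   the commutators [[A xi, A eta]] of shape operators, which forces [A] to be
   injective; the codimension being maximal, the traceless part of [A] is a
   homothety onto [Sim0 n] for which the skew normalizer of [g] is [so(n)]. The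
   equations of Gauss and Codazzi then identify the action of [h] on the ambient
   space with that of [so(n + 1)] on [Sim0 (n + 1)].

   Conversely, the normal space of a Veronese orbit at the point defined by a
   unit vector [q] consists of the traceless symmetric [Y] with [Y q = 0]. The
   normal curvatures generate the irreducible action of [so(n)] on it, and
   [tr (Y ^ 3)] is constant along parallel normal fields, so that the holonomy
   is not transitive. *)

(** The orbit need not be closed, and the restricted holonomy is only a set of transports along
    loops with continuous null homotopies. Its Lie algebra is therefore never formed. Transitivity
    uses only the elements realised by contractible words ([word_holonomy]), which are plentiful
    enough to fill a sphere ([orbit_sphere]). Irreducibility only asks that subspaces stable under
    [g] be preserved. Since the orbit may accumulate on itself, a curve or a homotopy given as a map
    into R^N with values in [M] must be shown not to jump between the sheets of [M] near a point.
    Each sheet has a fixed coordinate in a transverse slice, and words with rational parameters show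
    that only countably many such coordinates occur, so a continuous curve keeps its own. All
    comparisons of transports are made to first order by little-o estimates, whence charts that are
    merely Lipschitz, and scalar functions shown constant because their derivative vanishes. *)

(** * The sup norm of matrices *)

Lemma norm_mx_le (R : realType) m n (A : 'M[R]_(m, n)) (e : R) :
  0 <= e -> (`|A| <= e) <-> (forall i j, `|A i j| <= e).
Proof.
move=> e0; rewrite /Num.Def.normr/= mx_normrE; split.
  move=> H i j; apply: le_trans H.
  exact: (le_bigmax _ (fun ij : 'I_m * 'I_n => `|A ij.1 ij.2|) (i, j)).
by move=> H; apply: bigmax_le => // -[i j] _; exact: H.
Qed.

Lemma norm_entry (R : realType) m n (A : 'M[R]_(m, n)) i j : `|A i j| <= `|A|.
Proof. by move: i j; apply/norm_mx_le. Qed.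

Lemma norm_mulmx (R : realType) m n p (A : 'M[R]_(m, n)) (B : 'M[R]_(n, p)) :
  `|A *m B| <= n%:R * `|A| * `|B|.
Proof.
apply/norm_mx_le => [|i j]; first by rewrite !mulr_ge0.
rewrite mxE (le_trans (ler_norm_sum _ _ _))//.
rewrite -mulrA mulr_natl -[X in _ *+ X]card_ord -sumr_const ler_sum// => k _.
by rewrite normrM ler_pM// norm_entry.
Qed.

Lemma norm_trmx (R : realType) m n (A : 'M[R]_(m, n)) : `|A^T| = `|A|.
Proof.
apply/eqP; rewrite eq_le; apply/andP; split.
  by apply/norm_mx_le => // i j; rewrite mxE norm_entry.
by apply/norm_mx_le => // i j; have := norm_entry A^T j i; rewrite mxE.
Qed.

(** * Derivatives of matrix-valued curves *)

Section matrix_derivatives.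
Variable R : realType.

Lemma is_derive_mxP m n (M : R -> 'M[R]_(m, n)) (t : R) (D : 'M[R]_(m, n)) :
  is_derive t 1 M D <-> forall i j, is_derive t 1 (fun x => M x i j) (D i j).
Proof.
split=> [[dM <-] i j|H].
  by rewrite derive_mx// mxE; apply: DeriveDef => //; apply: (derivable_mxP M t 1).1.
have dM : derivable M t 1 by apply/derivable_mxP => i j; case: (H i j).
apply: DeriveDef => //; rewrite derive_mx//; apply/matrixP => i j.
by rewrite mxE; case: (H i j).
Qed.

Lemma is_derive_mulmx m n p (f : R -> 'M[R]_(m, n)) (g : R -> 'M[R]_(n, p)) (t : R) df dg :
  is_derive t 1 f df -> is_derive t 1 g dg ->
  is_derive t 1 (fun x => f x *m g x) (df *m g t + f t *m dg).
Proof.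
move=> /is_derive_mxP Hf /is_derive_mxP Hg; apply/is_derive_mxP => i j.
have -> : (fun x => (f x *m g x) i j) = \sum_k (fun x => f x i k * g x k j).
  by apply/funext => x; rewrite mxE fct_sumE.
rewrite !mxE -big_split/=.
apply: (@is_derive_sum _ _ _ _ (fun k x => f x i k * g x k j)) => k.
have := is_deriveM (Hf i k) (Hg k j).
by move=> H; apply: (is_derive_eq H); rewrite /GRing.scale/= addrC [g t k j * _]mulrC.
Qed.

Lemma is_derive_cstmul m n p (A : 'M[R]_(m, n)) (g : R -> 'M[R]_(n, p)) (t : R) dg :
  is_derive t 1 g dg -> is_derive t 1 (fun x => A *m g x) (A *m dg).
Proof.
move=> H; have := is_derive_mulmx (is_derive_cst A t 1) H.
by move=> H'; apply: (is_derive_eq H'); rewrite mul0mx add0r.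
Qed.

Lemma is_derive_mulcst m n p (A : 'M[R]_(n, p)) (g : R -> 'M[R]_(m, n)) (t : R) dg :
  is_derive t 1 g dg -> is_derive t 1 (fun x => g x *m A) (dg *m A).
Proof.
move=> H; have := is_derive_mulmx H (is_derive_cst A t 1).
by move=> H'; apply: (is_derive_eq H'); rewrite mulmx0 addr0.
Qed.

Lemma is_derive_trmx m n (g : R -> 'M[R]_(m, n)) (t : R) dg :
  is_derive t 1 g dg -> is_derive t 1 (fun x => (g x)^T) dg^T.
Proof.
move=> /is_derive_mxP H; apply/is_derive_mxP => i j; rewrite mxE.
by have -> : (fun x => (g x)^T i j) = (fun x => g x j i) by apply/funext => x; rewrite mxE.
Qed.

(** The little-o form trades the difference quotient for an estimate that can also be restricted to
    a segment; later expansions work with it. *)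
Lemma is_derive_oP (V : normedModType R) (f : R -> V) (t : R) v :
  is_derive t 1 f v <-> forall e : R, 0 < e -> exists2 d : R, 0 < d &
    forall h, `|h| < d -> `|f (h + t) - f t - h *: v| <= e * `|h|.
Proof.
split=> [[dv <-] e e0|H].
  have : h^-1 *: (f (h *: (1 : R) + t) - f t) @[h --> 0^'] --> 'D_1 f t by exact: dv.
  move=> /cvgrPdist_le/(_ _ e0)[d /= d0 dH]; exists d => // h hd.
  have [->|h0] := eqVneq h 0; first by rewrite !scale0r !add0r subrr subr0 !normr0 mulr0.
  have := dH h; rewrite /ball_ /= sub0r normrN => /(_ hd h0).
  rewrite -[h *: (1 : R)]/(h * 1) mulr1 => K.
  have -> : f (h + t) - f t - h *: 'D_1 f t =
     - (h *: ('D_1 f t - h^-1 *: (f (h + t) - f t))).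
    by rewrite scalerBr scalerA divff// scale1r opprB.
  by rewrite normrN normrZ mulrC ler_wpM2r.
suff K : h^-1 *: (f (h *: (1 : R) + t) - f t) @[h --> 0^'] --> v.
  by apply: DeriveDef; [apply/cvg_ex; exists v | exact: cvg_lim].
apply/cvgrPdist_le => e e0; have [d d0 dH] := H e e0; exists d => //= h.
rewrite /ball_ /= sub0r normrN => hd h0.
rewrite -[h *: (1 : R)]/(h * 1) mulr1.
have -> : v - h^-1 *: (f (h + t) - f t) = - (h^-1 *: (f (h + t) - f t - h *: v)).
  by rewrite [in RHS]scalerBr scalerA mulVf// scale1r opprB.
rewrite normrN normrZ normfV mulrC ler_pdivrMr ?normr_gt0//; exact: dH.
Qed.

Lemma is_derive_affine (V : normedModType R) (f : R -> V) (a b t : R) df :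
  is_derive (a * t + b) 1 f df -> is_derive t 1 (fun x => f (a * x + b)) (a *: df).
Proof.
move=> /is_derive_oP H; apply/is_derive_oP => e e0.
have a1 : 0 < `|a| + 1 by rewrite ltr_wpDl.
have [d d0 dH] := H _ (divr_gt0 e0 a1).
exists (d / (`|a| + 1)) => [|h hd]; first exact: divr_gt0.
have ahd : `|a * h| <= (`|a| + 1) * `|h|.
  by rewrite normrM ler_wpM2r// lerDl.
have := dH (a * h).
have -> : a * h + (a * t + b) = a * (h + t) + b by ring.
rewrite scalerA [h * a]mulrC => /(_ _)/le_trans -> //.
  by rewrite (le_lt_trans ahd)// mulrC -ltr_pdivlMr.
apply: (le_trans (ler_wpM2l _ ahd)); first by rewrite divr_ge0// ltW.
by rewrite mulrA divfK// gt_eqF.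
Qed.

Lemma is_derive_dist (V : normedModType R) (f : R -> V) (t : R) v :
  is_derive t 1 f v -> forall e : R, 0 < e -> exists2 d : R, 0 < d &
    forall s, `|s - t| < d -> `|f s - f t - (s - t) *: v| <= e * `|s - t|.
Proof.
move=> /is_derive_oP H e e0; have [d d0 dH] := H e e0; exists d => // s sd.
by have := dH (s - t) sd; rewrite subrK.
Qed.

Lemma is_derive0_cst m n (f : R -> 'M[R]_(m, n)) :
  (forall x : R, is_derive x 1 f 0) -> forall x y, f x = f y.
Proof.
move=> H x y; apply/matrixP => i j.
apply: (@is_derive_0_is_cst _ (fun t => f t i j)) => t.
by have /is_derive_mxP/(_ i j) := H t; rewrite mxE.
Qed.

End matrix_derivatives.

(** * The matrix exponential and linear differential equations *)

Section matrix_exponential.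
Variables (R : realType) (N : nat).
Implicit Types (A B : 'M[R]_N).

(** For fixed [A] each entry of the exponential is a scalar power series in [t], so termwise
    differentiation of scalar series gives the derivative. *)
Let coef A i j (k : nat) : R := k`!%:R^-1 * (A ^+ k) i j.

Lemma norm_mx1 : `|(1 : 'M[R]_N)| <= 1.
Proof.
by apply/norm_mx_le => // i j; rewrite mxE; case: eqP => _; rewrite ?normr1 ?normr0.
Qed.

Lemma norm_mxX A k : `|A ^+ k| <= (N%:R * `|A|) ^+ k.
Proof.
elim: k => [|k IH]; first by rewrite !expr0 norm_mx1.
rewrite !exprS (le_trans (norm_mulmx _ _))// ler_wpM2l// mulr_ge0//.
Qed.

Let cvg_coef A i j t : cvgn (pseries (coef A i j) t).
Proof.
apply: normed_cvg.
(* The entries of the k-th power are at most the k-th power of N |A|, so the scalar exponential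
   series at N |A| |t| dominates. *)
apply: (@series_le_cvg _ _ (exp_coeff (N%:R * `|A| * `|t|))).
- by move=> k /=.
- by move=> k; rewrite /exp_coeff/= mulr_ge0// exprn_ge0// !mulr_ge0.
- move=> k; rewrite /exp_coeff/= /coef normrM normrM normrX [leRHS]mulrC exprMn.
  rewrite mulrA ler_wpM2r// ?exprn_ge0//.
  rewrite normfV normr_nat ler_wpM2l//.
  exact: le_trans (norm_entry _ _ _) (norm_mxX _ _).
- exact: is_cvg_series_exp_coeff.
Qed.

Lemma coef_diffs A i j : pseries_diffs (coef A i j) =
  fun k => k`!%:R^-1 * (A ^+ k.+1) i j.
Proof.
apply/funext => k; rewrite /pseries_diffs /coef factS natrM invfM mulrA mulrA.
by rewrite divff ?mul1r// pnatr_eq0.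
Qed.

(** Termwise differentiation asks for convergence of the series derived once and twice; their
    coefficients are entries of [A ^+ (k + 1)] and [A ^+ (k + 2)], hence combinations of the entries
    of [A ^+ k]. *)
Let cvg_coefS A i j m t : cvgn (pseries (fun k => k`!%:R^-1 * (A ^+ (k + m)%N) i j) t).
Proof.
have -> : pseries (fun k => k`!%:R^-1 * (A ^+ (k + m)%N) i j) t =
  \sum_l (fun n => (A ^+ m) l j * pseries (coef A i l) t n).
  apply/funext => n; rewrite fct_sumE /pseries /series/=.
  under [RHS]eq_bigr do rewrite mulr_sumr.
  rewrite exchange_big/=; apply: eq_bigr => k _.
  rewrite exprD -mulmxE mxE mulr_sumr mulr_suml; apply: eq_bigr => l _.
  rewrite /coef; ring.
apply: (big_ind (fun f : nat -> R => cvgn f)) => //.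
- exact: is_cvg_cst.
- by move=> f g cf cg; exact: is_cvgD.
- by move=> l _; apply: is_cvgMr; exact: cvg_coef.
Qed.

Let expmx_term A t k : k`!%:R^-1 *: (t *: A) ^+ k = (k`!%:R^-1 * t ^+ k) *: A ^+ k.
Proof.
rewrite -scalerA; congr (_ *: _).
elim: k => [|l IHl]; first by rewrite !expr0 scale1r.
by rewrite !exprS IHl -!mulmxE -scalemxAl -scalemxAr scalerA.
Qed.

Lemma expmx_entry A t i j : expmx (t *: A) i j = limn (pseries (coef A i j) t).
Proof.
pose L : 'M[R]_N := \matrix_(i, j) limn (pseries (coef A i j) t).
suff : series (fun k => k`!%:R^-1 *: (t *: A) ^+ k) @ \oo --> L.
  by move=> /cvg_lim; rewrite /expmx => ->//; rewrite mxE.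
apply/cvgrPdist_le => e e0; near=> n.
apply/norm_mx_le; first exact: ltW.
move=> a b; rewrite !mxE /series/= summxE.
under eq_bigr do rewrite expmx_term mxE.
have -> : \sum_(0 <= k < n) k`!%:R^-1 * t ^+ k * (A ^+ k) a b = pseries (coef A a b) t n.
  by rewrite /pseries/series/=; apply: eq_bigr => k _; rewrite /coef mulrAC.
move: a b; near: n.
apply: filter_forall => a; apply: filter_forall => b.
have := @cvg_coef A a b t => /cvgrPdist_le/(_ _ e0); exact.
Unshelve. all: by end_near. Qed.

Lemma expmx_cvg A : series (fun k => k`!%:R^-1 *: A ^+ k) @ \oo --> expmx A.
Proof.
rewrite -[A in expmx A]scale1r.
apply/cvgrPdist_le => e e0; near=> n.
apply/norm_mx_le; first exact: ltW.
move=> a b; rewrite mxE expmx_entry mxE /series/= summxE.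
have -> : \sum_(0 <= k < n) (k`!%:R^-1 *: A ^+ k) a b = pseries (coef A a b) 1 n.
  by rewrite /pseries/series/=; apply: eq_bigr => k _; rewrite mxE /coef expr1n mulr1.
move: a b; near: n.
apply: filter_forall => a; apply: filter_forall => b.
have := @cvg_coef A a b 1 => /cvgrPdist_le/(_ _ e0); exact.
Unshelve. all: by end_near. Qed.

Lemma is_derive_expmx A (t : R) :
  is_derive t 1 (fun x => expmx (x *: A)) (A *m expmx (t *: A)).
Proof.
apply/is_derive_mxP => i j.
rewrite (_ : (fun x => _) = fun x => limn (pseries (coef A i j) x)); last first.
  by apply/funext => x; rewrite expmx_entry.
have E2 : pseries_diffs (pseries_diffs (coef A i j)) =
    fun k => k`!%:R^-1 * (A ^+ (k + 2)) i j.
  rewrite coef_diffs; apply/funext => k; rewrite /pseries_diffs factS natrM invfM !mulrA.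
  by rewrite divff ?mul1r ?pnatr_eq0// addn2.
have E1 : pseries_diffs (coef A i j) = fun k => k`!%:R^-1 * (A ^+ (k + 1)) i j.
  by rewrite coef_diffs; apply/funext => k; rewrite addn1.
have := @pseries_snd_diffs R (coef A i j) (`|t| + 1) t (@cvg_coef _ _ _ _).
rewrite E2 E1 => H.
have {}H := H (@cvg_coefS A i j 1 _) (@cvg_coefS A i j 2 _).
apply: (is_derive_eq (H _)).
  by rewrite [ltRHS]ger0_norm ?addr_ge0// ltrDl.
rewrite mxE.
under [RHS]eq_bigr do rewrite expmx_entry.
apply: cvg_lim => //.
have -> : pseries (fun k => k`!%:R^-1 * (A ^+ (k + 1)) i j) t =
  fun n => \sum_l A i l * pseries (coef A l j) t n.
  apply/funext => n; rewrite /pseries /series/=.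
  under [RHS]eq_bigr do rewrite mulr_sumr.
  rewrite exchange_big/=; apply: eq_bigr => k _.
  rewrite addn1 exprS -mulmxE mxE mulr_sumr mulr_suml; apply: eq_bigr => l _.
  rewrite /coef; ring.
apply: cvg_big => [|l _]; last by apply: cvgMr; exact: cvg_coef.
by move=> ?; apply: add_continuous.
Qed.

End matrix_exponential.

Section linear_maps.
Variable R : realType.

Lemma linear_bounded m n (V : normedModType R) (f : {linear 'M[R]_(m, n) -> V}) :
  exists2 C : R, 0 < C & forall x, `|f x| <= C * `|x|.
Proof.
pose C := \sum_i \sum_j `|f (delta_mx i j)|.
have C0 : 0 <= C by apply: sumr_ge0 => i _; apply: sumr_ge0.
exists (C + 1) => [|x]; first by rewrite ltr_wpDl.
apply: (@le_trans _ _ (C * `|x|)); last by rewrite ler_wpM2r// lerDl.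
rewrite {1}[x]matrix_sum_delta linear_sum mulr_suml (le_trans (ler_norm_sum _ _ _))//.
apply: ler_sum => i _; rewrite linear_sum mulr_suml (le_trans (ler_norm_sum _ _ _))//.
apply: ler_sum => j _; rewrite linearZ normrZ mulrC ler_wpM2l//; exact: norm_entry.
Qed.

(** Carries commutation and membership in a subspace from the partial sums of the exponential series
    to their limit. *)
Lemma lim_linear_eq0 m n (V : normedModType R) (f : {linear 'M[R]_(m, n) -> V})
    (u : nat -> 'M[R]_(m, n)) l :
  u @ \oo --> l -> (forall k, f (u k) = 0) -> f l = 0.
Proof.
move=> ul fu; have [C C0 fC] := linear_bounded f.
apply/eqP; rewrite -normr_le0; apply/ler_addgt0Pl => e e0; rewrite addr0.
have /cvgrPdist_le/(_ _ (divr_gt0 e0 C0))[n0 _ /(_ n0 (leqnn _))] := ul.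
move=> /(ler_wpM2l (ltW C0)); rewrite [C * (e / C)]mulrC divfK ?gt_eqF// => H.
by apply: le_trans H; rewrite -[f l]subr0 -(fu n0) -linearB.
Qed.

Lemma is_derive_linear m n (V : normedModType R) (f : {linear 'M[R]_(m, n) -> V})
    (g : R -> 'M[R]_(m, n)) (t : R) dg :
  is_derive t 1 g dg -> is_derive t 1 (fun x => f (g x)) (f dg).
Proof.
move=> /is_derive_oP H; apply/is_derive_oP => e e0.
have [C C0 fC] := linear_bounded f.
have [d d0 dH] := H _ (divr_gt0 e0 C0); exists d => // h /dH.
move=> /(ler_wpM2l (ltW C0)); rewrite mulrA [C * (e / C)]mulrC divfK ?gt_eqF//.
by apply: le_trans; rewrite -linearB -linearZ -linearB.
Qed.

End linear_maps.

Section exponential_theory.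
Variables (R : realType).

Lemma expmx0 N : expmx (0 : 'M[R]_N) = 1%:M.
Proof.
apply: (cvg_lim (@norm_hausdorff _ _)); rewrite -cvg_shiftS/=; apply: cvg_near_cst.
apply: nearW => n; rewrite /series/= big_nat_recl// expr0 fact0 invr1 scale1r big1 ?addr0//.
by move=> i _; rewrite exprS mul0r scaler0.
Qed.

Lemma expmx_comm N (A B : 'M[R]_N) : A *m B = B *m A -> B *m expmx A = expmx A *m B.
Proof.
move=> AB; apply/eqP; rewrite -subr_eq0; apply/eqP.
pose f := (mulmx B : 'M[R]_N -> 'M[R]_N) \- mulmxr B.
have @f' : {linear 'M[R]_N -> 'M[R]_N} := f.
apply: (lim_linear_eq0 (f := f') (@expmx_cvg _ _ A)) => k.
rewrite /f' /f /=; apply/eqP; rewrite subr_eq0; apply/eqP.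
rewrite /series/= mulmx_sumr mulmx_suml; apply: eq_bigr => i _.
rewrite -scalemxAr -scalemxAl; congr (_ *: _).
elim: i => [|i IH]; first by rewrite expr0 mulmx1 mul1mx.
by rewrite exprS -!mulmxE mulmxA -AB -mulmxA IH mulmxA.
Qed.

Lemma expmx_commZ N (A : 'M[R]_N) (t : R) : A *m expmx (t *: A) = expmx (t *: A) *m A.
Proof. by apply: expmx_comm; rewrite -scalemxAr -scalemxAl. Qed.

Lemma is_derive_expmxN N (A : 'M[R]_N) (t : R) :
  is_derive t 1 (fun x => expmx (- x *: A)) (- (A *m expmx (- t *: A))).
Proof.
have := @is_derive_affine R _ (fun x => expmx (x *: A)) (-1) 0 t.
move=> /(_ _ (@is_derive_expmx _ _ A _)).
rewrite (_ : (fun x => _) = fun x => expmx (- x *: A)); last first.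
  by apply/funext => y; rewrite addr0 mulN1r.
by move=> H; apply: (is_derive_eq H); rewrite scaleN1r addr0 mulN1r.
Qed.

Lemma expmxN N (A : 'M[R]_N) (t : R) : expmx (- t *: A) *m expmx (t *: A) = 1%:M.
Proof.
pose f t := expmx (- t *: A) *m expmx (t *: A).
rewrite -/(f t) -[RHS](_ : f 0 = _); last by rewrite /f oppr0 !scale0r expmx0 mulmx1.
apply: is_derive0_cst => x.
have d1 := @is_derive_expmxN _ A x.
apply: (is_derive_eq (is_derive_mulmx d1 (@is_derive_expmx _ _ A x))).
by rewrite mulNmx (expmx_commZ A (- x)) -!mulmxA addNr.
Qed.

Lemma expmxNr N (A : 'M[R]_N) (t : R) : expmx (t *: A) *m expmx (- t *: A) = 1%:M.
Proof. by have := expmxN A (- t); rewrite opprK. Qed.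

(** [expmx (- t *: A) *m f t] is constant. This uniqueness yields the later identities on
    exponentials: both sides solve the equation with the same initial value. *)
Lemma expmx_ode N m (A : 'M[R]_N) (f : R -> 'M[R]_(N, m)) :
  (forall t : R, is_derive t 1 f (A *m f t)) -> forall t, f t = expmx (t *: A) *m f 0.
Proof.
move=> fA t; pose g t := expmx (- t *: A) *m f t.
have gE : g t = g 0.
  apply: is_derive0_cst => x.
  have d1 := @is_derive_expmxN _ A x.
  apply: (is_derive_eq (is_derive_mulmx d1 (fA x))).
  by rewrite mulNmx (expmx_commZ A (- x)) -!mulmxA addNr.
move: gE; rewrite /g oppr0 scale0r expmx0 mul1mx => <-.
by rewrite mulmxA expmxNr mul1mx.
Qed.

Lemma expmxD N (A : 'M[R]_N) (s t : R) :
  expmx ((s + t) *: A) = expmx (s *: A) *m expmx (t *: A).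
Proof.
have H (x : R) : is_derive x 1 (fun s => expmx ((s + t) *: A)) (A *m expmx ((x + t) *: A)).
  have := @is_derive_affine R _ (fun x => expmx (x *: A)) 1 t x _ (@is_derive_expmx _ _ A _).
  rewrite (_ : (fun x => _) = fun s => expmx ((s + t) *: A)); last first.
    by apply/funext => y; rewrite mul1r.
  by move=> H; apply: (is_derive_eq H); rewrite scale1r mul1r.
by rewrite (expmx_ode H) add0r.
Qed.

Lemma expmx_tr N (A : 'M[R]_N) (t : R) : (expmx (t *: A))^T = expmx (t *: A^T).
Proof.
rewrite -[RHS]mulmx1 -[1%:M]trmx1 -(expmx0 N) -(scale0r A).
apply: (@expmx_ode _ _ A^T (fun t => (expmx (t *: A))^T)) => s.
have /is_derive_trmx := @is_derive_expmx _ _ A s.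
by rewrite expmx_commZ trmx_mul.
Qed.

Lemma expmx_vspace N m (A : 'M[R]_N) (U : {vspace 'M[R]_(N, m)}) (t : R) x :
  (forall y, y \in U -> A *m y \in U) -> x \in U -> expmx (t *: A) *m x \in U.
Proof.
move=> AU xU.
have H k : series (fun k : nat => k`!%:R^-1 *: (t *: A) ^+ k) k *m x \in U.
  rewrite /series/= mulmx_suml memv_suml// => i _.
  rewrite -scalemxAl memvZ//; elim: i => [|i IH]; first by rewrite expr0 mul1mx.
  by rewrite exprS -mulmxE -mulmxA -scalemxAl memvZ// AU.
pose f : {linear 'M[R]_N -> 'M[R]_(N, m)} := (\1 - projv U)%VF \o mulmxr x.
have fE y : f y = y *m x - projv U (y *m x) by rewrite /f/= add_lfunE opp_lfunE id_lfunE.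
suff /eqP : f (expmx (t *: A)) = 0 by rewrite fE subr_eq0 => /eqP ->; exact: memv_proj.
apply: lim_linear_eq0 (@expmx_cvg _ _ _) _ => k.
by rewrite fE projv_id ?subrr.
Qed.

(* The conjugate of [B] by [expmx (t *: A)] solves a linear equation in the
   space of matrices, so it stays in every subspace stable under [ad A]. *)
Lemma expmx_conj_vspace N (A : 'M[R]_N) (U : {vspace 'M[R]_N}) (t : R) B :
  (forall y, y \in U -> A *m y - y *m A \in U) -> B \in U ->
  expmx (t *: A) *m B *m expmx (- t *: A) \in U.
Proof.
move=> AU BU.
pose f : {linear 'M[R]_N -> 'M[R]_N} := mulmx A \- mulmxr A.
pose L := lin_mx f.
pose g s := (mxvec (expmx (s *: A) *m B *m expmx (- s *: A)))^T.
have dg (s : R) : is_derive s 1 g (L^T *m g s).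
  rewrite /g -trmx_mul mul_vec_lin/=.
  have d2 := @is_derive_expmxN _ A s.
  have d1 := is_derive_mulcst B (@is_derive_expmx _ _ A s).
  have := @is_derive_linear R _ _ _ mxvec _ _ _ (is_derive_mulmx d1 d2).
  move=> /is_derive_trmx H; apply: (is_derive_eq H); congr (mxvec _)^T.
  by rewrite mulmxN !mulmxA; congr (_ - _); rewrite -!mulmxA expmx_commZ.
pose V : {vspace 'cV[R]_(N * N)} := (linfun (trmx \o mxvec) @: U)%VS.
have VP y : y \in U <-> (mxvec y)^T \in V.
  split=> [yU|/memv_imgP[z zU]]; first by have := memv_img (linfun (trmx \o mxvec)) yU; rewrite lfunE.
  by rewrite lfunE/= => /trmx_inj /(can_inj mxvecK) ->.
apply/VP; rewrite -/(g t) (expmx_ode dg); apply: expmx_vspace => [y|].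
  case/memv_imgP => z zU ->; rewrite lfunE/= -trmx_mul mul_vec_lin/=.
  by apply/VP; exact: AU.
by rewrite /g oppr0 scale0r expmx0 mulmx1 mul1mx; apply/VP.
Qed.

End exponential_theory.

(** * The Euclidean inner product *)

Section euclidean.
Variables (R : realType).
Implicit Types N : nat.

Lemma dotpE N (u v : 'cV[R]_N) : dotp u v = \sum_i u i 0 * v i 0.
Proof. by rewrite /dotp mxE; apply: eq_bigr => i _; rewrite mxE. Qed.

Lemma dotpC N (u v : 'cV[R]_N) : dotp u v = dotp v u.
Proof. by rewrite !dotpE; apply: eq_bigr => i _; rewrite mulrC. Qed.

Lemma dotpDl N (u v w : 'cV[R]_N) : dotp (u + v) w = dotp u w + dotp v w.
Proof. by rewrite /dotp linearD mulmxDl mxE. Qed.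

Lemma dotpDr N (u v w : 'cV[R]_N) : dotp w (u + v) = dotp w u + dotp w v.
Proof. by rewrite /dotp mulmxDr mxE. Qed.

Lemma dotpZl N a (u v : 'cV[R]_N) : dotp (a *: u) v = a * dotp u v.
Proof. by rewrite /dotp linearZ/= -scalemxAl mxE. Qed.

Lemma dotpZr N a (u v : 'cV[R]_N) : dotp u (a *: v) = a * dotp u v.
Proof. by rewrite /dotp -scalemxAr mxE. Qed.

Lemma dotpNl N (u v : 'cV[R]_N) : dotp (- u) v = - dotp u v.
Proof. by rewrite -scaleN1r dotpZl mulN1r. Qed.

Lemma dotpNr N (u v : 'cV[R]_N) : dotp u (- v) = - dotp u v.
Proof. by rewrite -scaleN1r dotpZr mulN1r. Qed.

Lemma dotpBl N (u v w : 'cV[R]_N) : dotp (u - v) w = dotp u w - dotp v w.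
Proof. by rewrite dotpDl dotpNl. Qed.

Lemma dotpBr N (u v w : 'cV[R]_N) : dotp w (u - v) = dotp w u - dotp w v.
Proof. by rewrite dotpDr dotpNr. Qed.

Lemma dotp0l N (u : 'cV[R]_N) : dotp 0 u = 0.
Proof. by rewrite -(scale0r u) dotpZl mul0r. Qed.

Lemma dotp0r N (u : 'cV[R]_N) : dotp u 0 = 0.
Proof. by rewrite dotpC dotp0l. Qed.

Lemma dotp_suml N (I : Type) (r : seq I) (P : pred I) (F : I -> 'cV[R]_N) v :
  dotp (\sum_(i <- r | P i) F i) v = \sum_(i <- r | P i) dotp (F i) v.
Proof.
elim/big_rec2 : _ => [|i x y _ <-]; first by rewrite dotp0l.
by rewrite dotpDl.
Qed.

Lemma dotp_sumr N (I : Type) (r : seq I) (P : pred I) (F : I -> 'cV[R]_N) v :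
  dotp v (\sum_(i <- r | P i) F i) = \sum_(i <- r | P i) dotp v (F i).
Proof. by rewrite dotpC dotp_suml; apply: eq_bigr => i _; rewrite dotpC. Qed.

Lemma dotp_mulmxl N m (A : 'M[R]_(N, m)) u v : dotp (A *m u) v = dotp u (A^T *m v).
Proof. by rewrite /dotp trmx_mul mulmxA. Qed.

Lemma dotp_mulmxr N m (A : 'M[R]_(N, m)) u v : dotp u (A *m v) = dotp (A^T *m u) v.
Proof. by rewrite dotpC dotp_mulmxl dotpC. Qed.

Lemma dotp_ge0 N (u : 'cV[R]_N) : 0 <= dotp u u.
Proof. by rewrite dotpE sumr_ge0// => i _; rewrite -expr2 sqr_ge0. Qed.

Lemma dotp_eq0 N (u : 'cV[R]_N) : (dotp u u == 0) = (u == 0).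
Proof.
apply/eqP/eqP => [|->]; last by rewrite dotp0l.
rewrite dotpE => /eqP; rewrite psumr_eq0 => [/allP H|i _]; last by rewrite -expr2 sqr_ge0.
apply/matrixP => i j; rewrite ord1 mxE; apply/eqP.
by have := H i (mem_index_enum i); rewrite -expr2 sqrf_eq0.
Qed.

Lemma dotp_gt0 N (u : 'cV[R]_N) : (0 < dotp u u) = (u != 0).
Proof. by rewrite lt_def dotp_ge0 andbT dotp_eq0. Qed.

Lemma dotp_orth N m (Q : 'M[R]_(N, m)) u v : Q^T *m Q = 1%:M ->
  dotp (Q *m u) (Q *m v) = dotp u v.
Proof. by move=> QQ; rewrite dotp_mulmxl mulmxA QQ mul1mx. Qed.

Lemma dotp_skew N (A : 'M[R]_N) u v : A^T = - A -> dotp (A *m u) v = - dotp u (A *m v).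
Proof. by move=> AT; rewrite dotp_mulmxl AT mulNmx dotpNr. Qed.

Lemma dotp_skew0 N (A : 'M[R]_N) u : A^T = - A -> dotp (A *m u) u = 0.
Proof. by move=> AT; have := dotp_skew u u AT; rewrite [dotp u _]dotpC; lra. Qed.

Lemma dotp_ext N (u v : 'cV[R]_N) : (forall w, dotp u w = dotp v w) -> u = v.
Proof.
by move=> H; apply/eqP; rewrite -subr_eq0 -dotp_eq0 dotpBl H subrr.
Qed.

Lemma dotp_le_norm N (u v : 'cV[R]_N) : `|dotp u v| <= N%:R * `|u| * `|v|.
Proof.
by rewrite /dotp (le_trans (norm_entry _ _ _))// (le_trans (norm_mulmx _ _))// norm_trmx.
Qed.

Lemma norm_le_dotp N (u : 'cV[R]_N) : `|u| ^+ 2 <= dotp u u.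
Proof.
have [->|u0] := eqVneq u 0; first by rewrite normr0 expr0n/= dotp0l.
have [[i j] ij] : exists ij, `|u| = `|u ij.1 ij.2|.
  by apply: mx_norm_neq0; rewrite -[mx_norm u]/`|u| normr_eq0.
rewrite ij/= ord1 dotpE (bigD1 i)//= -normrX ger0_norm ?sqr_ge0// -expr2.
by rewrite lerDl sumr_ge0// => k _; rewrite -expr2 sqr_ge0.
Qed.

Lemma norm_orth N m (Q : 'M[R]_(N, m)) : Q^T *m Q = 1%:M -> `|Q| <= 1.
Proof.
move=> QQ; apply/norm_mx_le => // i j.
have /matrixP/(_ j j) := QQ; rewrite !mxE eqxx => H.
rewrite -(@ler_pXn2r _ 2)// ?qualifE//= expr1n -normrX ger0_norm ?sqr_ge0//.
rewrite -[leRHS]/(true%:R) -H (bigD1 i)//= !mxE -expr2 lerDl sumr_ge0// => k _.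
by rewrite !mxE -expr2 sqr_ge0.
Qed.

Lemma skew_expmx N (A : 'M[R]_N) (t : R) : A^T = - A ->
  (expmx (t *: A))^T = expmx (- t *: A).
Proof. by move=> AT; rewrite expmx_tr AT scalerN scaleNr. Qed.

Lemma orth_expmx N (A : 'M[R]_N) (t : R) : A^T = - A ->
  (expmx (t *: A))^T *m expmx (t *: A) = 1%:M.
Proof. by move=> AT; rewrite skew_expmx// expmxN. Qed.

End euclidean.

(** * Constancy of functions of one real variable *)

Section one_variable.
Variable R : realType.

(** The derivative is only known to vanish relative to the segment, one-sidedly at its ends;
    composing with the 1-Lipschitz retraction [c] gives a function on the line with zero
    derivative. *)
Lemma const_on_segment (f : R -> R) (a b : R) : a <= b ->
  (forall t, a <= t <= b -> forall e : R, 0 < e -> exists2 d : R, 0 < d &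
     forall s, a <= s <= b -> `|s - t| < d -> `|f s - f t| <= e * `|s - t|) ->
  f a = f b.
Proof.
move=> ab H; pose c (t : R) := Num.max a (Num.min b t).
have cP t : a <= c t <= b by rewrite le_max lexx/= ge_max ab ge_min lexx.
have cL (s t : R) : `|c s - c t| <= `|s - t|.
  have maxL (x y : R) : `|Num.max a x - Num.max a y| <= `|x - y|.
    by rewrite ler_norml; have := ler_norm (x - y); have := ler_norm (y - x);
      rewrite [`|y - x|]distrC; case: (leP a x); case: (leP a y) => *; apply/andP; split; lra.
  have minL (x y : R) : `|Num.min b x - Num.min b y| <= `|x - y|.
    by rewrite ler_norml; have := ler_norm (x - y); have := ler_norm (y - x);
      rewrite [`|y - x|]distrC; case: (leP b x); case: (leP b y) => *; apply/andP; split; lra.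
  exact: le_trans (maxL _ _) (minL _ _).
have ca : c a = a by rewrite /c min_r// maxxx.
have cb : c b = b by rewrite /c minxx max_r.
rewrite -ca -cb -[LHS]/((f \o c) a) -[RHS]/((f \o c) b).
apply: is_derive_0_is_cst => t; apply/is_derive_oP => e e0.
have [d d0 dH] := H _ (cP t) _ e0; exists d => // h hd.
have hh : `|c (h + t) - c t| <= `|h| by rewrite (le_trans (cL _ _))// addrK.
rewrite scaler0 subr0 (le_trans (dH _ (cP _) _))//; first exact: le_lt_trans hh hd.
by rewrite ler_wpM2l// ltW.
Qed.

(** Connectedness of the line: the indicator function of [P] has zero derivative. *)
Lemma locally_const_prop (P : R -> Prop) :
  (forall t, exists2 d : R, 0 < d & forall s, `|s - t| < d -> P s <-> P t) ->
  forall s t, P s -> P t.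
Proof.
move=> H s t Ps; pose f (x : R) : R := if pselect (P x) then 1 else 0.
have : f s = f t.
  apply: is_derive_0_is_cst => x; apply/is_derive_oP => e e0.
  have [d d0 dH] := H x; exists d => // h hd.
  have := dH (h + x); rewrite addrK => /(_ hd) hx.
  have -> : f (h + x) = f x.
    by rewrite /f; case: pselect => px; case: pselect => // px'; exfalso; tauto.
  by rewrite subrr scaler0 subr0 normr0 mulr_ge0// ltW.
rewrite /f; case: (pselect (P s)) => //= _; case: (pselect (P t)) => //= _ /eqP.
by rewrite oner_eq0.
Qed.

End one_variable.

(** * A Lipschitz implicit function theorem *)

(** Joins the completeness of matrices to their normed structure, as the Banach fixed point theorem
    below requires. *)
HB.instance Definition _ (R : realType) (m n : nat) :=
  Complete.copy 'M[R]_(m, n) 'M[R : completeType]_(m, n).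

Section implicit_function.
Variable R : realType.

Lemma contraction_fixpoint d (T : 'cV[R]_d -> 'cV[R]_d) (r : R) : 0 <= r ->
  (forall b, `|b| <= r -> `|T b| <= r) ->
  (forall b b', `|b| <= r -> `|b'| <= r -> `|T b - T b'| <= 4^-1 * `|b - b'|) ->
  exists2 b, `|b| <= r & b = T b.
Proof.
move=> r0 Tr Tc; pose U : set 'cV[R]_d := [set b | `|b| <= r].
have Ufun : set_fun U U T by move=> b; exact: Tr.
pose f : {fun U >-> U} := mkfun Ufun.
have [| | |b Ub bE] := @banach_fixed_point R 'cV[R]_d U f; last by exists b.
- have q0 : (0 : R) <= 4^-1 by rewrite invr_ge0.
  exists (NngNum q0); split => /=; first by rewrite invf_lt1// ltr1n.
  by move=> [b b'] [/= Ub Ub']; exact: Tc.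
- have -> : U = (fun b : 'cV[R]_d => `|b|) @^-1` [set x | x <= r] by [].
  by apply: preimage_closed; [move=> b _; exact: norm_continuous|exact: closed_le].
- by exists 0; rewrite /U/= normr0.
Qed.

(** The partial derivative in [b] is normalised to the identity, so [b - G x b] is a contraction of
    ratio 1/4; [D1] plays the role of the other partial derivative. The solution is claimed to be
    Lipschitz only, which suffices for first-order expansions. *)
Lemma implicit_function N d (G : 'cV[R]_N -> 'cV[R]_d -> 'cV[R]_d) (x0 : 'cV[R]_N)
    (D1 : 'cV[R]_N -> 'cV[R]_d) (C : R) :
  0 <= C -> (forall x y, `|D1 x - D1 y| <= C * `|x - y|) -> G x0 0 = 0 ->
  (forall e : R, 0 < e -> exists2 r : R, 0 < r &
     forall x x' b b', `|x - x0| < r -> `|x' - x0| < r -> `|b| < r -> `|b'| < r ->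
     `|G x b - G x' b' - (D1 x - D1 x' + (b - b'))| <= e * (`|x - x'| + `|b - b'|)) ->
  forall r : R, 0 < r -> exists2 rho : R, 0 < rho & exists beta : 'cV[R]_N -> 'cV[R]_d,
    [/\ beta x0 = 0,
        forall x, `|x - x0| < rho -> G x (beta x) = 0,
        forall x, `|x - x0| < rho -> `|beta x| < r &
        forall x y, `|x - x0| < rho -> `|y - x0| < rho ->
          `|beta x - beta y| <= (2 * C + 1) * `|x - y|].
Proof.
move=> C0 D1C G0 sd r1 r10.
have [|r0 r00 Gr] := sd (4^-1); first by rewrite invr_gt0.
pose r := Num.min r0 r1 / 2.
have m0 : 0 < Num.min r0 r1 by rewrite lt_min r00.
have rgt0 : 0 < r by rewrite divr_gt0.
have rlt : r < Num.min r0 r1 by rewrite /r ltr_pdivrMr// mulr2n mulrDr mulr1; lra.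
have [rr0 rr1] : r < r0 /\ r < r1 by move: rlt; rewrite lt_min => /andP.
have C1 : 0 < 2 * (C + 1) by lra.
(* Chosen so that [|T 0| <= r / 2]; the contraction adds at most r / 4, so the ball of radius [r] is
   preserved. *)
pose rho := Num.min r0 (r / (2 * (C + 1))).
have rho0 : 0 < rho by rewrite lt_min r00 divr_gt0.
have rhoP x : `|x - x0| < rho -> `|x - x0| < r0 /\ (C + 1) * `|x - x0| <= r / 2.
  rewrite lt_min => /andP[-> h]; split=> //; move: h; rewrite ltr_pdivlMr// => h; lra.
have ex x : `|x - x0| < rho -> exists b, `|b| <= r /\ G x b = 0.
  move=> /rhoP[xr0 xr]; pose T b := b - G x b.
  have Tc b b' : `|b| <= r -> `|b'| <= r -> `|T b - T b'| <= 4^-1 * `|b - b'|.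
    move=> br br'; have := Gr x x b b' xr0 xr0 (le_lt_trans br rr0) (le_lt_trans br' rr0).
    rewrite !subrr normr0 !add0r; apply: le_trans; rewrite -normrN /T.
    by rewrite (_ : - (b - _ - _) = G x b - G x b' - (b - b'))//; apply/matrixP => i j; rewrite !mxE; ring.
  have x00 : `|x0 - x0| < r0 by rewrite subrr normr0.
  have z0 : `|(0 : 'cV[R]_d)| < r0 by rewrite normr0.
  have T0 : `|T 0| <= r / 2.
    have := Gr x x0 0 0 xr0 x00 z0 z0; rewrite G0 !subrr normr0 !addr0 subr0 => H.
    rewrite /T sub0r normrN -[G x 0](subrK (D1 x - D1 x0)) (le_trans (ler_normD _ _))//.
    apply: le_trans (lerD H (D1C _ _)) _; apply: le_trans xr.
    by rewrite -mulrDl ler_wpM2r//; lra.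
  have [|b br|//|b br bE] := @contraction_fixpoint d T r; first exact: ltW.
    rewrite -[T b](subrK (T 0)) (le_trans (ler_normD _ _))//.
    have := Tc b 0 br; rewrite normr0 subr0 => /(_ (ltW rgt0)) H.
    by apply: le_trans (lerD H T0) _; move: br; lra.
  exists b; split=> //; apply/eqP; move: bE; rewrite /T => /eqP.
  by rewrite eq_sym subr_eq addrC -subr_eq subrr eq_sym.
(* Zeros are chosen without a uniqueness statement, so the value at [x0] is imposed; the Lipschitz
   estimate holds for any two zeros in the ball. *)
pose beta x := if x == x0 then 0 else xget 0 [set b | `|b| <= r /\ G x b = 0].
have betaP x : `|x - x0| < rho -> `|beta x| <= r /\ G x (beta x) = 0.
  move=> /ex xx; rewrite /beta; case: eqP => [->|_]; first by rewrite normr0 G0 ltW.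
  by case: xgetP => [b _ //|H]; case: xx => b /H.
exists rho => //; exists beta; split.
- by rewrite /beta eqxx.
- by move=> x /betaP[].
- by move=> x /betaP[/le_lt_trans ->].
- move=> x y xr yr; have [bx Gx] := betaP _ xr; have [by' Gy] := betaP _ yr.
  have := Gr x y (beta x) (beta y) (rhoP _ xr).1 (rhoP _ yr).1
    (le_lt_trans bx rr0) (le_lt_trans by' rr0).
  rewrite Gx Gy subrr sub0r normrN => H.
  have H2 : `|beta x - beta y| <= 4^-1 * (`|x - y| + `|beta x - beta y|) + C * `|x - y|.
    rewrite -[X in `|X| <= _](addKr (D1 x - D1 y)) addrC (le_trans (ler_normD _ _))//.
    by rewrite normrN lerD.
  have cw : 0 <= C * `|x - y| by rewrite mulr_ge0.
  have := normr_ge0 (x - y); move: H2 cw; rewrite mulrDl mul1r -mulrA.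
  move: `|beta x - beta y| (C * `|x - y|) `|x - y| => u v w; lra.
Qed.

End implicit_function.

(** * Strict derivatives of products of exponentials *)

Section strict_derivatives.
Variable R : realType.

(* Strict differentiability at the origin. *)
Definition sdiff0 (V : normedModType R) N (f L : V -> 'M[R]_N) :=
  forall e : R, 0 < e -> exists2 r : R, 0 < r & forall x y, `|x| < r -> `|y| < r ->
    `|f x - f y - (L x - L y)| <= e * `|x - y|.

Definition lipschitz_fun (V W : normedModType R) (L : V -> W) :=
  exists2 C : R, 0 <= C & forall x y, `|L x - L y| <= C * `|x - y|.

Lemma lipschitzD (V W : normedModType R) (L K : V -> W) :
  lipschitz_fun L -> lipschitz_fun K -> lipschitz_fun (fun x => L x + K x).
Proof.
move=> [C C0 LC] [D D0 KD]; exists (C + D) => [|x y]; first exact: addr_ge0.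
rewrite opprD addrACA mulrDl (le_trans (ler_normD _ _))//; exact: lerD.
Qed.

Lemma sdiff0_near1 (V : normedModType R) N (f L : V -> 'M[R]_N) :
  f 0 = 1%:M -> lipschitz_fun L -> sdiff0 f L ->
  forall e : R, 0 < e -> exists2 r : R, 0 < r & forall x, `|x| < r -> `|f x - 1%:M| <= e.
Proof.
move=> f0 [C C0 LC] fL e e0; have [r r0 H] := fL 1 ltr01.
have C1 : 0 < C + 1 by lra.
exists (Num.min r (e / (C + 1))) => [|x]; first by rewrite lt_min r0 divr_gt0.
rewrite lt_min ltr_pdivlMr// => /andP[xr xe].
have := H x 0 xr; rewrite normr0 f0 subr0 => /(_ r0) K.
rewrite -[f x - _](subrK (L x - L 0)) (le_trans (ler_normD _ _))//.
have := LC x 0; rewrite subr0 => K2; apply: le_trans (lerD K K2) _.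
by rewrite mul1r; move: xe; move: `|x| => w; lra.
Qed.

(** At the identity the derivative of a product is the sum of the derivatives, which is why
    everything is normalised to [1%:M] at 0. *)
Lemma sdiff0_mul (V : normedModType R) N (f g Lf Lg : V -> 'M[R]_N) :
  f 0 = 1%:M -> g 0 = 1%:M -> lipschitz_fun Lf -> lipschitz_fun Lg ->
  sdiff0 f Lf -> sdiff0 g Lg ->
  sdiff0 (fun x => f x *m g x) (fun x => Lf x + Lg x).
Proof.
move=> f0 g0 lf lg sf sg e e0; have [C C0 Cf] := lf; have [D D0 Cg] := lg.
pose K := (N.+1%:R * (4 + C + D)) : R.
have K0 : 0 < K by rewrite mulr_gt0// ?ltr0Sn//; lra.
pose e1 := Num.min 1 (e / K).
have e10 : 0 < e1 by rewrite lt_min ltr01 divr_gt0.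
have [r1 r10 H1] := sf _ e10; have [r2 r20 H2] := sg _ e10.
have [r3 r30 H3] := sdiff0_near1 f0 lf sf e10.
have [r4 r40 H4] := sdiff0_near1 g0 lg sg e10.
exists (Num.min (Num.min r1 r2) (Num.min r3 r4)) => [|x y].
  by rewrite !lt_min r10 r20 r30 r40.
rewrite !lt_min => /andP[/andP[x1 x2] /andP[x3 x4]] /andP[/andP[y1 y2] /andP[y3 y4]].
have near2 (B : 'M[R]_N) : `|B - 1%:M| <= e1 -> `|B| <= 2.
  move=> H; rewrite -[B](subrK 1%:M) (le_trans (ler_normD _ _))//.
  have -> : (2 : R) = 1 + 1 by []; apply: lerD (norm_mx1 R N).
  by apply: le_trans H _; rewrite ge_min lexx.
(* Each of the four terms carries both a small factor and a factor |x - y|. *)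
have E : f x *m g x - f y *m g y - (Lf x + Lg x - (Lf y + Lg y)) =
  (f x - f y - (Lf x - Lf y)) *m g x + (Lf x - Lf y) *m (g x - 1%:M)
  + f y *m (g x - g y - (Lg x - Lg y)) + (f y - 1%:M) *m (Lg x - Lg y).
  rewrite !(mulmxBl, mulmxBr) !(mul1mx, mulmx1) opprD.
  move: (f x *m g x) (f y *m g y) (f y *m g x) (f y *m Lg x) (f y *m Lg y).
  move: (Lf x *m g x) (Lf y *m g x) => a b c d j k l.
  by apply/matrixP => i0 j0; rewrite !mxE; ring.
rewrite E; set w := `|x - y|.
have b1 : `|(f x - f y - (Lf x - Lf y)) *m g x| <= N%:R * (e1 * w) * 2.
  apply: le_trans (norm_mulmx _ _) _; apply: ler_pM; rewrite ?mulr_ge0//.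
    by rewrite ler_wpM2l//; exact: H1.
  exact/near2/H4.
have b2 : `|(Lf x - Lf y) *m (g x - 1%:M)| <= N%:R * (C * w) * e1.
  apply: le_trans (norm_mulmx _ _) _; apply: ler_pM; rewrite ?mulr_ge0//.
    by rewrite ler_wpM2l.
  exact: H4.
have b3 : `|f y *m (g x - g y - (Lg x - Lg y))| <= N%:R * 2 * (e1 * w).
  apply: le_trans (norm_mulmx _ _) _; apply: ler_pM; rewrite ?mulr_ge0//.
    by rewrite ler_wpM2l//; exact/near2/H3.
  exact: H2.
have b4 : `|(f y - 1%:M) *m (Lg x - Lg y)| <= N%:R * e1 * (D * w).
  apply: le_trans (norm_mulmx _ _) _; apply: ler_pM; rewrite ?mulr_ge0//.
  by rewrite ler_wpM2l//; exact: H3.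
apply: (@le_trans _ _ (N%:R * (4 + C + D) * e1 * w)).
  apply: le_trans (ler_normD _ _) _; apply: le_trans (lerD _ b4) _.
    apply: le_trans (ler_normD _ _) _; apply: lerD b3.
    by apply: le_trans (ler_normD _ _) _; apply: lerD b1 b2.
  by rewrite le_eqVlt; apply/orP; left; apply/eqP; ring.
rewrite ler_wpM2r// /w//; apply: (@le_trans _ _ (K * e1)).
  by rewrite ler_wpM2r ?(ltW e10)// ler_wpM2r// ?ler_nat//; lra.
have : e1 <= e / K by rewrite ge_min lexx orbT.
by rewrite ler_pdivlMr// mulrC.
Qed.

Lemma sdiff0_prod (V : normedModType R) N (I : Type) (s : seq I)
    (F L : I -> V -> 'M[R]_N) :
  (forall i, F i 0 = 1%:M) -> (forall i, lipschitz_fun (L i)) ->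
  (forall i, sdiff0 (F i) (L i)) ->
  [/\ \prod_(i <- s) F i 0 = 1%:M, lipschitz_fun (fun x => \sum_(i <- s) L i x) &
      sdiff0 (fun x => \prod_(i <- s) F i x) (fun x => \sum_(i <- s) L i x)].
Proof.
move=> F0 Ll FL; elim: s => [|i s [IH1 IH2 IH3]].
  split; first by rewrite big_nil.
    by exists 0 => // x y; rewrite !big_nil subrr normr0 mul0r.
  move=> e e0; exists 1 => // x y _ _; rewrite !big_nil !subrr normr0.
  by rewrite mulr_ge0// ltW.
split; first by rewrite big_cons F0 IH1 mulr1.
  have [C C0 H] := lipschitzD (Ll i) IH2.
  by exists C => // x y; have := H x y; rewrite !big_cons.
move=> e e0; have [r r0 H] := sdiff0_mul (F0 i) IH1 (Ll i) IH2 (FL i) IH3 e0.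
by exists r => // x y xr yr; rewrite !big_cons; exact: H.
Qed.

Lemma sdiff0_comp (V : normedModType R) N (f : R -> 'M[R]_N) (B : 'M[R]_N)
    (phi : V -> R) : phi 0 = 0 -> lipschitz_fun (phi : V -> R^o) ->
  sdiff0 (f : R^o -> _) (fun t => t *: B) ->
  sdiff0 (fun x => f (phi x)) (fun x => phi x *: B).
Proof.
move=> p0 [C C0 pC] fB e e0; have C1 : 0 < C + 1 by lra.
have [r r0 H] := fB _ (divr_gt0 e0 C1).
exists (r / (C + 1)) => [|x y]; first exact: divr_gt0.
rewrite !ltr_pdivlMr// => xr yr.
have small z : `|z| * (C + 1) < r -> `|phi z| < r.
  move=> zr; have := pC z 0; rewrite p0 !subr0 => K.
  by apply: le_lt_trans K (le_lt_trans _ zr); rewrite mulrC ler_wpM2l//; lra.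
apply: le_trans (H _ _ (small _ xr) (small _ yr)) _.
rewrite -mulrA ler_wpM2l ?(ltW e0)// mulrC ler_pdivrMr// mulrC.
by apply: le_trans (pC x y) _; rewrite ler_wpM2r//; lra.
Qed.

Lemma lipschitz_scale (V : normedModType R) N (B : 'M[R]_N) (phi : V -> R) :
  lipschitz_fun (phi : V -> R^o) -> lipschitz_fun (fun x => phi x *: B).
Proof.
move=> [C C0 pC]; exists (C * `|B|) => [|x y]; first exact: mulr_ge0.
by rewrite -scalerBl normrZ mulrAC ler_wpM2r//; exact: pC.
Qed.

(** Strictness comes from the group law: the increment from [t] to [s] is the increment from 0 to s
    - t multiplied by [expmx (t *: A)]. *)
Lemma sdiff0_expmx N (A : 'M[R]_N) :
  sdiff0 ((fun t => expmx (t *: A)) : R^o -> _) (fun t => t *: A).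
Proof.
move=> e e0; pose K := N.+1%:R * (2 + `|A|) : R.
have K0 : 0 < K by rewrite mulr_gt0// ?ltr0Sn// ltr_pwDl.
have f1 (d1 : R) : 0 < d1 -> exists2 r : R, 0 < r & forall u : R, `|u| < r ->
    `|expmx (u *: A) - 1%:M - u *: A| <= d1 * `|u|.
  move=> d10; have := @is_derive_expmx _ _ A 0.
  move=> /is_derive_dist/(_ _ d10)[r r0 H]; exists r => // u ur.
  by have := H u; rewrite subr0 scale0r expmx0 mulmx1; exact.
pose e1 := Num.min 1 (e / K).
have e10 : 0 < e1 by rewrite lt_min ltr01 divr_gt0.
have [r1 r10 H1] := f1 _ e10.
have A1 : 0 < 1 + `|A| by rewrite ltr_pwDl.
exists (Num.min (r1 / 2) (e1 / (1 + `|A|))) => [|s t].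
  by rewrite lt_min !divr_gt0.
rewrite !lt_min ![_ < e1 / _]ltr_pdivlMr// => /andP[s1 s2] /andP[t1 t2].
have t1' : `|t| < r1 by lra.
have st : `|s - t| < r1 by rewrite (le_lt_trans (ler_normB _ _))//; lra.
have Et : `|expmx (t *: A) - 1%:M| <= e1.
  rewrite -[_ - 1%:M](subrK (t *: A)) (le_trans (ler_normD _ _))// normrZ.
  have e11 : e1 <= 1 by rewrite ge_min lexx.
  have tt : e1 * `|t| <= 1 * `|t| by rewrite ler_wpM2r.
  apply: le_trans (lerD (le_trans (H1 _ t1') tt) (lexx _)) _.
  by move: t2; rewrite mulrDr mulr1 mul1r => /ltW.
have Et2 : `|expmx (t *: A)| <= 2.
  rewrite -[expmx _](subrK 1%:M) (le_trans (ler_normD _ _))//.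
  have -> : (2 : R) = 1 + 1 by []; apply: lerD (norm_mx1 R N).
  by apply: le_trans Et _; rewrite ge_min lexx.
have E : expmx (s *: A) - expmx (t *: A) - (s *: A - t *: A) =
  (expmx ((s - t) *: A) - 1%:M - (s - t) *: A) *m expmx (t *: A)
  + ((s - t) *: A) *m (expmx (t *: A) - 1%:M).
  rewrite -[in expmx (s *: A)](subrK t s) expmxD !(mulmxBl, mulmxBr) mul1mx mulmx1.
  by rewrite addrA subrK scalerBl.
rewrite E (le_trans (ler_normD _ _))//; set w := `|s - t|.
have b1 : `|(expmx ((s - t) *: A) - 1%:M - (s - t) *: A) *m expmx (t *: A)| <=
    N%:R * (e1 * w) * 2.
  apply: le_trans (norm_mulmx _ _) _; apply: ler_pM; rewrite ?mulr_ge0//.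
  by rewrite ler_wpM2l//; exact: H1.
have b2 : `|((s - t) *: A) *m (expmx (t *: A) - 1%:M)| <= N%:R * (w * `|A|) * e1.
  apply: le_trans (norm_mulmx _ _) _; apply: ler_pM; rewrite ?mulr_ge0//.
  by rewrite normrZ.
apply: le_trans (lerD b1 b2) _.
apply: (@le_trans _ _ (K * e1 * w)).
  have -> : N%:R * (e1 * w) * 2 + N%:R * (w * `|A|) * e1 = N%:R * (2 + `|A|) * e1 * w by ring.
  by rewrite ler_wpM2r// /w// ler_wpM2r ?(ltW e10)// ler_wpM2r// ?ler_nat//.
rewrite ler_wpM2r// /w//.
have : e1 <= e / K by rewrite ge_min lexx orbT.
by rewrite ler_pdivlMr// mulrC.
Qed.

Lemma lipschitz_entry m n (i : 'I_m) (j : 'I_n) :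
  lipschitz_fun ((fun x : 'M[R]_(m, n) => x i j) : _ -> R^o).
Proof.
exists 1 => // x y; rewrite mul1r; have := norm_entry (x - y) i j.
by rewrite !mxE.
Qed.

End strict_derivatives.

(** * Spanning families and orthonormal bases *)

Section subspaces.

(** A finite family in [S] of maximal rank. It later turns predicates closed under linear
    combinations into subspaces. *)
Lemma span_set (K : fieldType) (vT : vectType K) (S : set vT) :
  exists b : seq vT, (forall x, x \in b -> S x) /\ (forall x, S x -> x \in <<b>>%VS).
Proof.
pose P d := `[< exists b : seq vT, (forall x, x \in b -> S x) /\ \dim <<b>> = d >].
have P0 : exists d, P d by exists 0%N; apply/asboolP; exists [::]; rewrite span_nil dimv0.
have Pm d : P d -> (d <= \dim {:vT})%N by move=> /asboolP[b [_ <-]]; exact/dimvS/subvf.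
case: (ex_maxnP P0 Pm) => d /asboolP[b [bS bd]] dmax; exists b; split=> // x Sx.
apply: contrapT => /negP xb; suff : P (\dim <<x :: b>>)%VS.
  move/dmax; rewrite leqNgt -bd => /negP; apply.
  rewrite ltn_neqAle dimvS ?andbT; last by rewrite span_cons addvSr.
  apply/negP => /eqP dE; move: xb; apply/negP; rewrite negbK.
  have /eqP -> : (<<b>> == <<x :: b>>)%VS by rewrite eqEdim span_cons addvSr -span_cons -dE leqnn.
  exact/memv_span/mem_head.
apply/asboolP; exists (x :: b); split=> // y; rewrite inE => /orP[/eqP->//|]; exact: bS.
Qed.

Variable R : realType.

Lemma mulmx_sum_col m n (F : 'M[R]_(m, n)) (y : 'cV[R]_n) :
  F *m y = \sum_j y j 0 *: col j F.
Proof.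
apply/matrixP => i k; rewrite ord1 mxE summxE; apply: eq_bigr => j _.
by rewrite !mxE mulrC.
Qed.

(** A maximal orthonormal family in [U]: a vector that it did not reproduce would leave a nonzero
    residue, and this residue, normalised, would extend the family. *)
Lemma orthonormal_basis N (U : {vspace 'cV[R]_N}) :
  exists F : 'M[R]_(N, \dim U),
    F^T *m F = 1%:M /\ forall u, (u \in U) = (F *m (F^T *m u) == u).
Proof.
pose P d := `[< exists F : 'M[R]_(N, d), F^T *m F = 1%:M /\ forall j, col j F \in U >].
have P0 : exists d, P d.
  by exists 0%N; apply/asboolP; exists 0; split=> [|[]//]; apply/matrixP => -[].
have Pm d : P d -> (d <= N)%N.
  move=> /asboolP[F [FF _]]; rewrite -(mxrank1 R d) -FF.
  by rewrite (leq_trans (mxrankM_maxr _ _))// rank_leq_row.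
case: (ex_maxnP P0 Pm) => d /asboolP[F [FF FU]] dmax.
have colU y : F *m y \in U by rewrite mulmx_sum_col memv_suml// => j _; rewrite memvZ.
have UE u : (u \in U) = (F *m (F^T *m u) == u).
  apply/idP/eqP => [uU|<-]; last exact: colU.
  apply/eqP; rewrite eq_sym -subr_eq0; apply: contrapT => /negP r0.
  set r := u - _ in r0.
  have rU : r \in U by rewrite memvB.
  have Fr : F^T *m r = 0 by rewrite mulmxBr !mulmxA FF mul1mx subrr.
  pose w := (Num.sqrt (dotp r r))^-1 *: r.
  have rr : 0 < dotp r r by rewrite dotp_gt0.
  have Fw : F^T *m w = 0 by rewrite -scalemxAr Fr scaler0.
  have ww : w^T *m w = 1%:M.
    apply/matrixP => i j; rewrite !ord1 -[LHS]/(dotp w w) dotpZl dotpZr mulrA -invfM.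
    by rewrite -expr2 sqr_sqrtr ?ltW// mulVf ?gt_eqF// mxE.
  suff /dmax : P (d + 1)%N by rewrite addn1 ltnn.
  apply/asboolP; exists (row_mx F w); split.
    rewrite tr_row_mx mul_col_row FF Fw ww.
    have -> : w^T *m F = 0 by apply: trmx_inj; rewrite trmx_mul trmxK Fw trmx0.
    by rewrite -scalar_mx_block.
  move=> j; case: (splitP j) => k jk.
    have -> : j = lshift 1 k by apply/val_inj.
    by have -> : col (lshift 1 k) (row_mx F w) = col k F by apply/matrixP => a b; rewrite mxE row_mxEl mxE.
  have -> : j = rshift d k by apply/val_inj.
  have -> : col (rshift d k) (row_mx F w) = w.
    by apply/matrixP => a b; rewrite mxE row_mxEr [k]ord1 [b]ord1.
  by rewrite memvZ.
suff dE : \dim U = d by rewrite dE; exists F.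
have -> : U = limg (linfun (mulmx F)).
  apply/vspaceP => u; rewrite UE; apply/eqP/memv_imgP => [<-|[y _ ->]].
    by exists (F^T *m u); rewrite ?memvf ?lfunE.
  by rewrite lfunE/= !mulmxA -(mulmxA F) FF mulmx1.
have := limg_ker_dim (linfun (mulmx F : 'cV[R]_d -> 'cV[R]_N)) fullv.
have -> : \dim (fullv : {vspace 'cV[R]_d}) = d by rewrite dimvf; exact: muln1.
suff -> : (lker (linfun (mulmx F : 'cV[R]_d -> 'cV[R]_N)) = 0)%VS.
  by rewrite capv0 dimv0.
apply/eqP; rewrite -subv0; apply/subvP => y; rewrite memv_ker lfunE/= memv0 => /eqP Fy.
by rewrite -[y]mul1mx -FF -mulmxA Fy mulmx0.
Qed.

Lemma orth_decomp N (U : {vspace 'cV[R]_N}) x :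
  exists2 u, u \in U & forall y, y \in U -> dotp (x - u) y = 0.
Proof.
have [F [FF UE]] := orthonormal_basis U.
exists (F *m (F^T *m x)); first by rewrite UE !mulmxA -(mulmxA F) FF mulmx1.
move=> y; rewrite UE => /eqP <-.
by rewrite dotp_mulmxr mulmxBr !mulmxA FF mul1mx subrr dotp0l.
Qed.

Lemma vspace_orthP N (U : {vspace 'cV[R]_N}) x :
  (forall w, (forall y, y \in U -> dotp w y = 0) -> dotp w x = 0) -> x \in U.
Proof.
move=> H; have [u uU xu] := orth_decomp U x.
suff /eqP : x - u = 0 by rewrite subr_eq0 => /eqP ->.
by apply/eqP; rewrite -dotp_eq0 dotpBr H// (xu _ uU) subrr.
Qed.

End subspaces.

(** * Transitivity on spheres from infinitesimal data *)

Section transitivity.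
Variable R : realType.

(** [G] is a mere set of matrices, without known manifold structure. Strict differentiability is
    what lets products of such curves be inverted locally. *)
Definition tangent_at_1 k (G : set 'M[R]_k) (B : 'M[R]_k) :=
  exists h : R -> 'M[R]_k,
    [/\ sdiff0 (h : R^o -> _) (fun t => t *: B), h 0 = 1%:M & forall t, G (h t)].

(** Products of curves with velocities spanning the orthogonal of [v], combined with a dilation,
    cover a neighbourhood of [v], and unit vectors are reached with dilation factor 1. Hence the
    orbit contains, around each of its points, a ball of the sphere of fixed radius, and it
    propagates along great circles. *)
Lemma orbit_sphere k (G : set 'M[R]_k) (v : 'cV[R]_k) : (1 < k)%N ->
  G 1%:M -> (forall g h, G g -> G h -> G (g *m h)) ->
  (forall g, G g -> g^T *m g = 1%:M) -> dotp v v = 1 ->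
  (forall eta, dotp v eta = 0 ->
     (forall B, tangent_at_1 G B -> B^T = - B -> dotp (B *m v) eta = 0) -> eta = 0) ->
  forall y, dotp y y = 1 -> exists2 g, G g & y = g *m v.
Proof.
move=> k1 G1 GM GO vv Hspan.
pose S : set 'cV[R]_k := [set x | exists B, [/\ tangent_at_1 G B, B^T = - B & x = B *m v]].
have [b [bS Sb]] := span_set S.
pose bt := in_tuple b.
have bE x : dotp x v = 0 -> x \in <<b>>%VS.
  move=> xv; have [u ub xu] := orth_decomp <<b>>%VS x.
  suff /eqP : x - u = 0 by rewrite subr_eq0 => /eqP ->.
  apply: Hspan => [|B BG BT]; last first.
    by rewrite dotpC xu//; apply: Sb; exists B.
  rewrite dotpBr dotpC xv sub0r; apply/eqP; rewrite oppr_eq0; apply/eqP.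
  rewrite (@coord_span _ _ _ bt u ub) dotp_sumr big1// => i _; rewrite dotpZr.
  have /bS[B [_ BT ->]] : b`_i \in b by rewrite mem_nth.
  by rewrite dotpC dotp_skew0 ?mulr0.
have /choice[hB hBP] : forall i : 'I_(size b), exists hB : (R -> 'M[R]_k) * 'M[R]_k,
    [/\ sdiff0 (hB.1 : R^o -> _) (fun t => t *: hB.2), hB.1 0 = 1%:M,
        forall t, G (hB.1 t) & b`_i = hB.2 *m v].
  move=> i; have /bS[B [[h [h1 h2 h3]] _ bB]] : b`_i \in b by rewrite mem_nth.
  by exists (h, B).
pose pr (x : 'cV[R]_k) := x - dotp x v *: v.
have prl : linear pr.
  move=> a x y; rewrite /pr dotpDl dotpZl scalerBr scalerDl scalerA opprD.
  by rewrite addrACA.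
pose prL := GRing.isLinear.Build _ _ _ _ pr prl.
pose prH : {linear 'cV[R]_k -> 'cV[R]_k} := HB.pack pr prL.
pose c i (x : 'cV[R]_k) : R := coord bt i (prH x).
have cl i : lipschitz_fun (c i : _ -> R^o).
  have [C C0 HC] := linear_bounded (coord bt i \o prH : {linear 'cV[R]_k -> R^o}).
  by exists C; [exact: ltW|move=> x y; have := HC (x - y); rewrite linearB].
pose phi (x : 'cV[R]_k) : R := dotp x v.
have phil : lipschitz_fun (phi : _ -> R^o).
  exists (k%:R * `|v|) => [|x y]; first exact: mulr_ge0.
  by rewrite /phi -dotpBl (le_trans (dotp_le_norm _ _))// mulrAC.
pose P (x : 'cV[R]_k) := \prod_(i < size b) (hB i).1 (c i x).
pose LP (x : 'cV[R]_k) := \sum_(i < size b) c i x *: (hB i).2.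
have [P1 LPl PLP] : [/\ P 0 = 1%:M, lipschitz_fun LP & sdiff0 P LP].
  apply: sdiff0_prod => i; have [h1 h2 h3 _] := hBP i.
  - by rewrite /c !linear0.
  - exact: lipschitz_scale.
  - by apply: sdiff0_comp => //; rewrite /c !linear0.
(* The dilation supplies the direction [v], which no skew velocity at [v] reaches. *)
pose f (x : 'cV[R]_k) : 'M[R]_k := (1 + phi x)%:M.
have fl : lipschitz_fun (fun x => phi x *: (1%:M : 'M[R]_k)) by exact: lipschitz_scale.
have fs : sdiff0 f (fun x => phi x *: 1%:M).
  move=> e e0; exists 1 => // x y _ _.
  rewrite /f !scalemx1 -!raddfB/=.
  have -> : 1 + phi x - (1 + phi y) - (phi x - phi y) = 0 by ring.
  by rewrite raddf0 normr0 mulr_ge0// ltW.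
have f0 : f 0 = 1%:M by rewrite /f /phi dotp0l addr0.
have FS := sdiff0_mul f0 P1 fl LPl fs PLP.
have LE x : (phi x *: 1%:M + LP x) *m v = x.
  rewrite mulmxDl -scalemxAl mul1mx /LP mulmx_suml.
  have -> : \sum_(i < size b) (c i x *: (hB i).2) *m v = pr x.
    rewrite [RHS](@coord_span _ _ _ bt (pr x)); last by rewrite bE// dotpBl dotpZl vv mulr1 subrr.
    by apply: eq_bigr => i _; have [_ _ _] := hBP i; rewrite -scalemxAl => <-.
  by rewrite addrC subrK.
have Q1 : forall e : R, 0 < e -> exists2 r : R, 0 < r &
     forall x x' b b' : 'cV[R]_k, `|x - v| < r -> `|x' - v| < r -> `|b| < r -> `|b'| < r ->
     `|((f b *m P b) *m v - x) - ((f b' *m P b') *m v - x') - (- x - - x' + (b - b'))|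
     <= e * (`|x - x'| + `|b - b'|).
  move=> e e0; have v0 : 0 < k%:R * `|v| + 1 by rewrite ltr_wpDl// mulr_ge0.
  have [r r0 H] := FS _ (divr_gt0 e0 v0); exists r => // x x' d d' _ _ dr d'r.
  have -> : f d *m P d *m v - x - (f d' *m P d' *m v - x') - (- x - - x' + (d - d')) =
    (f d *m P d - f d' *m P d' - (phi d *: 1%:M + LP d - (phi d' *: 1%:M + LP d'))) *m v.
    rewrite !(mulmxBl _ _ v) !LE; move: (f d *m _ *m _) (f d' *m _ *m _) => u w.
    by apply/matrixP => i j; rewrite !mxE; ring.
  apply: le_trans (norm_mulmx _ _) _.
  apply: (@le_trans _ _ ((k%:R * `|v| + 1) * (e / (k%:R * `|v| + 1) * `|d - d'|))).
    rewrite mulrAC; apply: ler_pM; rewrite ?mulr_ge0//; first by rewrite lerDl.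
    exact: H.
  rewrite mulrA [_ * (e / _)]mulrC divfK ?gt_eqF// ler_wpM2l ?(ltW e0)//.
  by rewrite lerDr.
have v1 : `|v| <= 1.
  rewrite -(@ler_pXn2r _ 2)// ?qualifE//= expr1n -vv; exact: norm_le_dotp.
have k0 : 0 < k.+1%:R :> R by rewrite ltr0Sn.
have C1 : forall x y : 'cV[R]_k, `|- x - - y| <= 1 * `|x - y|.
  by move=> x y; rewrite mul1r -opprD normrN.
have Q0 : f 0 *m P 0 *m v - v = 0 by rewrite f0 P1 !mul1mx subrr.
(* With [|beta y| < 1 / (k + 1)] the factor 1 + phi is positive, hence 1 and not -1 on unit
   vectors. *)
have ir : 0 < k.+1%:R^-1 :> R by rewrite invr_gt0.
have [rho rho0 [beta [_ bG br _]]] :=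
  implicit_function (G := fun x b => f b *m P b *m v - x) ler01 C1 Q0 Q1 ir.
have PG x : G (P x).
  rewrite /P; elim/big_ind : _ => //= i _; have [_ _ h _] := hBP i; exact: h.
have near_v y : dotp y y = 1 -> `|y - v| < rho -> exists2 g, G g & y = g *m v.
  move=> yy yr; have /eqP := bG _ yr; rewrite subr_eq0 => /eqP yE.
  exists (P (beta y)) => //.
  suff e1 : phi (beta y) = 0 by rewrite -[LHS]yE /f e1 addr0 mul1mx.
  have : (1 + phi (beta y)) ^+ 2 = dotp y y.
    rewrite -[in RHS]yE /f -scalemx1 -!scalemxAl mul1mx dotpZl dotpZr dotp_orth; last exact/GO/PG.
    by rewrite vv mulr1 expr2.
  have : `|phi (beta y)| < 1.
    apply: le_lt_trans (dotp_le_norm _ _) _.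
    have h : k%:R * `|beta y| * `|v| <= k.+1%:R * `|beta y|.
      rewrite -[leRHS]mulr1; apply: ler_pM => //; rewrite ?mulr_ge0//.
      by rewrite ler_wpM2r// ler_nat.
    by apply: le_lt_trans h _; rewrite mulrC -ltr_pdivlMr// div1r; exact: br.
  rewrite yy; move: (phi (beta y)) => u; rewrite ltr_norml => /andP[u1 u2] /eqP.
  by rewrite sqrf_eq1 => /orP[/eqP|/eqP]; lra.
(* Isometries transport the ball around [v]; the division by k + 1 accounts for their not preserving
   the sup norm. *)
have near_orbit g y : G g -> dotp y y = 1 -> `|y - g *m v| < rho / k.+1%:R ->
    exists2 g', G g' & y = g' *m v.
  move=> Gg yy; rewrite ltr_pdivlMr// => yr.
  have gg := GO _ Gg; have gg' : g *m g^T = 1%:M by exact: mulmx1C.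
  have [||g' Gg' yE] := near_v (g^T *m y).
  - by rewrite dotp_orth// trmxK.
  - rewrite -[v]mul1mx -gg -mulmxA -mulmxBr (le_lt_trans (norm_mulmx _ _))//.
    apply: le_lt_trans yr; rewrite mulrC; apply: ler_pM; rewrite ?mulr_ge0//.
    rewrite -[leRHS]mulr1; apply: ler_pM => //; first by rewrite ler_nat.
    by rewrite norm_trmx norm_orth.
  - by exists (g *m g'); [exact: GM|rewrite -mulmxA -yE mulmxA gg' mul1mx].
have circle w t : dotp v w = 0 -> dotp w w = 1 ->
    exists2 g, G g & cos t *: v + sin t *: w = g *m v.
  move=> vw ww; pose z (t : R) := cos t *: v + sin t *: w.
  have zz s : dotp (z s) (z s) = 1.
    rewrite /z !(dotpDl, dotpDr, dotpZl, dotpZr) vv ww [dotp w v]dotpC vw.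
    by rewrite !mulr0 !mulr1 addr0 add0r -!expr2 cos2Dsin2.
  have zc (s e : R) : 0 < e -> exists2 d : R, 0 < d & forall x, `|x - s| < d -> `|z x - z s| < e.
    move=> e0; have e20 : 0 < e / 2 / (`|v| + `|w| + 1).
      by rewrite !divr_gt0// ltr_wpDl// addr_ge0.
    have /cvgrPdist_lt/(_ _ e20)[d1 /= d10 h1] := @continuous_cos R s.
    have /cvgrPdist_lt/(_ _ e20)[d2 /= d20 h2] := @continuous_sin R s.
    exists (Num.min d1 d2) => [|x]; first by rewrite lt_min d10.
    rewrite lt_min distrC => /andP[/h1 k1' /h2 k2'].
    have -> : z x - z s = (cos x - cos s) *: v + (sin x - sin s) *: w.
      by rewrite /z !scalerBl opprD addrACA.
    rewrite (le_lt_trans (ler_normD _ _))// !normrZ.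
    move: k1' k2'; rewrite ![`|cos s - _|]distrC ![`|sin s - _|]distrC.
    rewrite !ltr_pdivlMr ?ltr_wpDl ?addr_ge0// => k1' k2'.
    have a1 : `|cos x - cos s| * `|v| <= `|cos x - cos s| * (`|v| + `|w| + 1).
      by rewrite ler_wpM2l//; have := normr_ge0 w; lra.
    have a2 : `|sin x - sin s| * `|w| <= `|sin x - sin s| * (`|v| + `|w| + 1).
      by rewrite ler_wpM2l//; have := normr_ge0 v; lra.
    by apply: le_lt_trans (lerD a1 a2) _; lra.
  apply: (@locally_const_prop _ (fun t => exists2 g, G g & z t = g *m v) _ 0 t).
    move=> s; have [d d0 H] := zc s _ (divr_gt0 rho0 k0); exists d => // x xs.
    split=> -[g Gg gE]; apply: (near_orbit g) => //; rewrite -gE; last exact: H.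
    by rewrite distrC; exact: H.
  by exists 1%:M => //; rewrite /z cos0 sin0 scale1r scale0r addr0 mul1mx.
move=> y yy; pose cc := dotp y v; pose r := y - cc *: v.
have vr : dotp v r = 0 by rewrite dotpBr dotpZr vv mulr1 dotpC subrr.
have rr : dotp r r = 1 - cc ^+ 2.
  by rewrite /r !(dotpBl, dotpBr, dotpZl, dotpZr) vv yy [dotp v y]dotpC -/cc; ring.
have cc1 : -1 <= cc <= 1.
  have := dotp_ge0 r; rewrite rr => h; apply/andP; split; nra.
have [r0|r0] := eqVneq r 0.
  (* Here [y] is [v] or [- v]; the latter is reached by half a great circle, which exists because 1
     < k. *)
  have [i vi] : exists i, v i 0 != 0.
    apply: contrapT => /forallNP H; move: vv; rewrite dotpE big1 => [/eqP|i _].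
      by rewrite eq_sym oner_eq0.
    by have /negP := H i; rewrite negbK => /eqP ->; rewrite mul0r.
  have [j ij] : exists j : 'I_k, j != i.
    have [i0|i0] := eqVneq i (Ordinal (ltnW k1)).
      by exists (Ordinal k1); rewrite i0; apply/eqP => /(congr1 val).
    by exists (Ordinal (ltnW k1)); rewrite eq_sym.
  pose u : 'cV[R]_k := v i 0 *: delta_mx j 0 - v j 0 *: delta_mx i 0.
  have dE (w : 'cV[R]_k) l : dotp w (delta_mx l 0) = w l 0.
    rewrite dotpE (bigD1 l)//= mxE !eqxx mulr1 big1 ?addr0// => m ml.
    by rewrite mxE (negPf ml) mulr0.
  have vu : dotp v u = 0 by rewrite dotpBr !dotpZr !dE; ring.
  have u0 : u != 0.
    apply/eqP => /matrixP/(_ j 0); rewrite !mxE !eqxx (negPf ij) mulr1 mulr0 subr0.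
    by move/eqP; rewrite (negPf vi).
  have uu : 0 < dotp u u by rewrite dotp_gt0.
  pose w := (Num.sqrt (dotp u u))^-1 *: u.
  have vw : dotp v w = 0 by rewrite dotpZr vu mulr0.
  have ww : dotp w w = 1.
    rewrite dotpZl dotpZr mulrA -invfM -expr2 sqr_sqrtr ?ltW// mulVf ?gt_eqF//.
  have : cc ^+ 2 = 1 by move: rr; rewrite r0 dotp0l => /eqP; rewrite eq_sym subr_eq0 => /eqP.
  have yE : y = cc *: v by apply/eqP; rewrite -subr_eq0 -/r r0.
  move=> /eqP; rewrite sqrf_eq1 => /orP[/eqP c1|/eqP c1]; rewrite yE c1.
    by exists 1%:M => //; rewrite mul1mx scale1r.
  by have := circle w pi vw ww; rewrite cospi sinpi scale0r addr0.
have rr0 : 0 < dotp r r by rewrite dotp_gt0.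
pose w := (Num.sqrt (dotp r r))^-1 *: r.
have vw : dotp v w = 0 by rewrite dotpZr vr mulr0.
have ww : dotp w w = 1.
  by rewrite dotpZl dotpZr mulrA -invfM -expr2 sqr_sqrtr ?ltW// mulVf ?gt_eqF.
have := circle w (acos cc) vw ww.
rewrite acosK ?in_itv//= sin_acos// -rr /w scalerA divff ?scale1r.
  by rewrite addrC subrK.
by rewrite gt_eqF// sqrtr_gt0.
Qed.

End transitivity.

(** * Words of exponentials and charts of their orbits *)

Section words.
Variables (R : realType) (N : nat).
Implicit Types (h : {vspace 'M[R]_N}) (w : seq (R * 'M[R]_N)) (g X Y : 'M[R]_N).

Definition lie_so h := (forall A, A \in h -> A^T = - A) /\
  (forall A B, A \in h -> B \in h -> A *m B - B *m A \in h).

Definition gword w : 'M[R]_N := \prod_(a <- w) expmx (a.1 *: a.2).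

Definition word_in h w := forall a, a \in w -> a.2 \in h.

Lemma gword_nil : gword [::] = 1%:M. Proof. by rewrite /gword big_nil. Qed.

Lemma gword_cons a w : gword (a :: w) = expmx (a.1 *: a.2) *m gword w.
Proof. by rewrite /gword big_cons. Qed.

Lemma gword_cat w1 w2 : gword (w1 ++ w2) = gword w1 *m gword w2.
Proof. by rewrite /gword big_cat. Qed.

Lemma word_in_cons h a w : word_in h (a :: w) -> a.2 \in h /\ word_in h w.
Proof.
move=> H; split; first exact/H/mem_head.
by move=> b bw; apply: H; rewrite inE bw orbT.
Qed.

(** What the estimates use of a group element; both conjugations are included so that the property
    passes to inverses. *)
Definition normalizes h g := g^T *m g = 1%:M /\
  (forall Y, Y \in h -> g *m Y *m g^T \in h) /\ (forall Y, Y \in h -> g^T *m Y *m g \in h).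

Lemma normalizes1 h : normalizes h 1%:M.
Proof. by split; [rewrite trmx1 mulmx1|split=> Y; rewrite trmx1 mulmx1 mul1mx]. Qed.

Lemma normalizesM h g g' : normalizes h g -> normalizes h g' -> normalizes h (g *m g').
Proof.
move=> [g1 [g2 g3]] [g1' [g2' g3']]; split; first by rewrite trmx_mul mulmxA -(mulmxA _ g^T) g1 mulmx1.
split=> Y Yh; rewrite trmx_mul; first by have := g2 _ (g2' _ Yh); rewrite !mulmxA.
by have := g3' _ (g3 _ Yh); rewrite !mulmxA.
Qed.

Lemma normalizesT h g : normalizes h g -> normalizes h g^T.
Proof. by move=> [g1 [g2 g3]]; split; [rewrite trmxK mulmx1C|split; rewrite trmxK]. Qed.

Lemma normalizes_expmx h X (t : R) : lie_so h -> X \in h -> normalizes h (expmx (t *: X)).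
Proof.
move=> [hT hB] Xh; split; first exact/orth_expmx/hT.
rewrite skew_expmx ?hT//; split=> Y Yh; first by apply: expmx_conj_vspace => // Z; exact: hB.
by have := @expmx_conj_vspace _ _ X h (- t) Y; rewrite opprK; apply=> // Z; exact: hB.
Qed.

Lemma normalizes_gword h w : lie_so h -> word_in h w -> normalizes h (gword w).
Proof.
move=> hh; elim: w => [|a w IH]; first by move=> _; rewrite gword_nil; exact: normalizes1.
move=> /word_in_cons[ah wh]; rewrite gword_cons; apply: normalizesM; last exact: IH.
exact: normalizes_expmx.
Qed.

Lemma gword_inv h w : lie_so h -> word_in h w -> exists2 w', word_in h w' & gword w' = (gword w)^T.
Proof.
move=> [hT hB]; elim: w => [|a w IH].
  by exists [::] => //; rewrite gword_nil trmx1.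
move=> /word_in_cons[ah /IH[w' wh' E]]; exists (w' ++ [:: (- a.1, a.2)]).
  move=> b; rewrite mem_cat inE => /orP[/wh'//|/eqP->//].
by rewrite gword_cat E !gword_cons gword_nil mulmx1 trmx_mul/= (skew_expmx _ (hT _ ah)).
Qed.

End words.

Section orthogonal_norms.
Variable R : realType.

Lemma norm_orth_mul N m (g : 'M[R]_N) (x : 'M[R]_(N, m)) :
  g^T *m g = 1%:M -> `|g *m x| <= N%:R * `|x|.
Proof.
move=> gg; apply: le_trans (norm_mulmx _ _) _; rewrite ler_wpM2r//.
by rewrite -[leRHS]mulr1 ler_wpM2l// norm_orth.
Qed.

Lemma unitmx_inj n (A : 'M[R]_n) : (forall c : 'cV_n, A *m c = 0 -> c = 0) -> A \in unitmx.
Proof.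
move=> H; rewrite -unitmx_tr -row_free_unit -kermx_eq0; apply/eqP/row_matrixP => i.
rewrite row0; apply: trmx_inj; rewrite trmx0; apply: H; apply: trmx_inj.
by rewrite trmx_mul trmxK trmx0; apply/sub_kermxP; rewrite row_sub.
Qed.

Lemma near1_inverse n (A : 'M[R]_n) c : `|A - 1%:M| <= (2 * n.+1%:R)^-1 ->
  `|c : 'cV_n| <= 2 * `|A *m c|.
Proof.
move=> AE; have : `|c| <= `|A *m c| + 2^-1 * `|c|.
  have cE : c = A *m c - (A - 1%:M) *m c by rewrite -mulmxBl opprB addrC subrK mul1mx.
  rewrite [X in `|X| <= _]cE.
  apply: le_trans (ler_normB _ _) _; rewrite lerD2l.
  apply: le_trans (norm_mulmx _ _) _; rewrite ler_wpM2r//.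
  apply: (@le_trans _ _ (n.+1%:R * (2 * n.+1%:R)^-1)).
    by apply: ler_pM => //; rewrite ler_nat.
  by rewrite invfM mulrCA divff ?mulr1// pnatr_eq0.
by move: `|c| `|A *m c| => a b; lra.
Qed.

End orthogonal_norms.

Section increments.
Variables (R : realType) (N : nat) (h : {vspace 'M[R]_N}).
Hypothesis hh : lie_so h.

Lemma expmx_conj (g X : 'M[R]_N) (t : R) : g *m g^T = 1%:M ->
  g^T *m expmx (t *: X) *m g = expmx (t *: (g^T *m X *m g)).
Proof.
move=> gg; pose f (t : R) := g^T *m expmx (t *: X) *m g.
have H (s : R) : is_derive s 1 f (g^T *m X *m g *m f s).
  have := is_derive_mulcst g (is_derive_cstmul g^T (@is_derive_expmx _ _ X s)).
  move=> H; apply: (is_derive_eq H).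
  by rewrite /f !mulmxA -(mulmxA _ g g^T) gg mulmx1.
by rewrite -/(f t) (expmx_ode H) /f scale0r expmx0 mulmx1 (mulmx1C gg) mulmx1.
Qed.

(* First-order expansion of a product of one-parameter subgroups: after
   translation to the identity it is again such a product. *)
Lemma gprod_increment d (X : 'I_d -> 'M[R]_N) (b : 'cV[R]_d) (s : seq 'I_d) :
  (forall i, X i \in h) ->
  exists L : 'cV[R]_d -> 'M[R]_N, (forall x, L x \in h) /\
  exists2 C : R, 0 <= C & (forall x, `|L x| <= C * `|x|) /\
    forall e : R, 0 < e -> exists2 r : R, 0 < r & forall x, `|x| < r ->
    `|(\prod_(i <- s) expmx (b i 0 *: X i))^T *m
        (\prod_(i <- s) expmx ((b + x) i 0 *: X i)) - 1%:M - L x| <= e * `|x|.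
Proof.
move=> Xh; pose P (b : 'cV[R]_d) s := \prod_(i <- s) expmx (b i 0 *: X i).
have PE b' i s' : P b' (i :: s') = expmx (b' i 0 *: X i) *m P b' s' by rewrite /P big_cons.
have Pn b' s' : normalizes h (P b' s').
  elim: s' => [|i s' IH]; first by rewrite /P big_nil; exact: normalizes1.
  by rewrite PE; apply: normalizesM => //; exact: normalizes_expmx.
have [t [th tE]] : exists t : seq ('I_d * 'M[R]_N), (forall q, q \in t -> q.2 \in h) /\
    forall x, (P b s)^T *m P (b + x) s = \prod_(q <- t) expmx (x q.1 0 *: q.2).
  elim: s => [|i s [t [th tE]]].
    by exists [::]; split=> // x; rewrite /P !big_nil trmx1 mulmx1.
  have [Q1 [Q2 Q3]] := Pn b s; have Q1' := mulmx1C Q1.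
  exists ((i, (P b s)^T *m X i *m P b s) :: t); split=> [q|x].
    by rewrite inE => /orP[/eqP->|/th//]; exact: Q3.
  rewrite big_cons -tE !PE trmx_mul (skew_expmx _ (hh.1 _ (Xh i))) -expmx_conj//.
  rewrite -[_ * _]/(_ *m _) !mulmxA -[in RHS](mulmxA _ (P b s)) Q1' mulmx1.
  by rewrite -(mulmxA _ (expmx (- b i 0 *: X i))) -expmxD mxE addrA addNr add0r.
pose F (q : 'I_d * 'M[R]_N) (x : 'cV[R]_d) := expmx (x q.1 0 *: q.2).
pose Lq (q : 'I_d * 'M[R]_N) (x : 'cV[R]_d) := x q.1 0 *: q.2.
have lq q : lipschitz_fun (Lq q) by apply: lipschitz_scale; exact: lipschitz_entry.
have [F1 [C C0 LC] FL] : [/\ \prod_(q <- t) F q 0 = 1%:M,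
   lipschitz_fun (fun x => \sum_(q <- t) Lq q x) &
   sdiff0 (fun x => \prod_(q <- t) F q x) (fun x => \sum_(q <- t) Lq q x)].
  apply: sdiff0_prod => q //; first by rewrite /F mxE scale0r expmx0.
  apply: (@sdiff0_comp _ _ _ (fun t => expmx (t *: _)) _ (fun x : 'cV[R]_d => x _ 0)).
  - by rewrite mxE.
  - exact: lipschitz_entry.
  - exact: sdiff0_expmx.
have L0 : \sum_(q <- t) Lq q 0 = 0 by rewrite big1// => q _; rewrite /Lq mxE scale0r.
exists (fun x => \sum_(q <- t) Lq q x); split=> [x|].
  by rewrite big_seq; apply: memv_suml => q /th qh; rewrite memvZ.
exists C => //; split=> [x|e e0]; first by have := LC x 0; rewrite L0 !subr0.
have [r r0 H] := FL _ e0; exists r => // x xr.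
by have := H x 0 xr; rewrite normr0 F1 L0 !subr0 -tE => /(_ r0).
Qed.

End increments.

Section orbit_charts.
Variables (R : realType) (N : nat) (h : {vspace 'M[R]_N}) (p : 'cV[R]_N).
Hypothesis hh : lie_so h.

Lemma orbit_frame : exists d (F0 : 'M[R]_(N, d)) (X : 'I_d -> 'M[R]_N),
  [/\ F0^T *m F0 = 1%:M, forall i, X i \in h, forall i, X i *m p = col i F0 &
      forall Y, Y \in h -> exists a, Y *m p = F0 *m a].
Proof.
pose U : {vspace 'cV[R]_N} := (linfun (mulmxr p : 'M[R]_N -> 'cV[R]_N) @: h)%VS.
have [F0 [FF UE]] := orthonormal_basis U.
have /choice[X HX] : forall i, exists X, X \in h /\ X *m p = col i F0.
  move=> i; have : col i F0 \in U.
    by rewrite UE colE !mulmxA -(mulmxA F0) FF mulmx1.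
  by case/memv_imgP => X Xh; rewrite lfunE/= => ->; exists X.
exists (\dim U), F0, X; split=> // [i|i|Y Yh]; [by case: (HX i)|by case: (HX i)|].
have : Y *m p \in U by have := memv_img (linfun (mulmxr p : 'M[R]_N -> 'cV[R]_N)) Yh; rewrite lfunE.
by rewrite UE => /eqP <-; exists (F0^T *m (Y *m p)).
Qed.

Variables (d : nat) (F0 : 'M[R]_(N, d)) (X : 'I_d -> 'M[R]_N).
Hypotheses (FF : F0^T *m F0 = 1%:M) (Xh : forall i, X i \in h)
  (Xp : forall i, X i *m p = col i F0)
  (hp : forall Y, Y \in h -> exists a, Y *m p = F0 *m a).

(** Canonical coordinates of the second kind, transverse to the isotropy of [p] since the [X i *m p]
    are independent. *)
Definition gchart (b : 'cV[R]_d) : 'M[R]_N := \prod_(i <- enum 'I_d) expmx (b i 0 *: X i).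

Lemma gchart_normalizes b : normalizes h (gchart b).
Proof.
rewrite /gchart; elim: (enum _) => [|i s IH]; first by rewrite big_nil; exact: normalizes1.
by rewrite big_cons; apply: normalizesM => //; exact: normalizes_expmx.
Qed.

Lemma gchart0 : gchart 0 = 1%:M.
Proof.
by rewrite /gchart big1// => i _; rewrite mxE scale0r expmx0.
Qed.

Let L (b : 'cV[R]_d) := \sum_(i <- enum 'I_d) b i 0 *: X i.

Let Lp b : L b *m p = F0 *m b.
Proof.
rewrite /L mulmx_suml mulmx_sum_col big_enum/=; apply: eq_bigr => i _.
by rewrite -scalemxAl Xp.
Qed.

Let LT b : (L b)^T = - L b.
Proof.
rewrite /L linear_sum/= -sumrN; apply: eq_bigr => i _.
by rewrite linearZ/= (hh.1 _ (Xh i)) scalerN.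
Qed.

Let sdiff_gchart : lipschitz_fun L /\ sdiff0 gchart L.
Proof.
have [_ ll sd] : [/\ \prod_(i <- enum 'I_d) expmx ((0 : 'cV[R]_d) i 0 *: X i) = 1%:M,
   lipschitz_fun L & sdiff0 gchart L].
  apply: (@sdiff0_prod _ 'cV[R]_d _ _ _ (fun i b => expmx (b i 0 *: X i)) (fun i b => b i 0 *: X i)) => i.
  - by rewrite mxE scale0r expmx0.
  - by apply: lipschitz_scale; exact: lipschitz_entry.
  - apply: (@sdiff0_comp _ _ _ (fun t => expmx (t *: _)) _ (fun x : 'cV[R]_d => x _ 0)).
    + by rewrite mxE.
    + exact: lipschitz_entry.
    + exact: sdiff0_expmx.
by split.
Qed.

Let chart_identity (g g' A B : 'M[R]_N) (x x' q : 'cV[R]_N) : A^T = - A -> B^T = - B ->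
  g^T *m x - g'^T *m x' - (x - x' - (A - B) *m q) =
  (g - 1%:M)^T *m (x - x') + ((g - g' - (A - B))^T *m x' + - ((A - B) *m (x' - q))).
Proof.
have trB (C D : 'M[R]_N) : (C - D)^T = C^T - D^T by rewrite linearB.
move=> AT BT; rewrite !trB AT BT trmx1.
rewrite [(g^T - 1%:M) *m _]mulmxBl !(mulmxBl _ _ x') mul1mx [(- A) *m _]mulNmx [(- B) *m _]mulNmx.
rewrite [(A - B) *m q]mulmxBl [(A - B) *m (x' - q)]mulmxBl ![_ *m (x' - q)]mulmxBr [g^T *m (x - x')]mulmxBr.
move: (g^T *m x) (g^T *m x') (g'^T *m x') (A *m q) (B *m q) (A *m x') (B *m x').
by move=> a1 a2 a3 a4 a5 a6 a7; apply/matrixP => i j; rewrite !mxE; ring.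
Qed.

(** The implicit function theorem solves for the chart element that carries [x] back into the slice
    through [p] orthogonal to [h p]. The point reached in the slice serves as transverse coordinate
    of the sheet through [x]. *)
Lemma orbit_chart (eps : R) : 0 < eps -> exists rho C : R, [/\ 0 < rho, 0 <= C &
  exists beta : 'cV[R]_N -> 'cV[R]_d, beta p = 0 /\
  (forall x, `|x - p| < rho -> F0^T *m ((gchart (beta x))^T *m x) = 0 /\
     `|(gchart (beta x))^T *m x - p| < eps) /\
  (forall x y, `|x - p| < rho -> `|y - p| < rho ->
     `|beta x - beta y| <= C * `|x - y|)].
Proof.
move=> eps0; have [ll sd] := sdiff_gchart; have [CL CL0 LC] := ll.
have L0 : L 0 = 0 by rewrite /L big1// => i _; rewrite mxE scale0r.
have p1 : 0 < `|p| + 1 by rewrite ltr_wpDl.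
have Np : 0 < 2 * (N.+1%:R * (`|p| + 1)) by rewrite !mulr_gt0// ltr0Sn.
have [r0 r00 near1] := sdiff0_near1 gchart0 ll sd (divr_gt0 eps0 Np).
(* Transposing the skew [L b] changes its sign; the minus makes the derivative in [b] the identity,
   as [L b *m p = F0 *m b]. *)
pose G (x : 'cV[R]_N) (b : 'cV[R]_d) := - F0^T *m ((gchart b)^T *m x).
pose D1 (x : 'cV[R]_N) := - F0^T *m x.
have F01 : `|F0| <= 1 by exact: norm_orth.
have D1C x y : `|D1 x - D1 y| <= N%:R * `|x - y|.
  rewrite /D1 -mulmxBr; apply: le_trans (norm_mulmx _ _) _; rewrite ler_wpM2r//.
  by rewrite normrN norm_trmx -[leRHS]mulr1 ler_wpM2l.
have G0 : G p 0 = 0.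
  rewrite /G gchart0 trmx1 mul1mx; apply/matrixP => i j.
  rewrite ord1 mulNmx mxE [RHS]mxE; apply/eqP; rewrite oppr_eq0; apply/eqP.
  have -> : (F0^T *m p) i 0 = dotp (X i *m p) p.
    by rewrite Xp /dotp; rewrite !mxE; apply: eq_bigr => k _; rewrite !mxE.
  by rewrite dotp_skew0// (hh.1 _ (Xh i)).
have sG : forall e : R, 0 < e -> exists2 r : R, 0 < r &
   forall x x' b b', `|x - p| < r -> `|x' - p| < r -> `|b| < r -> `|b'| < r ->
   `|G x b - G x' b' - (D1 x - D1 x' + (b - b'))| <= e * (`|x - x'| + `|b - b'|).
  move=> e e0; pose K := N.+1%:R * N.+1%:R * (`|p| + 2 + CL) : R.
  have K0 : 0 < K by rewrite !mulr_gt0 ?ltr0Sn//; have := normr_ge0 p; lra.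
  have eK := divr_gt0 e0 K0.
  have [r1 r10 H1] := sdiff0_near1 gchart0 ll sd eK.
  have [r2 r20 H2] := sd _ eK.
  exists (Num.min (Num.min r1 r2) (Num.min 1 (e / K))) => [|x x' b b'].
    by rewrite !lt_min r10 r20 ltr01.
  rewrite !lt_min => _ /andP[_ /andP[x1 x2]] /andP[/andP[b1 b2] _] /andP[/andP[b1' b2'] _].
  have E : G x b - G x' b' - (D1 x - D1 x' + (b - b')) =
     - F0^T *m ((gchart b - 1%:M)^T *m (x - x') +
        ((gchart b - gchart b' - (L b - L b'))^T *m x' + - ((L b - L b') *m (x' - p)))).
    have -> : b - b' = - (- F0^T *m ((L b - L b') *m p)).
      by rewrite mulmxBl !Lp mulNmx opprK -mulmxBr mulmxA FF mul1mx.
    rewrite /G /D1; move: (- F0^T) => A.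
    transitivity (A *m ((gchart b)^T *m x - (gchart b')^T *m x' - (x - x' - (L b - L b') *m p))).
      by rewrite !(mulmxBr A).
    by congr (A *m _); apply: chart_identity.
  rewrite E; apply: le_trans (norm_mulmx _ _) _; rewrite normrN norm_trmx.
  set w := `|x - x'|; set z := `|b - b'|.
  have c1 : `|(gchart b - 1%:M)^T *m (x - x')| <= N.+1%:R * (e / K) * w.
    apply: le_trans (norm_mulmx _ _) _; rewrite norm_trmx; apply: ler_pM; rewrite ?mulr_ge0//.
    by apply: ler_pM => //; [rewrite ler_nat|exact: H1].
  have x'p : `|x'| <= `|p| + 1.
    by rewrite -[x'](subrK p) (le_trans (ler_normD _ _))// addrC lerD2l ltW.
  have c2 : `|(gchart b - gchart b' - (L b - L b'))^T *m x'| <= N.+1%:R * ((e / K) * z) * (`|p| + 1).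
    apply: le_trans (norm_mulmx _ _) _; rewrite norm_trmx; apply: ler_pM; rewrite ?mulr_ge0//.
    by apply: ler_pM => //; [rewrite ler_nat|exact: H2].
  have c3 : `|- ((L b - L b') *m (x' - p))| <= N.+1%:R * (CL * z) * (e / K).
    rewrite normrN; apply: le_trans (norm_mulmx _ _) _; apply: ler_pM; rewrite ?mulr_ge0//.
      by rewrite ler_pM ?ler_nat.
    exact: ltW.
  have w0 : 0 <= w by exact: normr_ge0.
  have z0 : 0 <= z by exact: normr_ge0.
  apply: (@le_trans _ _ (N.+1%:R * (N.+1%:R * (e / K) * w + (N.+1%:R * ((e / K) * z) * (`|p| + 1) + N.+1%:R * (CL * z) * (e / K))))).
    apply: ler_pM; rewrite ?mulr_ge0//.
      by rewrite -[leRHS]mulr1; apply: ler_pM => //; rewrite ler_nat.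
    apply: le_trans (ler_normD _ _) _; apply: lerD => //.
    by apply: le_trans (ler_normD _ _) _; apply: lerD.
  have -> : N.+1%:R * (N.+1%:R * (e / K) * w + (N.+1%:R * ((e / K) * z) * (`|p| + 1) + N.+1%:R * (CL * z) * (e / K)))
    = (e / K) * (N.+1%:R * N.+1%:R) * (w + z * (`|p| + 1 + CL)) by ring.
  apply: (@le_trans _ _ ((e / K) * K * (w + z))); last by rewrite divfK// gt_eqF.
  move: (ltW eK) => {}eK; set q := e / K in eK *.
  have -> : q * K * (w + z) = q * (N.+1%:R * N.+1%:R) * ((`|p| + 2 + CL) * (w + z)).
    by rewrite /K; ring.
  apply: ler_wpM2l; first by apply: mulr_ge0 => //; apply: mulr_ge0.
  have : 0 <= w * (`|p| + 1 + CL) by rewrite mulr_ge0// !addr_ge0.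
  by lra.
have [rho rho0 [beta [b0 bG br bC]]] := implicit_function (ler0n R N) D1C G0 sG r00.
have e2 : 0 < eps / 2 by rewrite divr_gt0.
exists (Num.min rho (Num.min 1 (eps / 2))), (2 * N%:R + 1); split.
- by rewrite !lt_min rho0 ltr01.
- by rewrite addr_ge0// mulr_ge0.
- exists beta; split=> //; split=> [x|x y]; rewrite !lt_min; last first.
    by move=> /andP[xr _] /andP[yr _]; exact: bC.
  move=> /andP[xr /andP[x1 xe]]; split.
    by have /eqP := bG _ xr; rewrite /G mulNmx oppr_eq0 => /eqP.
  have xp : `|x| <= `|p| + 1.
    by rewrite -[x](subrK p) (le_trans (ler_normD _ _))// addrC lerD2l ltW.
  have -> : (gchart (beta x))^T *m x - p = (gchart (beta x) - 1%:M)^T *m x + (x - p).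
    by rewrite linearB/= trmx1 mulmxBl mul1mx addrA subrK.
  apply: le_lt_trans (ler_normD _ _) _.
  suff : `|(gchart (beta x) - 1%:M)^T *m x| <= eps / 2 by lra.
  apply: le_trans (norm_mulmx _ _) _; rewrite norm_trmx.
  apply: (@le_trans _ _ (N.+1%:R * (eps / (2 * (N.+1%:R * (`|p| + 1)))) * (`|p| + 1))).
    apply: ler_pM; rewrite ?mulr_ge0//; apply: ler_pM => //; first by rewrite ler_nat.
    exact/near1/br.
  rewrite le_eqVlt; apply/orP; left; apply/eqP.
  by field; rewrite gt_eqF//= nat1r pnatr_eq0.
Qed.

End orbit_charts.

(** * First-order estimates along a segment *)

Section local_asymptotics.
Variables (R : realType) (D : R -> Prop) (t : R).

(** Relative to a domain [D], so that one-sided expansions at the ends of a segment are included. *)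
Definition small_o (V : normedModType R) (f : R -> V) := forall e : R, 0 < e ->
  exists2 d : R, 0 < d & forall s, D s -> `|s - t| < d -> `|f s| <= e * `|s - t|.

Definition big_O (V : normedModType R) (f : R -> V) := exists2 K : R, 0 <= K &
  exists2 d : R, 0 < d & forall s, D s -> `|s - t| < d -> `|f s| <= K * `|s - t|.

Lemma small_oD (V : normedModType R) (f g : R -> V) :
  small_o f -> small_o g -> small_o (fun s => f s + g s).
Proof.
move=> Hf Hg e e0; have e2 : 0 < e / 2 by rewrite divr_gt0.
have [d1 d10 H1] := Hf _ e2; have [d2 d20 H2] := Hg _ e2.
exists (Num.min d1 d2) => [|s Ds]; first by rewrite lt_min d10.
rewrite lt_min => /andP[s1 s2]; apply: le_trans (ler_normD _ _) _.
by rewrite [e in leRHS]splitr mulrDl; apply: lerD; [exact: H1|exact: H2].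
Qed.

Lemma small_o_dom (V W : normedModType R) (f : R -> V) (g : R -> W) (K : R) :
  (forall s, D s -> `|f s| <= K * `|g s|) -> small_o g -> small_o f.
Proof.
move=> fg Hg e e0; have K1 : 0 < `|K| + 1 by rewrite ltr_wpDl.
have [d d0 H] := Hg _ (divr_gt0 e0 K1); exists d => // s Ds sd.
apply: le_trans (fg _ Ds) _; apply: (@le_trans _ _ ((`|K| + 1) * `|g s|)).
  by rewrite ler_wpM2r//; have := ler_norm K; lra.
apply: le_trans (ler_wpM2l (ltW K1) (H _ Ds sd)) _.
by rewrite mulrA [_ * (e / _)]mulrC divfK// gt_eqF.
Qed.

Lemma big_O_dom (V W : normedModType R) (f : R -> V) (g : R -> W) (K : R) :
  (forall s, D s -> `|f s| <= K * `|g s|) -> big_O g -> big_O f.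
Proof.
move=> fg [C C0 [d d0 H]]; exists (`|K| * C); first exact: mulr_ge0.
exists d => // s Ds sd; apply: le_trans (fg _ Ds) _.
rewrite -mulrA; apply: (@le_trans _ _ (`|K| * `|g s|)).
  by rewrite ler_wpM2r// ler_norm.
by rewrite ler_wpM2l//; exact: H.
Qed.

Lemma small_oW (V : normedModType R) (f : R -> V) : small_o f -> big_O f.
Proof. by move=> /(_ 1 ltr01)[d d0 H]; exists 1 => //; exists d. Qed.

Lemma big_OD (V : normedModType R) (f g : R -> V) :
  big_O f -> big_O g -> big_O (fun s => f s + g s).
Proof.
move=> [K K0 [d1 d10 H1]] [M M0 [d2 d20 H2]]; exists (K + M); first exact: addr_ge0.
exists (Num.min d1 d2) => [|s Ds]; first by rewrite lt_min d10.
rewrite lt_min => /andP[s1 s2]; apply: le_trans (ler_normD _ _) _.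
by rewrite mulrDl; apply: lerD; [exact: H1|exact: H2].
Qed.

Lemma small_oN (V : normedModType R) (f : R -> V) : small_o f -> small_o (fun s => - f s).
Proof. by apply: (small_o_dom (K := 1)) => s _; rewrite normrN mul1r. Qed.

Lemma big_ON (V : normedModType R) (f : R -> V) : big_O f -> big_O (fun s => - f s).
Proof. by apply: (big_O_dom (K := 1)) => s _; rewrite normrN mul1r. Qed.

Lemma big_O_linear (V : normedModType R) (v : V) : big_O (fun s => (s - t) *: v).
Proof.
by exists `|v| => //; exists 1 => // s _ _; rewrite normrZ mulrC.
Qed.

Lemma small_o_mull m n q (A : 'M[R]_(m, n)) (f : R -> 'M[R]_(n, q)) :
  small_o f -> small_o (fun s => A *m f s).
Proof. by apply: small_o_dom => s _; exact: norm_mulmx. Qed.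

Lemma big_O_mull m n q (A : 'M[R]_(m, n)) (f : R -> 'M[R]_(n, q)) :
  big_O f -> big_O (fun s => A *m f s).
Proof. by apply: big_O_dom => s _; exact: norm_mulmx. Qed.

Lemma small_o_mulr m n q (f : R -> 'M[R]_(m, n)) (A : 'M[R]_(n, q)) :
  small_o f -> small_o (fun s => f s *m A).
Proof.
apply: (small_o_dom (K := n%:R * `|A|)) => s _.
by rewrite mulrAC; exact: norm_mulmx.
Qed.

Lemma big_O_mulr m n q (f : R -> 'M[R]_(m, n)) (A : 'M[R]_(n, q)) :
  big_O f -> big_O (fun s => f s *m A).
Proof.
apply: (big_O_dom (K := n%:R * `|A|)) => s _.
by rewrite mulrAC; exact: norm_mulmx.
Qed.

Lemma small_o_tr m n (f : R -> 'M[R]_(m, n)) : small_o f -> small_o (fun s => (f s)^T).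
Proof. by apply: (small_o_dom (K := 1)) => s _; rewrite norm_trmx mul1r. Qed.

Lemma big_O_tr m n (f : R -> 'M[R]_(m, n)) : big_O f -> big_O (fun s => (f s)^T).
Proof. by apply: (big_O_dom (K := 1)) => s _; rewrite norm_trmx mul1r. Qed.

Lemma big_O_mul m n q (f : R -> 'M[R]_(m, n)) (g : R -> 'M[R]_(n, q)) :
  big_O f -> big_O g -> small_o (fun s => f s *m g s).
Proof.
move=> [K K0 [d1 d10 H1]] [M M0 [d2 d20 H2]] e e0.
have C0 : 0 < n%:R * K * M + 1 by rewrite ltr_wpDl// !mulr_ge0.
exists (Num.min (Num.min d1 d2) (e / (n%:R * K * M + 1))) => [|s Ds].
  by rewrite !lt_min d10 d20 divr_gt0.
rewrite !lt_min ltr_pdivlMr// => /andP[/andP[s1 s2] s3].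
apply: le_trans (norm_mulmx _ _) _.
apply: (@le_trans _ _ (n%:R * (K * `|s - t|) * (M * `|s - t|))).
  apply: ler_pM; rewrite ?mulr_ge0//; last exact: H2.
  by rewrite ler_wpM2l//; exact: H1.
have -> : n%:R * (K * `|s - t|) * (M * `|s - t|) = (`|s - t| * (n%:R * K * M)) * `|s - t| by ring.
rewrite ler_wpM2r//; apply: le_trans (ltW s3).
by rewrite ler_wpM2l// lerDl.
Qed.

Lemma small_o_comp (V W : normedModType R) (E : V -> W) (y : R -> V) :
  (forall e : R, 0 < e -> exists2 r : R, 0 < r & forall x, `|x| < r -> `|E x| <= e * `|x|) ->
  big_O y -> small_o (fun s => E (y s)).
Proof.
move=> HE [K K0 [d d0 Hy]] e e0; have K1 : 0 < K + 1 by lra.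
have [r r0 Hr] := HE _ (divr_gt0 e0 K1).
exists (Num.min d (r / (K + 1))) => [|s Ds]; first by rewrite lt_min d0 divr_gt0.
rewrite lt_min ltr_pdivlMr// => /andP[sd sr].
have yb : `|y s| <= (K + 1) * `|s - t|.
  by apply: le_trans (Hy _ Ds sd) _; rewrite ler_wpM2r// lerDl.
apply: le_trans (Hr _ _) _; first by apply: le_lt_trans yb _; rewrite mulrC.
apply: le_trans (ler_wpM2l _ yb) _; first by rewrite divr_ge0 ?ltW.
by rewrite mulrA divfK// gt_eqF.
Qed.

Lemma derive_small_o (V : normedModType R) (f : R -> V) v :
  is_derive t 1 f v -> small_o (fun s => f s - f t - (s - t) *: v).
Proof.
move=> /is_derive_dist H e e0; have [d d0 Hd] := H _ e0.
by exists d => // s _; exact: Hd.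
Qed.

Lemma small_o_incr (V : normedModType R) (f : R -> V) v :
  small_o (fun s => f s - f t - (s - t) *: v) -> big_O (fun s => f s - f t).
Proof.
move=> /small_oW H; have := big_OD H (big_O_linear v).
by apply: (big_O_dom (K := 1)) => s _; rewrite subrK mul1r.
Qed.

End local_asymptotics.

Lemma expmx_near1 (R : realType) N (A : 'M[R]_N) (e : R) : 0 < e ->
  exists2 r : R, 0 < r & forall t : R, `|t| < r -> `|expmx (t *: A) - 1%:M| <= e.
Proof.
move=> e0; have [K K0 [d d0 H]] : big_O (fun _ => True) 0 (fun t => expmx (t *: A) - expmx ((0 : R) *: A)).
  exact/small_o_incr/derive_small_o/is_derive_expmx.
have K1 : 0 < K + 1 by lra.
exists (Num.min d (e / (K + 1))) => [|t]; first by rewrite lt_min d0 divr_gt0.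
rewrite lt_min ltr_pdivlMr// => /andP[td te].
have := H t I; rewrite subr0 scale0r expmx0 => /(_ td)/le_trans; apply.
apply: le_trans (ltW te); rewrite mulrC ler_wpM2l//; lra.
Qed.

(** * Transverse slices and the countability of sheets *)

Section leaves.
Variables (R : realType) (N : nat) (h : {vspace 'M[R]_N}) (p : 'cV[R]_N).
Hypothesis hh : lie_so h.
Variables (d : nat) (F0 : 'M[R]_(N, d)) (X : 'I_d -> 'M[R]_N).
Hypotheses (FF : F0^T *m F0 = 1%:M) (Xh : forall i, X i \in h)
  (Xp : forall i, X i *m p = col i F0)
  (hp : forall Y, Y \in h -> exists a, Y *m p = F0 *m a).

Let F01 : `|F0| <= 1. Proof. exact: norm_orth. Qed.

(* The orbit through [p] has constant dimension, hence its tangent spaces stay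
   transversal to the slice [p + (h p)^perp]. *)
Lemma slice_transversal : exists eps C : R, [/\ 0 < eps, 0 <= C &
  forall g, normalizes h g -> `|g *m p - p| < eps ->
  forall Y, Y \in h -> `|Y *m (g *m p)| <= C * `|F0^T *m (Y *m (g *m p))|].
Proof.
pose SX := \sum_i `|X i|; have SX0 : 0 <= SX by exact: sumr_ge0.
have XS i : `|X i| <= SX by rewrite /SX (bigD1 i)//= lerDl sumr_ge0.
pose C1 := N.+1%:R * (N.+1%:R * (SX + 1)) : R.
have C10 : 0 < C1 by rewrite !mulr_gt0 ?ltr0Sn//; lra.
have d0 : 0 < 2 * d.+1%:R :> R by rewrite mulr_gt0// ltr0Sn.
pose eps := (2 * d.+1%:R)^-1 / C1.
pose C2 := N%:R * SX * (N%:R * `|p|).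
have C20 : 0 <= C2 by rewrite !mulr_ge0.
exists eps, (d%:R * C2 * 2); split=> [||g gn gp Y Yh].
- by rewrite divr_gt0// invr_gt0.
- by rewrite !mulr_ge0.
have [gg [g2 g3]] := gn; have gg' := mulmx1C gg.
have tang Z : Z \in h -> exists a, Z *m (g *m p) = g *m (F0 *m a).
  move=> Zh; have [a aE] := hp (g3 _ Zh); exists a.
  by rewrite -aE !mulmxA gg' mul1mx.
have /choice[a aE] : forall i, exists a, X i *m (g *m p) = g *m (F0 *m a).
  by move=> i; exact/tang/Xh.
(* The velocities of the [X i] at [g *m p]: near [p] they are almost the columns of [F0], hence
   independent, and by dimension they span the tangent space there. *)
pose As : 'M[R]_(N, d) := \matrix_(k, i) (X i *m (g *m p)) k 0.
pose B : 'M[R]_d := \matrix_(k, i) a i k 0.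
have AsE : As = g *m F0 *m B.
  apply/matrixP => k i; rewrite mxE aE mulmxA mxE [RHS]mxE.
  by apply: eq_bigr => j _; rewrite [B j i]mxE.
have As1 : `|F0^T *m As - 1%:M| <= (2 * d.+1%:R)^-1.
  apply/norm_mx_le => [|j i]; first by rewrite invr_ge0 ltW.
  have -> : (F0^T *m As - 1%:M) j i = (F0^T *m (X i *m (g *m p - p))) j 0.
    rewrite mulmxBr mulmxBr [RHS]mxE [LHS]mxE; congr (_ + _).
      by rewrite !mxE; apply: eq_bigr => k _; rewrite [As k i]mxE.
    by rewrite Xp -FF !mxE; congr (- _); apply: eq_bigr => k _; rewrite !mxE.
  apply: le_trans (norm_entry _ _ _) _.
  apply: le_trans (norm_mulmx _ _) _; rewrite norm_trmx.
  apply: (@le_trans _ _ (N.+1%:R * (N.+1%:R * (SX + 1) * `|g *m p - p|))).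
    apply: ler_pM; rewrite ?mulr_ge0//.
      by rewrite -[leRHS]mulr1; apply: ler_pM => //; rewrite ler_nat.
    apply: le_trans (norm_mulmx _ _) _; rewrite ler_wpM2r//.
    apply: ler_pM => //; rewrite ?ler_nat//; have := XS i; lra.
  by rewrite mulrA -ler_pdivlMl// mulrC; exact: ltW.
have inj (c : 'cV_d) : `|c| <= 2 * `|F0^T *m (As *m c)|.
  by rewrite mulmxA; exact: near1_inverse.
have Bu : B \in unitmx.
  apply: unitmx_inj => c Bc; apply/eqP; rewrite -normr_le0.
  by apply: le_trans (inj c) _; rewrite AsE -mulmxA Bc !mulmx0 normr0 mulr0.
have [a0 YE] := tang _ Yh; pose c := invmx B *m a0.
have {}YE : Y *m (g *m p) = As *m c.
  by rewrite YE AsE /c -!mulmxA (mulmxA B) mulmxV// mul1mx.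
rewrite YE; apply: le_trans (norm_mulmx _ _) _.
have AsC : `|As| <= C2.
  apply/norm_mx_le => // k i; rewrite mxE; apply: le_trans (norm_entry _ _ _) _.
  apply: le_trans (norm_mulmx _ _) _; apply: ler_pM; rewrite ?mulr_ge0//.
    by rewrite ler_wpM2l.
  exact: norm_orth_mul.
rewrite -[leRHS]mulrA; apply: ler_pM; rewrite ?mulr_ge0//.
by rewrite ler_wpM2l.
Qed.

Variables (rho K : R) (beta : 'cV[R]_N -> 'cV[R]_d) (eps C : R).
Hypotheses (rho0 : 0 < rho) (K0 : 0 <= K) (beta0 : beta p = 0)
  (C0 : 0 <= C)
  (betaS : forall x, `|x - p| < rho -> F0^T *m ((gchart X (beta x))^T *m x) = 0 /\
     `|(gchart X (beta x))^T *m x - p| < eps)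
  (betaL : forall x y, `|x - p| < rho -> `|y - p| < rho ->
     `|beta x - beta y| <= K * `|x - y|)
  (transv : forall g, normalizes h g -> `|g *m p - p| < eps ->
     forall Y, Y \in h -> `|Y *m (g *m p)| <= C * `|F0^T *m (Y *m (g *m p))|).

Let sigma x := (gchart X (beta x))^T *m x.

(** To first order [sigma] varies by a vector tangent to the orbit through its value, yet it stays
    in the slice; transversality makes this variation negligible. *)
Lemma slice_const_derive (c : R -> 'cV[R]_N) (a b : R) : a <= b ->
  (forall t : R, a <= t <= b -> [/\ `|c t - p| < rho,
     exists2 g, normalizes h g & c t = g *m p &
     exists2 Y, Y \in h & is_derive t 1 c (Y *m c t)]) ->
  sigma (c a) = sigma (c b).
Proof.
move=> ab Hc; apply/matrixP => i j.
apply: (@const_on_segment _ (fun t => sigma (c t) i j) _ _ ab) => t tab.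
suff : small_o (fun s => a <= s <= b) t (fun s => sigma (c s) - sigma (c t)).
  move=> H e e0; have [r r0 Hr] := H _ e0; exists r => // s sab sr.
  by apply: le_trans (Hr _ sab sr); have := norm_entry (sigma (c s) - sigma (c t)) i j; rewrite !mxE.
have [tr [g gn gE] [Y Yh dc]] := Hc _ tab.
pose P := gchart X (beta (c t)).
have Pn : normalizes h P by exact: gchart_normalizes.
have [PP [P2 P3]] := Pn; have PP' := mulmx1C PP.
have [L [Lh [CL CL0 [LC LE]]]] := gprod_increment hh (beta (c t)) (enum 'I_d) Xh.
pose D (s : R) := a <= s <= b.
have E2o : small_o D t (fun s => c s - c t - (s - t) *: (Y *m c t)) by exact: derive_small_o.
pose y s := beta (c s) - beta (c t).
have yO : big_O D t y.
  apply: big_O_dom (small_o_incr E2o) => s Ds; apply: betaL => //.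
  by case: (Hc _ Ds).
have E1o : small_o D t (fun s => P^T *m gchart X (beta (c s)) - 1%:M - L (y s)).
  have := small_o_comp (E := fun x => P^T *m gchart X (beta (c t) + x) - 1%:M - L x) LE yO.
  by apply: (small_o_dom (K := 1)) => s _; rewrite mul1r /y [beta (c t) + _]addrC subrK.
have LO : big_O D t (fun s => L (y s)) by apply: big_O_dom yO => s _; exact: LC.
pose Yt := P^T *m Y *m P.
have Yth : Yt \in h by exact: P3.
pose B s := P^T *m gchart X (beta (c s)) - 1%:M.
have BO : big_O D t (fun s => (B s)^T).
  apply: big_O_tr; have := big_OD (small_oW E1o) LO.
  by apply: (big_O_dom (K := 1)) => s _; rewrite mul1r subrK.
have cO : big_O D t (fun s => P^T *m (c s - c t)) by apply: big_O_mull; exact: small_o_incr E2o.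
pose Z s := - L (y s) + (s - t) *: Yt.
have Zh s : Z s \in h by rewrite memvD ?memvN// memvZ.
pose E s := sigma (c s) - sigma (c t) - Z s *m sigma (c t).
have EE s : E s = (B s - L (y s))^T *m sigma (c t) + ((B s)^T *m (P^T *m (c s - c t))
     + P^T *m (c s - c t - (s - t) *: (Y *m c t))).
  have sE : sigma (c s) = (1%:M + (B s)^T) *m (sigma (c t) + P^T *m (c s - c t)).
    have -> : 1%:M + (B s)^T = (gchart X (beta (c s)))^T *m P.
      by rewrite /B linearB/= trmx1 addrC subrK trmx_mul trmxK.
    have -> : sigma (c t) + P^T *m (c s - c t) = P^T *m c s.
      by rewrite -mulmxDr addrC subrK.
    by rewrite mulmxA -(mulmxA _ P) PP' mulmx1.
  have -> : (B s - L (y s))^T = (B s)^T + L (y s) by rewrite linearB/= (hh.1 _ (Lh _)) opprK.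
  have YtE : Yt *m sigma (c t) = P^T *m (Y *m c t).
    by rewrite /Yt /sigma -/P !mulmxA -(mulmxA _ P P^T) PP' mulmx1.
  rewrite /E sE /Z [(- L (y s) + _) *m _]mulmxDl -scalemxAl YtE mulNmx.
  rewrite ![(1%:M + _) *m _]mulmxDl !mul1mx ![_ *m (sigma (c t) + _)]mulmxDr.
  rewrite [((B s)^T + _) *m _]mulmxDl [P^T *m (c s - c t - _)]mulmxBr -scalemxAr.
  move: ((B s)^T *m sigma (c t)) ((B s)^T *m (P^T *m (c s - c t))) (P^T *m (c s - c t)).
  move: (P^T *m (Y *m c t)) (L (y s) *m sigma (c t)) (sigma (c t)) => a1 a2 a3 a4 a5 a6.
  by apply/matrixP => ? ?; rewrite !mxE; ring.
have Eo : small_o D t E.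
  have H1 := small_o_mulr (sigma (c t)) (small_o_tr E1o).
  have := small_oD H1 (small_oD (big_O_mul BO cO) (small_o_mull P^T E2o)).
  by apply: (small_o_dom (K := 1)) => s _; rewrite mul1r EE.
(* Both values of [sigma] lie in the slice, so the [F0] component of the tangent term is that of the
   error [E], and transversality bounds the whole term by it. *)
have Zo : small_o D t (fun s => Z s *m sigma (c t)).
  apply: small_o_dom (small_o_mull (F0^T) Eo) => s Ds.
  have [sr _ _] := Hc _ Ds.
  have -> : F0^T *m E s = - (F0^T *m (Z s *m sigma (c t))).
    by rewrite /E 2!mulmxBr (betaS sr).1 (betaS tr).1 subrr sub0r.
  rewrite normrN; have sgE : sigma (c t) = (P^T *m g) *m p by rewrite -mulmxA -gE.
  rewrite sgE; apply: transv => //; first by apply: normalizesM => //; exact: normalizesT.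
  by rewrite -sgE; exact: (betaS tr).2.
have := small_oD Eo Zo.
by apply: (small_o_dom (K := 1)) => s _; rewrite mul1r subrK.
Qed.

Section countable_leaves.
Hypothesis pin : forall i, X i \in h.

(* Words in the letters [expmx (a *: X i)], along which the parameters move affinely. *)
Let W (w : seq (R * R * 'I_d)) (t : R) : 'M[R]_N :=
  \prod_(u <- w) expmx ((u.1.1 + t * u.1.2) *: X u.2).

Let W_cons u w t : W (u :: w) t = expmx ((u.1.1 + t * u.1.2) *: X u.2) *m W w t.
Proof. by rewrite /W big_cons. Qed.

Let W_normalizes w t : normalizes h (W w t).
Proof.
elim: w => [|u w IH]; first by rewrite /W big_nil; exact: normalizes1.
by rewrite W_cons; apply: normalizesM => //; exact: normalizes_expmx.
Qed.

Let W_derive w (t : R) : exists2 Y, Y \in h & is_derive t 1 (W w) (Y *m W w t).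
Proof.
elim: w => [|u w [Y Yh dY]].
  exists 0; first exact: mem0v.
  rewrite mul0mx (_ : W [::] = cst 1%:M); first exact: is_derive_cst.
  by apply/funext => s; rewrite /W big_nil.
pose E t := expmx ((u.1.1 + t * u.1.2) *: X u.2).
have dE : is_derive t 1 E (u.1.2 *: (X u.2 *m E t)).
  have := @is_derive_affine R _ (fun x => expmx (x *: X u.2)) u.1.2 u.1.1 t _ (@is_derive_expmx _ _ _ _).
  rewrite /E (_ : (fun x => _) = fun x => expmx ((u.1.1 + x * u.1.2) *: X u.2)); last first.
    by apply/funext => x; rewrite addrC mulrC.
  by move=> H; apply: (is_derive_eq H); rewrite addrC [t * _]mulrC.
have [EE [E2 E3]] : normalizes h (E t) by exact: normalizes_expmx.
exists (u.1.2 *: X u.2 + E t *m Y *m (E t)^T); first by rewrite memvD ?E2// memvZ.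
rewrite (_ : W (u :: w) = fun s => E s *m W w s); last by apply/funext => s; rewrite W_cons.
apply: (is_derive_eq (is_derive_mulmx dE dY)).
by rewrite mulmxDl -!scalemxAl !mulmxA -(mulmxA _ (E t)^T) EE mulmx1.
Qed.

Let W_near (s : seq (R * 'I_d)) (e : R) : 0 < e -> exists2 r : R, 0 < r &
  forall w, [seq (u.1.1, u.2) | u <- w] = s -> (forall u, u \in w -> `|u.1.2| < r) ->
  forall t : R, 0 <= t <= 1 -> `|W w t - W w 0| <= e.
Proof.
elim: s e => [|[a i] s IH] e e0.
  by exists 1 => // -[|//] _ _ t _; rewrite /W !big_nil subrr normr0 ltW.
have Nn : 0 < 2 * N.+1%:R :> R by rewrite mulr_gt0// ltr0Sn.
have [r r0 Hr] := IH _ (divr_gt0 e0 Nn).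
have Nn2 : 0 < 2 * N.+1%:R * N.+1%:R :> R by rewrite mulr_gt0// ltr0Sn.
have [r2 r20 H2] := expmx_near1 (X i) (divr_gt0 e0 Nn2).
exists (Num.min r r2) => [|[//|u w] /= [u1 u2 ws] uw t t01]; first by rewrite lt_min r0.
have [ur ur2] : `|u.1.2| < r /\ `|u.1.2| < r2.
  by have := uw _ (mem_head _ _); rewrite lt_min => /andP.
have wr v : v \in w -> `|v.1.2| < r.
  by move=> vw; have := uw v; rewrite inE vw orbT lt_min => /(_ isT)/andP[].
rewrite !W_cons mul0r addr0 [u.1.1 + _]addrC expmxD u2.
set E := expmx (u.1.1 *: X i); set F := expmx (_ *: X i).
have En : E^T *m E = 1%:M by apply: orth_expmx; exact: hh.1.
have [Wn _] := W_normalizes w t.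
have -> : F *m E *m W w t - E *m W w 0 = (F - 1%:M) *m (E *m W w t) + E *m (W w t - W w 0).
  by rewrite mulmxBl mulmxBr mul1mx addrA subrK mulmxA.
apply: le_trans (ler_normD _ _) _; rewrite [leRHS]splitr lerD//.
  apply: le_trans (norm_mulmx _ _) _.
  have EW : `|E *m W w t| <= N.+1%:R.
    apply: le_trans (norm_orth_mul _ En) _; rewrite -[leRHS]mulr1; apply: ler_pM => //.
      by rewrite ler_nat.
    exact: norm_orth.
  have FF1 : `|F - 1%:M| <= e / (2 * N.+1%:R * N.+1%:R).
    apply: H2; apply: le_lt_trans ur2; rewrite normrM -[leRHS]mul1r ler_wpM2r//.
    by case/andP: t01 => t0 t1; rewrite ger0_norm.
  apply: (@le_trans _ _ (N.+1%:R * (e / (2 * N.+1%:R * N.+1%:R)) * N.+1%:R)).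
    by apply: ler_pM => //; rewrite ?mulr_ge0//; apply: ler_pM => //; rewrite ler_nat.
  rewrite le_eqVlt; apply/orP; left; apply/eqP.
  by field; rewrite nat1r pnatr_eq0.
apply: le_trans (norm_orth_mul _ En) _.
apply: (@le_trans _ _ (N.+1%:R * (e / (2 * N.+1%:R)))).
  apply: ler_pM => //; first by rewrite ler_nat.
  exact: (Hr w).
rewrite le_eqVlt; apply/orP; left; apply/eqP.
by field; rewrite nat1r pnatr_eq0.
Qed.

Let in_words x := exists w, x = W w 0 *m p.

Let plaque_words g x : (exists w, g = W w 0) -> sigma x = p -> in_words (g *m x).
Proof.
move=> [w ->] sx; pose w' := [seq (beta x i 0, 0, i) | i <- enum 'I_d] : seq (R * R * 'I_d).
exists (w ++ w'); rewrite /W big_cat/= -mulmxA; congr (_ *m _).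
have -> : \prod_(u <- w') expmx ((u.1.1 + 0 * u.1.2) *: X u.2) = gchart X (beta x).
  by rewrite /w' big_map /gchart; apply: eq_bigr => i _; rewrite mul0r addr0.
have [PP _] := gchart_normalizes hh Xh (beta x).
by rewrite -sx /sigma mulmxA (mulmx1C PP) mul1mx.
Qed.

Let sigma_p : sigma p = p.
Proof. by rewrite /sigma beta0 gchart0 trmx1 mul1mx. Qed.

(** Along [expmx (t *: A) *m (g *m p)] the times at which the point is reached by words in the [X i]
    form an open and closed set: a short arc, brought back to [p], keeps its slice coordinate and so
    lies in the chart. *)
Lemma orbit_in_words w : word_in h w -> in_words (gword w *m p).
Proof.
elim: w => [|[a A] w IH].
  by exists [::]; rewrite gword_nil /W big_nil.
move=> /word_in_cons[/= Ah wh]; rewrite gword_cons -mulmxA/=.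
have gn := normalizes_gword hh wh; set g := gword w in gn *.
have := IH wh; rewrite -/g => wP {IH}.
pose Q t := in_words (expmx (t *: A) *m (g *m p)).
pose Mx := N%:R * (N%:R * (N%:R * (N%:R * `|p|))).
have Mx0 : 0 <= Mx by rewrite !mulr_ge0.
have Np : 0 < Mx + 1 by lra.
have [r r0 Hr] := expmx_near1 A (divr_gt0 rho0 Np).
have step s t : `|s - t| < r -> Q t -> Q s.
  move=> st [w' wE]; have [gg' _] := W_normalizes w' 0; set g' := W w' 0 in gg' wE.
  have An u := normalizes_expmx u hh Ah.
  pose c u := g'^T *m (expmx ((u * (s - t) + t) *: A) *m (g *m p)).
  have c0 : c 0 = p by rewrite /c mul0r add0r wE mulmxA gg' mul1mx.
  have c1 : c 1 = g'^T *m (expmx (s *: A) *m (g *m p)) by rewrite /c mul1r subrK.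
  have [gg _] := gn.
  have cr u : 0 <= u <= 1 -> `|c u - p| < rho.
    move=> u01; rewrite -c0 /c -mulmxBr -mulmxBl mul0r add0r.
    apply: le_lt_trans (norm_orth_mul _ _) _; first by rewrite trmxK mulmx1C.
    rewrite expmxD -{2}[expmx (t *: A)]mul1mx -mulmxBl -mulmxA.
    have ur : `|u * (s - t)| < r.
      apply: le_lt_trans st; rewrite normrM -[leRHS]mul1r ler_wpM2r//.
      by case/andP: u01 => u0 u1; rewrite ger0_norm.
    have := Hr _ ur => {}Hr'.
    have b1 : `|expmx (t *: A) *m (g *m p)| <= N%:R * (N%:R * `|p|).
      apply: le_trans (norm_orth_mul _ (An t).1) _; rewrite ler_wpM2l//.
      exact: norm_orth_mul.
    apply: (@le_lt_trans _ _ (N%:R * (N%:R * (rho / (Mx + 1)) * (N%:R * (N%:R * `|p|))))).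
      rewrite ler_wpM2l//; apply: le_trans (norm_mulmx _ _) _.
      by apply: ler_pM; rewrite ?mulr_ge0// ler_wpM2l.
    have -> : N%:R * (N%:R * (rho / (Mx + 1)) * (N%:R * (N%:R * `|p|))) = rho * (Mx / (Mx + 1)).
      by rewrite /Mx; ring.
    by rewrite -[ltRHS]mulr1 ltr_pM2l// ltr_pdivrMr// mul1r ltrDl.
  have gn' := W_normalizes w' 0.
  have sc : sigma (c 0) = sigma (c 1).
    apply: (slice_const_derive ler01) => u u01; split; [exact: cr| |].
      exists (g'^T *m expmx ((u * (s - t) + t) *: A) *m g); last by rewrite /c !mulmxA.
      exact: normalizesM (normalizesM (normalizesT gn') (An _)) gn.
    exists ((s - t) *: (g'^T *m A *m g')); first exact/memvZ/(gn'.2.2 _ Ah).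
    have := @is_derive_affine R _ (fun x => expmx (x *: A)) (s - t) t u _ (@is_derive_expmx _ _ _ _).
    rewrite (_ : (fun x => _) = fun x => expmx ((x * (s - t) + t) *: A)); last first.
      by apply/funext => x; rewrite [x * _]mulrC.
    move=> /(is_derive_mulcst (g *m p))/(is_derive_cstmul g'^T) H.
    apply: (is_derive_eq H); rewrite /c [u * _]mulrC -!scalemxAl -scalemxAr; congr (_ *: _).
    by rewrite !mulmxA -(mulmxA _ g' g'^T) (mulmx1C gg') mulmx1.
  move: sc; rewrite c0 sigma_p c1 => sc.
  have := @plaque_words g' (g'^T *m (expmx (s *: A) *m (g *m p))) (ex_intro _ w' erefl) (esym sc).
  by rewrite mulmxA (mulmx1C gg') mul1mx.
have Q0 : Q 0 by rewrite /Q scale0r expmx0 mul1mx.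
suff : Q a by [].
apply: (@locally_const_prop _ Q _ 0 a Q0) => t; exists r => [|s st]; first exact: r0.
by split; [apply: step; rewrite distrC|exact: step].
Qed.

Let ratword (q : seq (rat * 'I_d)) : 'M[R]_N := \prod_(u <- q) expmx (ratr u.1 *: X u.2).

(* Rational words are dense, and [sigma] is locally constant in the parameters. *)
Lemma sigma_countable x : (exists2 w, word_in h w & x = gword w *m p) -> `|x - p| < rho ->
  exists q, sigma x = sigma (ratword q *m p).
Proof.
move=> [w0 wh ->]; have [w ->] := orbit_in_words wh => xr.
pose e := rho - `|W w 0 *m p - p|; have e0 : 0 < e by rewrite subr_gt0.
have Np : 0 < N%:R * `|p| + 1 by rewrite ltr_wpDl// mulr_ge0.
have [r r0 Hr] := W_near [seq (u.1.1, u.2) | u <- w] (divr_gt0 e0 Np).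
have [q [w' [ww' w'r qE]]] : exists (q : seq (rat * 'I_d)) (w' : seq (R * R * 'I_d)),
   [/\ [seq (u.1.1, u.2) | u <- w'] = [seq (u.1.1 + 0 * u.1.2, u.2) | u <- w],
       forall u, u \in w' -> `|u.1.2| < r & W w' 1 = ratword q].
  elim: w {xr e e0 Hr} => [|u w [q [w' [ww' w'r qE]]]].
    by exists [::], [::]; split=> //; rewrite /W /ratword !big_nil.
  have [b bI] : exists b : rat, u.1.1 < ratr b < u.1.1 + r.
    have := @rat_in_itvoo R u.1.1 (u.1.1 + r); rewrite ltrDl => /(_ r0)[b].
    by rewrite in_itv/=; exists b.
  exists ((b, u.2) :: q), ((u.1.1, ratr b - u.1.1, u.2) :: w'); split.
  - by rewrite /= ww' mul0r addr0.
  - move=> v; rewrite inE => /orP[/eqP->/=|/w'r//].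
    by rewrite ltr_norml; lra.
  - by rewrite W_cons qE /ratword big_cons/= mul1r addrC subrK.
have WW : W w' 0 = W w 0.
  have aux (v : seq (R * R * 'I_d)) : W v 0 = \prod_(u <- [seq (u.1.1, u.2) | u <- v]) expmx (u.1 *: X u.2).
    by rewrite /W big_map; apply: eq_bigr => u _; rewrite mul0r addr0.
  rewrite !aux ww'; congr (\prod_(u <- _) _); apply: eq_map => u.
  by rewrite mul0r addr0.
exists q; rewrite -qE -WW.
apply: (@slice_const_derive (fun t => W w' t *m p) 0 1 ler01) => t t01.
have ww'' : [seq (u.1.1, u.2) | u <- w'] = [seq (u.1.1, u.2) | u <- w].
  by rewrite ww'; apply: eq_map => u; rewrite mul0r addr0.
split.
- have b1 : `|W w' t *m p - W w' 0 *m p| < e.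
    rewrite -mulmxBl; apply: le_lt_trans (norm_mulmx _ _) _.
    apply: (@le_lt_trans _ _ (N%:R * (e / (N%:R * `|p| + 1)) * `|p|)).
      by rewrite ler_wpM2r// ler_wpM2l//; exact: Hr.
    have -> : N%:R * (e / (N%:R * `|p| + 1)) * `|p| = e * (N%:R * `|p| / (N%:R * `|p| + 1)) by ring.
    by rewrite -[ltRHS]mulr1 ltr_pM2l// ltr_pdivrMr// mul1r ltrDl.
  rewrite -[_ - p](subrKA (W w' 0 *m p)) (le_lt_trans (ler_normD _ _))// WW.
  by move: b1; rewrite /e WW; lra.
- by exists (W w' t).
- have [Y Yh dY] := W_derive w' t; exists Y => //.
  by apply: (is_derive_eq (is_derive_mulcst p dY)); rewrite mulmxA.
Qed.

End countable_leaves.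
End leaves.

(** * Plaques and velocities of curves in an orbit *)

Section plaques.
Variable R : realType.

(** If the end values differed, the intermediate value theorem would give an interval of values, of
    positive measure and yet countable. *)
Lemma countable_range_const (T : countType) (F : T -> R) (f : R -> R) (a b : R) :
  a <= b ->
  (forall t, a <= t <= b -> forall e : R, 0 < e -> exists2 r : R, 0 < r &
     forall s, a <= s <= b -> `|s - t| < r -> `|f s - f t| < e) ->
  (forall t, a <= t <= b -> exists q, f t = F q) -> f a = f b.
Proof.
move=> ab fc fF; apply: contrapT => fab.
have wc : {within `[a, b], continuous f}.
  apply/subspace_continuousP => t /= tab; apply/cvgrPdist_lt => e e0.
  have [|r r0 Hr] := fc t _ _ e0; first by move: tab; rewrite in_itv.
  rewrite near_withinE; exists r => //= s; rewrite distrC => st sab.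
  move: (sab); rewrite in_itv => /= sab2; move: tab st; rewrite in_itv => /= tab st.
  by rewrite distrC in st; exact: Hr.
have sub : [set` `[Num.min (f a) (f b), Num.max (f a) (f b)]] `<=` F @` setT.
  move=> v /=; rewrite in_itv/= => vI; have [c cab <-] := IVT ab wc vI.
  by have [|q ->] := fF c; [move: cab; rewrite in_itv|exists q].
have cF : countable (F @` setT) by apply: sub_countable (card_image_le F setT) _; exact: countableP.
have := countable_lebesgue_measure0 (sub_countable (subset_card_le sub) cF).
rewrite lebesgue_measure_itv/= lte_fin.
have ltm : Num.min (f a) (f b) < Num.max (f a) (f b).
  by rewrite gt_min !lt_max !ltxx/= orbF; move/eqP: fab; rewrite neq_lt.
by rewrite ltm => /eqP; rewrite -EFinB eqe subr_eq0 eq_sym lt_eqF.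
Qed.

(* The points of the orbit near [p] reached by continuous curves in the orbit
   lie in the plaque through [p], hence have coordinates in the chart. *)
Lemma orbit_plaque N (h : {vspace 'M[R]_N}) (p : 'cV[R]_N) : lie_so h ->
  exists d (X : 'I_d -> 'M[R]_N) (rho K : R) (beta : 'cV[R]_N -> 'cV[R]_d),
  [/\ forall i, X i \in h, 0 < rho /\ 0 <= K, beta p = 0,
    forall x y, `|x - p| < rho -> `|y - p| < rho -> `|beta x - beta y| <= K * `|x - y| &
    forall (c : R -> 'cV[R]_N) (a b : R), a <= b ->
      (forall t, a <= t <= b -> (exists2 w, word_in h w & c t = gword w *m p) /\ `|c t - p| < rho) ->
      (forall t, a <= t <= b -> forall e : R, 0 < e -> exists2 r : R, 0 < r &
         forall s, a <= s <= b -> `|s - t| < r -> `|c s - c t| < e) ->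
      c a = p -> c b = gchart X (beta (c b)) *m p].
Proof.
move=> hh; have [d [F0 [X [FF Xh Xp hp]]]] := orbit_frame h p.
have [eps [C [eps0 C0 transv]]] := slice_transversal FF Xh Xp hp.
have [rho [K [rho0 K0 [beta [beta0 [betaS betaL]]]]]] := orbit_chart hh FF Xh Xp eps0.
exists d, X, rho, K, beta; split=> // c a b ab cM cc ca.
pose sigma x := (gchart X (beta x))^T *m x.
have gn x := gchart_normalizes hh Xh (beta x).
suff sE : sigma (c b) = p.
  by rewrite -[in RHS]sE /sigma mulmxA (mulmx1C (gn _).1) mul1mx.
have -> : p = sigma (c a) by rewrite ca /sigma beta0 gchart0 trmx1 mul1mx.
apply/esym/matrixP => i j; rewrite ord1.
(* Each entry of the slice coordinate takes values indexed by rational words. *)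
apply: (@countable_range_const (seq (rat * 'I_d))
   (fun q => sigma ((\prod_(u <- q) expmx (ratr u.1 *: X u.2)) *m p) i 0)
   (fun t => sigma (c t) i 0)) => // [t tab e e0|t tab]; last first.
  have [tw tr] := cM _ tab.
  have [q qE] := sigma_countable hh Xh rho0 beta0 betaS betaL transv tw tr.
  by exists q; rewrite -[sigma (c t)]/((gchart X (beta (c t)))^T *m c t) qE.
have [_ tr] := cM _ tab.
have [L [_ [CL CL0 [LC LE]]]] := gprod_increment hh (beta (c t)) (enum 'I_d) Xh.
set P := gchart X (beta (c t)) in LE.
have [PP _] : normalizes h P by exact: gn.
have [r1 r10 H1] := LE 1 ltr01.
pose A := N%:R * (N%:R * ((1 + CL) * K)) * (`|p| + rho) + N%:R + 1.
have pr0 : 0 <= `|p| + rho by rewrite addr_ge0// ltW.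
have A0 : 0 < A.
  by rewrite /A ltr_wpDl// addr_ge0// !mulr_ge0// addr_ge0.
have K1 : 0 < K + 1 by lra.
have m0 : 0 < Num.min (r1 / (K + 1)) (e / A) by rewrite lt_min !divr_gt0.
have [r r0 Hr] := cc _ tab _ m0; exists r => // s sab st.
have := Hr _ sab st; rewrite lt_min !ltr_pdivlMr// => /andP[s1 s2].
have [_ sr] := cM _ sab.
pose y := beta (c s) - beta (c t).
have yK : `|y| <= K * `|c s - c t| by exact: betaL.
have yr : `|y| < r1.
  by apply: le_lt_trans yK (le_lt_trans _ s1); rewrite mulrC ler_wpM2l//; lra.
have Py : `|gchart X (beta (c s)) - P| <= N%:R * ((1 + CL) * (K * `|c s - c t|)).
  have -> : gchart X (beta (c s)) - P = P *m (P^T *m gchart X (beta (c s)) - 1%:M).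
    by rewrite mulmxBr mulmx1 mulmxA (mulmx1C PP) mul1mx.
  apply: le_trans (norm_orth_mul _ PP) _; rewrite ler_wpM2l//.
  have := H1 _ yr; rewrite /y [beta (c t) + _]addrC subrK -/(gchart X _) -/P -/y => H.
  rewrite -[_ - 1%:M](subrK (L y)); apply: le_trans (ler_normD _ _) _.
  rewrite [leRHS]mulrDl; apply: lerD; first by apply: le_trans H _; rewrite !mul1r.
  by apply: le_trans (LC _) _; rewrite ler_wpM2l.
have := norm_entry (sigma (c s) - sigma (c t)) i 0; rewrite mxE [(- sigma _) _ _]mxE => H.
apply: le_lt_trans H _.
have -> : sigma (c s) - sigma (c t) = (gchart X (beta (c s)) - P)^T *m c s + P^T *m (c s - c t).
  by rewrite linearB/= mulmxBl mulmxBr addrA subrK.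
apply: le_lt_trans (ler_normD _ _) _; apply: le_lt_trans s2.
rewrite mulrC /A -[_ + N%:R + 1]addrA mulrDl; apply: lerD.
  apply: le_trans (norm_mulmx _ _) _; rewrite norm_trmx.
  have -> : N%:R * (N%:R * ((1 + CL) * K)) * (`|p| + rho) * `|c s - c t| =
    N%:R * (N%:R * ((1 + CL) * (K * `|c s - c t|))) * (`|p| + rho) by ring.
  apply: ler_pM; rewrite ?mulr_ge0//; first by rewrite ler_wpM2l.
  by rewrite -[c s](subrK p) addrC (le_trans (ler_normD _ _))// lerD2l ltW.
apply: (@le_trans _ _ (N%:R * `|c s - c t|)).
  by apply: norm_orth_mul; rewrite trmxK (mulmx1C PP).
by rewrite mulrDl mul1r lerDl.
Qed.

(** The curve is differentiable only as a map into R^N, but it stays in the plaque of [p], where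
    [c s = gchart X (beta (c s)) *m p]; the first-order expansion of the chart then puts the
    velocity in [h p]. *)
Lemma orbit_velocity N (h : {vspace 'M[R]_N}) (p : 'cV[R]_N) (c : R -> 'cV[R]_N) u :
  lie_so h -> (forall t, exists2 w, word_in h w & c t = gword w *m p) -> c 0 = p ->
  (forall t : R, exists v, is_derive t 1 c v) -> is_derive (0 : R) 1 c u ->
  exists2 Y, Y \in h & u = Y *m p.
Proof.
move=> hh cM c0 dc du.
have [d [X [rho [K [beta [Xh [rho0 K0] beta0 betaL plaque]]]]]] := orbit_plaque p hh.
have cc t e : 0 < e -> exists2 r : R, 0 < r & forall s, `|s - t| < r -> `|c s - c t| < e.
  move=> e0; have [v /(derive_small_o (fun _ => True))/small_o_incr[M M0 [r r0 H]]] := dc t.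
  have M1 : 0 < M + 1 by lra.
  exists (Num.min r (e / (M + 1))) => [|s]; first by rewrite lt_min r0 divr_gt0.
  rewrite lt_min ltr_pdivlMr// => /andP[s1 s2]; apply: le_lt_trans (H _ I s1) _.
  by apply: le_lt_trans s2; rewrite mulrC ler_wpM2l//; lra.
have [r r0 Hr] := cc 0 _ rho0; rewrite c0 in Hr.
(* The plaque property follows a curve forwards from [p]; the right derivative is enough to
   determine [u]. *)
pose D (s : R) := 0 <= s < r.
have cE s : D s -> c s = gchart X (beta (c s)) *m p.
  move=> /andP[s0 sr]; apply: (plaque c 0 s) => // [t /andP[t0 ts]|t _ e e0].
    by split; [exact: cM|apply: Hr; rewrite subr0 ger0_norm//; lra].
  by have [q q0 Hq] := cc t e e0; exists q => // x _; exact: Hq.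
have [L [Lh [CL CL0 [LC LE]]]] := gprod_increment hh 0 (enum 'I_d) Xh.
have := LE; rewrite -/(gchart X 0) gchart0 trmx1 => {}LE.
have co := derive_small_o D du.
have bO : big_O D 0 (fun s => beta (c s)).
  apply: (big_O_dom (K := K)) (small_o_incr co) => s Ds.
  have sr : `|c s - p| < rho by apply: Hr; case/andP: Ds => s0 sr; rewrite subr0 ger0_norm.
  by have := betaL _ p sr; rewrite subrr normr0 beta0 subr0 c0 => /(_ rho0).
have Eo : small_o D 0 (fun s => gchart X (beta (c s)) - 1%:M - L (beta (c s))).
  have := small_o_comp (E := fun x => 1%:M *m gchart X (0 + x) - 1%:M - L x) LE bO.
  by apply: (small_o_dom (K := 1)) => s _; rewrite mul1r mul1mx add0r.
pose U : {vspace 'cV[R]_N} := (linfun (mulmxr p : 'M[R]_N -> 'cV[R]_N) @: h)%VS.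
have UP Y : Y \in h -> Y *m p \in U.
  by move=> Yh; have := memv_img (linfun (mulmxr p : 'M[R]_N -> 'cV[R]_N)) Yh; rewrite lfunE.
suff : u \in U by case/memv_imgP => Y Yh; rewrite lfunE/= => ->; exists Y.
have [F [FF UE]] := orthonormal_basis U.
pose Q := 1%:M - F *m F^T.
have QU y : y \in U -> Q *m y = 0.
  by rewrite UE => /eqP yE; rewrite mulmxBl mul1mx -mulmxA yE subrr.
suff Qu : Q *m u = 0.
  by rewrite UE; move: Qu; rewrite mulmxBl mul1mx -mulmxA => /eqP; rewrite subr_eq0 eq_sym.
have Qo : small_o D 0 (fun s => (s - 0) *: (Q *m u)).
  have := small_oD (small_oN (small_o_mull Q co)) (small_o_mull Q (small_o_mulr p Eo)).
  apply: (small_o_dom (K := 1)) => s Ds; rewrite mul1r/= c0.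
  have := cE s Ds; have := QU _ (UP _ (Lh (beta (c s)))).
  move: (gchart X _) (L _) => G Ls QL ->.
  have -> : (G - 1%:M - Ls) *m p = G *m p - p - Ls *m p by rewrite 2!(mulmxBl _ _ p) mul1mx.
  have QB (x y : 'cV[R]_N) : Q *m (x - y) = Q *m x - Q *m y by exact: mulmxBr.
  by rewrite !QB QL !subr0 -scalemxAr opprB subrK.
apply/eqP; rewrite -normr_le0; apply/ler_addgt0Pl => e e0; rewrite addr0.
have [q q0 Hq] := Qo _ e0.
pose s := Num.min r q / 2.
have m0 : 0 < Num.min r q by rewrite lt_min r0.
have s0 : 0 < s by rewrite divr_gt0.
have [sr sq] : s < r /\ s < q.
  have : s < Num.min r q by rewrite /s; lra.
  by rewrite lt_min => /andP.
have := Hq s; rewrite /D (ltW s0) sr subr0 ger0_norm ?(ltW s0)// normrZ ger0_norm ?(ltW s0)//.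
by move=> /(_ isT sq); rewrite [e * _]mulrC ler_pM2l.
Qed.

End plaques.

(** * Parallel transport along words and monodromy *)

Section exponential_paths.
Variable R : realType.

(** The mean value theorem applied entrywise to [expmx (t *: B) *m expmx (- t *: A)], whose
    derivative is controlled because orthogonal matrices have norm at most 1. *)
Lemma expmx_lipschitz N (A B : 'M[R]_N) : A^T = - A -> B^T = - B ->
  `|expmx B - expmx A| <= N%:R * (N%:R * (N%:R * `|B - A|)).
Proof.
move=> AT BT; pose f t := expmx (t *: B) *m expmx (- t *: A).
pose df t := expmx (t *: B) *m ((B - A) *m expmx (- t *: A)).
have dfP (t : R) : is_derive t 1 f (df t).
  apply: (is_derive_eq (is_derive_mulmx (is_derive_expmx B t) (is_derive_expmxN A t))).
  by rewrite expmx_commZ /df mulmxBl mulmxBr mulmxN mulmxA.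
have eN (C : 'M[R]_N) t : C^T = - C -> `|expmx (t *: C)| <= 1.
  by move=> CT; apply: norm_orth; exact: orth_expmx.
have H : `|expmx B *m expmx (- (1) *: A) - 1%:M| <= N%:R * (N%:R * `|B - A|).
  apply/norm_mx_le => [|i j]; first by rewrite !mulr_ge0.
  pose g t := f t i j; pose dg t := df t i j.
  have dgP (t : R) : is_derive t 1 g (dg t) by have /is_derive_mxP := dfP t; exact.
  have gc : {within `[0, 1], continuous g}.
    apply: derivable_within_continuous => t _; exact: ex_derive.
  have [c _ gE] := MVT ltr01 (fun t _ => dgP t) gc.
  have -> : (expmx B *m expmx (- (1) *: A) - 1%:M) i j = dg c.
    move: gE; rewrite subr0 mulr1 => <-.
    by rewrite /g /f oppr0 !scale0r expmx0 mulmx1 scale1r !mxE.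
  apply: le_trans (norm_entry _ _ _) _; apply: le_trans (norm_orth_mul _ _) _.
    exact: orth_expmx.
  rewrite ler_wpM2l//; apply: le_trans (norm_mulmx _ _) _.
  by rewrite -[leRHS]mulr1 ler_wpM2l ?mulr_ge0//; exact: eN.
have -> : expmx B - expmx A = (expmx B *m expmx (- (1) *: A) - 1%:M) *m expmx (1 *: A).
  by rewrite mulmxBl mul1mx -mulmxA (expmxN A 1) mulmx1 (scale1r A).
apply: le_trans (norm_mulmx _ _) _; rewrite -[leRHS]mulr1; apply: ler_pM; rewrite ?mulr_ge0//.
  by rewrite ler_wpM2l.
exact: eN.
Qed.

Lemma cvg_mulmx (T : Type) (F : set_system T) {FF : Filter F} m n q
    (f : T -> 'M[R]_(m, n)) (g : T -> 'M[R]_(n, q)) (a : 'M[R]_(m, n)) (b : 'M[R]_(n, q)) :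
  f @ F --> a -> g @ F --> b -> (fun x => f x *m g x) @ F --> a *m b.
Proof.
move=> fa gb; apply/cvgrPdist_le => e e0.
pose K := n%:R * (`|a| + 1 + `|b|) + 1; have K0 : 0 < K.
  by rewrite /K ltr_wpDl// mulr_ge0// !addr_ge0.
have eK : 0 < Num.min 1 (e / K) by rewrite lt_min ltr01 divr_gt0.
move/cvgrPdist_le/(_ _ eK) : fa => fa; move/cvgrPdist_le/(_ _ eK) : gb => gb.
apply: filterS2 fa gb => x; rewrite !le_min => /andP[f1 fK] /andP[_ gK].
have -> : a *m b - f x *m g x = (a - f x) *m b + f x *m (b - g x).
  by rewrite mulmxBl mulmxBr addrA subrK.
have fx : `|f x| <= `|a| + 1.
  by rewrite -[f x](subrK a) addrC (le_trans (ler_normD _ _))// lerD2l distrC.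
apply: le_trans (ler_normD _ _) _.
apply: (@le_trans _ _ (n%:R * (e / K) * `|b| + n%:R * (`|a| + 1) * (e / K))).
  apply: lerD; apply: le_trans (norm_mulmx _ _) _.
    by rewrite ler_wpM2r// ler_wpM2l.
  by apply: ler_pM; rewrite ?mulr_ge0// ler_wpM2l.
rewrite -[leRHS](divfK (lt0r_neq0 K0)) mulrC [leRHS]mulrC.
have -> : `|b| * (n%:R * (e / K)) + n%:R * (`|a| + 1) * (e / K) = (K - 1) * (e / K) by rewrite /K; ring.
by apply: ler_wpM2r; [rewrite divr_ge0 ?ltW|lra].
Qed.

Lemma continuous_mulmx (T : topologicalType) m n q (f : T -> 'M[R]_(m, n)) (g : T -> 'M[R]_(n, q)) :
  continuous f -> continuous g -> continuous (fun x => f x *m g x).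
Proof. by move=> fc gc x; apply: cvg_mulmx; [exact: fc|exact: gc]. Qed.

Lemma continuous_expmx (T : topologicalType) N (f : T -> 'M[R]_N) :
  (forall x, (f x)^T = - f x) -> continuous f -> continuous (fun x => expmx (f x)).
Proof.
move=> fT fc x; apply/cvgrPdist_le => e e0.
pose K := N%:R * (N%:R * N%:R) + 1 : R; have K0 : 0 < K.
  by rewrite /K ltr_wpDl// !mulr_ge0.
have /cvgrPdist_le/(_ _ (divr_gt0 e0 K0)) := fc x.
apply: filterS => y H; apply: le_trans (expmx_lipschitz (fT _) (fT _)) _.
rewrite -[leRHS](divfK (lt0r_neq0 K0)) !mulrA [leRHS]mulrC.
apply: ler_pM; rewrite ?mulr_ge0//.
by rewrite /K -mulrA lerDl.
Qed.

(** The family is closed under derivation: differentiating replaces [C] by [X *m C + C *m Y]. *)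
Lemma smooth_exp N m k (B : 'M[R]_(N, m)) X (C : 'M[R]_(m, k)) Y (z : 'cV[R]_k) :
  smooth_curve (fun t => B *m expmx (t *: X) *m C *m expmx (t *: Y) *m z).
Proof.
pose f C t := B *m expmx (t *: X) *m C *m expmx (t *: Y) *m z.
have df D (t : R) : is_derive t 1 (f D) (f (X *m D + D *m Y) t).
  apply: (is_derive_eq (is_derive_mulcst z (is_derive_mulmx (is_derive_mulcst D
    (is_derive_cstmul B (is_derive_expmx X t))) (is_derive_expmx Y t)))).
  by rewrite /f expmx_commZ !mulmxDr !mulmxDl !mulmxA.
have fE j : derive1n j (f C) = f (iter j (fun D => X *m D + D *m Y) C).
  elim: j => [//|j IH]; rewrite derive1nS IH iterS; apply/funext => t.
  by rewrite derive1E; exact: derive_val.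
by move=> j t; rewrite -/(f C) fE; have [] := df (iter j (fun D => X *m D + D *m Y) C) t.
Qed.

Definition clamp (x : R) : R := Num.max 0 (Num.min x 1).

Lemma clamp0 x : x <= 0 -> clamp x = 0.
Proof. by move=> x0; rewrite /clamp min_l ?max_l//; lra. Qed.

Lemma clamp1 x : 1 <= x -> clamp x = 1.
Proof. by move=> x0; rewrite /clamp min_r ?max_r. Qed.

Lemma clamp_id x : 0 <= x <= 1 -> clamp x = x.
Proof. by move=> /andP[x0 x1]; rewrite /clamp min_l ?max_r. Qed.

Lemma continuous_clamp : continuous clamp.
Proof.
move=> x; apply: (@continuous_max R R^o (cst 0) (fun x => Num.min x 1)); first exact: cvg_cst.
by apply: (@continuous_min R R^o id (cst 1)); [exact: cvg_id|exact: cvg_cst].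
Qed.

(* The letters are run through one after the other at unit speed. *)
Fixpoint wpath N (L : seq 'M[R]_N) (x : R) : 'M[R]_N :=
  if L is A :: L' then expmx (clamp x *: A) *m wpath L' (x - 1) else 1%:M.

Definition wprod N (L : seq 'M[R]_N) := \prod_(A <- L) expmx A.

Lemma wprod_cons N (A : 'M[R]_N) L : wprod (A :: L) = expmx A *m wprod L.
Proof. by rewrite /wprod big_cons. Qed.

Lemma wprod_cat N (L1 L2 : seq 'M[R]_N) : wprod (L1 ++ L2) = wprod L1 *m wprod L2.
Proof. by rewrite /wprod big_cat. Qed.

Lemma wpath0 N (L : seq 'M[R]_N) x : x <= 0 -> wpath L x = 1%:M.
Proof.
elim: L x => //= A L IH x x0; rewrite clamp0// scale0r expmx0 mul1mx IH//; lra.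
Qed.

Lemma wpath_piece N (L : seq 'M[R]_N) i x : (i < size L)%N -> i%:R <= x <= i.+1%:R ->
  wpath L x = wprod (take i L) *m expmx ((x - i%:R) *: nth 0 L i).
Proof.
elim: L i x => // A L IH [|i] x /= iL xi.
  rewrite wpath0; last by lra.
  by rewrite clamp_id ?mulmx1 ?subr0 ?/wprod ?big_nil ?mul1mx//; move: xi; rewrite mulr0n; lra.
have i0 : 0 <= i%:R :> R by [].
rewrite clamp1; last by move: xi; rewrite -!natr1; lra.
rewrite scale1r (IH i); [|by []|by move: xi; rewrite -!natr1; lra].
by rewrite wprod_cons mulmxA -[i.+1%:R]natr1 opprD addrA addrAC.
Qed.

Lemma wpath_end N (L : seq 'M[R]_N) x : (size L)%:R <= x -> wpath L x = wprod L.
Proof.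
elim: L x => [|A L IH] x /= Lx; first by rewrite /wprod big_nil.
have i0 : 0 <= (size L)%:R :> R by [].
rewrite clamp1 ?scale1r ?IH ?wprod_cons//; move: Lx; rewrite -natr1; lra.
Qed.

Lemma wpath_const0 N (L : seq 'M[R]_N) x : (forall A, A \in L -> A = 0) -> wpath L x = 1%:M.
Proof.
elim: L x => //= A L IH x L0; rewrite (L0 A) ?mem_head// scaler0 expmx0 mul1mx.
by apply: IH => B BL; apply: L0; rewrite inE BL orbT.
Qed.

Lemma wpath_word N (h : {vspace 'M[R]_N}) (L : seq 'M[R]_N) x :
  (forall A, A \in L -> A \in h) -> exists2 w, word_in h w & wpath L x = gword w.
Proof.
elim: L x => [|A L IH] x Lh; first by exists [::] => //; rewrite gword_nil.
have [|w wh wE] := IH (x - 1); first by move=> B BL; apply: Lh; rewrite inE BL orbT.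
exists ((clamp x, A) :: w); last by rewrite gword_cons /= wE.
by move=> a; rewrite inE => /orP[/eqP->|/wh//]; apply: Lh; exact: mem_head.
Qed.

(** Takes the place of membership for sequences of functions, which have no decidable equality. *)
Fixpoint each (T : Type) (P : T -> Prop) (s : seq T) : Prop :=
  if s is x :: s' then P x /\ each P s' else True.

Lemma each_cat (T : Type) (P : T -> Prop) s1 s2 : each P s1 -> each P s2 -> each P (s1 ++ s2).
Proof. by elim: s1 => //= x s IH [Px /IH H] /H. Qed.

Lemma each_map (T : Type) (U : eqType) (f : T -> U) (P : T -> Prop) (Q : U -> Prop) s :
  (forall x, P x -> Q (f x)) -> each P s -> forall u, u \in map f s -> Q u.
Proof.
move=> PQ; elim: s => //= x s IH [Px /IH H] u; rewrite inE => /orP[/eqP->|/H//].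
exact: PQ.
Qed.

Lemma continuous_wpath N (h : {vspace 'M[R]_N}) (T : topologicalType) (lam : seq (T -> 'M[R]_N)) (x : T -> R) :
  lie_so h -> each (fun f => continuous f /\ forall t, f t \in h) lam -> continuous x ->
  continuous (fun t => wpath [seq f t | f <- lam] (x t)).
Proof.
move=> hh; elim: lam x => [|f lam IH] x lamP xc; first by move=> t; exact: cvg_cst.
have [[fc fh] lamP'] := lamP.
apply: continuous_mulmx; last first.
  apply: IH => // t.
  by apply: cvgB; [exact: xc|exact: cvg_cst].
apply: continuous_expmx => [t|t]; first by rewrite linearZ/= (hh.1 _ (fh t)) scalerN.
apply: cvgZ; last exact: fc.
by apply: continuous_comp; [exact: xc|exact: continuous_clamp].
Qed.

End exponential_paths.

(** * Tangent and normal spaces, word holonomy and normal curvature *)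

Section orbit_geometry.
Variables (R : realType) (N : nat) (h : {vspace 'M[R]_N}) (p : 'cV[R]_N) (M : set 'cV[R]_N).
Hypothesis hh : lie_so h.
Hypothesis MP : forall x, M x <-> exists2 w, word_in h w & x = gword w *m p.

Lemma orbit_word w q : word_in h w -> M q -> M (gword w *m q).
Proof.
move=> wh /MP[v vh ->]; apply/MP; exists (w ++ v); last by rewrite gword_cat mulmxA.
by move=> a; rewrite mem_cat => /orP[/wh|/vh].
Qed.

Lemma orbit_base : M p.
Proof. by apply/MP; exists [::] => //; rewrite gword_nil mul1mx. Qed.

Lemma orbit_change q : M q -> forall x, M x <-> exists2 w, word_in h w & x = gword w *m q.
Proof.
move=> Mq x; split=> [/MP[w wh ->]|[w wh ->]]; last exact: orbit_word.
have /MP[v vh qE] := Mq; have [v' v'h v'E] := gword_inv hh vh.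
exists (w ++ v'); first by move=> a; rewrite mem_cat => /orP[/wh|/v'h].
by rewrite gword_cat v'E qE -mulmxA (mulmxA _ (gword v)) (normalizes_gword hh vh).1 mul1mx.
Qed.

Lemma orbit_tangent q u : M q -> tangent M q u <-> exists2 Y, Y \in h & u = Y *m q.
Proof.
move=> Mq; split=> [[c [cs cM c0 cu]]|[Y Yh ->]].
  have dc (t : R) : is_derive t 1 c (derive1 c t).
    by split; [exact: (cs 0%N)|rewrite derive1E].
  apply: (orbit_velocity hh _ c0) => [t|t|]; first exact/(orbit_change Mq).
    by exists (derive1 c t).
  by rewrite -cu.
exists (fun t => 1%:M *m expmx (t *: Y) *m 1%:M *m expmx (t *: 0) *m q); split.
- exact: smooth_exp.
- move=> t; rewrite scaler0 expmx0 !mulmx1 mul1mx.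
  have := @orbit_word [:: (t, Y)] q _ Mq; rewrite gword_cons gword_nil mulmx1; apply.
  by move=> a; rewrite inE => /eqP ->.
- by rewrite !scale0r !expmx0 !mulmx1 mul1mx.
rewrite derive1E; have H := is_derive_mulcst q (is_derive_expmx Y 0).
rewrite (_ : (fun _ => _) = fun t => expmx (t *: Y) *m q).
  by rewrite derive_val scale0r expmx0 mulmx1.
by apply/funext => t; rewrite scaler0 expmx0 !mulmx1 mul1mx.
Qed.

Lemma orbit_sphere_normal q x : M q ->
  sphere_normal M q x <-> dotp q x = 0 /\ forall Y, Y \in h -> dotp (Y *m q) x = 0.
Proof.
move=> Mq; split=> -[qx H]; split=> //; first by move=> Y Yh; apply: H; apply/orbit_tangent => //; exists Y.
by move=> u /(orbit_tangent _ Mq)[Y Yh ->]; exact: H.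
Qed.

Lemma sphere_normal_word w q x : word_in h w -> M q ->
  sphere_normal M (gword w *m q) (gword w *m x) <-> sphere_normal M q x.
Proof.
move=> wh Mq; have Mg := orbit_word wh Mq.
have [gg [g1 g2]] := normalizes_gword hh wh; have gg' := mulmx1C gg.
rewrite !orbit_sphere_normal// dotp_orth//; split=> -[qx H]; split=> // Y Yh.
  by have := H _ (g1 _ Yh); rewrite -!mulmxA (mulmxA _^T) gg mul1mx dotp_orth.
by have := H _ (g2 _ Yh); rewrite -!mulmxA dotp_mulmxl trmxK.
Qed.

Lemma unif_partition n : (0 < n)%N -> let s := [seq i.+1%:R / n%:R | i <- iota 0 n] : seq R in
  [/\ itv_partition 0 1 s, size s = n & forall i, (i < n)%N ->
    forall t, t \in `[nth 0 (0 :: s) i, nth 0 s i] -> i%:R <= n%:R * t <= i.+1%:R].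
Proof.
move=> n0 s; have nn : 0 < n%:R :> R by rewrite ltr0n.
have sn : size s = n by rewrite size_map size_iota.
have s1 i : (i < n)%N -> nth 0 s i = i.+1%:R / n%:R.
  by move=> ilt; rewrite (nth_map 0%N) ?size_iota// nth_iota.
have s0 i : (i <= n)%N -> nth 0 (0 :: s) i = i%:R / n%:R.
  by case: i => [|i] ile; rewrite ?mul0r//= s1.
split=> // [|i ilt t]; last first.
  by rewrite in_itv/= s0 ?s1// 1?ltnW// ler_pdivrMr// ler_pdivlMr// mulrC.
split; last by apply/eqP; rewrite (last_nth 0) sn s0// divff// lt0r_neq0.
apply/(pathP 0) => i; rewrite sn => ilt; rewrite s0 ?s1// 1?ltnW//.
by rewrite ltr_pM2r ?invr_gt0// ltr_nat.
Qed.

Section frame.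
Variables (k : nat) (F : 'M[R]_(N, k)).
Hypothesis FF : F^T *m F = 1%:M.
Hypothesis FV : forall x, sphere_normal M p x <-> F *m (F^T *m x) = x.

(** The connection form of the normal bundle in the frames [g *m F] carried along by the group. *)
Definition nu (X : 'M[R]_N) := F^T *m X *m F.

Lemma nu_skew X : X \in h -> (nu X)^T = - nu X.
Proof. by move=> /hh.1 XT; rewrite /nu !trmx_mul trmxK XT mulNmx mulmxN mulmxA. Qed.

Lemma nuB X Y : nu (X - Y) = nu X - nu Y.
Proof. by rewrite /nu mulmxBr mulmxBl. Qed.

Lemma nuZ a X : nu (a *: X) = a *: nu X.
Proof. by rewrite /nu -scalemxAr -scalemxAl. Qed.

Lemma frame_normal y : sphere_normal M p (F *m y).
Proof. by apply/FV; rewrite (mulmxA F^T) FF mul1mx. Qed.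

Lemma expmx_piece m (A : 'M[R]_m) (K i t : R) :
  expmx ((K * t - i) *: A) = expmx (- i *: A) *m expmx (t *: (K *: A)).
Proof. by rewrite addrC expmxD scalerA [t * K]mulrC. Qed.

Let path L (t : R) := wpath L ((size L)%:R * t) *m p.
(** In the frame [g *m F] moving with letter [X], the coordinates of a parallel field satisfy y' = -
    nu X y; the solution is the transpose of the word in the [nu X]. *)
Let field L (y : 'cV[R]_k) (t : R) : 'cV[R]_N :=
  wpath L ((size L)%:R * t) *m F *m (wpath (map nu L) ((size L)%:R * t))^T *m y.

Lemma path_smooth L : L != [::] -> (forall A, A \in L -> A \in h) -> piecewise_smooth (path L).
Proof.
move=> L0 Lh; have sL : (0 < size L)%N by case: (L) L0.
have [sp ss sn] := unif_partition sL.
exists [seq i.+1%:R / (size L)%:R | i <- iota 0 (size L)] => // i; rewrite ss => iL.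
set A := nth 0 L i; set P := wprod (take i L).
exists (fun t => (P *m expmx (- i%:R *: A)) *m expmx (t *: ((size L)%:R *: A)) *m 1%:M
    *m expmx (t *: 0) *m p); first exact: smooth_exp.
move=> t /(sn _ iL) ti; rewrite /path (wpath_piece iL ti) scaler0 expmx0 !mulmx1.
by rewrite expmx_piece mulmxA.
Qed.

Lemma path_orbit L t : (forall A, A \in L -> A \in h) -> M (path L t).
Proof.
move=> Lh; have [w wh wE] := wpath_word ((size L)%:R * t) Lh.
by rewrite /path wE; exact: orbit_word orbit_base.
Qed.

Lemma field_normal L y t : (forall A, A \in L -> A \in h) -> sphere_normal M (path L t) (field L y t).
Proof.
move=> Lh; have [w wh wE] := wpath_word ((size L)%:R * t) Lh.
rewrite /path /field wE -!mulmxA; apply/(sphere_normal_word _ wh orbit_base).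
exact: frame_normal.
Qed.

Lemma field_parallel L y : L != [::] -> (forall A, A \in L -> A \in h) ->
  parallel_normal M (path L) (field L y).
Proof.
move=> L0 Lh; split=> [t _|]; first exact: field_normal.
have sL : (0 < size L)%N by case: (L) L0.
have [sp ss sn] := unif_partition sL.
exists [seq i.+1%:R / (size L)%:R | i <- iota 0 (size L)] => // i; rewrite ss => iL.
have Ah : nth 0 L i \in h by apply: Lh; exact: mem_nth.
pose A := nth 0 L i; pose P := wprod (take i L); pose Q := wprod (take i (map nu L)).
pose K : R := (size L)%:R.
pose B := P *m expmx (- i%:R *: A).
pose z := expmx (i%:R *: nu A) *m (Q^T *m y).
exists (fun t => B *m expmx (t *: (K *: A)) *m F *m expmx (t *: (- K *: nu A)) *m z).
  exact: smooth_exp.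
move=> t /(sn _ iL) ti.
have gE : wpath L (K * t) = B *m expmx (t *: (K *: A)).
  by rewrite /K (wpath_piece iL ti) expmx_piece mulmxA.
split.
  rewrite /field -/K gE -!mulmxA; do 3!congr (_ *m _).
  have iL' : (i < size (map nu L))%N by rewrite size_map.
  rewrite (wpath_piece iL' ti) (nth_map 0)// trmx_mul skew_expmx ?nu_skew//.
  rewrite opprB -[i%:R - _]addrC expmxD -mulmxA scalerA mulrN [t * K]mulrC.
  by rewrite /z -!mulmxA.
move=> eta; rewrite /path -/K gE => etaN.
have [w wh wE] := wpath_word (K * t) Lh; rewrite gE in wE.
have [BB _] := normalizes_gword hh wh; rewrite -wE in BB.
set E := B *m _ in BB wE etaN *.
have [e eE] : exists e, eta = E *m (F *m e).
  exists (F^T *m (E^T *m eta)); have /FV : sphere_normal M p (E^T *m eta).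
    by apply/(sphere_normal_word _ wh orbit_base); rewrite -wE mulmxA (mulmx1C BB) mul1mx.
  by move=> ->; rewrite mulmxA (mulmx1C BB) mul1mx.
have := is_derive_mulcst z (is_derive_mulmx (is_derive_mulcst F
    (is_derive_cstmul B (is_derive_expmx (K *: A) t))) (is_derive_expmx (- K *: nu A) t)).
set D := (X in is_derive _ _ _ X) => dz; rewrite derive1E (_ : 'D_1 _ t = D); last exact: derive_val.
have -> : D = E *m (((K *: A) *m F - F *m (K *: nu A)) *m (expmx (t *: (- K *: nu A)) *m z)).
  rewrite /D expmx_commZ mulmxBl mulmxBr mulmxDl !mulmxA; congr (_ + _).
  by rewrite scaleNr !(mulmxN, mulNmx).
have Z : F^T *m ((K *: A) *m F - F *m (K *: nu A)) = 0.
  by rewrite mulmxBr [F^T *m (F *m _)]mulmxA FF mul1mx mulmxA -/(nu _) nuZ subrr.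
by rewrite eE dotp_orth// dotp_mulmxl mulmxA Z mul0mx dotp0r.
Qed.

(* Closed words which contract to the constant loop; [wprod (map nu _)] is the
   inverse of the holonomy, read in the frame [F]. *)
Definition contractible (lam : seq (R -> 'M[R]_N)) :=
  [/\ lam != [::], each (fun f => [/\ continuous f, forall s, f s \in h & f 0 = 0]) lam &
      forall s, wprod [seq f s | f <- lam] = 1%:M].

Definition word_holonomy : set 'M[R]_k :=
  [set m | exists2 lam, contractible lam & m = wprod [seq nu (f 1) | f <- lam]].

Lemma word_holonomyP m : word_holonomy m ->
  restricted_holonomy M p (fun x => F *m (m^T *m (F^T *m x))).
Proof.
move=> [lam [lam0 lamP lamp] ->].
pose L s := [seq f s | f <- lam].
have L0 s : L s != [::] by rewrite /L; case: (lam) lam0.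
have Lh s A : A \in L s -> A \in h by move: A; apply: each_map lamP => f [].
have sL s : size (L s) = size lam by rewrite size_map.
have path0 s : path (L s) 0 = p by rewrite /path mulr0 wpath0// mul1mx.
have path1 s : path (L s) 1 = p by rewrite /path mulr1 wpath_end// lamp mul1mx.
exists (path (L 1)); first split=> //.
- exact: path_smooth (L0 1) (Lh 1).
- by move=> t _; exact: path_orbit (Lh 1).
(* The homotopy scales the parameter of all letters down to 0; each intermediate word is still
   closed. *)
- exists (fun st => path (L (1 - st.1)) st.2); split.
  + apply: continuous_subspaceT; apply: continuous_mulmx; last by move=> ?; exact: cvg_cst.
    rewrite (_ : (fun _ => _) = fun st : R * R => wpath [seq g st | g <-
      [seq (fun st : R * R => f (1 - st.1)) | f <- lam]] ((size lam)%:R * st.2)); last first.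
      by apply/funext => st; rewrite sL /L -map_comp.
    apply: (continuous_wpath hh).
      elim: (lam) lamP => //= f l IH [[fc fh _] /IH lP]; split=> //; split=> // st.
      apply: (@continuous_comp _ _ _ (fun st : R * R => 1 - st.1) f); last exact: fc.
      by apply: cvgB; [exact: cvg_cst|exact: cvg_fst].
    by move=> st; apply: cvgMr; exact: cvg_snd.
  + by move=> s t _ _; exact: path_orbit (Lh _).
  + move=> t _; rewrite subr0; split=> //=; rewrite subrr /path wpath_const0 ?mul1mx//.
    by apply: each_map lamP => f [].
  + by move=> s _ /=; rewrite path0 path1.
move=> x /FV xE; exists (field (L 1) (F^T *m x)); split.
- exact: field_parallel (L0 1) (Lh 1).
- by rewrite /field mulr0 !wpath0// trmx1 mul1mx mulmx1.
by rewrite /field mulr1 !wpath_end ?size_map// lamp mul1mx -map_comp -mulmxA.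
Qed.

Lemma word_holonomy1 : word_holonomy 1%:M.
Proof.
exists [:: fun=> 0]; last by rewrite /wprod big_seq1 /= /nu mulmx0 mul0mx expmx0.
split=> // [|s]; last by rewrite /wprod big_seq1 expmx0.
by split=> //; split=> [s|s|]; [exact: cvg_cst|exact: mem0v|].
Qed.

Lemma word_holonomyM m1 m2 : word_holonomy m1 -> word_holonomy m2 -> word_holonomy (m1 *m m2).
Proof.
move=> [l1 [n1 c1 p1] ->] [l2 [n2 c2 p2] ->]; exists (l1 ++ l2); last by rewrite map_cat wprod_cat.
split=> [||s]; [by case: (l1) n1|exact: each_cat|by rewrite map_cat wprod_cat p1 p2 mul1mx].
Qed.

Lemma wprod_orth m (L : seq 'M[R]_m) : (forall A, A \in L -> A^T = - A) -> (wprod L)^T *m wprod L = 1%:M.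
Proof.
elim: L => [|A L IH] LT; first by rewrite /wprod big_nil trmx1 mul1mx.
rewrite wprod_cons trmx_mul -mulmxA (mulmxA _^T (expmx A)).
have := orth_expmx 1 (LT _ (mem_head _ _)); rewrite scale1r => ->.
by rewrite mul1mx; apply: IH => B BL; apply: LT; rewrite inE BL orbT.
Qed.

Lemma word_holonomy_orth m : word_holonomy m -> m^T *m m = 1%:M.
Proof.
move=> [lam [_ lamP _] ->]; apply: wprod_orth; apply: each_map lamP => f [_ fh _].
exact: nu_skew.
Qed.

(** The curvature of the invariant connection [nu]: its failure to be a morphism of Lie algebras. *)
Definition ncurv (X Y : 'M[R]_N) := nu X *m nu Y - nu Y *m nu X - nu (X *m Y - Y *m X).

Let nuword (w : seq (R * 'M[R]_N)) := [seq (a.1, nu a.2) | a <- w].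

Lemma wprod_word m (w : seq (R * 'M[R]_m)) : wprod [seq a.1 *: a.2 | a <- w] = gword w.
Proof. by rewrite /wprod /gword big_map. Qed.

(* The lasso whose tail is [w], around the parallelogram spanned by [s X] and
   [t Y], contracted by scaling all the letters. *)
Lemma lasso w X Y (s t : R) : word_in h w -> X \in h -> Y \in h ->
  word_holonomy (gword (nuword w) *m (expmx (s *: nu X) *m expmx (t *: nu Y) *m
    expmx (- s *: nu (expmx (- t *: Y) *m X *m expmx (t *: Y))) *m expmx (- t *: nu Y))
    *m (gword (nuword w))^T).
Proof.
move=> wh Xh Yh; pose w' := [seq (- a.1, a.2) | a <- rev w].
(* Conjugating the third side makes the four sides multiply to the identity even when [X] and [Y] do
   not commute. *)
pose Xt (u : R) := expmx (- u *: Y) *m X *m expmx (u *: Y).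
have Xth u : Xt u \in h.
  have [_ [_ H]] := normalizes_expmx u hh Yh; rewrite /Xt.
  by rewrite -skew_expmx ?(hh.1 _ Yh)//; exact: H.
pose sc (v : seq (R * 'M[R]_N)) : seq (R -> 'M[R]_N) := [seq (fun u => (u * a.1) *: a.2) | a <- v].
pose lam := sc w ++ [:: fun u => (u * s) *: X; fun u => (u * t) *: Y;
    fun u => (u * - s) *: Xt (u * t); fun u => (u * - t) *: Y] ++ sc w'.
have w'h : word_in h w'.
  by move=> a /mapP[b]; rewrite mem_rev => /wh bh ->.
have c1 (r : R) : continuous (fun u : R => u * r) by move=> u; apply: cvgMl; exact: cvg_id.
have c2 (r : R) A : continuous (fun u : R => (u * r) *: (A : 'M[R]_N)).
  by move=> u; apply: cvgZr_tmp; exact: c1.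
pose P (f : R -> 'M[R]_N) := [/\ continuous f, forall s, f s \in h & f 0 = 0].
have base (r : R) A : A \in h -> P (fun u => (u * r) *: A).
  by move=> Ah; split=> [|u|]; [exact: c2|exact: memvZ|rewrite mul0r scale0r].
have scP v : word_in h v -> each P (sc v).
  elim: v => //= a v IH av; have [ah /IH vh] := word_in_cons av.
  by split=> //; exact: base.
have lamP : each P lam.
  apply: each_cat (scP _ wh) (each_cat _ (scP _ w'h)).
  split; [exact: base|split; [exact: base|split; [|split; [exact: base|by []]]]].
  split=> [|u|]; [|exact: memvZ|by rewrite mul0r scale0r].
  have ce (f : R -> R) : continuous f -> continuous (fun u : R => expmx (f u *: Y)).
    move=> fc; apply: continuous_expmx => [u|u]; first by rewrite linearZ/= (hh.1 _ Yh) scalerN.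
    by apply: cvgZr_tmp; exact: fc.
  have ct : continuous (fun u : R => - (u * t)) by move=> u; apply: cvgN; exact: c1.
  move=> u; apply: cvgZ; first exact: c1.
  apply: cvg_mulmx; last exact: (ce _ (c1 t)).
  by apply: cvg_mulmx; [exact: (ce _ ct)|exact: cvg_cst].
have wpE m (f : 'M[R]_N -> 'M[R]_m) (u : R) v : (forall a A, f (a *: A) = a *: f A) ->
    wprod [seq f (g u) | g <- sc v] = gword [seq (u * a.1, f a.2) | a <- v].
  by move=> fZ; rewrite -wprod_word -!map_comp; congr wprod; apply: eq_map => a /=; rewrite fZ.
have inv m (f : 'M[R]_N -> 'M[R]_m) (u : R) : (forall A, A \in h -> (f A)^T = - f A) ->
    gword [seq (u * a.1, f a.2) | a <- w'] = (gword [seq (u * a.1, f a.2) | a <- w])^T.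
  move=> fT; rewrite /w'; elim: w wh {w' w'h lam lamP} => [|a w IH] wh; first by rewrite gword_nil trmx1.
  have [ah /IH wE] := word_in_cons wh.
  rewrite rev_cons -cats1 !map_cat gword_cat wE /= !gword_cons trmx_mul gword_nil mulmx1.
  by rewrite skew_expmx ?fT// mulrN.
exists lam.
  split=> // [|u]; first by rewrite /lam; case: (sc w).
  rewrite /lam !map_cat !wprod_cat /= !wprod_cons /wprod big_nil mulmx1 -!/(wprod _).
  rewrite (wpE _ id) // (wpE _ id u w') // (inv _ id) //; last by move=> A /hh.1.
  set W := gword _; have WW : W^T *m W = 1%:M.
    suff : normalizes h W by case.
    by apply: normalizes_gword => // a /mapP[b /wh bh ->].
  have -> : expmx ((u * - s) *: Xt (u * t)) = expmx (- (u * t) *: Y) *m expmx ((u * - s) *: X) *m expmx ((u * t) *: Y).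
    have YT := hh.1 _ Yh; have := @expmx_conj _ _ (expmx ((u * t) *: Y)) X (u * - s).
    by rewrite (mulmx1C (orth_expmx _ YT)) skew_expmx// => /(_ erefl) <-.
  rewrite !mulrN; have := expmxNr Y (u * t); have := expmxNr X (u * s).
  move: (expmx ((u * s) *: X)) (expmx (- (u * s) *: X)) (expmx ((u * t) *: Y)) (expmx (- (u * t) *: Y)).
  move=> a a' b b' aa bb; have -> : b *m (b' *m a' *m b *m b') = a'.
    by rewrite !mulmxA bb mul1mx -mulmxA bb mulmx1.
  by rewrite aa mul1mx (mulmx1C WW).
rewrite /lam !map_cat !wprod_cat /= !wprod_cons /wprod big_nil mulmx1 -!/(wprod _).
rewrite (wpE _ nu) ?(wpE _ nu 1 w'); try by move=> a A; exact: nuZ.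
rewrite (inv _ nu); last exact: nu_skew.
rewrite !mul1r !nuZ; have -> : [seq (1 * a.1, nu a.2) | a <- w] = nuword w.
  by apply: eq_map => a; rewrite mul1r.
rewrite /Xt; move: (gword _) (expmx (s *: nu X)) (expmx (t *: nu Y)) => W a b.
by move: (expmx (- s *: _)) (expmx (- t *: nu Y)) => c e; rewrite !mulmxA.
Qed.

Lemma derive_vspace m n (U : {vspace 'M[R]_(m, n)}) (g : R -> 'M[R]_(m, n)) (t : R) v :
  (forall s, g s \in U) -> is_derive t 1 g v -> v \in U.
Proof.
move=> gU dg; pose f : {linear 'M[R]_(m, n) -> 'M[R]_(m, n)} := (\1 - projv U)%VF.
have fU x : f x = x - projv U x by rewrite /f/= add_lfunE opp_lfunE id_lfunE.
have := is_derive_linear f dg; rewrite (_ : (fun x => _) = cst 0); last first.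
  by apply/funext => s; rewrite fU projv_id ?subrr.
move=> H; have : f v = 0 by rewrite -[LHS](@derive_val _ _ _ _ _ _ _ H) derive_cst.
by rewrite fU => /eqP; rewrite subr_eq0 => /eqP ->; exact: memv_proj.
Qed.

Lemma nu_derive (g : R -> 'M[R]_N) (t : R) v : is_derive t 1 g v -> is_derive t 1 (fun s => nu (g s)) (nu v).
Proof. by move=> dg; apply/is_derive_mulcst/is_derive_cstmul. Qed.

Lemma gword_nu_orth w : word_in h w -> (gword (nuword w))^T *m gword (nuword w) = 1%:M.
Proof.
rewrite -wprod_word => wh; apply: wprod_orth => A /mapP[b /mapP[a aw ->] ->] /=.
by rewrite linearZ/= nu_skew ?scalerN//; exact: wh.
Qed.

(** A lasso differentiated in [s], then in [t], gives the curvature. The tangent directions are not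
    shown to form a vector space, so they are tested against a subspace [S] containing the skew
    ones; the derivative in [t] stays in [S]. *)
Lemma word_holonomy_curv (S : {vspace 'M[R]_k}) w X Y :
  (forall B, tangent_at_1 word_holonomy B -> B^T = - B -> B \in S) ->
  word_in h w -> X \in h -> Y \in h ->
  gword (nuword w) *m ncurv X Y *m (gword (nuword w))^T \in S.
Proof.
move=> HS wh Xh Yh; set m := gword (nuword w).
have mm : m^T *m m = 1%:M by exact: gword_nu_orth.
have YT := nu_skew Yh.
pose B t := expmx (t *: nu Y) *m nu (expmx (- t *: Y) *m X *m expmx (t *: Y)) *m expmx (- t *: nu Y).
have BT t : (B t)^T = - B t.
  have [_ [_ H]] := normalizes_expmx t hh Yh.
  rewrite /B -!skew_expmx ?(hh.1 _ Yh)//; set E := expmx _; set E' := expmx (t *: Y).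
  have := nu_skew (H _ Xh); move: (nu _) => Z ZT.
  by rewrite !trmx_mul trmxK ZT mulNmx mulmxN mulmxA.
have lp (C : 'M[R]_k) : lipschitz_fun ((fun s => s *: C) : R^o -> _).
  by exists `|C| => // s t; rewrite -scalerBl normrZ mulrC.
have DS t : m *m (nu X - B t) *m m^T \in S.
  apply: HS; last by rewrite !trmx_mul trmxK linearB/= BT nu_skew// mulmxA -opprB opprK mulmxN mulNmx [- B t + _]addrC.
  exists (fun s => expmx (s *: (m *m nu X *m m^T)) *m expmx (s *: (m *m - B t *m m^T))); split.
  - rewrite mulmxBr mulmxBl; have := @sdiff0_mul R R^o k (fun s => expmx (s *: (m *m nu X *m m^T)))
      (fun s => expmx (s *: (m *m - B t *m m^T))) _ _ _ _ _ _ (sdiff0_expmx _) (sdiff0_expmx _).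
    rewrite (_ : (fun x : R^o => x *: _ + _) = fun s => s *: (m *m nu X *m m^T - m *m B t *m m^T)).
      by apply; [rewrite scale0r expmx0|rewrite scale0r expmx0|exact: lp|exact: lp].
    by apply/funext => s; rewrite mulmxN mulNmx scalerBr scalerN.
  - by rewrite !scale0r !expmx0 mulmx1.
  move=> s; have H := lasso s t wh Xh Yh; apply: (eq_ind _ word_holonomy H).
  rewrite -/m; have mm' : m^T *m m^T^T = 1%:M by rewrite trmxK.
  have := expmx_conj (nu X) s mm'; have := expmx_conj (- B t) s mm'; rewrite trmxK => <- <-.
  rewrite scalerN -scaleNr; have EE := orth_expmx (- t) YT.
  have := @expmx_conj _ _ (expmx (- t *: nu Y)) (nu (expmx (- t *: Y) *m X *m expmx (t *: Y))) (- s).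
  rewrite (mulmx1C EE) skew_expmx// opprK -/(B t) => /(_ erefl) <-.
  move: (expmx (s *: nu X)) (expmx (t *: nu Y)) (expmx (- s *: _)) (expmx (- t *: nu Y)) => e1 e2 e3 e4.
  have -> : m *m e1 *m m^T *m (m *m (e2 *m e3 *m e4) *m m^T) = m *m e1 *m (m^T *m m) *m (e2 *m e3 *m e4) *m m^T.
    by move: (m) (m^T) => a b; rewrite !mulmxA.
  by rewrite mm; move: (m) (m^T) => a b; rewrite mulmx1 !mulmxA.
have d1 := is_derive_mulmx (is_derive_mulmx (is_derive_expmx (nu Y) (0 : R))
  (nu_derive (is_derive_mulmx (is_derive_mulcst X (is_derive_expmxN Y (0 : R))) (is_derive_expmx Y (0 : R)))))
  (is_derive_expmxN (nu Y) (0 : R)).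
have d2 : is_derive (0 : R) 1 (fun t => m *m (nu X - B t) *m m^T)
   (m *m (0 - (nu Y *m nu X + nu (X *m Y - Y *m X) - nu X *m nu Y)) *m m^T).
  apply/is_derive_mulcst/is_derive_cstmul; apply: is_deriveB; apply: (is_derive_eq d1).
  rewrite !oppr0 !scale0r !expmx0 !(mulmx1, mul1mx) mulNmx mulmxN; congr (_ + nu _ - _).
  by rewrite addrC.
have := derive_vspace DS d2; rewrite /ncurv; congr (_ *m _ *m _ \in S).
move: (nu X *m nu Y) (nu Y *m nu X) (nu _) => a b c.
by apply/matrixP => i j; rewrite !mxE; ring.
Qed.

Lemma span_ind (vT : vectType R) (b : seq vT) (P : vT -> Prop) :
  P 0 -> (forall a x y, P x -> P y -> P (a *: x + y)) -> (forall x, x \in b -> P x) ->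
  forall x, x \in <<b>>%VS -> P x.
Proof.
move=> P0 PD Pb x xb; rewrite (@coord_span _ _ _ (in_tuple b) x xb).
elim/big_ind: _ => // [u v Pu Pv|i _]; first by rewrite -[u]scale1r; exact: PD.
by rewrite -[_ *: _]addr0; apply: PD => //; exact/Pb/mem_nth.
Qed.

Lemma nuword_cat w1 w2 : gword (nuword (w1 ++ w2)) = gword (nuword w1) *m gword (nuword w2).
Proof. by rewrite /nuword map_cat gword_cat. Qed.

Lemma nuword_inv w : word_in h w -> exists2 w', word_in h w' & gword (nuword w') = (gword (nuword w))^T.
Proof.
elim: w => [|a w IH] aw; first by exists [::] => //; rewrite gword_nil trmx1.
have [ah /IH[w' wh' wE]] := word_in_cons aw; exists (w' ++ [:: (- a.1, a.2)]).
  by move=> b; rewrite mem_cat inE => /orP[/wh'|/eqP->].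
by rewrite nuword_cat wE /= !gword_cons gword_nil mulmx1 trmx_mul skew_expmx// nu_skew.
Qed.

(** Differentiating conjugation by words shows stability under brackets with the [nu X]. As
    [ncurv X Y] is [nu X, nu Y] - nu [X, Y], the bracket with a curvature is a combination of
    iterated brackets of this kind, so the span of the conjugates is a Lie algebra. The last clause
    is its minimality. *)
Lemma curvature_algebra : exists g0 : {vspace 'M[R]_k},
  [/\ lie_so g0, forall X Y, X \in h -> Y \in h -> ncurv X Y \in g0,
    forall X T, X \in h -> T \in g0 -> nu X *m T - T *m nu X \in g0,
    forall w T, word_in h w -> T \in g0 ->
      gword (nuword w) *m T *m (gword (nuword w))^T \in g0 &
    forall S : {vspace 'M[R]_k},
      (forall w X Y, word_in h w -> X \in h -> Y \in h ->
        gword (nuword w) *m ncurv X Y *m (gword (nuword w))^T \in S) -> (g0 <= S)%VS].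
Proof.
pose gen : set 'M[R]_k := [set T | exists w X Y, [/\ word_in h w, X \in h, Y \in h &
  T = gword (nuword w) *m ncurv X Y *m (gword (nuword w))^T]].
have [b [bg gb]] := span_set gen; pose g0 := <<b>>%VS.
have ncT X Y : X \in h -> Y \in h -> (ncurv X Y)^T = - ncurv X Y.
  move=> Xh Yh; have := nu_skew (hh.2 _ _ Xh Yh); have := nu_skew Xh; have := nu_skew Yh.
  rewrite /ncurv; move: (nu X) (nu Y) (nu (X *m Y - Y *m X)) => A B C BT AT CT.
  rewrite !linearB/= !trmx_mul AT BT CT !mulmxN !mulNmx !opprK.
  by apply/matrixP => i j; rewrite !mxE; ring.
have skew T : T \in g0 -> T^T = - T.
  move: T; apply: span_ind => [|a x y xT yT|T /bg[w [X [Y [_ Xh Yh ->]]]]].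
  - by rewrite trmx0 oppr0.
  - by rewrite linearP/= xT yT scalerN opprD.
  - by rewrite !trmx_mul trmxK ncT// mulNmx mulmxN mulmxA.
have nc X Y : X \in h -> Y \in h -> ncurv X Y \in g0.
  move=> Xh Yh; apply: gb; exists [::], X, Y; split=> //.
  by rewrite gword_nil trmx1 mulmx1 mul1mx.
have cnj w T : word_in h w -> T \in g0 -> gword (nuword w) *m T *m (gword (nuword w))^T \in g0.
  move=> wh; move: T; apply: span_ind => [|a x y xg yg|T /bg[v [X [Y [vh Xh Yh ->]]]]].
  - by rewrite mulmx0 mul0mx mem0v.
  - by rewrite mulmxDr mulmxDl -scalemxAr -scalemxAl memvD// memvZ.
  - apply: gb; exists (w ++ v), X, Y; split=> //; last by rewrite nuword_cat trmx_mul !mulmxA.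
    by move=> c; rewrite mem_cat => /orP[/wh|/vh].
have ad X T : X \in h -> T \in g0 -> nu X *m T - T *m nu X \in g0.
  move=> Xh Tg.
  have := is_derive_mulmx (is_derive_mulcst T (is_derive_expmx (nu X) (0 : R))) (is_derive_expmxN (nu X) (0 : R)).
  move=> H; apply: derive_vspace (is_derive_eq H _); last first.
    by rewrite !oppr0 !scale0r !expmx0 !(mulmx1, mul1mx) mulmxN.
  move=> s; have := cnj [:: (s, X)] T _ Tg; rewrite /= gword_cons gword_nil mulmx1/=.
  by rewrite skew_expmx ?nu_skew//; apply => c; rewrite inE => /eqP->.
exists g0; split=> //; first split=> // A B; last first.
  move=> S HS; apply/span_subvP => x /bg[w [X [Y [wh Xh Yh ->]]]].
  exact: HS.
move=> Ag Bg; move: A Ag; apply: span_ind => [|a x y xg yg|T /bg[v [X [Y [vh Xh Yh ->]]]]].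
- by rewrite mul0mx mulmx0 subr0 mem0v.
- rewrite mulmxDl mulmxDr -scalemxAl -scalemxAr opprD addrACA -scalerBr.
  by rewrite memvD// memvZ.
set m := gword _; have mm : m^T *m m = 1%:M by exact: gword_nu_orth.
have -> : m *m ncurv X Y *m m^T *m B - B *m (m *m ncurv X Y *m m^T) =
   m *m (ncurv X Y *m (m^T *m B *m m) - m^T *m B *m m *m ncurv X Y) *m m^T.
  have mm' := mulmx1C mm; move: (ncurv X Y) => C; rewrite mulmxBr mulmxBl !mulmxA mm' mul1mx.
  by rewrite -[_ *m m *m m^T](mulmxA _ m) mm' mulmx1.
apply: (cnj) => //; have [v' vh' vE] := nuword_inv vh.
have : m^T *m B *m m \in g0 by have := cnj _ _ vh' Bg; rewrite vE trmxK.
move: (m^T *m B *m m) => C Cg; rewrite /ncurv.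
have := memvB (memvB (ad _ _ Xh (ad _ _ Yh Cg)) (ad _ _ Yh (ad _ _ Xh Cg))) (ad _ _ (hh.2 _ _ Xh Yh) Cg).
congr (_ \in g0); move: (nu X) (nu Y) (nu (X *m Y - Y *m X)) => P Q D.
rewrite !mulmxBr !mulmxBl !mulmxA.
move: (P *m Q *m C) (P *m B *m Q) (Q *m B *m P) (B *m Q *m P) (Q *m P *m C) (B *m P *m Q) (C *m C) (B *m C).
by move=> *; apply/matrixP => i j; rewrite !mxE; ring.
Qed.

End frame.
End orbit_geometry.

(** * First-order comparison of charts and parallel transport *)

Section chart_increments.
Variables (R : realType) (N : nat) (h : {vspace 'M[R]_N}) (k : nat) (F : 'M[R]_(N, k)) (g0 : {vspace 'M[R]_k}).
Hypothesis hh : lie_so h.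
Hypothesis FF : F^T *m F = 1%:M.
Hypothesis gg : lie_so g0.
Hypothesis gc : forall X Y, X \in h -> Y \in h -> ncurv F X Y \in g0.
Hypothesis ga : forall X T, X \in h -> T \in g0 -> nu F X *m T - T *m nu F X \in g0.

(** Couples a group element with its normal transport, so that a single expansion of a product of
    exponentials controls both with the same increments. *)
Let dg (A : 'M[R]_N) (B : 'M[R]_k) : 'M[R]_(N + k) := block_mx A 0 0 B.

Let dg_mul A B A' B' : dg A B *m dg A' B' = dg (A *m A') (B *m B').
Proof. by rewrite /dg mulmx_block !mulmx0 !mul0mx !addr0 add0r. Qed.

Let dgP a A B A' B' : dg (a *: A + A') (a *: B + B') = a *: dg A B + dg A' B'.
Proof. by rewrite /dg scale_block_mx add_block_mx !scaler0 !addr0. Qed.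

Let dg1 : dg 1%:M 1%:M = 1%:M. Proof. by rewrite /dg -scalar_mx_block. Qed.

Let dg_tr A B : (dg A B)^T = dg A^T B^T.
Proof. by rewrite /dg tr_block_mx !trmx0. Qed.

Let expmx_dg A B (t : R) : expmx (t *: dg A B) = dg (expmx (t *: A)) (expmx (t *: B)).
Proof.
pose I1 : 'M[R]_(N + k, N) := col_mx 1%:M 0; pose I2 : 'M[R]_(N + k, k) := col_mx 0 1%:M.
have dgE C D : dg C D = I1 *m C *m I1^T + I2 *m D *m I2^T.
  rewrite /I1 /I2 !tr_col_mx !trmx0 !trmx1 !mul_col_mx !mul1mx !mul0mx !mul_mx_row.
  by rewrite !mulmx0 !mulmx1 add_col_mx addr0 add0r.
pose f t := dg (expmx (t *: A)) (expmx (t *: B)).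
have df (s : R) : is_derive s 1 f (dg A B *m f s).
  rewrite /f dg_mul dgE (_ : (fun _ => _) = fun s => I1 *m expmx (s *: A) *m I1^T + I2 *m expmx (s *: B) *m I2^T).
    by apply: is_deriveD; apply/is_derive_mulcst/is_derive_cstmul/is_derive_expmx.
  by apply/funext => u; rewrite dgE.
by have := expmx_ode df t; rewrite /f !scale0r !expmx0 dg1 mulmx1 => ->.
Qed.

(** The pairs (X, nu X) do not form a Lie algebra when the normal bundle is curved; adding [g0] to
    the second component absorbs the defect [ncurv]. *)
Let thP : exists th : {vspace 'M[R]_(N + k)}, lie_so th /\
  (forall A, A \in th <-> exists X T, [/\ X \in h, T \in g0 & A = dg X (nu F X + T)]).
Proof.
pose S : set 'M[R]_(N + k) := [set A | exists X T, [/\ X \in h, T \in g0 & A = dg X (nu F X + T)]].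
have [b [bS Sb]] := span_set S.
have SE A : A \in <<b>>%VS <-> S A.
  split; last exact: Sb.
  move: A; apply: span_ind => [|a x y [X [T [Xh Tg ->]]] [Y [U [Yh Ug ->]]]|//].
    exists 0, 0; split; rewrite ?mem0v//.
    by rewrite /dg /nu mulmx0 mul0mx addr0 block_mx0.
  exists (a *: X + Y), (a *: T + U); split; rewrite ?memvD ?memvZ//.
  rewrite -dgP; congr (dg _ _); rewrite /nu mulmxDr mulmxDl -scalemxAr -scalemxAl scalerDr.
  by rewrite addrACA.
exists <<b>>%VS; split=> //; split=> [A /SE[X [T [Xh Tg ->]]]|A B /SE[X [T [Xh Tg ->]]] /SE[Y [U [Yh Ug ->]]]].
  have YT := nu_skew hh F Xh.
  by rewrite dg_tr (hh.1 _ Xh) linearD/= YT (gg.1 _ Tg) /dg -opprD opp_block_mx !oppr0.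
apply/SE; exists (X *m Y - Y *m X), (ncurv F X Y + (nu F X *m U - U *m nu F X)
   - (nu F Y *m T - T *m nu F Y) + (T *m U - U *m T)); split; first exact: hh.2.
  exact: memvD (memvB (memvD (gc Xh Yh) (ga Xh Ug)) (ga Yh Tg)) (gg.2 _ _ Tg Ug).
rewrite !dg_mul /dg opp_block_mx add_block_mx !oppr0 !addr0; congr block_mx.
rewrite /ncurv !mulmxDr !mulmxDl; move: (nu F (X *m Y - Y *m X)) (nu F X) (nu F Y) => C A1 B1.
move: (A1 *m B1) (A1 *m U) (B1 *m A1) (B1 *m T) (U *m A1) (T *m B1) (U *m T) (T *m U) => *.
by apply/matrixP => i j; rewrite !mxE; ring.
Qed.

Variables (d : nat) (X : 'I_d -> 'M[R]_N).
Hypothesis Xh : forall i, X i \in h.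

Definition mchart (b : 'cV[R]_d) : 'M[R]_k := gchart (fun i => nu F (X i)) b.

Let gchart_dg b : gchart (fun i => dg (X i) (nu F (X i))) b = dg (gchart X b) (mchart b).
Proof.
rewrite /mchart /gchart; elim: (enum _) => [|i s IH]; first by rewrite !big_nil dg1.
by rewrite !big_cons IH expmx_dg; exact: dg_mul.
Qed.

Lemma mchart_orth b : (mchart b)^T *m mchart b = 1%:M.
Proof.
rewrite /mchart /gchart; elim: (enum _) => [|i s IH]; first by rewrite !big_nil trmx1 mul1mx.
rewrite !big_cons trmx_mul -mulmxA (mulmxA _^T (expmx _)).
by rewrite orth_expmx ?mul1mx// (nu_skew hh F).
Qed.

Lemma mchart_conj b T : T \in g0 -> mchart b *m T *m (mchart b)^T \in g0.
Proof.
rewrite /mchart /gchart; elim: (enum _) => [|i s IH] Tg; first by rewrite !big_nil trmx1 mul1mx mulmx1.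
rewrite !big_cons trmx_mul !mulmxA -2!(mulmxA (expmx _)) skew_expmx ?(nu_skew hh F)//.
by apply: expmx_conj_vspace (IH Tg) => S Sg; exact: ga.
Qed.

Lemma norm_block_ul (A : 'M[R]_(N + k)) : `|ulsubmx A| <= `|A|.
Proof. by apply/norm_mx_le => // i j; rewrite !mxE; exact: norm_entry. Qed.

Lemma norm_block_dr (A : 'M[R]_(N + k)) : `|drsubmx A| <= `|A|.
Proof. by apply/norm_mx_le => // i j; rewrite !mxE; exact: norm_entry. Qed.

(** Inside the chart, transport along the chart words obeys the connection [nu] up to a term in
    [g0]: to first order, path dependence is confined to [g0]. *)
Lemma chart_increment b : exists (L : 'cV[R]_d -> 'M[R]_N) (T : 'cV[R]_d -> 'M[R]_k) (C : R),
  [/\ forall x, L x \in h /\ T x \in g0, 0 <= C,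
    forall x, [/\ `|L x| <= C * `|x|, `|nu F (L x) + T x| <= C * `|x| & `|T x| <= C * `|x|] &
    forall e : R, 0 < e -> exists2 r : R, 0 < r & forall x : 'cV[R]_d, `|x| < r ->
      `|(gchart X b)^T *m gchart X (b + x) - 1%:M - L x| <= e * `|x| /\
      `|(mchart b)^T *m mchart (b + x) - 1%:M - (nu F (L x) + T x)| <= e * `|x|].
Proof.
have [th [thl thE]] := thP.
have Xt i : dg (X i) (nu F (X i)) \in th.
  by apply/thE; exists (X i), 0; split; rewrite ?mem0v ?addr0.
have [L [Lh [C C0 [LC LE]]]] := gprod_increment thl b (enum 'I_d) Xt.
have /choice[L1 H1] : forall x, exists Y, exists T, [/\ Y \in h, T \in g0 & L x = dg Y (nu F Y + T)].
  by move=> x; have /thE := Lh x.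
have /choice[T1 H2] := H1.
pose C1 := C + N%:R * (N%:R * `|F^T| * C) * `|F|.
have C1C : C <= C1 by rewrite lerDl !mulr_ge0.
exists L1, T1, C1; split=> // [x||x|e e0]; [by have [] := H2 x|exact: le_trans C1C| |].
  have [_ _ LxE] := H2 x.
  have b1 : `|L1 x| <= C * `|x|.
    by apply: le_trans (LC x); have := norm_block_ul (L x); rewrite {1}LxE /dg block_mxKul.
  have b2 : `|nu F (L1 x) + T1 x| <= C * `|x|.
    by apply: le_trans (LC x); have := norm_block_dr (L x); rewrite {1}LxE /dg block_mxKdr.
  have CC : C * `|x| <= C1 * `|x| by rewrite ler_wpM2r.
  split; [exact: le_trans CC|exact: le_trans CC|].
  rewrite -[T1 x](addKr (nu F (L1 x))) addrC (le_trans (ler_normD _ _))// /C1 mulrDl lerD// normrN.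
  apply: (@le_trans _ _ (N%:R * (N%:R * `|F^T| * (C * `|x|)) * `|F|)); last first.
    by rewrite le_eqVlt; apply/orP; left; apply/eqP; ring.
  apply: le_trans (norm_mulmx _ _) _; apply: ler_wpM2r => //; apply: ler_wpM2l => //.
  by apply: le_trans (norm_mulmx _ _) _; apply: ler_wpM2l; rewrite ?mulr_ge0.
have [r r0 Hr] := LE _ e0; exists r => // x xr; have := Hr _ xr.
rewrite -!/(gchart _ _) !gchart_dg dg_tr dg_mul; have [_ _ ->] := H2 x.
rewrite -dg1 /dg !opp_block_mx !add_block_mx => H.
split; apply: le_trans H.
  by have := norm_block_ul (block_mx ((gchart X b)^T *m gchart X (b + x) - 1%:M - L1 x) (0 - 0 - 0) (0 - 0 - 0)
    ((mchart b)^T *m mchart (b + x) - 1%:M - (nu F (L1 x) + T1 x))); rewrite block_mxKul.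
by have := norm_block_dr (block_mx ((gchart X b)^T *m gchart X (b + x) - 1%:M - L1 x) (0 - 0 - 0) (0 - 0 - 0)
    ((mchart b)^T *m mchart (b + x) - 1%:M - (nu F (L1 x) + T1 x))); rewrite block_mxKdr.
Qed.

Variables (rho K : R) (beta : 'cV[R]_N -> 'cV[R]_d) (p : 'cV[R]_N).
Hypothesis betaL : forall x y, `|x - p| < rho -> `|y - p| < rho -> `|beta x - beta y| <= K * `|x - y|.

(* [Xi] need only be parallel up to rotations of its columns, which do not
   affect the trace. *)
Lemma chart_parallel (c : R -> 'cV[R]_N) j (Xi : R -> 'M[R]_(N, j)) (P : 'M[R]_k) (a b : R) : a <= b ->
  (forall T, T \in g0 -> P *m T = T *m P) ->
  (forall t, a <= t <= b -> `|c t - p| < rho) ->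
  (forall t, a <= t <= b -> big_O (fun s => a <= s <= b) t (fun s => c s - c t)) ->
  (forall t, a <= t <= b -> let G := gchart X (beta (c t)) in G *m F *m (F^T *m G^T *m Xi t) = Xi t) ->
  (forall t, a <= t <= b -> exists (A : R -> 'M[R]_j) (D : R -> 'M[R]_(N, j)),
    [/\ forall s, (A s)^T = - A s, forall s, (gchart X (beta (c t)) *m F)^T *m D s = 0,
        big_O (fun s => a <= s <= b) t A, big_O (fun s => a <= s <= b) t D &
        small_o (fun s => a <= s <= b) t (fun s => Xi s - Xi t - D s - Xi t *m A s)]) ->
  let Z t := P *m (mchart (beta (c t)) *m (F^T *m ((gchart X (beta (c t)))^T *m Xi t))) in
  \tr ((Z a)^T *m Z a) = \tr ((Z b)^T *m Z b).
Proof.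
move=> ab Pg cr cO XiN XiD Z.
apply: (@const_on_segment _ (fun t => \tr ((Z t)^T *m Z t)) _ _ ab) => t tab.
pose D (s : R) := a <= s <= b.
have trle (A : 'M[R]_j) : `|\tr A| <= j%:R * `|A|.
  apply: le_trans (ler_norm_sum _ _ _) _; apply: le_trans (ler_sum _ (fun i _ => norm_entry A i i)) _.
  by rewrite sumr_const card_ord [leRHS]mulr_natl.
have tro (f : R -> 'M[R]_j) : small_o D t f -> small_o D t (fun s => (\tr (f s) : R^o)).
  by move=> H; apply: (small_o_dom (K := j%:R)) H => s _; exact: trle.
pose G := gchart X (beta (c t)); pose m := mchart (beta (c t)).
have [GG _] : normalizes h G by exact: gchart_normalizes.
have GG' := mulmx1C GG.
have mm : m^T *m m = 1%:M by exact: mchart_orth.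
have mm' := mulmx1C mm.
have [L [T [C [LT C0 LC LE]]]] := chart_increment (beta (c t)).
pose y s := beta (c s) - beta (c t).
have yO : big_O D t y.
  by apply: (big_O_dom (K := K)) (cO _ tab) => s Ds; apply: betaL; exact: cr.
have byE s : beta (c t) + y s = beta (c s) by rewrite /y addrC subrK.
have B1 : small_o D t (fun s => G^T *m gchart X (beta (c s)) - 1%:M - L (y s)).
  have H : forall e : R, 0 < e -> exists2 r : R, 0 < r & forall x : 'cV[R]_d, `|x| < r ->
    `|G^T *m gchart X (beta (c t) + x) - 1%:M - L x| <= e * `|x|.
    by move=> e e0; have [r r0 Hr] := LE _ e0; exists r => // x /Hr[].
  have := small_o_comp H yO; apply: (small_o_dom (K := 1)) => s _; by rewrite mul1r byE.
have B2 : small_o D t (fun s => m^T *m mchart (beta (c s)) - 1%:M - (nu F (L (y s)) + T (y s))).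
  have H : forall e : R, 0 < e -> exists2 r : R, 0 < r & forall x : 'cV[R]_d, `|x| < r ->
    `|m^T *m mchart (beta (c t) + x) - 1%:M - (nu F (L x) + T x)| <= e * `|x|.
    by move=> e e0; have [r r0 Hr] := LE _ e0; exists r => // x /Hr[].
  have := small_o_comp H yO; apply: (small_o_dom (K := 1)) => s _; by rewrite mul1r byE.
pose B s := G^T *m gchart X (beta (c s)) - 1%:M.
pose Cm s := m^T *m mchart (beta (c s)) - 1%:M.
pose W s := nu F (L (y s)) + T (y s).
have BO : big_O D t (fun s => (B s)^T).
  apply: big_O_tr; have LO : big_O D t (fun s => L (y s)) by apply: (big_O_dom (K := C)) yO => s _; have [] := LC (y s).
  by have := big_OD (small_oW B1) LO; apply: (big_O_dom (K := 1)) => s _; rewrite mul1r subrK.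
have CO : big_O D t Cm.
  have LO : big_O D t W by apply: (big_O_dom (K := C)) yO => s _; have [] := LC (y s).
  by have := big_OD (small_oW B2) LO; apply: (big_O_dom (K := 1)) => s _; rewrite mul1r subrK.
have [A [Dn [AT DnN AO DnO XiE]]] := XiD _ tab.
pose x s := G^T *m (Xi s - Xi t).
have xO : big_O D t x.
  apply: big_O_mull.
  have AO' : big_O D t (fun s => Xi t *m A s) by exact: big_O_mull.
  have := big_OD (big_OD (small_oW XiE) AO') DnO.
  by apply: (big_O_dom (K := 1)) => s _; rewrite mul1r !subrK.
pose eta := G^T *m Xi t; pose u := F^T *m eta.
have etaE : eta = F *m u.
  by rewrite /u /eta -{1}(XiN _ tab) -/G !mulmxA GG mul1mx.
pose E s := P *m (m *m ((Cm s - W s) *m u + F^T *m ((B s - L (y s))^T *m eta)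
  + F^T *m (G^T *m (Xi s - Xi t - Dn s - Xi t *m A s))
  + (Cm s *m (F^T *m ((B s)^T *m eta)) + Cm s *m (F^T *m x s) + F^T *m ((B s)^T *m x s)
     + Cm s *m (F^T *m ((B s)^T *m x s))))).
have Eo : small_o D t E.
  do 2!apply: small_o_mull; apply: small_oD; first apply: small_oD; first apply: small_oD.
  - exact: small_o_mulr B2.
  - by apply/small_o_mull/small_o_mulr/small_o_tr.
  - by do 2!apply: small_o_mull.
  apply: small_oD; first apply: small_oD; first apply: small_oD.
  - by apply: big_O_mul => //; apply/big_O_mull/big_O_mulr.
  - by apply: big_O_mul => //; exact: big_O_mull.
  - by apply: small_o_mull; exact: big_O_mul.
  - by apply: big_O_mul => //; apply/big_O_mull/small_oW/big_O_mul.
pose T' s := m *m T (y s) *m m^T.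
have ZtE : Z t = P *m (m *m u) by [].
(* The first-order variation is a skew matrix acting on each side, which does not change the trace
   of [(Z t)^T *m Z t]; [P] passes through the left one because it commutes with [g0]. *)
have dZ s : Z s - Z t = T' s *m Z t + Z t *m A s + E s.
  have e1 : mchart (beta (c s)) = m *m (1%:M + Cm s).
    by rewrite /Cm addrC subrK mulmxA mm' mul1mx.
  have e2 : (gchart X (beta (c s)))^T *m Xi s = (1%:M + (B s)^T) *m (eta + x s).
    have -> : 1%:M + (B s)^T = (gchart X (beta (c s)))^T *m G.
      by rewrite /B linearB/= trmx1 addrC subrK trmx_mul trmxK.
    by rewrite -mulmxDr addrC subrK !mulmxA -(mulmxA _ G) GG' mulmx1.
  have PT : P *m (m *m (T (y s) *m u)) = T' s *m Z t.
    rewrite ZtE /T'; have := Pg _ (mchart_conj (beta (c t)) (LT (y s)).2).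
    by move=> H; rewrite [RHS]mulmxA -H -!mulmxA (mulmxA m^T) mm mul1mx.
  have main : W s *m u + F^T *m ((L (y s))^T *m eta) + F^T *m (G^T *m Dn s) + F^T *m (eta *m A s) =
     T (y s) *m u + u *m A s.
    have -> : F^T *m (G^T *m Dn s) = 0 by rewrite mulmxA -trmx_mul DnN.
    rewrite addr0 etaE (hh.1 _ (LT (y s)).1) mulNmx mulmxN /W mulmxDl /nu.
    rewrite -(mulmxA F u) (mulmxA F^T F) FF mul1mx !mulmxA.
    by rewrite [X in X - _]addrC addrK.
  have e3 : Z s = P *m (m *m ((1%:M + Cm s) *m (F^T *m ((1%:M + (B s)^T) *m (eta + x s))))).
    by rewrite /Z e1 e2 -!mulmxA.
  have lin V1 V2 V3 V4 : V1 = u + V3 + V4 + V2 ->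
      P *m (m *m V1) - P *m (m *m u) = P *m (m *m V3) + P *m (m *m V4) + P *m (m *m V2) :> 'M[R]_(k, j).
    move=> ->; rewrite !(mulmxDr m) !(mulmxDr P).
    move: (P *m (m *m u)) (P *m (m *m V2)) (P *m (m *m V3)) (P *m (m *m V4)) => *.
    by apply/matrixP => ? ?; rewrite !mxE; ring.
  have ZA : Z t *m A s = P *m (m *m (u *m A s)) by rewrite ZtE !mulmxA.
  rewrite e3 -PT ZA ZtE /E; apply: lin; rewrite -[u + _ + _]addrA.
  rewrite -main; have -> : F^T *m (G^T *m (Xi s - Xi t - Dn s - Xi t *m A s)) =
     F^T *m x s - F^T *m (G^T *m Dn s) - F^T *m (eta *m A s).
    rewrite (mulmxBr G^T _ (Xi t *m A s)) (mulmxBr G^T _ (Dn s)).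
    by rewrite (mulmxBr F^T _ (G^T *m (Xi t *m A s))) (mulmxBr F^T _ (G^T *m Dn s)) /x /eta (mulmxA G^T (Xi t)).
  have -> : (B s - L (y s))^T *m eta = (B s)^T *m eta - (L (y s))^T *m eta by rewrite linearB/= mulmxBl.
  move: (x s) (Cm s) (B s)^T (L (y s))^T (W s) => xs C1 Bt Lt W1; rewrite /u.
  rewrite (mulmxBl C1) (mulmxBr F^T (Bt *m eta)) ![(1%:M + _) *m _]mulmxDl !mul1mx !mulmxDr.
  move: (F^T *m eta) (F^T *m xs) (F^T *m (Bt *m eta)) (F^T *m (Bt *m xs)) (F^T *m (eta *m A s)).
  move: (F^T *m (G^T *m Dn s)) (F^T *m (Lt *m eta)) => a1 a2 a3 a4 a5 a6 a7.
  move: (C1 *m a3) (C1 *m a4) (C1 *m a5) (C1 *m a6) (W1 *m a3) => *.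
  by apply/matrixP => ? ?; rewrite !mxE; ring.
have trZ s : \tr ((Z s)^T *m Z s) - \tr ((Z t)^T *m Z t) =
   \tr ((Z t)^T *m E s + ((Z t)^T *m E s)^T + (Z s - Z t)^T *m (Z s - Z t)).
  have T'T : (T' s)^T = - T' s.
    by rewrite /T' !trmx_mul trmxK (gg.1 _ (LT (y s)).2) mulNmx mulmxN mulmxA.
  have t1 : \tr ((Z t)^T *m (T' s *m Z t)) = 0.
    apply/eqP; rewrite -[_ == 0](@mulrn_eq0 _ _ 2) mulr2n -{1}mxtrace_tr (trmx_mul (Z t)^T) trmxK (trmx_mul (T' s)) T'T.
    by rewrite mulmxN mulNmx linearN/= mulmxA addNr.
  have t2 : \tr ((Z t)^T *m (Z t *m A s)) = 0.
    apply/eqP; rewrite -[_ == 0](@mulrn_eq0 _ _ 2) mulr2n -{1}mxtrace_tr (trmx_mul (Z t)^T) trmxK (trmx_mul (Z t)) AT.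
    by rewrite -mulmxA mulNmx linearN/= mxtrace_mulC -mulmxA addNr.
  have t0 : \tr ((Z t)^T *m (Z s - Z t)) = \tr ((Z t)^T *m E s).
    by rewrite dZ !mulmxDr !linearD/= t1 t2 !add0r.
  have key (U V : 'M[R]_(k, j)) : \tr ((U + V)^T *m (U + V)) - \tr (U^T *m U) =
      \tr (U^T *m V) + \tr (U^T *m V) + \tr (V^T *m V).
    have VU : \tr (V^T *m U) = \tr (U^T *m V) by rewrite -mxtrace_tr trmx_mul trmxK.
    have -> : (U + V)^T = U^T + V^T by rewrite linearD.
    by rewrite mulmxDl !mulmxDr !mxtraceD VU; ring.
  rewrite 2!mxtraceD mxtrace_tr -t0 -key; congr (\tr (_^T *m _) - _); by rewrite addrC subrK.
have VO : big_O D t (fun s => Z s - Z t).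
  have TO : big_O D t (fun s => T' s *m Z t).
    apply: big_O_mulr; apply: big_O_mulr; apply: big_O_mull.
    by apply: (big_O_dom (K := C)) yO => s _; have [] := LC (y s).
  have := big_OD (big_OD TO (big_O_mull (Z t) AO)) (small_oW Eo).
  by apply: (big_O_dom (K := 1)) => s _; rewrite mul1r dZ.
have H : small_o D t (fun s => \tr ((Z s)^T *m Z s) - \tr ((Z t)^T *m Z t) : R^o).
  have o1 : small_o D t (fun s => (Z t)^T *m E s) by exact: small_o_mull.
  have := tro _ (small_oD (small_oD o1 (small_o_tr o1)) (big_O_mul (big_O_tr VO) VO)).
  by apply: (small_o_dom (K := 1)) => s _; rewrite mul1r trZ.
by move=> e e0; have [r r0 Hr] := H _ e0; exists r.
Qed.

End chart_increments.

Lemma heine2 (R : realType) N (f : R * R -> 'cV[R]_N) :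
  {within `[0, 1] `*` `[0, 1], continuous f} ->
  forall e : R, 0 < e -> exists2 d : R, 0 < d & forall s t s' t' : R,
    0 <= s <= 1 -> 0 <= t <= 1 -> 0 <= s' <= 1 -> 0 <= t' <= 1 ->
    `|s - s'| < d -> `|t - t'| < d -> `|f (s, t) - f (s', t')| < e.
Proof.
move=> fc e e0; pose K : set (R * R) := `[0, 1] `*` `[0, 1].
have Kc : compact K by apply: compact_setX; exact: segment_compact.
pose P (d : R) (x : R * R) := K x -> forall y, K y -> `|y - x| < d -> `|f y - f x| < e.
have := (compact_near_coveringP K).1 Kc R (nbhs (0 : R)) P _.
move=> /(_ _)[x Kx|d /= d0 Hd]; last first.
  exists (d / 2) => [|s t s' t' s01 t01 s'01 t'01 ss tt]; first exact: divr_gt0.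
  have K1 (u v : R) : 0 <= u <= 1 -> 0 <= v <= 1 -> K (u, v) by split; rewrite /= in_itv.
  apply: (Hd (d / 2)); [|exact: K1|exact: K1|exact: K1|by rewrite prod_normE /= gt_max ss].
  by rewrite /ball_ /= sub0r normrN gtr0_norm; lra.
have e2 : 0 < e / 2 by rewrite divr_gt0.
have /subspace_continuousP/(_ x Kx)/cvgrPdist_lt/(_ _ e2) := fc.
rewrite near_withinE => /nbhs_ballP[r /= r0 Hr].
have r2 : 0 < r / 2 by rewrite divr_gt0.
exists (ball x (r / 2), ball (0 : R) (r / 2)); first by split; exact: nbhsx_ballx.
move=> [y d] /= [xy dr] Ky z Kz zy; move: xy dr; rewrite -!ball_normE /= sub0r normrN => xy dr.
have zr : `|x - z| < r.
  rewrite -[x](subrK y) -addrA (le_lt_trans (ler_normD _ _))//.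
  have := le_lt_trans (ler_norm d) dr; move: xy zy; rewrite [`|y - z|]distrC => *; lra.
have yr : `|x - y| < r by lra.
have h1 := Hr z; have h2 := Hr y; rewrite -!ball_normE /= in h1 h2.
have := h1 zr Kz; have := h2 yr Ky; rewrite -[f z - f y](subrKA (f x)) => a1 a2.
by rewrite (le_lt_trans (ler_normD _ _))// [`|f z - f x|]distrC; lra.
Qed.

Lemma partition_chain (R : realType) (Rel : R -> R -> Prop) (s : seq R) (x y : R) :
  itv_partition x y s ->
  (forall a b c, a <= b -> b <= c -> Rel a b -> Rel b c -> Rel a c) -> (forall a, Rel a a) ->
  (forall i a b, (i < size s)%N -> nth 0 (x :: s) i <= a -> a <= b -> b <= nth 0 s i -> Rel a b) ->
  forall a b, x <= a -> a <= b -> b <= y -> Rel a b.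
Proof.
move=> + tr rf; elim: s x => [|z s IH] x.
  move=> /itv_partition_nil xy _ a b xa ab byy; rewrite (_ : a = b)//; apply/eqP.
  by rewrite eq_le ab (le_trans byy)// -xy.
move=> H Hp a b xa ab byy; have zs := itv_partition_cons H.
have H2 : forall a b, z <= a -> a <= b -> b <= y -> Rel a b.
  by apply: IH zs _ => i; exact: (Hp i.+1).
have H1 : forall a b, x <= a -> a <= b -> b <= z -> Rel a b by move=> a' b'; exact: (Hp 0%N).
have [bz|zb] := leP b z; first exact: H1.
have [za|az] := leP z a; first exact: H2.
by apply: (tr a z b); [exact: ltW|exact: ltW|apply: H1 => //; exact: ltW|apply: H2 => //; exact: ltW].
Qed.

(** Restricting to a subinterval lets the partitions of a curve and of a field be used one inside
    the other, without a common refinement. *)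
Lemma partition_chain_in (R : realType) (Rel : R -> R -> Prop) (s : seq R) (x y a0 b0 : R) :
  itv_partition x y s ->
  (forall a b c, a <= b -> b <= c -> Rel a b -> Rel b c -> Rel a c) -> (forall a, Rel a a) ->
  x <= a0 -> a0 <= b0 -> b0 <= y ->
  (forall i a b, (i < size s)%N -> nth 0 (x :: s) i <= a -> a <= b -> b <= nth 0 s i ->
     a0 <= a -> b <= b0 -> Rel a b) ->
  Rel a0 b0.
Proof.
move=> sP tr rf xa ab byy H; suff : a0 <= a0 -> b0 <= b0 -> Rel a0 b0 by apply.
apply: (partition_chain (Rel := fun a b => a0 <= a -> b <= b0 -> Rel a b) sP) => //.
  move=> a b c ab' bc Rab Rbc a0a cb0; apply: (tr a b c) => //.
    by apply: Rab => //; exact: le_trans cb0.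
  by apply: Rbc => //; exact: le_trans ab'.
Qed.

Lemma mx_ext (R : realType) m n (A B : 'M[R]_(m, n)) : (forall y : 'cV_n, A *m y = B *m y) -> A = B.
Proof.
move=> H; apply/matrixP => i j; have := H (delta_mx j 0); rewrite -!colE.
by move=> /matrixP/(_ i 0); rewrite !mxE.
Qed.

Lemma trmul_eq0 (R : realType) m n (A : 'M[R]_(m, n)) : \tr (A^T *m A) = 0 -> A = 0.
Proof.
move=> H; apply/matrixP => i j; rewrite mxE.
have {}H : \sum_j \sum_i A i j ^+ 2 = 0.
  rewrite -{}[RHS]H; apply: eq_bigr => k _; rewrite mxE; apply: eq_bigr => l _.
  by rewrite mxE expr2.
have H1 : \sum_i A i j ^+ 2 = 0.
  by apply: (psumr_eq0P _ H) => // l _; apply: sumr_ge0 => q _; exact: sqr_ge0.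
have : A i j ^+ 2 = 0 by apply: (psumr_eq0P _ H1) => // l _; exact: sqr_ge0.
by move=> /eqP; rewrite sqrf_eq0 => /eqP.
Qed.

(** * Invariant subspaces are preserved by the restricted holonomy *)

Section monodromy.
Variables (R : realType) (N : nat) (h : {vspace 'M[R]_N}) (p : 'cV[R]_N) (M : set 'cV[R]_N).
Hypothesis hh : lie_so h.
Hypothesis MP : forall x, M x <-> exists2 w, word_in h w & x = gword w *m p.
Variables (k : nat) (F : 'M[R]_(N, k)) (g0 : {vspace 'M[R]_k}).
Hypothesis FF : F^T *m F = 1%:M.
Hypothesis FV : forall x, sphere_normal M p x <-> F *m (F^T *m x) = x.
Hypothesis gg : lie_so g0.
Hypothesis gc : forall X Y, X \in h -> Y \in h -> ncurv F X Y \in g0.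
Hypothesis ga : forall X T, X \in h -> T \in g0 -> nu F X *m T - T *m nu F X \in g0.

Definition mword (w : seq (R * 'M[R]_N)) := gword [seq (a.1, nu F a.2) | a <- w].

Hypothesis gj : forall w T, word_in h w -> T \in g0 -> mword w *m T *m (mword w)^T \in g0.

(** The parallel transport of [F] along the word [w]. *)
Definition frame w := gword w *m F *m (mword w)^T.

Lemma mword_orth w : word_in h w -> (mword w)^T *m mword w = 1%:M.
Proof. by move=> wh; exact: (@gword_nu_orth _ _ h hh _ F). Qed.

Lemma frame_orth w : word_in h w -> (frame w)^T *m frame w = 1%:M.
Proof.
move=> wh; have [gw _] := normalizes_gword hh wh; have mw := mword_orth wh.
rewrite /frame !trmx_mul trmxK -!mulmxA (mulmxA _^T (gword w)) gw mul1mx.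
by rewrite (mulmxA F^T) FF mul1mx mulmx1C.
Qed.

Lemma frame_proj w : word_in h w -> frame w *m (frame w)^T = gword w *m (F *m F^T) *m (gword w)^T.
Proof.
move=> wh; have mw := mword_orth wh.
by rewrite /frame !trmx_mul trmxK !mulmxA -(mulmxA _ (mword w)^T) mw mulmx1.
Qed.

Lemma frameP w x : word_in h w ->
  sphere_normal M (gword w *m p) x <-> frame w *m ((frame w)^T *m x) = x.
Proof.
move=> wh; have [gw _] := normalizes_gword hh wh; have gw' := mulmx1C gw.
rewrite mulmxA frame_proj// -!mulmxA -{1}[x]mul1mx -{1}gw' -mulmxA.
rewrite (sphere_normal_word hh MP _ wh (orbit_base MP)) FV.
by split=> [->|{2}<-]; rewrite !mulmxA ?gw' ?gw !mul1mx.
Qed.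

Lemma frame_change v w : word_in h v -> word_in h w -> gword v *m p = gword w *m p ->
  frame v *m ((frame v)^T *m frame w) = frame w.
Proof.
move=> vh wh vw; apply: mx_ext => y; rewrite -(mulmxA (frame v)) -(mulmxA _^T (frame w)); apply/(frameP _ vh).
by rewrite vw; apply/(frameP _ wh); rewrite (mulmxA _^T) frame_orth// mul1mx.
Qed.

Variables (d : nat) (X : 'I_d -> 'M[R]_N) (rho K : R) (beta : 'cV[R]_N -> 'cV[R]_d).
Hypothesis Xh : forall i, X i \in h.
Hypotheses (rho0 : 0 < rho) (K0 : 0 <= K) (beta0 : beta p = 0).
Hypothesis betaL : forall x y, `|x - p| < rho -> `|y - p| < rho -> `|beta x - beta y| <= K * `|x - y|.
Hypothesis plaque : forall (c : R -> 'cV[R]_N) (a b : R), a <= b ->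
  (forall t, a <= t <= b -> (exists2 w, word_in h w & c t = gword w *m p) /\ `|c t - p| < rho) ->
  (forall t, a <= t <= b -> forall e : R, 0 < e -> exists2 r : R, 0 < r &
     forall s, a <= s <= b -> `|s - t| < r -> `|c s - c t| < e) ->
  c a = p -> c b = gchart X (beta (c b)) *m p.

Definition bword (b : 'cV[R]_d) := [seq (b i 0, X i) | i <- enum 'I_d].

Lemma bword_in b : word_in h (bword b).
Proof. by move=> a /mapP[i _ ->]; exact: Xh. Qed.

Lemma gword_bword b : gword (bword b) = gchart X b.
Proof. by rewrite /gword /bword big_map. Qed.

Lemma mword_bword b : mword (bword b) = mchart F X b.
Proof. by rewrite /mword /mchart /gchart /gword /bword !big_map. Qed.

Lemma mword_cat w1 w2 : mword (w1 ++ w2) = mword w1 *m mword w2.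
Proof. by rewrite /mword map_cat gword_cat. Qed.

(** Prolongs a word through the chart at its end point, in order to end at the nearby point [x]. *)
Definition next w x := w ++ bword (beta ((gword w)^T *m x)).

Lemma next_in w x : word_in h w -> word_in h (next w x).
Proof. by move=> wh a; rewrite mem_cat => /orP[/wh|/bword_in]. Qed.

(** Closeness alone would not do: [x] must lie on the plaque of the end point of [w]. *)
Definition near_word w x := `|(gword w)^T *m x - p| < rho /\ gword (next w x) *m p = x.

Lemma next_base w : word_in h w -> near_word w (gword w *m p) /\ frame (next w (gword w *m p)) = frame w.
Proof.
move=> wh; have [gw _] := normalizes_gword hh wh.
have E : beta ((gword w)^T *m (gword w *m p)) = 0 by rewrite mulmxA gw mul1mx.
have b0 : gchart X 0 = 1%:M by exact: gchart0.
have m0 : mchart F X 0 = 1%:M by exact: gchart0.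
split; last by rewrite /frame /next E gword_cat mword_cat gword_bword mword_bword b0 m0 !mulmx1.
split; first by rewrite mulmxA gw mul1mx subrr normr0.
by rewrite /next E gword_cat gword_bword b0 mulmx1.
Qed.

Variables (e : nat) (B : 'M[R]_(k, e)).
Hypothesis BB : B^T *m B = 1%:M.
Hypothesis Bg : forall T, T \in g0 -> T *m B = B *m (B^T *m T *m B).

Let P := 1%:M - B *m B^T.

Let PB : P *m B = 0.
Proof. by rewrite /P mulmxBl mul1mx -mulmxA BB mulmx1 subrr. Qed.

Let P0 j (Y : 'M[R]_(k, j)) : P *m Y = 0 -> Y = B *m (B^T *m Y).
Proof. by rewrite /P mulmxBl mul1mx -mulmxA => /eqP; rewrite subr_eq0 => /eqP. Qed.

(** The columns of [B] span a subspace stable under [g0]; as [g0] is skew, the complement onto which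
    [P] projects is stable too. *)
Let Pg T : T \in g0 -> P *m T = T *m P.
Proof.
move=> Tg; have H := Bg Tg; have TT := gg.1 _ Tg.
have {}TT : B^T *m T = B^T *m T *m B *m B^T.
  have := congr1 trmx H; rewrite (trmx_mul T) (trmx_mul B) (trmx_mul (B^T *m T)) (trmx_mul B^T) trmxK TT.
  by rewrite mulNmx !mulmxN mulNmx => /eqP; rewrite eqr_opp => /eqP; rewrite !mulmxA.
rewrite /P mulmxBl mulmxBr mul1mx mulmx1 [T *m (B *m _)]mulmxA H; congr (_ - _).
by rewrite -!mulmxA; congr (_ *m _); rewrite !mulmxA.
Qed.

(** [chart_parallel] at the end of [v] instead of [p]: the isometry [gword v] brings the picture
    back, and by [gj] the conjugate of [P] by [mword v] still commutes with [g0]. The conserved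
    trace vanishes at one end, hence at the other. *)
Lemma chart_transport v (c : R -> 'cV[R]_N) j (Xi : R -> 'M[R]_(N, j)) (a b : R) : word_in h v -> a <= b ->
  (forall t, a <= t <= b -> near_word v (c t)) ->
  (forall t, a <= t <= b -> big_O (fun s => a <= s <= b) t (fun s => c s - c t)) ->
  (forall t, a <= t <= b -> frame (next v (c t)) *m ((frame (next v (c t)))^T *m Xi t) = Xi t) ->
  (forall t, a <= t <= b -> exists (A : R -> 'M[R]_j) (D : R -> 'M[R]_(N, j)),
    [/\ forall s, (A s)^T = - A s, forall s, (frame (next v (c t)))^T *m D s = 0,
        big_O (fun s => a <= s <= b) t A, big_O (fun s => a <= s <= b) t D &
        small_o (fun s => a <= s <= b) t (fun s => Xi s - Xi t - D s - Xi t *m A s)]) ->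
  P *m ((frame (next v (c a)))^T *m Xi a) = 0 -> P *m ((frame (next v (c b)))^T *m Xi b) = 0.
Proof.
move=> vh ab cn cO XiN XiD Ya.
have [gv _] := normalizes_gword hh vh; have gv' := mulmx1C gv.
have mv := mword_orth vh; have mv' := mulmx1C mv.
pose c' t := (gword v)^T *m c t; pose Xi' t := (gword v)^T *m Xi t.
pose P' := (mword v)^T *m P *m mword v.
have frE t : (frame (next v (c t)))^T = mword v *m (mchart F X (beta (c' t)) *m (F^T *m ((gchart X (beta (c' t)))^T *m (gword v)^T))).
  rewrite /frame /next gword_cat mword_cat gword_bword mword_bword -/(c' t).
  by rewrite !trmx_mul !trmxK !mulmxA.
have [v' v'h v'E] : exists2 v', word_in h v' & mword v' = (mword v)^T.
  exact: (@nuword_inv _ _ h hh _ F).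
have P'g T : T \in g0 -> P' *m T = T *m P'.
  move=> Tg; have := gj vh Tg => /Pg H.
  have -> : P' *m T = (mword v)^T *m (P *m (mword v *m T *m (mword v)^T)) *m mword v.
    by rewrite /P' !mulmxA -[RHS]mulmxA mv mulmx1.
  by rewrite H /P' !mulmxA mv mul1mx.
have ZE t : P' *m (mchart F X (beta (c' t)) *m (F^T *m ((gchart X (beta (c' t)))^T *m Xi' t))) =
   (mword v)^T *m (P *m ((frame (next v (c t)))^T *m Xi t)).
  by rewrite frE /P' /Xi' !mulmxA.
have H1 t : a <= t <= b -> `|c' t - p| < rho by move=> tab; have [] := cn _ tab.
have H2 t : a <= t <= b -> big_O (fun s => a <= s <= b) t (fun s => c' s - c' t).
  move=> tab; have := big_O_mull (gword v)^T (cO _ tab).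
  by apply: (big_O_dom (K := 1)) => s _; rewrite mul1r /c' mulmxBr.
have H3 t : a <= t <= b -> let G := gchart X (beta (c' t)) in G *m F *m (F^T *m G^T *m Xi' t) = Xi' t.
  move=> tab; have := XiN _ tab; rewrite mulmxA frame_proj; last exact: next_in.
  rewrite /next gword_cat gword_bword -/(c' t) => XE /=.
  rewrite /Xi' -{2}XE trmx_mul; move: (gchart X _) => G.
  by rewrite !mulmxA gv mul1mx.
have H4 t : a <= t <= b -> exists (A : R -> 'M[R]_j) (D : R -> 'M[R]_(N, j)),
    [/\ forall s, (A s)^T = - A s, forall s, (gchart X (beta (c' t)) *m F)^T *m D s = 0,
        big_O (fun s => a <= s <= b) t A, big_O (fun s => a <= s <= b) t D &
        small_o (fun s => a <= s <= b) t (fun s => Xi' s - Xi' t - D s - Xi' t *m A s)].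
  move=> tab; have [A [D [AT DN AO DO XE]]] := XiD _ tab; exists A, (fun s => (gword v)^T *m D s); split=> //.
  + move=> s; have := DN s; rewrite frE trmx_mul -!(mulmxA (mword v)) => H.
    have {}H : mchart F X (beta (c' t)) *m (F^T *m ((gchart X (beta (c' t)))^T *m (gword v)^T)) *m D s = 0.
      by rewrite -[LHS]mul1mx -mv -mulmxA H mulmx0.
    have Hm := mchart_orth F hh Xh (beta (c' t)).
    move: (gchart X (beta (c' t))) (mchart F X (beta (c' t))) Hm H => G m mm H.
    have : m^T *m (m *m (F^T *m (G^T *m (gword v)^T)) *m D s) = 0 by rewrite H mulmx0.
    by rewrite !mulmxA mm mul1mx.
  + exact: big_O_mull.
  + have := small_o_mull (gword v)^T XE; apply: (small_o_dom (K := 1)) => s _.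
    by rewrite mul1r /Xi' !mulmxBr mulmxA.
have := @chart_parallel R N h k F g0 hh FF gg gc ga d X Xh rho K beta p betaL c' j Xi' P' a b ab P'g H1 H2 H3 H4.
cbv beta zeta; rewrite !ZE Ya !mulmx0 mxtrace0 => /esym/trmul_eq0 H.
by rewrite -[LHS]mul1mx -mv' -mulmxA H mulmx0.
Qed.

Lemma trmul0_dotp j (A : 'M[R]_(N, j)) z : (forall y, dotp (A *m y) z = 0) -> A^T *m z = 0.
Proof.
by move=> H; apply/eqP; rewrite -dotp_eq0 -dotp_mulmxl; apply/eqP; exact: H.
Qed.

(** On each piece [chart_transport] applies with one column and no rotation: the derivative of a
    parallel field, having no component in the normal space, provides the term [D]. *)
Lemma field_transport v (c xi : R -> 'cV[R]_N) (a b : R) : word_in h v ->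
  piecewise_smooth c -> parallel_normal M c xi -> 0 <= a -> a <= b -> b <= 1 ->
  (forall t, a <= t <= b -> near_word v (c t)) ->
  P *m ((frame (next v (c a)))^T *m xi a) = 0 -> P *m ((frame (next v (c b)))^T *m xi b) = 0.
Proof.
move=> vh [sc scP cS] [xiN [sx sxP xS]] a0 ab b1 Hn.
pose Rel a b := 
  P *m ((frame (next v (c a)))^T *m xi a) = 0 -> P *m ((frame (next v (c b)))^T *m xi b) = 0.
have Rt x y z : x <= y -> y <= z -> Rel x y -> Rel y z -> Rel x z by move=> _ _ H1 H2 /H1/H2.
have Rr x : Rel x x by [].
suff : Rel a b by [].
apply: (partition_chain_in scP Rt Rr a0 ab b1) => i x y isz ix xy yi ax yb.
have [x0 y1] : 0 <= x /\ y <= 1 by split; [exact: le_trans ax|exact: le_trans b1].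
apply: (partition_chain_in sxP Rt Rr x0 xy y1) => l x' y' lsz lx xy' yl xx' yy'.
have [g gs gE] := cS _ isz; have [zeta zs zE] := xS _ lsz.
have cg t : x' <= t <= y' -> c t = g t.
  by move=> /andP[t1 t2]; apply: gE; rewrite in_itv/= (le_trans ix) ?(le_trans xx')// (le_trans t2)// (le_trans yy').
have {}zE t : x' <= t <= y' -> xi t = zeta t /\ forall eta, sphere_normal M (c t) eta -> dotp eta (derive1 zeta t) = 0.
  by move=> /andP[t1 t2]; apply: zE; rewrite in_itv/= (le_trans lx)// (le_trans t2).
have nt t : x' <= t <= y' -> near_word v (c t).
  by move=> /andP[t1 t2]; apply: Hn; rewrite (le_trans ax) ?(le_trans xx')//= (le_trans t2)// (le_trans yy').
have der (f : R -> 'cV[R]_N) (t : R) : smooth_curve f -> is_derive t 1 f (derive1 f t).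
  by move=> fs; split; [exact: (fs 0%N)|rewrite derive1E].
have nrm t eta : x' <= t <= y' -> sphere_normal M (c t) eta <->
    frame (next v (c t)) *m ((frame (next v (c t)))^T *m eta) = eta.
  by move=> tab; rewrite -{1}(nt _ tab).2; apply: frameP; exact: next_in.
apply: (chart_transport vh xy' nt) => t tab.
- apply: (big_O_dom (K := 1)) (small_o_incr (derive_small_o (fun s => x' <= s <= y') (der g t gs))) => s Ds.
  by rewrite mul1r !cg.
- apply/nrm => //; apply: xiN; case/andP: tab => t1 t2.
  by rewrite in_itv/= (le_trans x0) ?(le_trans xx')//= (le_trans t2)// (le_trans yy').
exists (fun _ => 0), (fun s => (s - t) *: derive1 zeta t); split.
- by move=> s; rewrite trmx0 oppr0.
- move=> s; rewrite -scalemxAr trmul0_dotp ?scaler0// => y0; have [_ H] := zE _ tab; apply: H.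
  have nh : word_in h (next v (c t)) by exact: next_in.
  by apply/nrm => //; rewrite (mulmxA _^T) (frame_orth nh) mul1mx.
- by exists 0 => //; exists 1 => // s _ _; rewrite normr0 mul0r.
- exact: big_O_linear.
apply: (small_o_dom (K := 1)) (derive_small_o (fun s => x' <= s <= y') (der zeta t zs)) => s Ds.
by rewrite mul1r mulmx0 subr0 !(zE _ _).1.
Qed.

Lemma gchart_lipschitz : exists2 C : R, 0 <= C & forall b b', `|gchart X b - gchart X b'| <= C * `|b - b'|.
Proof.
rewrite /gchart; elim: (enum _) => [|i s [C C0 IH]].
  by exists 0 => // b b'; rewrite !big_nil subrr normr0 mul0r.
exists (N%:R * C + N%:R * (N%:R * (N%:R * (N%:R * `|X i|)))); first by rewrite addr_ge0 ?mulr_ge0.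
move=> b b'; rewrite !big_cons; have XT := hh.1 _ (Xh i).
set Q := \prod_(j <- s) _; set Q' := \prod_(j <- s) _.
set E := expmx _; set E' := expmx _.
have QQ : Q'^T *m Q' = 1%:M.
  have [] : normalizes h Q'; last by [].
  by rewrite /Q'; elim: (s) => [|l s' IHs]; rewrite ?big_nil ?big_cons; [exact: normalizes1|apply: normalizesM IHs; exact: normalizes_expmx].
have -> : E * Q - E' * Q' = E *m (Q - Q') + (E - E') *m Q' by rewrite mulmxBr mulmxBl addrA subrK.
apply: le_trans (ler_normD _ _) _; rewrite mulrDl; apply: lerD.
  apply: le_trans (norm_orth_mul _ (orth_expmx _ XT)) _.
  by rewrite -mulrA; apply: ler_wpM2l => //; exact: IH.
apply: le_trans (norm_mulmx _ _) _; rewrite -!mulrA; apply: ler_wpM2l => //.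
apply: (@le_trans _ _ `|E - E'|); first by rewrite -[leRHS]mulr1; apply: ler_wpM2l => //; exact: norm_orth.
have sk (r : R) : (r *: X i)^T = - (r *: X i) by rewrite linearZ/= XT scalerN.
apply: le_trans (expmx_lipschitz (sk _) (sk _)) _; rewrite -scalerBl normrZ.
apply: ler_wpM2l => //; apply: ler_wpM2l => //; apply: ler_wpM2l => //.
rewrite mulrC; apply: (@le_trans _ _ (`|X i| * `|b - b'|)).
  by apply: ler_wpM2l => //; have := norm_entry (b - b') i 0; rewrite !mxE.
by [].
Qed.

(** Says that [B] spans the same subspace in both transported frames. *)
Definition subframe u v := exists C : 'M[R]_e, frame u *m B = frame v *m B *m C.

Lemma subframe_refl u : subframe u u.
Proof. by exists 1%:M; rewrite mulmx1. Qed.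

Lemma subframe_trans u v w : subframe u v -> subframe v w -> subframe u w.
Proof. by move=> [C CE] [D DE]; exists (D *m C); rewrite CE DE mulmxA. Qed.

Lemma subframe_sym u v : word_in h u -> word_in h v -> subframe u v -> subframe v u.
Proof.
move=> uh vh [C CE].
have iso w : word_in h w -> (frame w *m B)^T *m (frame w *m B) = 1%:M.
  by move=> wh; rewrite trmx_mul -mulmxA (mulmxA _^T (frame w)) frame_orth// mul1mx.
have CC : C^T *m C = 1%:M.
  have := iso u uh; rewrite CE; have := iso v vh; move: (frame v *m B) => A AA.
  by rewrite trmx_mul -mulmxA (mulmxA A^T) AA mul1mx.
by exists C^T; rewrite CE -mulmxA (mulmx1C CC) mulmx1.
Qed.

Lemma word_gap w (x : 'cV[R]_N) : word_in h w -> `|(gword w)^T *m x| <= N%:R * `|x|.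
Proof.
move=> wh; have [gw _] := normalizes_gword hh wh.
by apply: norm_orth_mul; rewrite trmxK (mulmx1C gw).
Qed.

Lemma orbit_back w x : word_in h w -> M x -> exists2 w', word_in h w' & (gword w)^T *m x = gword w' *m p.
Proof.
move=> wh /MP[v vh ->]; have [w' wh' wE] := gword_inv hh wh.
exists (w' ++ v); last by rewrite gword_cat wE mulmxA.
by move=> a; rewrite mem_cat => /orP[/wh'|/vh].
Qed.

Lemma near_curve v (c : R -> 'cV[R]_N) (b : R) : word_in h v -> 0 <= b ->
  (forall t, 0 <= t <= b -> M (c t) /\ `|(gword v)^T *m c t - p| < rho) ->
  (forall t, 0 <= t <= b -> forall e : R, 0 < e -> exists2 r : R, 0 < r &
     forall s, 0 <= s <= b -> `|s - t| < r -> `|c s - c t| < e) ->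
  c 0 = gword v *m p -> near_word v (c b).
Proof.
move=> vh b0 cM cc c0; have [gv _] := normalizes_gword hh vh.
split; first by apply: (cM b _).2; rewrite b0 lexx.
rewrite /next gword_cat gword_bword -mulmxA.
rewrite -(plaque (c := fun t => (gword v)^T *m c t) b0); first by rewrite mulmxA (mulmx1C gv) mul1mx.
- by move=> t tb; have [Mt tr] := cM _ tb; split=> //; exact: orbit_back.
- move=> t tb e1 e10; have N1 : 0 < N.+1%:R :> R by rewrite ltr0Sn.
  have [r r0 Hr] := cc _ tb _ (divr_gt0 e10 N1); exists r => // s sb st.
  rewrite -mulmxBr; apply: le_lt_trans (word_gap _ vh) _.
  have := Hr _ sb st; rewrite ltr_pdivlMr// mulrC; apply: le_lt_trans.
  by apply: ler_wpM2r => //; rewrite ler_nat.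
by rewrite c0 mulmxA gv mul1mx.
Qed.

(** The points between [gword v *m p] and [z] are joined by a segment in the coordinates of the
    chart at [u]. Along it the subspace spanned by [B] in the frames of [u] is parallel up to
    rotations of its columns, so [chart_transport] in the chart at [v] propagates the equality of
    the two subspaces. *)
Lemma cocycle : exists2 del : R, 0 < del & forall u v z, word_in h u -> word_in h v ->
  near_word u (gword v *m p) -> near_word u z -> `|z - gword v *m p| < del ->
  subframe (next u (gword v *m p)) v -> near_word v z /\ subframe (next u z) (next v z).
Proof.
have [CG CG0 GL] := gchart_lipschitz.
pose C1 := N%:R * (N%:R * CG * `|p|).
have C10 : 0 <= C1 by rewrite !mulr_ge0.
pose C2 := C1 * (K * N%:R); have C20 : 0 <= C2 by rewrite !mulr_ge0.
have D1 : 0 < N%:R * C2 + 1 by rewrite ltr_wpDl// mulr_ge0.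
exists (rho / (N%:R * C2 + 1)) => [|u v z uh vh]; first exact: divr_gt0.
set y := gword v *m p => uy uz zy [C0 C0E].
pose b_y := beta ((gword u)^T *m y); pose bz := beta ((gword u)^T *m z).
have bzy : `|bz - b_y| <= K * (N%:R * `|z - y|).
  apply: le_trans (betaL uz.1 uy.1) _; apply: ler_wpM2l => //.
  by rewrite -mulmxBr; exact: word_gap.
pose br (r : R) := b_y + r *: (bz - b_y).
pose U r := u ++ bword (br r).
have Uh r : word_in h (U r) by move=> a; rewrite mem_cat => /orP[/uh|/bword_in].
pose c r := gword (U r) *m p.
have [gu _] := normalizes_gword hh uh.
have cL r s : `|c s - c r| <= C1 * (`|s - r| * `|bz - b_y|).
  rewrite /c /U !gword_cat !gword_bword -mulmxBl -mulmxBr -mulmxA.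
  apply: le_trans (norm_orth_mul _ gu) _; rewrite /C1 -[leRHS]mulrA; apply: ler_wpM2l => //.
  apply: le_trans (norm_mulmx _ _) _; rewrite -[leRHS]mulrA [`|p| * _]mulrC [leRHS]mulrA.
  apply: ler_wpM2r => //; rewrite -mulrA; apply: ler_wpM2l => //.
  apply: le_trans (GL _ _) _; apply: ler_wpM2l => //.
  by rewrite /br opprD addrACA subrr add0r -scalerBl normrZ.
have c0 : c 0 = y.
  by rewrite /c /U /br scale0r addr0; exact: uy.2.
have c1 : c 1 = z.
  by rewrite /c /U /br scale1r addrC subrK; exact: uz.2.
have cM r : M (c r) by exact: (orbit_word MP (Uh r) (orbit_base MP)).
have cc r (e1 : R) : 0 < e1 -> exists2 q : R, 0 < q & forall s, `|s - r| < q -> `|c s - c r| < e1.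
  move=> e10; have D2 : 0 < C1 * `|bz - b_y| + 1 by rewrite ltr_wpDl// mulr_ge0.
  exists (e1 / (C1 * `|bz - b_y| + 1)) => [|s]; first exact: divr_gt0.
  rewrite ltr_pdivlMr// => H; apply: le_lt_trans (cL _ _) _; apply: le_lt_trans H.
  by rewrite mulrCA; apply: ler_wpM2l => //; rewrite lerDl.
have nc r : 0 <= r <= 1 -> near_word v (c r).
  move=> /andP[r0 r1]; apply: near_curve => // [t /andP[t0 tr]|t _ e1 e10].
    split=> //; have [gv _] := normalizes_gword hh vh.
    have -> : p = (gword v)^T *m c 0 by rewrite c0 mulmxA gv mul1mx.
    rewrite -mulmxBr; apply: le_lt_trans (word_gap _ vh) _.
    move: zy; rewrite ltr_pdivlMr// mulrC mulrDl mul1r => zy.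
    apply: le_lt_trans zy; rewrite -mulrA -[leLHS]addr0; apply: lerD => //; apply: ler_wpM2l => //.
    have -> : C2 * `|z - y| = C1 * (K * (N%:R * `|z - y|)) by rewrite /C2 !mulrA.
    apply: le_trans (cL _ _) _; apply: ler_wpM2l => //.
    rewrite subr0 ger0_norm// -[leRHS]mul1r; apply: ler_pM => //; exact: le_trans r1.
  by have [q q0 Hq] := cc t e1 e10; exists q => // s _; exact: Hq.
have zn : near_word v z by rewrite -c1; apply: nc; rewrite ler01 lexx.
split=> //.
pose Xi r := frame (U r) *m B.
have X0 : Xi 0 = frame (next u y) *m B by rewrite /Xi /U /br scale0r addr0.
have X1 : Xi 1 = frame (next u z) *m B by rewrite /Xi /U /br scale1r addrC subrK.
have fc r : 0 <= r <= 1 -> frame (next v (c r)) *m ((frame (next v (c r)))^T *m frame (U r)) = frame (U r).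
  by move=> r01; apply: frame_change; [exact: next_in|exact: Uh|exact: (nc _ r01).2].
have XN r : 0 <= r <= 1 -> frame (next v (c r)) *m ((frame (next v (c r)))^T *m Xi r) = Xi r.
  by move=> r01; rewrite /Xi [_^T *m (_ *m B)]mulmxA mulmxA fc.
have z01 : 0 <= (0 : R) <= 1 by rewrite lexx ler01.
have o01 : 0 <= (1 : R) <= 1 by rewrite lexx ler01.
suff XiD : P *m ((frame (next v (c 1)))^T *m Xi 1) = 0.
  exists (B^T *m ((frame (next v z))^T *m (frame (next u z) *m B))).
  have := XN _ o01; rewrite {1}(P0 XiD) c1 X1 => XE; rewrite -[LHS]XE -mulmxA; congr (_ *m _).
apply: (chart_transport vh ler01 nc _ XN) => [r r01|r r01|]; last first.
- rewrite X0 C0E c0; have [_ ->] := next_base vh.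
  by rewrite -[frame v *m B *m C0]mulmxA (mulmxA _^T) frame_orth// mul1mx mulmxA PB mul0mx.
- have [L [T [C [LT C0' LC LE]]]] := chart_increment hh gg gc ga Xh (br r).
  pose D (s : R) := 0 <= s <= 1.
  pose y' s := br s - br r.
  have yE s : y' s = (s - r) *: (bz - b_y) by rewrite /y' /br opprD addrACA subrr add0r scalerBl.
  have yO : big_O D r y'.
    by apply: (big_O_dom (K := 1)) (big_O_linear D r (bz - b_y)) => s _; rewrite mul1r yE.
  have byE s : br r + y' s = br s by rewrite /y' addrC subrK.
  pose G := gchart X (br r); pose m := mchart F X (br r).
  have [GG _] : normalizes h G by exact: gchart_normalizes.
  have mm : m^T *m m = 1%:M by exact: (mchart_orth F hh Xh).
  pose Bs s := G^T *m gchart X (br s) - 1%:M; pose Cs s := m^T *m mchart F X (br s) - 1%:M.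
  have B1 : small_o D r (fun s => Bs s - L (y' s)).
    have H : forall e : R, 0 < e -> exists2 q : R, 0 < q & forall x : 'cV[R]_d, `|x| < q ->
      `|G^T *m gchart X (br r + x) - 1%:M - L x| <= e * `|x|.
      by move=> e1 e10; have [q q0 Hq] := LE _ e10; exists q => // x /Hq[].
    by have := small_o_comp H yO; apply: (small_o_dom (K := 1)) => s _; rewrite mul1r byE.
  have C1' : small_o D r (fun s => Cs s - (nu F (L (y' s)) + T (y' s))).
    have H : forall e : R, 0 < e -> exists2 q : R, 0 < q & forall x : 'cV[R]_d, `|x| < q ->
      `|m^T *m mchart F X (br r + x) - 1%:M - (nu F (L x) + T x)| <= e * `|x|.
      by move=> e1 e10; have [q q0 Hq] := LE _ e10; exists q => // x /Hq[].
    by have := small_o_comp H yO; apply: (small_o_dom (K := 1)) => s _; rewrite mul1r byE.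
  have LO : big_O D r (fun s => L (y' s)) by apply: (big_O_dom (K := C)) yO => s _; have [] := LC (y' s).
  have TO : big_O D r (fun s => T (y' s)) by apply: (big_O_dom (K := C)) yO => s _; have [] := LC (y' s).
  have BO : big_O D r Bs.
    by have := big_OD (small_oW B1) LO; apply: (big_O_dom (K := 1)) => s _; rewrite mul1r subrK.
  have CO : big_O D r (fun s => (Cs s)^T).
    apply: big_O_tr; have WO : big_O D r (fun s => nu F (L (y' s)) + T (y' s)).
      by apply: (big_O_dom (K := C)) yO => s _; have [] := LC (y' s).
    by have := big_OD (small_oW C1') WO; apply: (big_O_dom (K := 1)) => s _; rewrite mul1r subrK.
  pose mu := mword u; have mmu := mword_orth uh.
  pose Q := m^T *m (mu^T *m B).
  pose T2 s := mu *m (m *m T (y' s) *m m^T) *m mu^T.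
  have T2g s : T2 s \in g0 by apply: gj => //; have := gj (@bword_in (br r)) (LT (y' s)).2; rewrite mword_bword.
  have UE s : frame (U s) = gword u *m (gchart X (br s) *m (F *m ((mchart F X (br s))^T *m mu^T))).
    by rewrite /frame /U gword_cat mword_cat gword_bword mword_bword trmx_mul !mulmxA.
  pose Dm s := gword u *m (G *m ((L (y' s) *m F - F *m nu F (L (y' s))) *m Q)).
  have AE s : Xi r *m - (B^T *m T2 s *m B) = - (gword u *m (G *m (F *m (T (y' s) *m Q)))).
    have H : B *m (B^T *m T2 s *m B) = T2 s *m B by rewrite -Bg.
    have HQ : m^T *m (mu^T *m (T2 s *m B)) = T (y' s) *m Q.
      rewrite /T2 /Q; move: (T (y' s)) => t0.
      by rewrite -!mulmxA (mulmxA mu^T mu) mmu mul1mx (mulmxA m^T m) mm mul1mx.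
    rewrite mulmxN /Xi -(mulmxA (frame (U r))) H UE -/G -/m -HQ; congr (- _).
    by move: (T2 s *m B) => z0; rewrite !mulmxA.
  (* As [g0] preserves the span of [B], the failure [T2] of the frame to be parallel amounts to a
     rotation of the columns; [Dm] has no normal component. *)
  exists (fun s => - (B^T *m T2 s *m B)), Dm; split.
  + move=> s; have := gg.1 _ (T2g s); move: (T2 s) => t2 t2T.
    by rewrite linearN/= (trmx_mul (B^T *m t2)) (trmx_mul B^T) trmxK t2T mulNmx mulmxN mulmxA.
  + move=> s; have E : (frame (next v (c r)))^T = (frame (next v (c r)))^T *m frame (U r) *m (frame (U r))^T.
      have H : frame (U r) *m ((frame (U r))^T *m frame (next v (c r))) = frame (next v (c r)).
        by apply: frame_change; [exact: Uh|exact: next_in|exact/esym/(nc _ r01).2].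
      by rewrite -{1}H (trmx_mul (frame (U r))) (trmx_mul (frame (U r))^T) trmxK.
    rewrite E -mulmxA; have -> : (frame (U r))^T *m Dm s = 0; last by rewrite mulmx0.
    rewrite UE -/G -/m /Dm !trmx_mul !trmxK -!mulmxA (mulmxA _^T (gword u)) gu mul1mx.
    rewrite (mulmxA G^T G) GG mul1mx (mulmxA F^T); have -> : F^T *m (L (y' s) *m F - F *m nu F (L (y' s))) = 0.
      by rewrite mulmxBr [F^T *m (F *m _)]mulmxA FF mul1mx mulmxA subrr.
    by rewrite mul0mx !mulmx0.
  + apply: big_ON; apply: big_O_mulr; apply: big_O_mull; apply: big_O_mulr; apply: big_O_mull.
    by apply: big_O_mulr; exact: big_O_mull.
  + do 2!apply: big_O_mull; apply: big_O_mulr; apply: big_OD; first exact: big_O_mulr.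
    by apply: big_ON; apply: big_O_mull; apply: big_O_mulr; exact: big_O_mull.
  pose E s := gword u *m (G *m ((Bs s - L (y' s)) *m (F *m Q) + F *m ((Cs s - (nu F (L (y' s)) + T (y' s)))^T *m Q)
     + Bs s *m (F *m (Cs s)^T) *m Q)).
  have Eo : small_o D r E.
    do 2!apply: small_o_mull; apply: small_oD; first apply: small_oD.
    - exact: small_o_mulr.
    - by apply: small_o_mull; apply: small_o_mulr; exact: small_o_tr.
    by apply: small_o_mulr; apply: big_O_mul => //; exact: big_O_mull.
  apply: (small_o_dom (K := 1)) Eo => s Ds; rewrite mul1r le_eqVlt; apply/orP; left; apply/eqP; congr (`|_|).
  rewrite AE /Xi !UE -/G -/m.
  have -> : gchart X (br s) = G *m (1%:M + Bs s) by rewrite /Bs addrC subrK mulmxA (mulmx1C GG) mul1mx.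
  have -> : (mchart F X (br s))^T = (1%:M + (Cs s)^T) *m m^T.
    have -> : 1%:M + (Cs s)^T = (mchart F X (br s))^T *m m.
      by rewrite /Cs linearB/= trmx1 addrC subrK trmx_mul trmxK.
    by rewrite -mulmxA (mulmx1C mm) mulmx1.
  have TT : (T (y' s))^T = - T (y' s) by exact: (gg.1 _ (LT _).2).
  have NT : (nu F (L (y' s)))^T = - nu F (L (y' s)) by exact: (nu_skew hh F (LT _).1).
  have TE : (Cs s - (nu F (L (y' s)) + T (y' s)))^T = (Cs s)^T + nu F (L (y' s)) + T (y' s).
    have trB (A1 A2 : 'M[R]_k) : (A1 - A2)^T = A1^T - A2^T by exact: linearB.
    have trD (A1 A2 : 'M[R]_k) : (A1 + A2)^T = A1^T + A2^T by exact: linearD.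
    by rewrite (trB (Cs s)) (trD (nu F (L (y' s)))) TT NT opprD !opprK addrA.
  have lin V1 V2 V3 V4 V5 : V1 = V2 + V3 - V4 + V5 ->
     gword u *m (G *m V1) - gword u *m (G *m V2) - gword u *m (G *m V3) - - (gword u *m (G *m V4)) =
     gword u *m (G *m V5).
    move=> ->; rewrite !mulmxDr !mulmxN.
    move: (gword u *m (G *m V2)) (gword u *m (G *m V3)) (gword u *m (G *m V4)) (gword u *m (G *m V5)) => *.
    by apply/matrixP => ? ?; rewrite !mxE; ring.
  rewrite /E TE /Dm.
  move: (Bs s) (Cs s)^T (L (y' s)) (nu F (L (y' s))) (T (y' s)) => b1 c1' l1 n1 t1.
  have -> : gword u *m (G *m (1%:M + b1) *m (F *m ((1%:M + c1') *m m^T *m mu^T))) *m B =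
    gword u *m (G *m ((1%:M + b1) *m (F *m ((1%:M + c1') *m Q)))) by rewrite /Q !mulmxA.
  have -> : gword u *m (G *m (F *m (m^T *m mu^T))) *m B = gword u *m (G *m (F *m Q)) by rewrite /Q !mulmxA.
  apply: lin; move: (Q) => q.
  rewrite ![(1%:M + _) *m _]mulmxDl !mul1mx !mulmxDl !mulmxDr !mulNmx -!mulmxA.
  move: (F *m q) (b1 *m (F *m q)) (F *m (c1' *m q)) (b1 *m (F *m (c1' *m q))) => a1 a2 a3 a4.
  move: (F *m (n1 *m q)) (F *m (t1 *m q)) (l1 *m a1) => *.
  by apply/matrixP => ? ?; rewrite !mxE; ring.
have D3 : forall s : R, (0 <= s <= 1) -> `|c s - c r| <= C1 * `|bz - b_y| * `|(s - r) *: (1 : R^o)|.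
  by move=> s _; apply: le_trans (cL _ _) _; rewrite normrZ normr1 mulr1 le_eqVlt; apply/orP; left; apply/eqP; ring.
exact: big_O_dom D3 (big_O_linear _ _ _).
Qed.

(** The null homotopy is cut into a grid whose cells each fit in one chart. Along the first row the
    words follow the loop and carry the field; [cocycle] compares consecutive rows cell by cell; the
    last row is the constant loop, whose frame is [F]. *)
Lemma holonomy_preserves tau y : restricted_holonomy M p tau -> P *m y = 0 ->
  P *m (F^T *m tau (F *m y)) = 0.
Proof.
move=> [c [cs cM c0 c1 [H [Hc HM H01 Hp]]] ctau] Py.
have [xi [xiP xi0 xi1]] := ctau _ (frame_normal FF FV y).
have [del del0 coc] := cocycle.
have N1 : 0 < N.+1%:R :> R by rewrite ltr0Sn.
have eps0 : 0 < Num.min del (rho / N.+1%:R) by rewrite lt_min del0 divr_gt0.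
have [dl dl0 UC0] := heine2 Hc eps0.
have UC s t s' t' : 0 <= s <= 1 -> 0 <= t <= 1 -> 0 <= s' <= 1 -> 0 <= t' <= 1 ->
    `|s - s'| < dl -> `|t - t'| < dl -> `|H (s, t) - H (s', t')| < del /\
      N.+1%:R * `|H (s, t) - H (s', t')| < rho.
  move=> s0 t0 s0' t0' ss tt; have := UC0 _ _ _ _ s0 t0 s0' t0' ss tt.
  by rewrite lt_min ltr_pdivlMr// [_ * N.+1%:R]mulrC => /andP.
pose n := Num.bound dl^-1.
have ndl : dl^-1 < n%:R by apply: archi_boundP; rewrite invr_ge0 ltW.
have n0 : 0 < n%:R :> R by apply: lt_trans ndl; rewrite invr_gt0.
pose pt (i : nat) : R := i%:R / n%:R.
have pt01 i : (i <= n)%N -> 0 <= pt i <= 1.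
  by move=> ilen; rewrite divr_ge0 //= ler_pdivrMr// mul1r ler_nat.
have pt0 : pt 0%N = 0 by rewrite /pt mul0r.
have ptn : pt n = 1 by rewrite /pt divff// lt0r_neq0.
have ptS i t : pt i <= t <= pt i.+1 -> `|pt i - t| < dl.
  move=> /andP[t1 t2]; rewrite distrC ger0_norm ?subr_ge0//.
  apply: (@le_lt_trans _ _ (pt i.+1 - pt i)); first by rewrite lerD2r.
  by rewrite /pt -mulrBl -natrB// subSnn mul1r -[dl]invrK ltf_pV2// posrE invr_gt0.
have ptm i : pt i <= pt i.+1 by rewrite /pt ler_pM2r ?invr_gt0// ler_nat.
have ptd i : `|pt i - pt i.+1| < dl by apply: ptS; rewrite ptm lexx.
have cvx (a b r : R) : 0 <= a <= 1 -> 0 <= b <= 1 -> 0 <= r <= 1 -> 0 <= a + r * (b - a) <= 1.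
  move=> /andP[a0 a1] /andP[b0 b1] /andP[r0 r1].
  have h1 : 0 <= (1 - r) * a by rewrite mulr_ge0//; lra.
  have h2 : 0 <= r * b by rewrite mulr_ge0.
  have h3 : 0 <= (1 - r) * (1 - a) by rewrite mulr_ge0//; lra.
  have h4 : 0 <= r * (1 - b) by rewrite mulr_ge0//; lra.
  by lra.
have d1 (a b : R) : 0 <= a <= 1 -> 0 <= b <= 1 -> `|b - a| <= 1.
  by move=> *; rewrite ler_norml; lra.
(* The segment between two points of a cell is mapped by the homotopy to a continuous curve in [M],
   which stays in one plaque. *)
have cell w s t s' t' : 0 <= s <= 1 -> 0 <= t <= 1 -> 0 <= s' <= 1 -> 0 <= t' <= 1 ->
    `|s - s'| < dl -> `|t - t'| < dl -> word_in h w -> gword w *m p = H (s, t) -> near_word w (H (s', t')).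
  move=> s0 t0 s0' t0' ss tt wh wE.
  pose ga' r := H (s + r * (s' - s), t + r * (t' - t)).
  have <- : ga' 1 = H (s', t') by rewrite /ga' !mul1r ![_ + (_ - _)]addrC !subrK.
  have ga0 : ga' 0 = gword w *m p by rewrite /ga' !mul0r !addr0 wE.
  have sm (a b r e1 : R) : 0 <= r <= 1 -> `|a - b| < e1 -> `|a - (a + r * (b - a))| < e1.
    move=> /andP[r0 r1] ab; rewrite opprD addrA subrr add0r normrN normrM ger0_norm// distrC.
    by apply: le_lt_trans ab; rewrite -[leRHS]mul1r; apply: ler_wpM2r.
  apply: (near_curve wh ler01) ga0 => [r r01|r r01 e1 e10].
    split; first by apply: HM; rewrite in_itv /=; exact: cvx.
    have [gw _] := normalizes_gword hh wh.
    have -> : p = (gword w)^T *m H (s, t) by rewrite -wE mulmxA gw mul1mx.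
    rewrite -mulmxBr; apply: le_lt_trans (word_gap _ wh) _.
    apply: le_lt_trans (UC s t _ _ s0 t0 (cvx _ _ _ s0 s0' r01) (cvx _ _ _ t0 t0' r01) (sm _ _ _ _ r01 ss) (sm _ _ _ _ r01 tt)).2.
    by rewrite distrC; apply: ler_wpM2r => //; rewrite ler_nat.
  have [d2 d20 Hd] := heine2 Hc e10; exists d2 => // r' r'01 rr.
  have dd (a b : R) : 0 <= a <= 1 -> 0 <= b <= 1 -> `|a + r' * (b - a) - (a + r * (b - a))| < d2.
    move=> a0 b0; rewrite opprD addrACA subrr add0r -mulrBl normrM; apply: le_lt_trans rr.
    by rewrite -[leRHS]mulr1; apply: ler_wpM2l => //; exact: d1.
  by apply: Hd; [exact: cvx|exact: cvx|exact: cvx|exact: cvx|exact: dd|exact: dd].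
(* [wd i j] follows row [i] from the edge on which the homotopy is at [p] up to column [j]. *)
pose wd (i : nat) := fix f (j : nat) : seq (R * 'M[R]_N) :=
  if j is j'.+1 then next (f j') (H (pt i, pt j'.+1)) else [::].
have H0 i : (i <= n)%N -> H (pt i, 0) = p /\ H (pt i, 1) = p.
  by move=> ilen; apply: Hp; rewrite in_itv /=; exact: pt01.
have dl00 (x : R) : `|x - x| < dl by rewrite subrr normr0.
have wdP i j : (i <= n)%N -> (j <= n)%N -> word_in h (wd i j) /\ gword (wd i j) *m p = H (pt i, pt j).
  move=> ilen; elim: j => [|j IH] jn; first by split=> //; rewrite gword_nil mul1mx pt0 (H0 i ilen).1.
  have [wh wE] := IH (ltnW jn); split; first exact: next_in.
  have := cell _ _ _ (pt i) (pt j.+1) (pt01 _ ilen) (pt01 _ (ltnW jn)) (pt01 _ ilen) (pt01 _ jn) (dl00 _) (ptd j) wh wE.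
  by case.
have nbase w q : word_in h w -> gword w *m p = q -> frame (next w q) = frame w.
  by move=> wh <-; exact: (next_base wh).2.
have rows i : (i < n)%N -> forall j, (j <= n)%N -> subframe (next (wd i j) (H (pt i.+1, pt j))) (wd i.+1 j).
  move=> iln; have ilen := ltnW iln; elim=> [|j IH] jn.
    rewrite /subframe /= pt0 (H0 _ iln).1 nbase ?gword_nil ?mul1mx//.
    exact: subframe_refl.
  have jn' := ltnW jn; have [u_h u_E] := wdP _ _ ilen jn'; have [v_h v_E] := wdP _ _ iln jn'.
  have [w_h w_E] := wdP _ _ ilen jn; have [x_h x_E] := wdP _ _ iln jn.
  have cl i' j' := cell _ _ _ (pt i') (pt j') (pt01 _ ilen) (pt01 _ jn').
  have nuz : near_word (wd i j) (H (pt i.+1, pt j.+1)).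
    by apply: (cl _ _ _ (pt01 _ iln) (pt01 _ jn) (ptd i) (ptd j) u_h u_E).
  have ucl (a b a' b' : nat) : (a <= n)%N -> (b <= n)%N -> (a' <= n)%N -> (b' <= n)%N ->
      `|pt a - pt a'| < dl -> `|pt b - pt b'| < dl -> `|H (pt a, pt b) - H (pt a', pt b')| < del.
    by move=> an bn a'n b'n h1 h2; exact: (UC _ _ _ _ (pt01 _ an) (pt01 _ bn) (pt01 _ a'n) (pt01 _ b'n) h1 h2).1.
  (* Each way around the cell is compared with the direct passage to the opposite corner. *)
  have [_ sA] : near_word (wd i.+1 j) (H (pt i.+1, pt j.+1)) /\
      subframe (next (wd i j) (H (pt i.+1, pt j.+1))) (next (wd i.+1 j) (H (pt i.+1, pt j.+1))).
    apply: coc => //; rewrite ?v_E.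
    - by apply: (cl _ _ _ (pt01 _ iln) (pt01 _ jn') (ptd i) (dl00 _) u_h u_E).
    - by apply: ucl => //; rewrite distrC.
    - exact: IH.
  have [_ sB] : near_word (wd i j.+1) (H (pt i.+1, pt j.+1)) /\
      subframe (next (wd i j) (H (pt i.+1, pt j.+1))) (next (wd i j.+1) (H (pt i.+1, pt j.+1))).
    apply: coc => //; rewrite ?w_E.
    - by apply: (cl _ _ _ (pt01 _ ilen) (pt01 _ jn) (dl00 _) (ptd j) u_h u_E).
    - by apply: ucl => //; rewrite distrC.
    - exact: subframe_refl.
  by apply: subframe_trans sA; apply: subframe_sym sB; exact: next_in.
have last i : (i <= n)%N -> subframe (wd 0%N n) (wd i n).
  elim: i => [|i IH] iln; first exact: subframe_refl.
  apply: subframe_trans (IH (ltnW iln)) _; have [wh wE] := wdP _ _ (ltnW iln) (leqnn n).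
  have := rows _ iln _ (leqnn n); rewrite ptn (H0 _ iln).2 /subframe nbase//.
  by rewrite wE ptn (H0 _ (ltnW iln)).2.
have frame0 : frame [::] = F by rewrite /frame /mword !gword_nil trmx1 mulmx1 mul1mx.
have top j : (j <= n)%N -> frame (wd n j) = F.
  elim: j => [|j IH] jn; first exact: frame0.
  have [wh wE] := wdP _ _ (leqnn n) (ltnW jn).
  have Hn t : 0 <= t <= 1 -> H (1, t) = p by move=> t01; have [] := H01 t; rewrite ?in_itv.
  have -> : wd n j.+1 = next (wd n j) (H (pt n, pt j.+1)) by [].
  rewrite nbase; [exact: IH (ltnW jn)|exact: wh|].
  by rewrite wE ptn (Hn _ (pt01 _ (ltnW jn))) (Hn _ (pt01 _ jn)).
have low j : (j <= n)%N -> P *m ((frame (wd 0%N j))^T *m xi (pt j)) = 0.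
  elim: j => [|j IH] jn; first by rewrite frame0 pt0 xi0 (mulmxA F^T) FF mul1mx.
  have [wh wE] := wdP _ _ (leq0n n) (ltnW jn); rewrite pt0 in wE.
  have cE t : 0 <= t <= 1 -> c t = H (0, t).
    move=> t01; have tI : t \in `[0, 1] by rewrite in_itv.
    by have [-> _] := H01 _ tI.
  have /andP[j0 j1] := pt01 _ (ltnW jn); have /andP[j0' j1'] := pt01 _ jn.
  have := @field_transport (wd 0%N j) c xi (pt j) (pt j.+1) wh cs xiP j0 (ptm j) j1'.
  rewrite (cE _ (pt01 _ (ltnW jn))) nbase// (cE _ (pt01 _ jn)) /= pt0; apply; last exact: IH (ltnW jn).
  move=> t tj; have t01 : 0 <= t <= 1 by case/andP: tj => t1 t2; rewrite (le_trans j0)//= (le_trans t2).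
  rewrite cE//; apply: (cell _ _ _ _ _ _ (pt01 _ (ltnW jn)) _ t01 _ (ptS _ _ tj) wh wE) => //.
    by rewrite lexx ler01.
  by rewrite lexx ler01.
have [wh wE] := wdP _ _ (leq0n n) (leqnn n).
have XE : frame (wd 0%N n) *m ((frame (wd 0%N n))^T *m xi 1) = xi 1.
  apply/frameP => //; rewrite wE pt0 ptn; have := xiP.1 1; rewrite c1.
  have o01 : (1 : R) \in `[0, 1] by rewrite in_itv /= ler01 lexx.
  by have [-> _] := H01 1 o01; rewrite c1; exact.
have := low _ (leqnn n); rewrite ptn => /P0 XB.
have [C CE] := last _ (leqnn n); rewrite top// in CE.
rewrite -xi1 -XE XB (mulmxA (frame _)) CE -(mulmxA (F *m B)) -(mulmxA F) (mulmxA F^T F) FF mul1mx.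
by rewrite (mulmxA P) PB mul0mx.
Qed.

End monodromy.

(** * Orthonormal frames and their rotations *)

Section orthonormal_frames.
Variable R : realType.

Definition orthoframe n (u : 'I_n -> 'cV[R]_n) := forall i j, dotp (u i) (u j) = (i == j)%:R.

Definition frame_rot n (u : 'I_n -> 'cV[R]_n) (i j : 'I_n) (c s : R) l :=
  if l == i then c *: u i + s *: u j else if l == j then c *: u j - s *: u i else u l.

Lemma orthoframe_rot n (u : 'I_n -> 'cV[R]_n) i j c s : orthoframe u -> i != j -> c ^+ 2 + s ^+ 2 = 1 ->
  orthoframe (frame_rot u i j c s).
Proof.
move=> uu ij cs a b; have ji : j != i by rewrite eq_sym.
have H := (uu, eqxx, negbTE ij, negbTE ji).
have E : c * c + s * s = 1 by rewrite -cs; ring.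
rewrite /frame_rot; have [?|ai] := eqVneq a i; [subst a|have [?|aj] := eqVneq a j; [subst a|]];
  (have [?|bi] := eqVneq b i; [subst b|have [?|bj] := eqVneq b j; [subst b|]]);
  rewrite ?(dotpDl, dotpDr, dotpNl, dotpNr, dotpZl, dotpZr) ?H /= ?mulr1n ?mulr0n.
- by rewrite -[RHS]E; ring.
- by ring.
- by rewrite [i == b]eq_sym [j == b]eq_sym (negbTE bi) (negbTE bj) !mulr0n; ring.
- by ring.
- by rewrite -[RHS]E; ring.
- by rewrite [i == b]eq_sym [j == b]eq_sym (negbTE bi) (negbTE bj) !mulr0n; ring.
- by rewrite ?(negbTE ai) ?(negbTE aj) !mulr0n; ring.
- by rewrite ?(negbTE ai) ?(negbTE aj) !mulr0n; ring.
- by [].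
Qed.

Lemma frame_roti n (u : 'I_n -> 'cV[R]_n) i j c s : frame_rot u i j c s i = c *: u i + s *: u j.
Proof. by rewrite /frame_rot eqxx. Qed.

Lemma frame_rotj n (u : 'I_n -> 'cV[R]_n) i j c s : i != j -> frame_rot u i j c s j = c *: u j - s *: u i.
Proof. by move=> ij; rewrite /frame_rot eqxx eq_sym (negbTE ij). Qed.

Lemma frame_rotl n (u : 'I_n -> 'cV[R]_n) i j c s l : l != i -> l != j -> frame_rot u i j c s l = u l.
Proof. by move=> li lj; rewrite /frame_rot (negbTE li) (negbTE lj). Qed.

Lemma orthoframe_expand n (u : 'I_n -> 'cV[R]_n) : orthoframe u -> forall v, v = \sum_l dotp (u l) v *: u l.
Proof.
move=> uu v; pose P : 'M[R]_n := \matrix_(a, l) u l a 0.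
have PP : P^T *m P = 1%:M.
  by apply/matrixP => i j; rewrite !mxE -uu dotpE; apply: eq_bigr => l _; rewrite !mxE.
rewrite -{1}[v]mul1mx -(mulmx1C PP) -mulmxA mulmx_sum_col; apply: eq_bigr => l _; congr (_ *: _).
  by rewrite mxE dotpE; apply: eq_bigr => a _; rewrite !mxE.
by apply/matrixP => a b; rewrite !mxE ord1.
Qed.

Lemma orthoframe_ext n (u : 'I_n -> 'cV[R]_n) v w : orthoframe u -> (forall l, dotp (u l) v = dotp (u l) w) -> v = w.
Proof.
move=> uu H; rewrite (orthoframe_expand uu v) (orthoframe_expand uu w).
by apply: eq_bigr => l _; rewrite H.
Qed.

Lemma orthoframe_std n : orthoframe (fun i : 'I_n => delta_mx i 0 : 'cV[R]_n).
Proof.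
move=> i j; rewrite dotpE (bigD1 i)//= big1 => [|l li]; rewrite !mxE ?eqxx ?andbT ?mul1r ?addr0//.
by rewrite (negbTE li) mul0r.
Qed.

Lemma frame_mx_ext n (u : 'I_n -> 'cV[R]_n) (X Y : 'M[R]_n) : orthoframe u ->
  (forall l, X *m u l = Y *m u l) -> X = Y.
Proof.
move=> uu H; apply: mx_ext => v; rewrite (orthoframe_expand uu v) !mulmx_sumr.
by apply: eq_bigr => l _; rewrite -!scalemxAr H.
Qed.

Lemma dyad_mul n (u v w : 'cV[R]_n) : u *m v^T *m w = dotp v w *: u.
Proof. by rewrite -mulmxA (mx11_scalar (v^T *m w)) mul_mx_scalar. Qed.

Lemma tr_dyad n (u v : 'cV[R]_n) (X : 'M[R]_n) : \tr (u *m v^T *m X) = dotp v (X *m u).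
Proof. by rewrite -mulmxA mxtrace_mulC /mxtrace big_ord1 -mulmxA. Qed.

End orthonormal_frames.

(** * Irreducible intransitive holonomy algebras *)

Section frame_forms.
Variables (R : realType) (n : nat).
Implicit Types (u : 'I_n -> 'cV[R]_n) (F : 'cV[R]_n -> 'cV[R]_n -> 'cV[R]_n -> 'cV[R]_n -> R).

Lemma vspace_of_pred (vT : vectType R) (P : vT -> Prop) :
  P 0 -> (forall a x y, P x -> P y -> P (a *: x + y)) ->
  exists U : {vspace vT}, forall x, x \in U <-> P x.
Proof.
move=> P0 PD; have [b [bP Pb]] := span_set P; exists <<b>>%VS => x; split; last exact: Pb.
by move: x; exact: span_ind.
Qed.

Lemma sim0_ind (P : 'M[R]_n -> Prop) (o : 'I_n) : P 0 -> (forall a x y, P x -> P y -> P (a *: x + y)) ->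
  (forall i j, i != j -> P (delta_mx i j + delta_mx j i)) -> (forall i, P (delta_mx i i - delta_mx o o)) ->
  forall X, Sim0 X -> P X.
Proof.
move=> P0 PD Pij Pii X [XT X0]; have [W WP] := vspace_of_pred P0 PD; apply/WP.
have -> : X = \sum_i \sum_j (X i j / 2) *: (delta_mx i j + delta_mx j i - (i == j)%:R *: (delta_mx o o *+ 2)).
  under eq_bigr do under eq_bigr do rewrite scalerBr scalerDr.
  under eq_bigr do rewrite big_split/= big_split/=.
  rewrite big_split/= big_split/= [X in _ + X + _]exchange_big/=.
  have dE (Y : 'I_n -> 'I_n -> R) : \sum_i \sum_j Y i j *: delta_mx i j = \matrix_(i, j) Y i j.
    by rewrite [RHS]matrix_sum_delta; apply: eq_bigr => i _; apply: eq_bigr => j _; rewrite mxE.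
  rewrite (dE (fun i j => X i j / 2)) (dE (fun j i => X i j / 2)).
  rewrite [X in _ + X](_ : _ = 0).
    rewrite addr0; apply/matrixP => a b; rewrite !mxE; have -> : X b a = X a b by rewrite -{1}XT mxE.
    by field.
  transitivity (- \tr X *: delta_mx o o); last by rewrite X0 oppr0 scale0r.
  rewrite /mxtrace -sumrN scaler_suml; apply: eq_bigr => i _.
  rewrite (bigD1 i)//= big1 ?addr0 => [|j ji]; last by rewrite eq_sym (negbTE ji) scale0r scaler0 oppr0.
  rewrite -scaleNr eqxx scale1r -scalerMnr scalerMnl; congr (_ *: _).
  by rewrite -mulr_natr; field.
apply: memv_suml => i _; apply: memv_suml => j _; apply: memvZ; apply/WP.
have [->|ij] := eqVneq i j; last by rewrite scale0r subr0; exact: Pij.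
by rewrite scale1r -mulr2n -mulrnBl -scaler_nat -[_ *: _]addr0; exact: PD.
Qed.

Section quadrilinear.
(** To be read as a bilinear form on symmetric matrices, evaluated on symmetrised dyads; forms
    symmetric and skew under exchange of the two pairs are treated separately. *)
Variable F : 'cV[R]_n -> 'cV[R]_n -> 'cV[R]_n -> 'cV[R]_n -> R.
Hypothesis FDl : forall a x x' y z w, F (a *: x + x') y z w = a * F x y z w + F x' y z w.
Hypothesis FDr : forall a x y z z' w, F x y (a *: z + z') w = a * F x y z w + F x y z' w.
Hypothesis FCl : forall x y z w, F x y z w = F y x z w.
Hypothesis FCr : forall x y z w, F x y z w = F x y w z.

Let FDl' a x y y' z w : F x (a *: y + y') z w = a * F x y z w + F x y' z w.
Proof. by rewrite FCl FDl ![F _ x _ _]FCl. Qed.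

Let FDr' a x y z w w' : F x y z (a *: w + w') = a * F x y z w + F x y z w'.
Proof. by rewrite FCr FDr ![F _ _ _ z]FCr. Qed.

Let F0l y z w : F 0 y z w = 0.
Proof. by have := FDl (-1) 0 0 y z w; rewrite scaler0 addr0 mulN1r addNr. Qed.

Let F0r x y w : F x y 0 w = 0.
Proof. by have := FDr (-1) x y 0 0 w; rewrite scaler0 addr0 mulN1r addNr. Qed.

Let FZl a x y z w : F (a *: x) y z w = a * F x y z w.
Proof. by rewrite -[a *: x]addr0 FDl F0l addr0. Qed.

Let FZl' a x y z w : F x (a *: y) z w = a * F x y z w. Proof. by rewrite FCl FZl FCl. Qed.

Let FZr a x y z w : F x y (a *: z) w = a * F x y z w.
Proof. by rewrite -[a *: z]addr0 FDr F0r addr0. Qed.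

Let FZr' a x y z w : F x y z (a *: w) = a * F x y z w. Proof. by rewrite FCr FZr FCr. Qed.

Let FE := (FDl, FDl', FDr, FDr', FZl, FZl', FZr, FZr').

Let roti u i j c s : frame_rot u i j c s i = c *: u i + s *: u j. Proof. exact: frame_roti. Qed.

Let rotj u i j c s : i != j -> frame_rot u i j c s j = c *: u j + (- s) *: u i.
Proof. by move=> ij; rewrite frame_rotj// scaleNr. Qed.

(** Rotations through this rational angle and its complement are enough for the polarisations below
    and keep them within rational arithmetic. *)
Let c1 : (3 / 5 : R) ^+ 2 + (4 / 5) ^+ 2 = 1. Proof. by field. Qed.
Let c2 : (4 / 5 : R) ^+ 2 + (3 / 5) ^+ 2 = 1. Proof. by field. Qed.

Section symmetric.
Hypothesis FC : forall x y z w, F x y z w = F z w x y.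
Hypothesis F0 : forall u i j l, orthoframe u -> i != j -> i != l -> j != l -> F (u i) (u j) (u i) (u l) = 0.

(** The relations [S1] to [S3] come from expanding [F0] in a rotated frame and removing the terms
    that [F0] kills in the original one. *)
Let S1 u i j l : orthoframe u -> i != j -> i != l -> j != l -> F (u i) (u j) (u i) (u j) = F (u i) (u l) (u i) (u l).
Proof.
move=> uu ij il jl; have := F0 (orthoframe_rot uu jl c1) ij il jl.
rewrite (frame_rotl _ _ _ ij il) roti rotj// !FE.
have := F0 uu ij il jl; have := F0 uu il ij; rewrite eq_sym jl => /(_ isT); lra.
Qed.

Let S2 u i j l : orthoframe u -> i != j -> i != l -> j != l -> F (u i) (u i) (u i) (u l) = F (u j) (u j) (u i) (u l).
Proof.
move=> uu ij il jl; have ji : j != i by rewrite eq_sym.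
have li : l != i by rewrite eq_sym. have lj : l != j by rewrite eq_sym.
have := F0 (orthoframe_rot uu ij c1) ij il jl; have := F0 (orthoframe_rot uu ij c2) ij il jl.
rewrite !(frame_rotl _ _ _ li lj) !roti !rotj// !FE.
have := F0 uu ij il jl; have := F0 uu ji jl il; rewrite (FCl (u j) (u i)) => h1 h2.
rewrite !(FCl (u j) (u i)) h1 h2; lra.
Qed.

Let S3a u i j l m : orthoframe u -> i != j -> i != l -> j != l -> i != m -> j != m -> l != m ->
  F (u i) (u j) (u m) (u l) + F (u m) (u j) (u i) (u l) = 0.
Proof.
move=> uu ij il jl im jm lm; have ji : j != i by rewrite eq_sym.
have li : l != i by rewrite eq_sym. have [mj ml] : m != j /\ m != l by split; rewrite eq_sym.
have := F0 (orthoframe_rot uu im c1) ij il jl.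
rewrite !(frame_rotl _ _ _ li lm) (frame_rotl _ _ _ ji jm) !roti !FE.
have := F0 uu ij il jl; have := F0 uu mj ml jl; lra.
Qed.

Let S3 u i j l m : orthoframe u -> i != j -> i != l -> j != l -> i != m -> j != m -> l != m ->
  F (u i) (u j) (u m) (u l) = 0.
Proof.
move=> uu ij il jl im jm lm; have ji : j != i by rewrite eq_sym.
have li : l != i by rewrite eq_sym. have [mj ml] : m != j /\ m != l by split; rewrite eq_sym.
have mi : m != i by rewrite eq_sym.
have := S3a uu ij il jl im jm lm; have := S3a uu ji jl il jm im lm; have := S3a uu jm jl ml ji mi li.
have := FCl (u i) (u j) (u m) (u l); have := FCl (u j) (u m) (u i) (u l); have := FCl (u i) (u m) (u j) (u l); lra.
Qed.

Lemma symmetric_form_offdiag (o o' : 'I_n) (hn : (2 < n)%N) u : orthoframe u -> o != o' -> F (u o) (u o') (u o) (u o') = 0 ->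
  forall i j, i != j -> F (u i) (u j) (u i) (u j) = 0.
Proof.
move=> uu oo' Fo; have S1' i j l : i != j -> i != l -> F (u i) (u j) (u i) (u j) = F (u i) (u l) (u i) (u l).
  by move=> ij il; have [->//|jl] := eqVneq j l; exact: S1.
have sw i j : F (u i) (u j) (u i) (u j) = F (u j) (u i) (u j) (u i) by rewrite FCl FCr.
have z l : o != l -> F (u o) (u l) (u o) (u l) = 0 by move=> ol; rewrite (S1' _ _ o').
move=> i j ij; have [oi|io] := eqVneq o i; first by rewrite -oi in ij *; exact: z.
by rewrite (S1' _ _ o)// 1?eq_sym// sw z.
Qed.

(** Taken together, the three identities say that the form vanishes on traceless symmetric matrices.
    The relations between diagonal entries pass through a third index, which exists as 2 < n. *)
Lemma symmetric_form_zero (o o' : 'I_n) (hn : (2 < n)%N) u : orthoframe u -> o != o' -> F (u o) (u o') (u o) (u o') = 0 ->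
  [/\ forall i j k l, i != j -> k != l -> F (u i) (u j) (u k) (u l) = 0,
      forall i j k l, k != l -> F (u i) (u i) (u k) (u l) = F (u j) (u j) (u k) (u l) &
      forall i j l, F (u i) (u i) (u i) (u i) - F (u i) (u i) (u l) (u l) - F (u j) (u j) (u i) (u i) + F (u j) (u j) (u l) (u l) = 0].
Proof.
move=> uu oo' Fo; have Fd := symmetric_form_offdiag hn uu oo' Fo.
have third i j : exists l : 'I_n, l != i /\ l != j.
  apply: contrapT => H; have : (#|'I_n| <= #|pred2 i j|)%N.
    by apply/subset_leq_card/fintype.subsetP => l _; rewrite !inE; apply/negPn/negP => /norP[li lj]; apply: H; exists l.
  by rewrite card_ord card2 leqNgt; case: (i != j); rewrite ?hn//= ltnW.
have Foff i j k l : i != j -> k != l -> F (u i) (u j) (u k) (u l) = 0.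
  move=> ij kl; have E (a b : 'I_n) : a != b -> b != a by rewrite eq_sym.
  have [e|ik] := eqVneq k i.
    rewrite e in kl *; have [->|lj] := eqVneq l j; first exact: Fd.
    by apply: F0 => //; exact: E.
  have [e|il] := eqVneq l i.
    rewrite e in kl *; rewrite FCr; have [->|kj] := eqVneq k j; first exact: Fd.
    by apply: F0 => //; exact: E.
  have [e|kj] := eqVneq k j.
    by rewrite e in kl *; rewrite FCl; apply: F0 => //; exact: E.
  have [e|lj] := eqVneq l j.
    by rewrite e in kl *; rewrite FCl FCr; apply: F0 => //; exact: E.
  by apply: S3 => //; exact: E.
have Fdo i j l m : l != m -> i != l -> i != m -> j != l -> j != m -> F (u i) (u i) (u l) (u m) = F (u j) (u j) (u l) (u m).
  by move=> lm il im jl jm; transitivity (F (u l) (u l) (u l) (u m)); [apply/esym|]; apply: S2; rewrite // eq_sym.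
have Fe i j l : l != i -> l != j -> i != j -> F (u i) (u i) (u i) (u j) = F (u l) (u l) (u i) (u j).
  by move=> li lj ij; apply: S2; rewrite // eq_sym.
have Fany i k l : k != l -> forall m, m != k -> m != l -> F (u i) (u i) (u k) (u l) = F (u m) (u m) (u k) (u l).
  move=> kl m mk ml; have [->|ik] := eqVneq i k; first exact: Fe.
  have [->|il] := eqVneq i l; last exact: Fdo.
  by rewrite FCr (Fe _ _ m) 1?FCr// eq_sym.
split=> // [i j k l kl|].
  by have [m [mk ml]] := third k l; rewrite (Fany i _ _ kl m)// (Fany j _ _ kl m).
have dd i j : F (u i) (u i) (u i) (u i) - 2 * F (u i) (u i) (u j) (u j) + F (u j) (u j) (u j) (u j) = 0.
  have [->|ij] := eqVneq i j; first lra.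
  have [l [li lj]] := third i j; have [il jl] : i != l /\ j != l by split; rewrite eq_sym.
  have ji : j != i by rewrite eq_sym.
  have := S1 (orthoframe_rot uu ij c1) ij il jl; rewrite !(frame_rotl _ _ _ li lj) !roti !rotj// !FE.
  rewrite !(FCl (u j) (u i)) !(FCr _ _ (u j) (u i)) !(FC (u i) (u j) (u i) (u i)) !(FC (u i) (u j) (u j) (u j)) (FC (u j) (u j) (u i) (u i)).
  have := Fany i i j ij l li lj; have := Fany j i j ij l li lj.
  have := Fd i j ij; have := Fd i l il; have := Fd j l jl; have := Foff i l j l il jl; have := Foff j l i l jl il.
  lra.
by move=> i j l; have := dd i j; have := dd i l; have := dd j l; rewrite (FC (u j) (u j) (u i) (u i)); lra.
Qed.

End symmetric.

Section skew.
Hypothesis FC : forall x y z w, F x y z w = - F z w x y.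
Hypothesis F0 : forall u i j l, orthoframe u -> i != j -> i != l -> j != l -> F (u i) (u i) (u j) (u l) = 0.

Lemma skew_form_zero (hn : (2 < n)%N) u : orthoframe u -> (forall z w, \sum_m F (u m) (u m) z w = 0) ->
  (forall i l, i != l -> F (u i) (u i) (u i) (u l) = 0) ->
  forall i j k l, F (u i) (u j) (u k) (u l) = 0.
Proof.
move=> uu Ftr Fii.
have Fd i k l : k != l -> F (u i) (u i) (u k) (u l) = 0.
  move=> kl; have [->|ik] := eqVneq i k; first exact: Fii.
  by have [->|il] := eqVneq i l; [rewrite FCr Fii// eq_sym|exact: F0].
have Fdd i j : F (u i) (u i) (u j) (u j) = 0.
  have Fe j' l' : i != j' -> i != l' -> F (u i) (u i) (u j') (u j') = F (u i) (u i) (u l') (u l').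
    move=> ij il; have [->//|jl] := eqVneq j' l'.
    have := F0 (orthoframe_rot uu jl c1) ij il jl; rewrite !(frame_rotl _ _ _ ij il) !roti !rotj// !FE.
    have := Fd i j' l' jl; have := Fd i l' j'; rewrite eq_sym jl => /(_ isT); lra.
  have F1 : F (u i) (u i) (u i) (u i) = 0 by have := FC (u i) (u i) (u i) (u i); lra.
  have [->//|nij] := eqVneq i j; first by have := FC (u j) (u j) (u j) (u j); lra.
  have := Ftr (u i) (u i); rewrite (bigD1 i)//= F1 add0r.
  rewrite (eq_bigr (fun=> - F (u i) (u i) (u j) (u j))) => [|m mi]; last first.
    by rewrite FC (Fe m j) // eq_sym.
  rewrite sumr_const => /eqP; rewrite mulrn_eq0 => /orP[|]; last by rewrite oppr_eq0 => /eqP.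
  by move=> /pred0P/(_ j); rewrite /= eq_sym nij.
have S1 m j l : m != j -> m != l -> j != l -> F (u m) (u j) (u m) (u l) = 0 /\ F (u m) (u j) (u j) (u l) = 0.
  move=> mj ml jl; have [lm lj] : l != m /\ l != j by split; rewrite eq_sym.
  have := F0 (orthoframe_rot uu mj c1) mj ml jl; have := F0 (orthoframe_rot uu mj c2) mj ml jl.
  rewrite !(frame_rotl _ _ _ lm lj) !roti !rotj// !FE !(FCl (u j) (u m)).
  have := Fd m m l ml; have := Fd m j l jl; have := Fd j m l ml; have := Fd j j l jl.
  by split; lra.
have S2 m i j l : m != i -> m != j -> m != l -> i != j -> i != l -> j != l -> F (u m) (u i) (u j) (u l) = 0.
  move=> mi mj ml ij il jl; have [jm lm] : j != m /\ l != m by split; rewrite eq_sym.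
  have [ji li] : j != i /\ l != i by split; rewrite eq_sym.
  have := F0 (orthoframe_rot uu mi c1) mj ml jl.
  rewrite !(frame_rotl _ _ _ lm li) (frame_rotl _ _ _ jm ji) !roti !FE (FCl (u i) (u m)).
  have := Fd m j l jl; have := Fd i j l jl; lra.
move=> i j k l; have [<-|ij] := eqVneq i j.
  by have [<-|kl] := eqVneq k l; [exact: Fdd|exact: Fd].
have [<-|kl] := eqVneq k l; first by rewrite FC Fd ?oppr0.
have S1' m j' l' : m != j' -> m != l' -> F (u m) (u j') (u m) (u l') = 0.
  move=> mj ml; have [<-|jl] := eqVneq j' l'; first by have := FC (u m) (u j') (u m) (u j'); lra.
  by have [] := S1 m j' l' mj ml jl.
have E (a b : 'I_n) : a != b -> b != a by rewrite eq_sym.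
have [e|ik] := eqVneq i k; first by rewrite -e in kl *; exact: S1'.
have [e|il] := eqVneq i l; first by rewrite -e in kl *; rewrite FCr; apply: S1' => //; exact: E.
have [e|jk] := eqVneq j k; first by rewrite -e in kl *; rewrite FCl; apply: S1' => //; exact: E.
have [e|jl] := eqVneq j l; first by rewrite -e in kl *; rewrite FCl FCr; apply: S1'; exact: E.
exact: S2.
Qed.

End skew.
End quadrilinear.

(** [E] is read off the entries [F (e b) (e b) (e b) (e a)]; subtracting the form given by the
    commutator with [E] leaves one that [skew_form_zero] annihilates. *)
Lemma skew_form_trace F : (forall a x x' y z w, F (a *: x + x') y z w = a * F x y z w + F x' y z w) ->
  (forall a x y z z' w, F x y (a *: z + z') w = a * F x y z w + F x y z' w) ->
  (forall x y z w, F x y z w = F y x z w) -> (forall x y z w, F x y z w = F x y w z) ->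
  (forall x y z w, F x y z w = - F z w x y) ->
  (forall u i j l, orthoframe u -> i != j -> i != l -> j != l -> F (u i) (u i) (u j) (u l) = 0) ->
  (2 < n)%N -> let e i : 'cV[R]_n := delta_mx i 0 in
  (forall z w, \sum_m F (e m) (e m) z w = 0) ->
  exists E : 'M[R]_n, E^T = - E /\ forall i j k l, let X := e i *m (e j)^T in let Z := e k *m (e l)^T in
    F (e i) (e j) (e k) (e l) = 2^-1 * \tr ((Z + Z^T) *m (E *m (X + X^T) - (X + X^T) *m E)).
Proof.
move=> FDl FDr FCl FCr FC F0 hn e ttr; have uu : orthoframe e := @orthoframe_std R n.
pose E : 'M[R]_n := \matrix_(a, b) (if a == b then 0 else F (e b) (e b) (e b) (e a) / 2).
have Ee a b : dotp (e a) (E *m e b) = E a b.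
  rewrite -colE dotpE (bigD1 a)//= big1 ?addr0 => [|i ia]; rewrite [X in X * _]mxE ?eqxx ?mul1r ?mxE//.
  by rewrite (negbTE ia) mul0r.
have Esk a b : E a b = - E b a.
  rewrite !mxE [b == a]eq_sym; have [_|ab] := eqVneq a b; first by rewrite oppr0.
  have ba : b != a by rewrite eq_sym.
  have := ttr (e b) (e a); rewrite (bigD1 a)// (bigD1 b)//= big1 ?addr0 => [|m /andP[ma mb]]; last by apply: F0.
  rewrite (FCr (e a)); lra.
have ET : E^T = - E by apply/matrixP => a b; rewrite [LHS]mxE Esk [RHS]mxE.
pose ep x y := dotp x (E *m y).
have epC x y : ep x y = - ep y x.
  by rewrite /ep dotp_mulmxr ET mulNmx dotpNl dotpC.
have epDl a x x' y : ep (a *: x + x') y = a * ep x y + ep x' y by rewrite /ep dotpDl dotpZl.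
have epDr a x x' y : ep y (a *: x + x') = a * ep y x + ep y x' by rewrite epC epDl epC (epC x'); ring.
pose a4 x y z w := dotp y z * ep w x + dotp x z * ep w y + dotp y w * ep z x + dotp x w * ep z y.
exists E; split=> // i j k l X Z.
have -> : F (e i) (e j) (e k) (e l) = a4 (e i) (e j) (e k) (e l).
  apply/eqP; rewrite -subr_eq0; apply/eqP.
  pose G x y z w := F x y z w - a4 x y z w; rewrite -/(G _ _ _ _).
  apply: (@skew_form_zero G) => //.
  - by move=> a x x' y z w; rewrite /G /a4 FDl epDr !(dotpDl, dotpZl) epDr; ring.
  - by move=> a x y z z' w; rewrite /G /a4 FDr epDl !(dotpDr, dotpZr) epDl; ring.
  - by move=> x y z w; rewrite /G /a4 FCl; ring.
  - by move=> x y z w; rewrite /G /a4 FCr; ring.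
  - move=> x y z w; rewrite /G /a4 FC !(dotpC w) !(dotpC z) (epC w x) (epC w y) (epC z x) (epC z y); ring.
  - move=> u i' j' l' uf ij il jl; rewrite /G F0// /a4 !uf (negbTE ij) (negbTE il) !mulr0n; ring.
  - move=> z w; rewrite /G sumrB ttr sub0r /a4.
    have H x y : \sum_m dotp (e m) x * ep y (e m) = ep y x.
      rewrite {2}(orthoframe_expand uu x) /ep mulmx_sumr dotp_sumr; apply: eq_bigr => m _.
      by rewrite -scalemxAr dotpZr.
    by rewrite !big_split/= !H (epC w z); ring.
  - move=> i' l' il; rewrite /G /a4 !uu eqxx (negbTE il) /ep !Ee [E l' i']mxE [l' == i']eq_sym (negbTE il) mulr1n mulr0n; by field.
have Sv v : (X + X^T) *m v = dotp (e j) v *: e i + dotp (e i) v *: e j.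
  by rewrite mulmxDl /X trmx_mul trmxK !dyad_mul.
rewrite {1}/Z trmx_mul trmxK mulmxDl linearD/= !tr_dyad !mulmxBl -!mulmxA !Sv.
rewrite !mulmxDr -!scalemxAr !(dotpBr, dotpDr, dotpZr) /a4 -!/(ep _ _).
rewrite (epC (e i)) (epC (e i) (e l)) (epC (e j)) (epC (e j) (e l)) !(dotpC (e l)) !(dotpC (e k)).
by field.
Qed.

End frame_forms.

Section irreducible_algebras.
Variable R : realType.

Lemma perp_exists k (U : {vspace 'cV[R]_k}) :
  exists V : {vspace 'cV[R]_k}, forall x, x \in V <-> forall u, u \in U -> dotp u x = 0.
Proof.
apply: vspace_of_pred => [u _|a x y Hx Hy u uU]; first by rewrite dotp0r.
by rewrite dotpDr dotpZr Hx// Hy// mulr0 addr0.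
Qed.

Lemma perp_full k (U : {vspace 'cV[R]_k}) : (forall x, (forall u, u \in U -> dotp u x = 0) -> x = 0) ->
  U = fullv.
Proof.
move=> H; apply/vspaceP => x; rewrite memvf; apply: vspace_orthP => w Hw.
by rewrite (H w) ?dotp0l// => u uU; rewrite dotpC; exact: Hw.
Qed.

Lemma quad_nonneg (a b c : R) : (forall t, 0 <= a + t * b * 2 + t ^+ 2 * c) -> 0 <= c -> b ^+ 2 <= a * c.
Proof.
move=> H c0; have [c1|c1] := ltP 0 c.
  have := H (- b / c); rewrite -(pmulr_lge0 _ c1).
  have -> : (a + - b / c * b * 2 + (- b / c) ^+ 2 * c) * c = a * c - b ^+ 2.
    by field; rewrite lt0r_neq0.
  by rewrite subr_ge0.
have c00 : c = 0 by apply/eqP; rewrite eq_le c1.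
rewrite {c0 c1}c00 in H *; rewrite mulr0 le_eqVlt sqrf_eq0; apply/orP; left; apply/eqP; apply: contrapT => /eqP b0.
have := H (- (a + 1) / (2 * b)).
have -> : a + - (a + 1) / (2 * b) * b * 2 + (- (a + 1) / (2 * b)) ^+ 2 * 0 = -1 by field.
by rewrite oppr_ge0 ler10.
Qed.

(* The least upper bound of the Rayleigh quotient is an eigenvalue: otherwise
   [c - S] would be bounded below by a positive constant. *)
Lemma sym_eigen d (S : 'M[R]_d) : (0 < d)%N -> S^T = S -> exists (c : R) (v : 'cV[R]_d), v != 0 /\ S *m v = c *: v.
Proof.
case: d S => // d S _ ST.
pose E : set R := [set x | exists2 u : 'cV[R]_d.+1, dotp u u = 1 & x = dotp u (S *m u)].
pose e0 : 'cV[R]_d.+1 := delta_mx 0 0.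
have e01 : dotp e0 e0 = 1.
  rewrite dotpE (bigD1 0)//= big1 ?addr0 => [|i i0]; first by rewrite mxE !eqxx mulr1.
  by rewrite mxE (negbTE i0) mul0r.
have Sb : forall u : 'cV[R]_d.+1, dotp u (S *m u) <= d.+1%:R * (d.+1%:R * `|S|) * dotp u u.
  move=> u; apply: le_trans (ler_norm _) _; apply: le_trans (dotp_le_norm _ _) _.
  rewrite -!mulrA; apply: ler_wpM2l => //; apply: (@le_trans _ _ (`|u| * (d.+1%:R * `|S| * `|u|))).
    by apply: ler_wpM2l => //; exact: norm_mulmx.
  have -> : `|u| * (d.+1%:R * `|S| * `|u|) = d.+1%:R * `|S| * `|u| ^+ 2 by ring.
  by rewrite mulrA; apply: ler_wpM2l; rewrite ?mulr_ge0//; exact: norm_le_dotp.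
have Eb : has_sup E.
  split; first by exists (dotp e0 (S *m e0)), e0.
  by exists (d.+1%:R * (d.+1%:R * `|S|)) => _ [u uu ->]; have := Sb u; rewrite uu mulr1.
pose c := sup E; pose B := c%:M - S.
have BT : B^T = B by rewrite /B linearB/= tr_scalar_mx ST.
have BE u : dotp u (B *m u) = c * dotp u u - dotp u (S *m u).
  by rewrite /B mulmxBl dotpBr mul_scalar_mx dotpZr.
have B0 u : 0 <= dotp u (B *m u).
  have [->|u0] := eqVneq u 0; first by rewrite mulmx0 dotp0r.
  have uu : 0 < dotp u u by rewrite dotp_gt0.
  rewrite BE subr_ge0; pose s := Num.sqrt (dotp u u).
  have s0 : s != 0 by rewrite sqrtr_eq0 -ltNge.
  have ss : s ^+ 2 = dotp u u by rewrite sqr_sqrtr// ltW.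
  have : dotp (s^-1 *: u) (S *m (s^-1 *: u)) <= c.
    apply: ub_le_sup; first exact: Eb.2.
    exists (s^-1 *: u) => //; rewrite dotpZl dotpZr -ss.
    by rewrite expr2; field.
  rewrite -scalemxAr dotpZl dotpZr mulrA -invfM -expr2 ss => H.
  by rewrite -ler_pdivrMr// mulrC.
pose K := d.+1%:R * (d.+1%:R * `|B|).
have K0 : 0 <= K by rewrite !mulr_ge0.
have CS u : dotp (B *m u) (B *m u) <= K * dotp u (B *m u).
  have [->|Bu] := eqVneq (B *m u) 0; first by rewrite !dotp0r mulr0.
  set v := B *m u in Bu *; have vv : 0 < dotp v v by rewrite dotp_gt0.
  have H : dotp u (B *m v) ^+ 2 <= dotp u (B *m u) * dotp v (B *m v).
    apply: quad_nonneg (B0 v) => t; have := B0 (u + t *: v).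
    have vu : dotp v (B *m u) = dotp u (B *m v) by rewrite dotp_mulmxr BT dotpC.
    by rewrite mulmxDr -scalemxAr !(dotpDl, dotpDr, dotpZl, dotpZr) vu; congr (_ <= _); ring.
  have uv : dotp u (B *m v) = dotp v v by rewrite dotp_mulmxr BT.
  have vB : dotp v (B *m v) <= K * dotp v v.
    apply: le_trans (ler_norm _) _; apply: le_trans (dotp_le_norm _ _) _.
    rewrite /K -!mulrA; apply: ler_wpM2l => //; apply: (@le_trans _ _ (`|v| * (d.+1%:R * `|B| * `|v|))).
      by apply: ler_wpM2l => //; exact: norm_mulmx.
    have -> : `|v| * (d.+1%:R * `|B| * `|v|) = d.+1%:R * `|B| * `|v| ^+ 2 by ring.
    by rewrite mulrA; apply: ler_wpM2l; rewrite ?mulr_ge0//; exact: norm_le_dotp.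
  rewrite uv -/v in H; rewrite -(ler_pM2r vv) -expr2; apply: le_trans H _.
  rewrite -/v; apply: le_trans (ler_wpM2l (B0 u) vB) _; rewrite -/v.
  by rewrite le_eqVlt; apply/orP; left; apply/eqP; ring.
have [Bu|Bnu] := boolP (B \in unitmx); last first.
  have [v v0 Bv] : exists2 v : 'cV[R]_d.+1, v != 0 & B *m v = 0.
    apply: contrapT => H; move/negP: Bnu; apply; apply: unitmx_inj => v Bv.
    by apply: contrapT => /eqP v0; apply: H; exists v.
  exists c, v; split=> //; move: Bv; rewrite /B mulmxBl mul_scalar_mx => /eqP.
  by rewrite subr_eq0 => /eqP.
exfalso; pose L := d.+1%:R * (d.+1%:R * (d.+1%:R * `|invmx B|) ^+ 2) + 1 : R.
have L0 : 0 < L by rewrite ltr_wpDl// !mulr_ge0// exprn_ge0// mulr_ge0.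
have low u : dotp u u <= L * K * dotp u (B *m u).
  apply: (@le_trans _ _ (L * dotp (B *m u) (B *m u))); last first.
    by rewrite -mulrA; apply: ler_wpM2l; [exact: ltW|exact: CS].
  apply: le_trans (ler_norm _) _; apply: le_trans (dotp_le_norm _ _) _.
  have {1 2}-> : u = invmx B *m (B *m u) by rewrite mulmxA mulVmx// mul1mx.
  apply: (@le_trans _ _ (d.+1%:R * (d.+1%:R * `|invmx B| * `|B *m u|) ^+ 2)).
    rewrite -mulrA expr2; apply: ler_wpM2l => //.
    by apply: ler_pM => //; exact: norm_mulmx.
  rewrite exprMn mulrA; apply: (@le_trans _ _ (d.+1%:R * (d.+1%:R * `|invmx B|) ^+ 2 * dotp (B *m u) (B *m u))).
    by apply: ler_wpM2l; [rewrite mulr_ge0// exprn_ge0// mulr_ge0|exact: norm_le_dotp].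
  apply: ler_wpM2r; first exact: dotp_ge0.
  have x0 : 0 <= (d.+1%:R * `|invmx B|) ^+ 2 by rewrite exprn_ge0// mulr_ge0.
  rewrite /L; apply: (@le_trans _ _ (d.+1%:R * (d.+1%:R * (d.+1%:R * `|invmx B|) ^+ 2))); last by rewrite lerDl.
  by apply: ler_wpM2l => //; rewrite -[leLHS]mul1r; apply: ler_wpM2r => //; rewrite ler1n.
have LK : 0 < L * K.
  rewrite lt_neqAle; apply/andP; split; last by rewrite mulr_ge0// ltW.
  apply/eqP => LK0.
  by have := low e0; rewrite e01 -LK0 mul0r ler10.
have : c <= c - (L * K)^-1.
  apply: ge_sup; first exact: Eb.1.
  move=> _ [u uu ->]; have := low u; rewrite uu BE uu mulr1 mulrC -ler_pdivrMr// div1r; lra.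
have : 0 < (L * K)^-1 by rewrite invr_gt0.
by move: (_^-1) => z; lra.
Qed.

(** * Subalgebras supported on a subspace *)

Section good_subspaces.
Variables (k : nat) (g : {vspace 'M[R]_k}).
Hypothesis gs : lie_so g.
Hypothesis irr : forall W : {vspace 'cV[R]_k},
  (forall T x, T \in g -> x \in W -> T *m x \in W) -> W = 0%VS \/ W = fullv.
Hypothesis ntr : forall v : 'cV[R]_k, v != 0 ->
  exists2 eta, (forall c : R, eta != c *: v) & forall T, T \in g -> dotp eta (T *m v) = 0.

Definition perp_to (U : {vspace 'cV[R]_k}) x := forall u, u \in U -> dotp u x = 0.

Definition supported (U : {vspace 'cV[R]_k}) T := T \in g /\ forall x, perp_to U x -> T *m x = 0.

(** The operators of [g] living on [U] are not all zero and act irreducibly there. Such a subspace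
    can be enlarged until it fills the whole space. *)
Definition good (U : {vspace 'cV[R]_k}) := (exists2 T, supported U T & T != 0) /\
  forall W : {vspace 'cV[R]_k}, (forall x, x \in W -> x \in U) ->
    (forall T x, supported U T -> x \in W -> T *m x \in W) -> W = 0%VS \/ W = U.

Let skew T u v : T \in g -> dotp (T *m u) v = - dotp u (T *m v).
Proof. by move=> /gs.1 TT; exact: dotp_skew. Qed.

Lemma supported_in U T x : supported U T -> T *m x \in U.
Proof.
move=> [Tg TU]; apply: vspace_orthP => w Hw; have : dotp (T *m w) x = 0.
  by rewrite TU ?dotp0l// => u uU; rewrite dotpC; exact: Hw.
by rewrite skew// => /eqP; rewrite oppr_eq0 => /eqP.
Qed.

Let decomp (U : {vspace 'cV[R]_k}) x : exists u z, [/\ u \in U, perp_to U z & x = u + z].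
Proof.
have [u uU H] := orth_decomp U x; exists u, (x - u); split=> //; last by rewrite addrC subrK.
by move=> y yU; rewrite dotpC; exact: H.
Qed.

(** The vectors of [U] killed by all supported operators form a stable subspace; it is not [U],
    since a nonzero operator is supported on [U]. *)
Lemma good_faithful U u : good U -> u \in U -> (forall T, supported U T -> T *m u = 0) -> u = 0.
Proof.
move=> [[T0 T0s T00] Uirr] uU Hu.
have [W WP] : exists W : {vspace 'cV[R]_k}, forall x, x \in W <-> (x \in U /\ forall T, supported U T -> T *m x = 0).
  apply: vspace_of_pred => [|a x y [xU Hx] [yU Hy]].
    by split=> [|T _]; [exact: mem0v|rewrite mulmx0].
  split=> [|T Ts]; first by rewrite memvD// memvZ.
  by rewrite mulmxDr -scalemxAr Hx// Hy// scaler0 addr0.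
have [||W0|WU] := Uirr W; [by move=> x /WP[]| | |].
- by move=> T x Ts /WP[xU Hx]; rewrite Hx// mem0v.
- by have : u \in W by [apply/WP]; rewrite W0 memv0 => /eqP.
exfalso; move/eqP: T00; apply; apply: mx_ext => y; rewrite mul0mx.
have [v [z [vU zU ->]]] := decomp U y; rewrite mulmxDr (T0s.2 z zU) addr0.
by have : v \in W by [rewrite WU]; move=> /WP[_]; exact.
Qed.

Let gbr A B : A \in g -> B \in g -> A *m B - B *m A \in g. Proof. exact: gs.2. Qed.

(** Supported operators kill [z], so they preserve the set of vectors orthogonal to [g z]. Those
    lying in [U] form a stable subspace, which is not [U] unless [g z] is orthogonal to [U]. *)
Lemma good_perp U z (eta : 'cV[R]_k) : good U -> perp_to U z ->
  ~ (forall T, T \in g -> perp_to U (T *m z)) ->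
  (forall T, T \in g -> dotp eta (T *m z) = 0) -> perp_to U eta.
Proof.
move=> Ug Uz nZ Nz.
have inN T x : supported U T -> (forall S, S \in g -> dotp x (S *m z) = 0) ->
    forall S, S \in g -> dotp (T *m x) (S *m z) = 0.
  move=> [Tg TU] Hx S Sg; rewrite skew//; apply/eqP; rewrite oppr_eq0; apply/eqP.
  by have := Hx _ (gbr Tg Sg); rewrite mulmxBl dotpBr -!mulmxA (TU z Uz) mulmx0 dotp0r subr0.
have [W WP] : exists W : {vspace 'cV[R]_k}, forall x, x \in W <->
    (x \in U /\ forall S, S \in g -> dotp x (S *m z) = 0).
  apply: vspace_of_pred => [|a x y [xU Hx] [yU Hy]].
    by split=> [|T _]; [exact: mem0v|rewrite dotp0l].
  split=> [|T Ts]; first by rewrite memvD// memvZ.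
  by rewrite dotpDl dotpZl Hx// Hy// mulr0 addr0.
have W0 : W = 0%VS.
  have [||//|WU] := Ug.2 W; [by move=> x /WP[]| |].
    by move=> T x Ts /WP[xU Hx]; apply/WP; split; [exact: supported_in|exact: inN].
  by exfalso; apply: nZ => T Tg u; rewrite -WU => /WP[_]; exact.
have [u [y [uU yU etaE]]] := decomp U eta => v vU; rewrite etaE.
suff -> : u = 0 by rewrite add0r yU.
apply: (good_faithful Ug uU) => T Ts.
have : T *m u \in W.
  apply/WP; split; first exact: supported_in.
  by move=> S Sg; have := inN _ _ Ts Nz S Sg; rewrite etaE mulmxDr (Ts.2 y yU) addr0.
by rewrite W0 memv0 => /eqP.
Qed.

Let swap T1 T2 z (eta : 'cV[R]_k) : (forall T, T \in g -> dotp eta (T *m z) = 0) -> T1 \in g -> T2 \in g ->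
  dotp (T1 *m z) (T2 *m eta) = dotp (T2 *m z) (T1 *m eta).
Proof.
move=> Nz T1g T2g; have := Nz _ (gbr T1g T2g); rewrite mulmxBl dotpBr -!mulmxA.
move=> /eqP; rewrite subr_eq0 => /eqP H.
by rewrite dotpC [RHS]dotpC !skew// H.
Qed.

Lemma good_kernel U : good U -> U <> fullv -> exists2 z, z != 0 &
  perp_to U z /\ forall T, T \in g -> perp_to U (T *m z).
Proof.
move=> Ug Un; have [z [z0 Uz]] : exists z, z != 0 /\ perp_to U z.
  apply: contrapT => H; apply: Un; apply: perp_full => x Ux.
  by apply: contrapT => /eqP x0; apply: H; exists x.
have [Zz|nZ] := pselect (forall T, T \in g -> perp_to U (T *m z)); first by exists z.
have [eta etaz Nz] := ntr z0.
have Ueta := good_perp Ug Uz nZ Nz.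
have N0 u : u \in U -> (forall T, T \in g -> dotp u (T *m z) = 0) -> u = 0.
  by move=> uU /(good_perp Ug Uz nZ)/(_ _ uU)/eqP; rewrite dotp_eq0 => /eqP.
have reach u : u \in U -> exists T, [/\ T \in g, T *m z = u & T *m eta \in U].
  have [W WP] : exists W : {vspace 'cV[R]_k}, forall x, x \in W <->
      exists T, [/\ T \in g, T *m z = x & T *m eta \in U].
    apply: vspace_of_pred => [|a x y [T [Tg Tz Te]] [T' [Tg' Tz' Te']]].
      by exists 0; rewrite !mul0mx; split=> //; exact: mem0v.
    exists (a *: T + T'); rewrite !mulmxDl -!scalemxAl Tz Tz'.
    by split=> //; rewrite memvD// memvZ.
  move=> uU; apply/WP; apply: vspace_orthP => w Hw.
  have [w1 [w2 [w1U w2U wE]]] := decomp U w.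
  suff w10 : w1 = 0 by rewrite wE w10 add0r dotpC w2U.
  apply: (good_faithful Ug w1U) => rho rs; apply: N0; first exact: supported_in.
  move=> T Tg; rewrite skew ?rs.1//; apply/eqP; rewrite oppr_eq0; apply/eqP.
  have rTU : rho *m (T *m z) \in U by exact: supported_in.
  have : dotp w (rho *m (T *m z)) = 0.
    apply: Hw; apply/WP; exists (rho *m T - T *m rho); split; first exact: gbr rs.1 Tg.
      by rewrite mulmxBl -!mulmxA (rs.2 z Uz) mulmx0 subr0.
    by rewrite mulmxBl -!mulmxA (rs.2 eta Ueta) mulmx0 subr0; exact: supported_in.
  by rewrite wE dotpDl [dotp w2 _]dotpC w2U// addr0.
have [f [ff fE]] := orthonormal_basis U.
have dU : (0 < \dim U)%N.
  rewrite lt0n dimv_eq0; apply/eqP => U0; apply: nZ => T Tg u.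
  by rewrite U0 memv0 => /eqP->; rewrite dotp0l.
have fU i : f *m delta_mx i 0 \in U by rewrite fE (mulmxA f^T) ff mul1mx.
have /choice[Ti TiP] := fun i => reach _ (fU i).
(* The matrix on [U] of the map sending [Ti j *m z] to [Ti j *m eta]. *)
pose S : 'M[R]_(\dim U) := \matrix_(i, j) dotp (Ti i *m z) (Ti j *m eta).
have ST : S^T = S.
  apply/matrixP => i j; rewrite !mxE; have [gi _ _] := TiP i; have [gj _ _] := TiP j.
  exact: swap.
have [c [v [v0 Sv]]] := sym_eigen dU ST.
pose T0 := \sum_j v j 0 *: Ti j; pose u0 := f *m v.
have T0g : T0 \in g by apply: memv_suml => j _; rewrite memvZ//; have [] := TiP j.
have vE : v = \sum_j v j 0 *: delta_mx j 0.
  by rewrite {1}[v]matrix_sum_delta; apply: eq_bigr => i _; rewrite big_ord1.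
have T0z : T0 *m z = u0.
  rewrite /T0 mulmx_suml /u0 {2}vE mulmx_sumr; apply: eq_bigr => j _.
  by rewrite -scalemxAl -scalemxAr; have [_ -> _] := TiP j.
have T0e : T0 *m eta = c *: u0.
  have TU : T0 *m eta \in U.
    by rewrite /T0 mulmx_suml; apply: memv_suml => j _; rewrite -scalemxAl memvZ//; have [] := TiP j.
  move: TU; rewrite fE => /eqP <-; rewrite /u0 scalemxAr; congr (_ *m _).
  rewrite -Sv; apply/matrixP => i q; rewrite ord1.
  have -> : (f^T *m (T0 *m eta)) i 0 = dotp (f *m delta_mx i 0) (T0 *m eta).
    rewrite dotp_mulmxl dotpE (bigD1 i)//= big1 ?addr0 => [|l li].
      by rewrite [X in X * _]mxE !eqxx mul1r.
    by rewrite [X in X * _]mxE (negbTE li) mul0r.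
  rewrite /T0 mulmx_suml dotp_sumr mxE; apply: eq_bigr => j _; rewrite [S i j]mxE.
  by rewrite -scalemxAl dotpZr mulrC; have [_ -> _] := TiP i.
have u00 : u0 != 0.
  by apply: contra_neq v0 => u00; rewrite -[v]mul1mx -ff -mulmxA -/u0 u00 mulmx0.
pose eta' := eta - c *: z.
have Nz' T : T \in g -> dotp eta' (T *m z) = 0.
  by move=> Tg; rewrite /eta' dotpBl dotpZl Nz// dotpC dotp_skew0 ?mulr0 ?subr0//; exact: gs.1.
have Ueta' : perp_to U eta' by move=> u uU; rewrite /eta' dotpBr dotpZr Ueta// Uz// mulr0 subr0.
have T0e' : T0 *m eta' = 0 by rewrite /eta' mulmxBr T0e -scalemxAr T0z subrr.
have [W WP] : exists W : {vspace 'cV[R]_k}, forall x, x \in W <->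
    (x \in U /\ exists T, [/\ T \in g, T *m z = x & T *m eta' = 0]).
  apply: vspace_of_pred => [|a x y [xU [T [Tg Tz Te]]] [yU [T' [Tg' Tz' Te']]]].
    by split; [exact: mem0v|exists 0; rewrite !mul0mx; split=> //; exact: mem0v].
  split; first by rewrite memvD// memvZ.
  exists (a *: T + T'); rewrite !mulmxDl -!scalemxAl Tz Tz' Te Te' scaler0 addr0.
  by split=> //; rewrite memvD// memvZ.
(* [W] contains [u0], hence is [U] by irreducibility: each vector of [U] is [T *m z] for some [T]
   killing [eta'], and [swap] then makes [g eta'] orthogonal to [U]. *)
have WU : W = U.
  have [||W0|//] := Ug.2 W; [by move=> x /WP[]| |].
    move=> rho x rs /WP[xU [T [Tg Tz Te]]]; apply/WP; split; first exact: supported_in.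
    exists (rho *m T - T *m rho); split; first exact: gbr rs.1 Tg.
      by rewrite mulmxBl -!mulmxA (rs.2 z Uz) mulmx0 subr0 Tz.
    by rewrite mulmxBl -!mulmxA (rs.2 _ Ueta') Te !mulmx0 subr0.
  have : u0 \in W.
    apply/WP; split; last by exists T0.
    by rewrite fE /u0 (mulmxA f^T) ff mul1mx.
  by rewrite W0 memv0 (negbTE u00).
exists eta'; first by rewrite subr_eq0; exact: etaz.
split=> // T Tg u; rewrite -WU => /WP[_ [Tu [Tug <- Te]]].
by rewrite (swap Nz')// Te dotp0r.
Qed.

(** [Z] collects the vectors provided by [good_kernel], and [U'] is its orthogonal. Brackets of
    operators supported on [U] with [g] are supported on [U']; they link [U] to the rest of [U'] and
    make it irreducible. If [U'] were [U], then [Z] would be stable under [g]. *)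
Lemma good_step U : good U -> U <> fullv -> exists U' : {vspace 'cV[R]_k},
  [/\ good U', U' <> fullv, forall x, x \in U -> x \in U' & U' <> U].
Proof.
move=> Ug Un; have [z0 z00 [Uz0 Zz0]] := good_kernel Ug Un.
have [Z ZP] : exists Z : {vspace 'cV[R]_k}, forall z, z \in Z <->
    (perp_to U z /\ forall T, T \in g -> perp_to U (T *m z)).
  apply: vspace_of_pred => [|a x y [Ux Hx] [Uy Hy]].
    by split=> [u _|T _ u _]; rewrite ?mulmx0 dotp0r.
  split=> [u uU|T Tg u uU]; first by rewrite dotpDr dotpZr Ux// Uy// mulr0 addr0.
  by rewrite mulmxDr -scalemxAr dotpDr dotpZr Hx// Hy// mulr0 addr0.
have z0Z : z0 \in Z by apply/ZP.
have [U' U'P] := perp_exists Z.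
have UU' x : x \in U -> x \in U' by move=> xU; apply/U'P => z /ZP[Uz _]; rewrite dotpC Uz.
have U'Z x : perp_to U' x -> x \in Z.
  move=> Hx; apply: vspace_orthP => w Hw; apply: Hx; apply/U'P => z zZ.
  by rewrite dotpC Hw.
have [[T0 T0s T00] Uirr] := Ug.
have sU' T : supported U T -> supported U' T.
  by move=> [Tg TU]; split=> // x /U'Z/ZP[Ux _]; exact: TU.
have sbr rho T : supported U rho -> T \in g -> supported U' (rho *m T - T *m rho).
  move=> rs Tg; split; first exact: gbr rs.1 Tg.
  by move=> x /U'Z/ZP[Ux Hx]; rewrite mulmxBl -!mulmxA (rs.2 x Ux) (rs.2 _ (Hx _ Tg)) mulmx0 subrr.
exists U'; split=> //; last 2 first.
- move=> U'f; move/eqP: z00; apply; apply/eqP; rewrite -dotp_eq0; apply/eqP.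
  have /U'P : z0 \in U' by rewrite U'f memvf.
  exact.
- move=> U'U; have UZ x : perp_to U x -> x \in Z by rewrite -U'U; exact: U'Z.
  have [T x Tg /ZP[_ Hx]|Z0|Zf] := irr (W := Z); first by apply: UZ; exact: Hx.
    by move: z0Z; rewrite Z0 memv0 (negbTE z00).
  move/eqP: T00; apply; apply: mx_ext => y; rewrite mul0mx; apply: T0s.2.
  by have /ZP[] : y \in Z by rewrite Zf memvf.
split; first by exists T0 => //; exact: sU'.
have case1 (W : {vspace 'cV[R]_k}) : (forall x, x \in W -> x \in U') ->
    (forall T x, supported U' T -> x \in W -> T *m x \in W) ->
    (forall x, x \in W -> x \in U -> x = 0) -> W = 0%VS.
  move=> WU' Wi WU; have WUp x : x \in W -> perp_to U x.
    move=> xW; have [u [y [uU yU xE]]] := decomp U x; rewrite xE => v vU.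
    suff -> : u = 0 by rewrite add0r yU.
    apply: (good_faithful Ug uU) => T Ts; apply: WU; last exact: supported_in.
    by have := Wi _ _ (sU' _ Ts) xW; rewrite xE mulmxDr (Ts.2 y yU) addr0.
  apply/eqP; rewrite -subv0; apply/subvP => x xW; rewrite memv0 -dotp_eq0; apply/eqP.
  have /U'P := WU' _ xW; apply; apply/ZP; split; first exact: WUp.
  move=> T Tg; have [u [y [uU yU xE]]] := decomp U (T *m x); rewrite xE => v vU.
  suff -> : u = 0 by rewrite add0r yU.
  apply: (good_faithful Ug uU) => rho rs; apply: WU; last exact: supported_in.
  have := Wi _ _ (sbr _ _ rs Tg) xW; rewrite mulmxBl -!mulmxA (rs.2 x (WUp _ xW)) mulmx0 subr0.
  by rewrite xE mulmxDr (rs.2 y yU) addr0.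
move=> W WU' Wi.
have [I IP] : exists I : {vspace 'cV[R]_k}, forall x, x \in I <-> (x \in W /\ x \in U).
  apply: vspace_of_pred => [|a x y [xW xU] [yW yU]]; first by split; exact: mem0v.
  by split; rewrite memvD// memvZ.
have [||I0|IU] := Uirr I; [by move=> x /IP[]| | |].
- by move=> T x Ts /IP[xW xU]; apply/IP; split; [exact: Wi (sU' _ Ts) xW|exact: supported_in].
- left; apply: case1 => // x xW xU; have : x \in I by apply/IP.
  by rewrite I0 memv0 => /eqP.
right; have [W' W'P] : exists W' : {vspace 'cV[R]_k}, forall x, x \in W' <-> (x \in U' /\ perp_to W x).
  apply: vspace_of_pred => [|a x y [xU Hx] [yU Hy]].
    by split=> [|u _]; [exact: mem0v|rewrite dotp0r].
  split=> [|u uW]; first by rewrite memvD// memvZ.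
  by rewrite dotpDr dotpZr Hx// Hy// mulr0 addr0.
have W'0 : W' = 0%VS.
  apply: case1 => [x /W'P[]//|T x Ts /W'P[xU' Hx]|x /W'P[xU' Hx] xU].
    apply/W'P; split; first by exact: supported_in Ts.
    move=> w wW; rewrite dotpC skew ?Ts.1// dotpC Hx ?oppr0//; exact: Wi.
  apply/eqP; rewrite -dotp_eq0; apply/eqP; apply: Hx.
  by have /IP[] : x \in I by rewrite IU.
apply/vspaceP => x; apply/idP/idP; first exact: WU'.
move=> xU'; have [w [y [wW yW xE]]] := decomp W x.
have : y \in W'.
  by apply/W'P; split=> //; have -> : y = x - w; [rewrite xE addrC addKr|rewrite memvB// WU'].
by rewrite W'0 memv0 => /eqP y0; rewrite xE y0 addr0.
Qed.

(** A proper good subspace would start an endless strictly increasing chain of proper ones. *)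
Lemma good_full U : good U -> U = fullv.
Proof.
move: {2}(k - \dim U)%N (leqnn (k - \dim U)) => m; elim: m U => [|m IH] U Um Ug;
    apply: contrapT => /(good_step Ug)[U' [U'g U'n UU' U'U]].
all: have ltd : (\dim U < \dim U')%N by
  rewrite ltnNge; apply/negP => le; apply: U'U; apply/esym/eqP; rewrite eqEdim le andbT; apply/subvP.
all: have := dimvS (subvf U'); rewrite dimvf /dim /= muln1 => led.
  by move: Um; rewrite leqn0 subn_eq0 => H; have := leq_trans ltd (leq_trans led H); rewrite ltnn.
apply: U'n; apply: IH U'g; rewrite -ltnS; apply: leq_trans Um.
by apply: ltn_sub2l => //; exact: leq_trans ltd led.
Qed.

End good_subspaces.

(** * Shape operators in maximal codimension *)

Section second_fundamental_form.
Variables (k n : nat) (g : {vspace 'M[R]_k}).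
Hypothesis gs : lie_so g.
Hypothesis irr : forall W : {vspace 'cV[R]_k},
  (forall T x, T \in g -> x \in W -> T *m x \in W) -> W = 0%VS \/ W = fullv.
Hypothesis ntr : forall v : 'cV[R]_k, v != 0 ->
  exists2 eta, (forall c : R, eta != c *: v) & forall T, T \in g -> dotp eta (T *m v) = 0.
Variable A : {linear 'cV[R]_k -> 'M[R]_n}.
Hypothesis AT : forall xi, (A xi)^T = A xi.
Hypothesis hR : forall B : 'M[R]_n, exists2 T, T \in g & forall xi eta,
  dotp eta (T *m xi) = \tr (B^T *m (A eta *m A xi - A xi *m A eta)).
Hypothesis noncomm : exists xi eta, A xi *m A eta - A eta *m A xi <> 0.

Let br xi eta := A xi *m A eta - A eta *m A xi.

Let brT xi eta : (br xi eta)^T = - br xi eta.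
Proof. by rewrite /br linearB/= !trmx_mul !AT opprB. Qed.

Let brN xi eta : br eta xi = - br xi eta. Proof. by rewrite /br opprB. Qed.

Let brD xi eta zeta : br xi (eta + zeta) = br xi eta + br xi zeta.
Proof. by rewrite /br linearD/= mulmxDr mulmxDl opprD addrACA. Qed.

Let br0 xi : br xi 0 = 0.
Proof. by rewrite /br linear0 mulmx0 mul0mx subrr. Qed.

Let brZ xi a eta : br xi (a *: eta) = a *: br xi eta.
Proof. by rewrite /br linearZ/= -scalemxAr -scalemxAl scalerBr. Qed.

(** The shape operators of [U] commute with those of its orthogonal; by the Ricci equation the
    curvature then respects this splitting. *)
Definition curv_invariant (U : {vspace 'cV[R]_k}) := forall w z, w \in U -> perp_to U z -> br w z = 0.

Let central xi := forall eta, br xi eta = 0.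

(** Feeding the commutator itself into the Ricci operator turns the coefficient at [w] and [v] into
    its squared norm up to sign, so orthogonality forces commutation. *)
Lemma commutator_curv w v : exists2 T, T \in g &
  (forall z y, dotp y (T *m z) = - \tr (br w v *m br y z)) /\ (dotp v (T *m w) = 0 -> br w v = 0).
Proof.
have [T Tg TE] := hR (br w v); exists T => //; split=> [z y|].
  by rewrite TE brT mulNmx linearN.
rewrite TE -/(br v w) [br v w]brN mulmxN linearN /= => /eqP; rewrite oppr_eq0 => /eqP H.
by apply: (@trmul_eq0 R); rewrite H.
Qed.

Let decomp' (U : {vspace 'cV[R]_k}) x : exists u z, [/\ u \in U, perp_to U z & x = u + z].
Proof.
have [u uU H] := orth_decomp U x; exists u, (x - u); split=> //; last by rewrite addrC subrK.
by move=> y yU; rewrite dotpC; exact: H.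
Qed.

Lemma curv_invariant_perp (U U' : {vspace 'cV[R]_k}) : curv_invariant U -> (forall x, x \in U' <-> perp_to U x) -> curv_invariant U'.
Proof.
move=> Ui U'P w z /U'P Uw U'z; rewrite brN Ui ?oppr0//.
by apply: vspace_orthP => y Hy; apply: U'z; apply/U'P => v vU; rewrite dotpC Hy.
Qed.

(** For [w] in [U], the Ricci operators of the commutators [br w v] are supported on [U]. A subspace
    stable under the supported operators therefore splits [U] into two pieces satisfying
    [curv_invariant], and minimality leaves only one of them. *)
Lemma minimal_good (U : {vspace 'cV[R]_k}) : curv_invariant U -> ~ (forall x, x \in U -> central x) ->
  (forall W : {vspace 'cV[R]_k}, curv_invariant W -> ~ (forall x, x \in W -> central x) ->
    (\dim U <= \dim W)%N) -> good g U.
Proof.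
move=> Ui Unc Um.
have sup w v T : w \in U -> T \in g -> (forall z y, dotp y (T *m z) = - \tr (br w v *m br y z)) ->
    supported g U T.
  move=> wU Tg TE; split=> // z Uz; apply: dotp_ext => y; rewrite dotp0l dotpC TE.
  have [v1 [v2 [v1U v2U ->]]] := decomp' U v; have [y1 [y2 [y1U y2U ->]]] := decomp' U y.
  rewrite brD (Ui w v2)// addr0 [br _ z]brN brD [br z y1]brN (Ui y1 z)// oppr0 add0r mulmxN linearN opprK.
  suff H : \tr (br w v1 *m br z y2) = 0 by exact: H.
  have com a b : a \in U -> perp_to U b -> A a *m A b = A b *m A a.
    by move=> aU bU; apply/eqP; rewrite -subr_eq0; apply/eqP; exact: Ui.
  have comz : br w v1 *m A z = A z *m br w v1.
    by rewrite /br mulmxBl mulmxBr -!mulmxA (com v1 z)// (com w z)// !mulmxA (com w z)// (com v1 z).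
  rewrite {2}/br mulmxBr linearB/= (mulmxA _ (A z)) comz -mulmxA mxtrace_mulC -mulmxA subrr.
  by [].
split.
  have [w [v [wU wv]]] : exists w v, w \in U /\ br w v <> 0.
    apply: contrapT => H; apply: Unc => w wU v; apply: contrapT => wv; apply: H; by exists w, v.
  have [T Tg [TE Tz]] := commutator_curv w v; exists T; first exact: sup wU Tg TE.
  by apply/eqP => T0; apply: wv; apply: Tz; rewrite T0 mul0mx dotp0r.
move=> W WU Wi.
have [W' W'P] : exists W' : {vspace 'cV[R]_k}, forall x, x \in W' <-> (x \in U /\ perp_to W x).
  apply: vspace_of_pred => [|a x y [xU Hx] [yU Hy]].
    by split=> [|u _]; [exact: mem0v|rewrite dotp0r].
  split=> [|u uW]; first by rewrite memvD// memvZ.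
  by rewrite dotpDr dotpZr Hx// Hy// mulr0 addr0.
have WW' w u : w \in W -> u \in W' -> br w u = 0.
  move=> wW /W'P[uU Hu]; have [T Tg [TE Tz]] := commutator_curv w u; apply: Tz.
  by rewrite dotpC Hu//; apply: Wi => //; exact: sup (WU _ wW) Tg TE.
have Wc : curv_invariant W.
  move=> w z wW Wz; have [z1 [z2 [z1U z2U zE]]] := decomp' U z.
  rewrite zE brD (Ui w z2) ?WU// addr0 WW'//; apply/W'P; split=> // u uW.
  have -> : z1 = z - z2 by rewrite zE addrK.
  by rewrite dotpBr Wz// z2U ?WU// subr0.
have decW x : x \in U -> exists w w', [/\ w \in W, w' \in W' & x = w + w'].
  move=> xU; have [w [w' [wW Hw' xE]]] := decomp' W x; exists w, w'; split=> //.
  by apply/W'P; split=> //; have -> : w' = x - w; [rewrite xE addrC addKr|rewrite memvB// WU].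
have W'c : curv_invariant W'.
  move=> w z wW' W'z; have [z1 [z2 [z1U z2U zE]]] := decomp' U z.
  have wU : w \in U by case/W'P: wW'.
  rewrite zE brD (Ui w z2)// addr0; have [a [b [aW bW' z1E]]] := decW _ z1U.
  suff b0 : b = 0 by rewrite z1E b0 addr0 brN WW'// oppr0.
  apply/eqP; rewrite -dotp_eq0; apply/eqP.
  have bE : b = z - z2 - a by rewrite zE z1E addrK addrC addKr.
  have [bU bW] := (W'P b).1 bW'.
by rewrite {2}bE !dotpBr W'z// z2U// [dotp b a]dotpC bW// !subr0.
have dimU (V : {vspace 'cV[R]_k}) : curv_invariant V -> (forall x, x \in V -> x \in U) ->
    ~ (forall x, x \in V -> central x) -> V = U.
  by move=> Vi VU Vn; apply/eqP; rewrite eqEdim Um// andbT; apply/subvP.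
have [WC|WN] := pselect (forall x, x \in W -> central x); last by right; exact: dimU.
have [W'C|W'N] := pselect (forall x, x \in W' -> central x).
  exfalso; apply: Unc => x /decW[w [w' [wW w'W ->]]] y.
  by rewrite brN brD brN WC// brN W'C// !oppr0 addr0 oppr0.
left; have W'U : W' = U by apply: dimU => // x /W'P[].
apply/eqP; rewrite -subv0; apply/subvP => x xW; rewrite memv0 -dotp_eq0; apply/eqP.
have : x \in W' by rewrite W'U WU.
by move=> /W'P[_]; exact.
Qed.

(** By [good_full] a minimal noncentral subspace is the whole space. The orthogonal of the centre
    satisfies [curv_invariant] and is not central, so it is everything and the centre is zero. *)
Lemma shape_faithful xi : (forall eta, A xi *m A eta = A eta *m A xi) -> xi = 0.
Proof.
move=> Hxi; pose P d := `[< exists U : {vspace 'cV[R]_k}, [/\ curv_invariant U,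
  ~ (forall x, x \in U -> central x) & \dim U = d] >].
have fc : curv_invariant fullv.
  move=> w z _ Hz; suff -> : z = 0 by rewrite br0.
  by apply/eqP; rewrite -dotp_eq0; apply/eqP; apply: Hz; exact: memvf.
have fn : ~ (forall x, x \in (fullv : {vspace 'cV[R]_k}) -> central x).
  by have [x [y xy]] := noncomm => H; apply: xy; apply: (H x); exact: memvf.
have exP : exists d, P d by exists (\dim {: 'cV[R]_k}); apply/asboolP; exists fullv.
case: (ex_minnP exP) => d /asboolP[U [Ui Un Ud]] dm.
have Um (W : {vspace 'cV[R]_k}) : curv_invariant W -> ~ (forall x, x \in W -> central x) -> (\dim U <= \dim W)%N.
  by move=> Wi Wn; rewrite Ud; apply: dm; apply/asboolP; exists W.
have Uf : U = fullv by apply: (good_full gs irr ntr); exact: minimal_good.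
have [K KP] : exists K : {vspace 'cV[R]_k}, forall x, x \in K <-> central x.
  apply: vspace_of_pred => [y|a x y Hx Hy z]; first by rewrite brN br0 oppr0.
  by rewrite brN brD brZ [br z x]brN Hx [br z y]brN Hy oppr0 scaler0 addr0 oppr0.
have [K' K'P] := perp_exists K.
have Ki : curv_invariant K by move=> w z /KP.
have K'i := curv_invariant_perp Ki K'P.
have K'f : K' = fullv.
  apply/eqP; rewrite eqEdim subvf/= -Uf; apply: Um => // K'c; apply: fn => x _.
  have [a [b [aK bK xE]]] := decomp' K x.
  suff b0 : b = 0 by rewrite xE b0 addr0; apply/KP.
  have bb : b \in K by apply/KP; apply: K'c; apply/K'P.
  by apply/eqP; rewrite -dotp_eq0; apply/eqP; exact: bK.
have xK : xi \in K by apply/KP => eta; rewrite /br Hxi subrr.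
apply/eqP; rewrite -dotp_eq0; apply/eqP.
have : xi \in K' by rewrite K'f memvf.
by move=> /K'P; exact.
Qed.

Lemma shape_scalar xi c : A xi = c%:M -> xi = 0.
Proof. by move=> E; apply: shape_faithful => eta; rewrite E scalar_mxC. Qed.

Hypothesis hk : k.+1 = (n * n.+1)./2.

(** A dimension count: [A] is injective, its image misses the identity, and k + 1 is the dimension
    of the space of symmetric matrices. *)
Lemma shape_onto (S : 'M[R]_n) : S^T = S -> exists xi c, A xi = S + c%:M.
Proof.
move=> ST; case: n A AT hR noncomm hk S ST shape_scalar => [|m] A' AT' _ _ hk' S ST scal.
  by exists 0, 0; apply/matrixP => -[].
pose f := linfun A'; pose I := limg f.
have fE x : f x = A' x by rewrite lfunE.
have f0 : lker f == 0%VS.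
  apply/eqP/vspaceP => x; rewrite memv_ker memv0 fE; apply/eqP/eqP => [Ax|->]; last by rewrite linear0.
  by apply: (@scal _ 0); rewrite Ax raddf0.
have dI : \dim I = k by rewrite limg_dim_eq ?(eqP f0) ?capv0// dimvf /dim/= muln1.
have I1 : (1%:M : 'M[R]_m.+1) \notin I.
  apply/negP => /memv_imgP[x _]; rewrite fE => Ax; have /esym x0 := Ax.
  have := scal _ _ x0 => x0'; move: Ax; rewrite x0' linear0 => /matrixP/(_ 0 0).
  by rewrite !mxE eqxx mulr1n => /eqP; rewrite oner_eq0.
have n1 : (1%:M : 'M[R]_m.+1) != 0 by apply/eqP => /matrixP/(_ 0 0); rewrite !mxE eqxx mulr1n => /eqP; rewrite oner_eq0.
have dJ : \dim (I + <[1%:M]>)%VS = k.+1.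
  rewrite dimv_disjoint_sum ?dI ?dim_vline ?n1 ?addn1//.
  apply/eqP; rewrite -subv0; apply/subvP => x; rewrite memv_cap memv0 => /andP[xI /vlineP[a xE]].
  move: xI; rewrite xE; have [->|a0] := eqVneq a 0; first by rewrite scale0r.
  by move=> /(memvZ a^-1); rewrite scalerA mulVf// scale1r (negbTE I1).
(* Generators of the symmetric matrices indexed by j <= i; their number bounds the dimension from
   above. *)
pose ee := [seq delta_mx (inord i) (inord j) + delta_mx (inord j) (inord i) : 'M[R]_m.+1 |
  i <- iota 0 m.+1, j <- iota 0 i.+1].
have ss : size ee = k.+1.
  rewrite size_allpairs_dep hk'.
  rewrite (_ : [seq _ | i <- _] = [seq i.+1 | i <- iota 0 m.+1]); last by apply: eq_map => i; rewrite size_iota.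
  rewrite sumnE big_map -[iota 0 m.+1]/(index_iota 0 m.+1).
  have -> : (\sum_(0 <= i < m.+1) i.+1 = \sum_(0 <= i < m.+2) i)%N by rewrite [RHS]big_nat_recl.
  by rewrite bin2_sum bin2 mulnC.
have symspan (X : 'M[R]_m.+1) : X^T = X -> X \in <<ee>>%VS.
  move=> XT; have -> : X = \sum_i \sum_j (X i j / 2) *: (delta_mx i j + delta_mx j i).
    under eq_bigr do under eq_bigr do rewrite scalerDr.
    under eq_bigr do rewrite big_split/=.
    rewrite big_split/= [X in _ + X]exchange_big/=.
    have dE (Y : 'I_m.+1 -> 'I_m.+1 -> R) : \sum_i \sum_j Y i j *: delta_mx i j = \matrix_(i, j) Y i j.
      by rewrite [RHS]matrix_sum_delta; apply: eq_bigr => i _; apply: eq_bigr => j _; rewrite mxE.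
    rewrite (dE (fun i j => X i j / 2)) (dE (fun j i => X i j / 2)).
    apply/matrixP => a b; rewrite !mxE; have -> : X b a = X a b by rewrite -{1}XT mxE.
    by field.
  apply: memv_suml => i _; apply: memv_suml => j _; apply: memvZ; apply: memv_span.
  wlog ji : i j / (j <= i)%N.
    by move=> H; case: (leqP j i) => [/H//|/ltnW/H]; rewrite addrC.
  apply/allpairsPdep; exists (i : nat), (j : nat); rewrite !mem_iota !add0n !leq0n ltn_ord/= ltnS ji.
  by rewrite !inord_val.
have JS : (I + <[1%:M]> <= <<ee>>)%VS.
  apply/subvP => x /memv_addP[y /memv_imgP[z _ ->] [w /vlineP[a ->] ->]].
  by apply: symspan; rewrite linearD/= fE AT' linearZ/= trmx1.
have EJ : (I + <[1%:M]>)%VS = <<ee>>%VS.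
  by apply/eqP; rewrite eqEdim JS dJ -ss dim_span.
have := symspan _ ST; rewrite -EJ => /memv_addP[y /memv_imgP[z _ ->] [w /vlineP[a ->] ->]].
by exists z, (- a); rewrite fE scalemx1 raddfN addrK.
Qed.

(** The adjoint of [A] for the trace form; on dyads it is the second fundamental form. *)
Definition nuv (X : 'M[R]_n) : 'cV[R]_k := \col_i \tr (X *m A (delta_mx i 0)).

Lemma nuv_is_linear : linear nuv.
Proof. by move=> a X Y; apply/matrixP => i j; rewrite !mxE mulmxDl -scalemxAl linearD linearZ. Qed.
HB.instance Definition _ := @GRing.isLinear.Build R 'M[R]_n 'cV[R]_k _ nuv nuv_is_linear.

Lemma nuvP X xi : dotp (nuv X) xi = \tr (X *m A xi).
Proof.
rewrite [in RHS](orthoframe_expand (@orthoframe_std R k) xi) linear_sum mulmx_sumr linear_sum /=.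
rewrite dotpE; apply: eq_bigr => l _; rewrite linearZ/= -scalemxAr linearZ/= mxE mulrC; congr (_ * _).
rewrite dotpE (bigD1 l)//= big1 => [|i il]; rewrite !mxE ?eqxx ?mul1r ?addr0//.
by rewrite (negbTE il) mul0r.
Qed.

Lemma nuv_tr X : nuv X^T = nuv X.
Proof.
by apply: dotp_ext => w; rewrite !nuvP -mxtrace_tr trmx_mul AT trmxK mxtrace_mulC.
Qed.

Lemma curv_nuv B : exists2 T, T \in g & forall xi, T *m xi = nuv (A xi *m B - B *m A xi).
Proof.
have [T Tg TE] := hR B^T; exists T => // xi; apply: dotp_ext => y; rewrite dotpC TE trmxK nuvP.
move: (A xi) (A y) => X Y.
by rewrite mulmxBr mulmxBl !raddfB/= -(mulmxA X) (mxtrace_mulC X) !mulmxA.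
Qed.

(* In an eigenframe of [A xi], the shape operators commuting with [A xi] are diagonal too;
   the noncollinearity says that [eta] is not a multiple of [xi]. *)
Lemma regular_pair (u : 'I_n -> 'cV[R]_n) (x : 'I_n -> R) : orthoframe u -> injective x ->
  exists xi eta c (y : 'I_n -> R), [/\ forall l, A xi *m u l = (x l + c) *: u l,
    forall l, A eta *m u l = y l *: u l, forall T, T \in g -> dotp eta (T *m xi) = 0 &
    forall j l, j != l -> exists i, [/\ i != j, i != l &
      (y i - y j) * (x i - x l) - (y i - y l) * (x i - x j) != 0]].
Proof.
move=> uu xi_inj; pose S := \sum_l x l *: (u l *m (u l)^T).
have ST : S^T = S.
  by rewrite /S linear_sum; apply: eq_bigr => l _; rewrite linearZ/= trmx_mul trmxK.
have Su l : S *m u l = x l *: u l.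
  rewrite /S mulmx_suml (bigD1 l)//= big1 ?addr0 => [|i il]; rewrite -scalemxAl dyad_mul uu.
    by rewrite eqxx scale1r.
  by rewrite (negbTE il) scale0r scaler0.
have [xi [c xiE]] := shape_onto ST.
have xiu l : A xi *m u l = (x l + c) *: u l.
  by rewrite xiE mulmxDl Su mul_scalar_mx scalerDl.
have [xi0|xi0] := eqVneq xi 0.
  have xc l : u l != 0 -> x l = - c.
    have := xiu l; rewrite xi0 raddf0 mul0mx => /esym/eqP; rewrite scaler_eq0 => /orP[/eqP H _|->//].
    by apply/eqP; rewrite -subr_eq0 opprK H.
  have u0 l : u l != 0 by rewrite -dotp_eq0 uu eqxx oner_eq0.
  exfalso; have [x1 [x2 x12]] := noncomm; apply: x12.
  have one (i j : 'I_n) : i = j by apply: xi_inj; rewrite !xc.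
  by apply/matrixP => i j; rewrite !mxE [X in _ - X](_ : _ = \sum_j0 A x1 i j0 * A x2 j0 j) ?subrr//;
    apply: eq_bigr => l _; rewrite mulrC (one i j) (one l j).
have [eta eta_xi eta_g] := ntr xi0.
have com : A xi *m A eta = A eta *m A xi.
  apply/eqP; rewrite -subr_eq0; apply/eqP; apply: (@trmul_eq0 R).
  have [T Tg TE] := hR (A xi *m A eta - A eta *m A xi).
  have := TE xi eta; rewrite eta_g// -[X in _ *m X]opprB mulmxN linearN/= => /eqP.
  by rewrite eq_sym oppr_eq0 => /eqP.
pose y l := dotp (u l) (A eta *m u l).
have etau l : A eta *m u l = y l *: u l.
  apply: (orthoframe_ext uu) => i; rewrite dotpZr uu; have [->|il] := eqVneq i l.
    by rewrite mulr1.
  rewrite mulr0; have : dotp (u i) ((A xi *m A eta) *m u l) = dotp (u i) ((A eta *m A xi) *m u l) by rewrite com.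
  rewrite -!mulmxA xiu dotp_mulmxr AT xiu -scalemxAr dotpZl dotpZr => /eqP.
  rewrite -subr_eq0 -mulrBl mulf_eq0 opprD addrACA subrr addr0 subr_eq0 => /orP[/eqP/xi_inj E|/eqP//].
  by rewrite E eqxx in il.
exists xi, eta, c, y; split=> // j l jl; apply: contrapT => H.
have xjl : x j - x l != 0 by rewrite subr_eq0; apply: contra_neq jl; exact: xi_inj.
(* If every expression vanished, [y] would be the affine function a x + b of [x], and
   [A (eta - a *: xi)] would be scalar. *)
pose a := (y j - y l) / (x j - x l); pose b := y j - a * x j.
have yE i : y i = a * x i + b.
  have [->|ij] := eqVneq i j; first by rewrite /b; ring.
  have [->|il] := eqVneq i l; first by rewrite /b /a; field.
  have /eqP E : (y i - y j) * (x i - x l) - (y i - y l) * (x i - x j) == 0.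
    by apply: contrapT => /negP E; apply: H; exists i.
  have : (y i - y j) * (x j - x l) - (y j - y l) * (x i - x j) = 0 by rewrite -E; ring.
  move=> /eqP; rewrite subr_eq0 => /eqP E'; rewrite /b /a -[y i](subrK (y j)).
  by apply: (mulIf xjl); rewrite mulrDl E'; field.
have : A (eta - a *: xi) = (b - a * c)%:M.
  apply: (frame_mx_ext uu) => i; rewrite linearB linearZ/= mulmxBl -scalemxAl etau xiu mul_scalar_mx yE.
  by rewrite scalerA -scalerBl; congr (_ *: _); ring.
by move=> /shape_scalar/eqP; rewrite subr_eq0 => /eqP; apply/eqP; exact: eta_xi.
Qed.

Definition dyad (u v : 'cV[R]_n) := nuv (u *m v^T).

Lemma dyadC u v : dyad u v = dyad v u.
Proof. by rewrite /dyad -nuv_tr trmx_mul trmxK. Qed.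

Lemma dyadDl u u' v : dyad (u + u') v = dyad u v + dyad u' v.
Proof. by rewrite /dyad mulmxDl linearD. Qed.

Lemma dyadZl a u v : dyad (a *: u) v = a *: dyad u v.
Proof. by rewrite /dyad -scalemxAl linearZ. Qed.

Lemma dyadNl u v : dyad (- u) v = - dyad u v.
Proof. by rewrite /dyad mulNmx linearN. Qed.

Lemma curv_eigen (u : 'I_n -> 'cV[R]_n) xi (x : 'I_n -> R) i j T :
  (forall l, A xi *m u l = x l *: u l) -> (forall zeta, T *m zeta = nuv (A zeta *m (u i *m (u j)^T) - u i *m (u j)^T *m A zeta)) ->
  T *m xi = (x i - x j) *: dyad (u i) (u j).
Proof.
move=> xu ->; rewrite mulmxA xu -(mulmxA (u i)) -[X in u i *m X]trmxK trmx_mul trmxK AT xu.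
by rewrite linearZ/= -scalemxAl -scalemxAr -scalerBl linearZ.
Qed.

(** The bracket of the Ricci operators of two dyads sharing [u i] lies in [g], so it maps [xi] to a
    vector orthogonal to [eta]. In the common eigenframe this says that the product of the two
    dyads, times the nonzero number of [regular_pair], vanishes. *)
Lemma dyad_orth_ex (u : 'I_n -> 'cV[R]_n) j l : orthoframe u -> j != l ->
  exists i, [/\ i != j, i != l & dotp (dyad (u i) (u j)) (dyad (u i) (u l)) = 0].
Proof.
move=> uu jl; have [xi [eta [c [y [xiu etau Hg Hy]]]]] := regular_pair (x := fun i => (i : nat)%:R) uu (fun i j H => val_inj (mulrIn (@oner_neq0 R) H)).
have [i [ij il E]] := Hy _ _ jl; exists i; split=> //.
have [T Tg TE] := curv_nuv (u i *m (u j)^T).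
have [S Sg SE] := curv_nuv (u i *m (u l)^T).
have := Hg _ (gs.2 _ _ Tg Sg); rewrite mulmxBl dotpBr -!mulmxA => /eqP.
rewrite subr_eq0 => /eqP H; have {H} : dotp (T *m eta) (S *m xi) = dotp (S *m eta) (T *m xi).
  by rewrite !dotp_skew ?gs.1// H.
rewrite (curv_eigen etau TE) (curv_eigen etau SE) (curv_eigen xiu TE) (curv_eigen xiu SE).
rewrite !(dotpZl, dotpZr) [dotp (dyad (u i) (u l)) _]dotpC => /eqP; rewrite -subr_eq0.
set q := dotp _ _ => H; move: H.
move=> /eqP H; apply: (mulfI E); rewrite mulr0 -[RHS]H; ring.
Qed.

(* If the quadratic form [u |-> <uv, uw>] did not vanish on every frame, a suitable rotation would
   decrease the number of its zeros until none is left. *)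
Lemma dyad_orth (u : 'I_n -> 'cV[R]_n) i j l : orthoframe u -> i != j -> i != l -> j != l ->
  dotp (dyad (u i) (u j)) (dyad (u i) (u l)) = 0.
Proof.
move=> + ij il jl; pose f u i := dotp (dyad (u i) (u j)) (dyad (u i) (u l)).
pose Z u := #|[pred i | [&& i != j, i != l & f u i == 0]]|.
suff H m : forall u, orthoframe u -> (Z u <= m)%N -> forall i, i != j -> i != l -> f u i = 0.
  by move=> uu; exact: (H _ _ uu (leqnn _)).
elim: m => [|m IH] {}u uu Zm {ij il}i ij il.
  have [i0 [i0j i0l fi0]] := dyad_orth_ex uu jl; move: Zm; rewrite /Z leqn0 => /pred0P/(_ i0).
  by rewrite /= i0j i0l /f fi0 eqxx.
apply: contrapT => /eqP fi; have [i0 [i0j i0l fi0]] := dyad_orth_ex uu jl.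
have i0i : i0 != i by apply: contra_neq fi => <-.
pose b := dotp (dyad (u i0) (u j)) (dyad (u i) (u l)) + dotp (dyad (u i) (u j)) (dyad (u i0) (u l)).
have fr c s a : f (frame_rot u i0 i c s) a = if a == i0 then c * s * b + s ^+ 2 * f u i
    else if a == i then c ^+ 2 * f u i - c * s * b else f u a.
  rewrite /f (frame_rotl _ _ _ _ (l := j)) 1?eq_sym// 1?[j == i]eq_sym// (frame_rotl _ _ _ _ (l := l)) 1?eq_sym// 1?[l == i]eq_sym//.
  have [->|ai0] := eqVneq a i0; [|have [->|ai] := eqVneq a i]; rewrite ?frame_roti ?frame_rotj// ?frame_rotl//.
    rewrite !(dyadDl, dyadZl, dotpDl, dotpDr, dotpZl, dotpZr) fi0 /b; ring.
  rewrite !(dyadDl, dyadNl, dyadZl, dotpDl, dotpDr, dotpNl, dotpNr, dotpZl, dotpZr) fi0 /b; ring.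
have ns (c s : R) : c ^+ 2 + s ^+ 2 = 1 -> c * s * b + s ^+ 2 * f u i != 0 -> c ^+ 2 * f u i - c * s * b != 0 -> False.
  move=> cs h1 h2; have := IH _ (orthoframe_rot uu i0i cs) _ i ij il.
  rewrite fr eqxx eq_sym (negbTE i0i) => H; move/eqP: (h2); apply; apply: H; rewrite -ltnS; apply: leq_trans Zm.
  apply: proper_card; apply/properP; split.
    apply/fintype.subsetP => a; rewrite !inE fr => /and3P[-> -> /=].
    have [->|_] := eqVneq a i0; first by rewrite (negbTE h1).
    by have [->|//] := eqVneq a i; rewrite (negbTE h2).
  by exists i0; rewrite !inE i0j i0l ?fr ?eqxx ?(negbTE h1)// /f fi0 eqxx.
have [e1|n1] := eqVneq ((3/5) * (4/5) * b + (4/5) ^+ 2 * f u i) 0; last first.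
  have [e2|n2] := eqVneq ((3/5) ^+ 2 * f u i - (3/5) * (4/5) * b) 0; last by apply: ns n1 n2; field.
  apply: (ns (4/5) (3/5)); first by field.
    by apply/eqP => e3; move/eqP: fi; apply; lra.
  by apply/eqP => e3; move/eqP: fi; apply; lra.
apply: (ns (4/5) (3/5)); first by field.
  by apply/eqP => e3; move/eqP: fi; apply; lra.
by apply/eqP => e3; move/eqP: fi; apply; lra.
Qed.

Hypothesis hn : (2 < n)%N.

Let o : 'I_n := Ordinal (ltnW (ltnW hn)).
Let o' : 'I_n := Ordinal (ltnW hn).
Let e (i : 'I_n) : 'cV[R]_n := delta_mx i 0.

Let deltaE i j : delta_mx i j = e i *m (e j)^T.
Proof. by rewrite /e trmx_delta mul_delta_mx. Qed.

Let n0 : n%:R != 0 :> R.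
Proof. by rewrite pnatr_eq0 -lt0n (ltn_trans _ hn). Qed.

Let tr2 (x y z w : 'cV[R]_n) : \tr (x *m y^T *m (z *m w^T)) = dotp x w * dotp y z.
Proof. by rewrite tr_dyad dyad_mul dotpZr (dotpC w). Qed.

Let cQ : R := 2 * dotp (dyad (e o) (e o')) (dyad (e o) (e o')).

(** The inner product pulled back by [nuv], minus [cQ] times the trace form, satisfies [F0] by
    [dyad_orth]; [cQ] is the value making it vanish at one off-diagonal pair, so
    [symmetric_form_zero] applies. *)
Lemma nuv_dot X Y : Sim0 X -> Sim0 Y -> dotp (nuv X) (nuv Y) = cQ * \tr (X *m Y).
Proof.
pose F x y z w := dotp (dyad x y) (dyad z w) - cQ * (dotp x z * dotp y w + dotp x w * dotp y z) / 2.
have uu : orthoframe e := @orthoframe_std R n; have oo : o != o' by [].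
have [| | | | | | |F1 F2 F3] := @symmetric_form_zero R n F _ _ _ _ _ _ o o' hn e uu oo.
- by move=> a x x' y z w; rewrite /F dyadDl dyadZl !(dotpDl, dotpZl); field.
- by move=> a x y z z' w; rewrite /F dyadDl dyadZl !(dotpDr, dotpZr); field.
- by move=> x y z w; rewrite /F dyadC; field.
- by move=> x y z w; rewrite /F (dyadC z); field.
- by move=> x y z w; rewrite /F dotpC !(dotpC z) !(dotpC w); field.
- move=> u i j l uf ij il jl; rewrite /F (dyad_orth uf ij il jl) !uf eqxx (negbTE il) (negbTE jl) [j == i]eq_sym (negbTE ij) !mulr0n; by field.
- by rewrite /F /cQ !uu !eqxx /= mulr1n mulr0n; field.
have FE x y z w : dotp (dyad x y) (dyad z w) = F x y z w + cQ * (dotp x z * dotp y w + dotp x w * dotp y z) / 2.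
  by rewrite /F subrK.
have nE x y : nuv (x *m y^T) = dyad x y by [].
have P0 Z : (fun X => dotp (nuv X) (nuv Z) = cQ * \tr (X *m Z)) 0.
  by rewrite linear0 dotp0l mul0mx mxtrace0 mulr0.
have PD Z a X1 X2 : dotp (nuv X1) (nuv Z) = cQ * \tr (X1 *m Z) -> dotp (nuv X2) (nuv Z) = cQ * \tr (X2 *m Z) ->
    dotp (nuv (a *: X1 + X2)) (nuv Z) = cQ * \tr (a *: X1 *m Z + X2 *m Z).
  by rewrite linearD linearZ/= dotpDl dotpZl linearD/= -scalemxAl linearZ/= => -> ->; ring.
have sw Z W : dotp (nuv Z) (nuv W) = cQ * \tr (Z *m W) -> dotp (nuv W) (nuv Z) = cQ * \tr (W *m Z).
  by rewrite dotpC mxtrace_mulC.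
have nD Z W : nuv (Z + W) = nuv Z + nuv W by rewrite linearD.
have nB Z W : nuv (Z - W) = nuv Z - nuv W by rewrite linearB.
have tD (Z W : 'M[R]_n) : \tr (Z + W) = \tr Z + \tr W by rewrite linearD.
have tB (Z W : 'M[R]_n) : \tr (Z - W) = \tr Z - \tr W by rewrite linearB.
move=> X0 Y0; move: X X0; apply: (@sim0_ind R n _ o) => [|a X1 X2 H1 H2|i j ij|i].
- exact: P0.
- by rewrite mulmxDl; exact: PD.
- apply: (sw); move: Y Y0; apply: (@sim0_ind R n _ o) => [|a X1 X2 H1 H2|k' l kl|k'].
  + exact: P0.
  + by rewrite mulmxDl; exact: PD.
  + rewrite !deltaE !nD !nE (dyadC (e l)) (dyadC (e j)) mulmxDl !mulmxDr !tD !tr2 !(dotpDl, dotpDr) FE F1//.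
    by field.
  + rewrite !deltaE nB nD !nE (dyadC (e j)) mulmxBl !mulmxDr !tB !tD !tr2 dotpDr !dotpBl !FE.
    have -> : F (e k') (e k') (e i) (e j) = F (e o) (e o) (e i) (e j) by apply: F2.
    by field.
- apply: (sw); move: Y Y0; apply: (@sim0_ind R n _ o) => [|a X1 X2 H1 H2|k' l kl|k'].
  + exact: P0.
  + by rewrite mulmxDl; exact: PD.
  + apply: (sw); rewrite !deltaE nB nD !nE (dyadC (e l)) mulmxBl !mulmxDr !tB !tD !tr2 dotpDr !dotpBl !FE.
    have -> : F (e i) (e i) (e k') (e l) = F (e o) (e o) (e k') (e l) by apply: F2.
    by field.
  + rewrite !deltaE !nB !nE mulmxBl !mulmxBr !tB !tr2 dotpBr !dotpBl !FE.
    have H1 := F3 o k' i; have H2 := F3 o k' o; have H3 := F3 o o i; have H4 := F3 k' o i.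
    have H5 := F3 o i k'; have H6 := F3 k' i o; have H7 := F3 i k' o.
    have sy a b : F (e a) (e a) (e b) (e b) = F (e b) (e b) (e a) (e a).
      by rewrite /F dotpC !(dotpC (e a) (e b)); field.
    suff -> : F (e k') (e k') (e i) (e i) = F (e o) (e o) (e i) (e i) + F (e k') (e k') (e o) (e o) - F (e o) (e o) (e o) (e o) by field.
    by move: H1 H2 H3 H4 H5 H6 H7; rewrite !(sy k' i) !(sy k' o) !(sy o i); lra.
Qed.

(** Otherwise the dyad of [o] and [o'] would vanish, whereas [shape_onto] provides a shape operator
    with nonzero entry there. *)
Lemma cQ_gt0 : 0 < cQ.
Proof.
rewrite /cQ mulr_gt0// dotp_gt0; apply/eqP => d0.
have [|xi [c xiE]] := @shape_onto (delta_mx o o' + delta_mx o' o).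
  by rewrite linearD/= !trmx_delta addrC.
have := nuvP (e o *m (e o')^T) xi; rewrite -/(dyad (e o) (e o')) d0 dotp0l tr_dyad xiE.
rewrite !deltaE mulmxDl mulmxDl !dyad_mul mul_scalar_mx !(dotpDr, dotpZr) !orthoframe_std !eqxx /=.
by rewrite mulr1 !mulr0n !mulr0 !addr0 !add0r => /esym/eqP; rewrite oner_eq0.
Qed.

Definition trless (X : 'M[R]_n) : 'M[R]_n := X - (\tr X / n%:R)%:M.

Definition shape0 xi := trless (A xi).

Lemma trless_sim0 X : X^T = X -> Sim0 (trless X).
Proof.
move=> XT; split; first by rewrite /trless linearB/= XT tr_scalar_mx.
by rewrite /trless linearB/= mxtrace_scalar -mulr_natr; field.
Qed.

Lemma shape0_sim0 xi : Sim0 (shape0 xi). Proof. exact: trless_sim0. Qed.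

Lemma trless_id X : \tr X = 0 -> trless X = X.
Proof. by move=> X0; rewrite /trless X0 mul0r raddf0 subr0. Qed.

Lemma tr_shape0 X xi : \tr X = 0 -> \tr (X *m shape0 xi) = dotp (nuv X) xi.
Proof.
by move=> X0; rewrite /shape0 /trless mulmxBr linearB/= mul_mx_scalar linearZ/= X0 mulr0 subr0 nuvP.
Qed.

Lemma tr_sim0_eq0 (X : 'M[R]_n) : Sim0 X -> \tr (X *m X) = 0 -> X = 0.
Proof. by move=> [XT _]; rewrite -{1}XT; exact: trmul_eq0. Qed.

Lemma shape0_eq0 xi : shape0 xi = 0 -> xi = 0.
Proof. by move=> /eqP; rewrite subr_eq0 => /eqP; exact: shape_scalar. Qed.

Lemma nuv_shape0 xi : nuv (shape0 xi) = cQ *: xi.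
Proof.
apply/eqP; rewrite -subr_eq0; apply/eqP; set v := _ - _.
have vY Y : Sim0 Y -> dotp v (nuv Y) = 0.
  move=> YS; have [_ Y0] := YS; rewrite /v dotpBl dotpZl nuv_dot//; last exact: shape0_sim0.
  by rewrite mxtrace_mulC (tr_shape0 xi Y0) [dotp xi _]dotpC subrr.
apply: shape0_eq0; apply: tr_sim0_eq0; first exact: shape0_sim0.
have vS := shape0_sim0 v; have [_ v0] := vS.
by rewrite (tr_shape0 v v0) dotpC vY.
Qed.

Lemma nuv_dotT (Z W : 'M[R]_n) : \tr Z = 0 -> \tr W = 0 ->
  dotp (nuv Z) (nuv W) = cQ * (\tr (Z *m W) + \tr (Z *m W^T)) / 2.
Proof.
have H (X : 'M[R]_n) : nuv X = 2^-1 *: nuv (X + X^T).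
  by rewrite linearD/= nuv_tr -mulr2n -[X in _ *: X]scaler_nat scalerA mulVf// scale1r.
have S (X : 'M[R]_n) : \tr X = 0 -> Sim0 (X + X^T).
  by move=> X0; split; rewrite linearD/= ?trmxK ?mxtrace_tr ?X0 ?addr0// addrC.
move=> Z0 W0; rewrite (H Z) (H W) dotpZl dotpZr nuv_dot; try exact: S.
rewrite mulmxDl !mulmxDr !linearD/=.
have -> : \tr (Z^T *m W^T) = \tr (Z *m W) by rewrite -trmx_mul mxtrace_tr mxtrace_mulC.
have -> : \tr (Z^T *m W) = \tr (Z *m W^T) by rewrite -mxtrace_tr trmx_mul trmxK mxtrace_mulC.
by field.
Qed.

Lemma curv_dyad (u : 'I_n -> 'cV[R]_n) i j l T zeta : orthoframe u -> i != j -> i != l -> j != l ->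
  (forall z, T *m z = nuv (A z *m (u i *m (u j)^T) - u i *m (u j)^T *m A z)) ->
  dotp (T *m zeta) (dyad (u i) (u l)) = - (cQ / 2 * dotp zeta (dyad (u j) (u l))).
Proof.
move=> uu ij il jl ->; rewrite /dyad nuv_dotT; last 2 first.
- by rewrite linearB/= mxtrace_mulC subrr.
- by rewrite -[u i *m _]mulmx1 tr_dyad mul1mx uu eq_sym (negbTE il).
set Z := _ - _; have Zv v : Z *m v = dotp (u j) v *: (A zeta *m u i) - dotp (u j) (A zeta *m v) *: u i.
  by rewrite /Z mulmxBl -(mulmxA (A zeta)) dyad_mul -scalemxAr -(mulmxA (u i *m _)) dyad_mul.
rewrite trmx_mul trmxK (dotpC zeta) -(nuv_tr (u j *m _)) trmx_mul trmxK nuvP.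
rewrite (mxtrace_mulC Z) (mxtrace_mulC Z) !tr_dyad !Zv.
rewrite !(dotpBr, dotpZr) !uu eqxx [j == i]eq_sym [l == i]eq_sym (negbTE ij) (negbTE il) (negbTE jl) mulr1n !mulr0n.
by field.
Qed.

Lemma shape0_nuv S : Sim0 S -> shape0 (nuv S) = cQ *: S.
Proof.
move=> SS; apply/eqP; rewrite -subr_eq0; apply/eqP; have LS := shape0_sim0 (nuv S).
have DS : Sim0 (shape0 (nuv S) - cQ *: S).
  by split; rewrite linearB/= linearZ/= ?LS.1 ?SS.1// LS.2 SS.2 mulr0 subr0.
apply: tr_sim0_eq0 => //; have key Y : Sim0 Y -> \tr (Y *m (shape0 (nuv S) - cQ *: S)) = 0.
  move=> YS; rewrite mulmxBr linearB/= (tr_shape0 _ YS.2) nuv_dot// -scalemxAr linearZ/= subrr.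
  by [].
exact: key.
Qed.

(** * Skew operators normalizing the holonomy algebra *)

Section normalizer.
Variable T : 'M[R]_k.
Hypothesis Tskew : T^T = - T.
Hypothesis Tnorm : forall S, S \in g -> T *m S - S *m T \in g.

(** [T] carried to traceless symmetric matrices by [nuv], written as a form to which the results on
    forms skew under exchange apply. *)
Let tform (x y z w : 'cV[R]_n) := dotp (T *m nuv (trless (x *m y^T))) (nuv (trless (z *m w^T))).

Let gsk S u v : S \in g -> dotp (S *m u) v = - dotp u (S *m v).
Proof. by move=> /gs.1 ST; exact: dotp_skew. Qed.

Let trless_off (u : 'I_n -> 'cV[R]_n) i j : orthoframe u -> i != j -> nuv (trless (u i *m (u j)^T)) = dyad (u i) (u j).
Proof.
move=> uu ij; rewrite trless_id// -[u i *m _]mulmx1 tr_dyad mul1mx uu eq_sym (negbTE ij).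
by [].
Qed.

(** Both [T, T3] and the bracket of [T, T1] with [T2] are in [g], so they map [xi] to vectors
    orthogonal to [eta]; eliminating the entry [Y], which involves [eta], leaves a relation on [xi]
    alone. *)
Lemma normalizer_entry (u : 'I_n -> 'cV[R]_n) (x : 'I_n -> R) j l : orthoframe u -> injective x -> j != l ->
  exists i, [/\ i != j, i != l &
    \sum_a x a * tform (u a) (u a) (u j) (u l) = 2 * (x j - x l) * tform (u i) (u j) (u i) (u l)].
Proof.
move=> uu xi_inj jl; have [xi [eta [c [y [xiu etau Hg Hy]]]]] := regular_pair uu xi_inj.
have [i [ij il D]] := Hy _ _ jl; exists i; split=> //.
have [T1 T1g T1E] := curv_nuv (u i *m (u j)^T).
have [T2 T2g T2E] := curv_nuv (u i *m (u l)^T).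
have [T3 T3g T3E] := curv_nuv (u j *m (u l)^T).
have xic a b : (x a + c) - (x b + c) = x a - x b by ring.
have e11 := curv_eigen etau T1E; have e12 := curv_eigen etau T2E; have e13 := curv_eigen etau T3E.
have e21 := curv_eigen xiu T1E; have e22 := curv_eigen xiu T2E; have e23 := curv_eigen xiu T3E.
rewrite xic in e21; rewrite xic in e22; rewrite xic in e23.
pose X := dotp (T *m xi) (dyad (u j) (u l)); pose Y := dotp (T *m eta) (dyad (u j) (u l)).
pose t := dotp (T *m dyad (u i) (u j)) (dyad (u i) (u l)).
have E1 : (x j - x l) * Y = (y j - y l) * X.
  have := Hg _ (Tnorm T3g); rewrite mulmxBl dotpBr -!mulmxA => /eqP; rewrite subr_eq0 => /eqP.
  have -> : dotp eta (T *m (T3 *m xi)) = - ((x j - x l) * Y).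
    by rewrite -[LHS]opprK -(dotp_skew _ _ Tskew) e23 dotpZr.
  have -> : dotp eta (T3 *m (T *m xi)) = - ((y j - y l) * X).
    by rewrite -[LHS]opprK -gsk// e13 dotpZl dotpC.
  by move=> /oppr_inj.
have E2 : ((y i - y j) * (x i - x l) - (y i - y l) * (x i - x j)) * t + cQ / 2 * ((x i - x l) * Y - (y i - y l) * X) = 0.
  have Sg := Tnorm T1g; have := Hg _ (gs.2 _ _ Sg T2g).
  rewrite mulmxBl dotpBr -!mulmxA => /eqP; rewrite subr_eq0 => /eqP.
  move=> H; have : dotp ((T *m T1 - T1 *m T) *m eta) (T2 *m xi) = dotp (T2 *m eta) ((T *m T1 - T1 *m T) *m xi).
    by rewrite !gsk// H.
  rewrite !mulmxBl -!mulmxA e11 e22 e12 e21 !(dotpZl, dotpZr, dotpBl, dotpBr) -!scalemxAr !(dotpZl, dotpZr).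
  rewrite (curv_dyad _ uu ij il jl T1E) -/Y [dotp (dyad (u i) (u l)) (T *m _)]dotpC -/t.
  rewrite [dotp (dyad (u i) (u l)) (T1 *m _)]dotpC (curv_dyad _ uu ij il jl T1E) -/X.
  by move=> /eqP; rewrite -subr_eq0 => /eqP <-; ring.
have xjl : x j - x l != 0 by rewrite subr_eq0; apply: contra_neq jl; exact: xi_inj.
have E3 : cQ * X = 2 * (x j - x l) * t.
  have : (x j - x l) * (((y i - y j) * (x i - x l) - (y i - y l) * (x i - x j)) * t + cQ / 2 * ((x i - x l) * Y - (y i - y l) * X)) = 0.
    by rewrite E2 mulr0.
  have -> : (x j - x l) * (((y i - y j) * (x i - x l) - (y i - y l) * (x i - x j)) * t + cQ / 2 * ((x i - x l) * Y - (y i - y l) * X)) =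
    (x j - x l) * ((y i - y j) * (x i - x l) - (y i - y l) * (x i - x j)) * t + cQ / 2 * ((x i - x l) * ((x j - x l) * Y) - (x j - x l) * (y i - y l) * X) by ring.
  rewrite E1 => H; apply: (mulfI D); rewrite -[RHS]subr0 -[in RHS](mul0r 2) -H; by field.
have -> : tform (u i) (u j) (u i) (u l) = t by rewrite /tform !trless_off.
rewrite -E3 /X -dotpZl scalemxAr -nuv_shape0.
have -> : shape0 xi = \sum_a x a *: trless (u a *m (u a)^T).
  have tru a : \tr (u a *m (u a)^T) = 1 by rewrite -[u a *m _]mulmx1 tr_dyad mul1mx uu eqxx.
  have E d : shape0 xi - \sum_a x a *: trless (u a *m (u a)^T) = d%:M -> d = 0.
    have trl a : \tr (trless (u a *m (u a)^T)) = 0.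
      by rewrite /trless linearB/= mxtrace_scalar tru -[_ *+ n]mulr_natr mulfVK ?subrr.
    have ts : \tr (\sum_a x a *: trless (u a *m (u a)^T)) = 0.
      by rewrite raddf_sum/=; apply: big1 => a _; rewrite linearZ/= trl mulr0.
    move=> /(congr1 mxtrace); rewrite raddfB/= (shape0_sim0 xi).2 ts subr0 mxtrace_scalar => /esym/eqP.
    by rewrite -mulr_natr mulf_eq0 (negbTE n0) orbF => /eqP.
  have H : shape0 xi - \sum_a x a *: trless (u a *m (u a)^T) =
      (c - \tr (A xi) / n%:R + (\sum_a x a) / n%:R)%:M.
    apply: (frame_mx_ext uu) => b; rewrite mulmxBl mul_scalar_mx /shape0 {1}/trless mulmxBl xiu mul_scalar_mx mulmx_suml.
    rewrite (eq_bigr (fun a => x a *: (dotp (u a) (u b) *: u a) - (x a / n%:R) *: u b)) => [|a _]; last first.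
      by rewrite -scalemxAl /trless tru mulmxBl dyad_mul mul_scalar_mx scalerBr !scalerA div1r.
    rewrite big_split/= (bigD1 b)//= big1 ?addr0 => [|a ab]; last by rewrite uu (negbTE ab) scale0r scaler0.
    rewrite uu eqxx scale1r sumrN -scaler_suml -mulr_suml; move: (u b) (\sum_a x a) => v sx.
    by apply/matrixP => i0 j0; rewrite !mxE; ring.
  by apply/eqP; rewrite -subr_eq0; move: (H) => ->; rewrite (E _ H) raddf0.
rewrite linear_sum mulmx_sumr dotp_suml; apply: eq_bigr => a _.
by rewrite linearZ/= -scalemxAr dotpZl /tform (trless_off uu jl).
Qed.

(** The relation of [normalizer_entry] involves an index [i] that is not under control. It is used
    for [n] diagonal matrices differing only in the entry at [m]; as [i] avoids [j], two of them
    share it, and their difference isolates the coefficient. *)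
Lemma normalizer_diag (u : 'I_n -> 'cV[R]_n) m j l : orthoframe u -> m != j -> m != l -> j != l ->
  tform (u m) (u m) (u j) (u l) = 0.
Proof.
move=> uu mj ml jl.
(* Shifting the entry at [m] by a multiple of [n] keeps the entries distinct. *)
pose x (s : 'I_n) (a : 'I_n) : R := (a + (a == m) * (s * n))%N%:R.
have x_inj s : injective (x s).
  move=> a b /(mulrIn (@oner_neq0 R)) H; apply: val_inj => /=; move: H.
  have [->|am] := eqVneq a m; have [->|bm] := eqVneq b m; rewrite ?mul1n ?mul0n ?addn0 //.
    by have := ltn_ord b; case: (nat_of_ord s) => [|q]; rewrite ?mul0n ?addn0// mulSn => + H; rewrite -H addnCA ltnNge leq_addr.
  by have := ltn_ord a; case: (nat_of_ord s) => [|q]; rewrite ?mul0n ?addn0// mulSn => + H; rewrite H addnCA ltnNge leq_addr.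
have /choice[i iP] := fun s => normalizer_entry uu (x_inj s) jl.
have [s [s' [ss ii]]] : exists s s', s != s' /\ i s = i s'.
  apply: contrapT => H; have inj : injective i.
    by move=> s s' ii; apply: contrapT => /eqP ss; apply: H; exists s, s'.
  have [f _ fi] := injF_bij inj; have [+ _ _] := iP (f j).
  by rewrite fi eqxx.
have [_ _ E] := iP s; have [_ _ E'] := iP s'.
have xo r a : a != m -> x r a = a%:R by move=> am; rewrite /x (negbTE am) mul0n addn0.
rewrite !xo 1?eq_sym// -ii in E'; rewrite !xo 1?eq_sym// -E' in E.
move: E; rewrite (bigD1 m)//= [RHS](bigD1 m)//=.
rewrite (eq_bigr (fun a : 'I_n => a%:R * tform (u a) (u a) (u j) (u l))) => [|a am]; last by rewrite xo.
rewrite [X in _ = _ + X](eq_bigr (fun a : 'I_n => a%:R * tform (u a) (u a) (u j) (u l))) => [|a am]; last by rewrite xo.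
move=> /addIr/eqP; rewrite -subr_eq0 -mulrBl mulf_eq0 => /orP[|/eqP//].
rewrite /x eqxx !mul1n subr_eq0 eqr_nat eqn_add2l eqn_pmul2r ?(ltn_trans _ hn)// => /eqP/val_inj E.
by rewrite E eqxx in ss.
Qed.

Lemma normalizer_shape : exists E, E^T = - E /\ forall xi, shape0 (T *m xi) = E *m shape0 xi - shape0 xi *m E.
Proof.
have tl_lin a (Z W : 'M[R]_n) : trless (a *: Z + W) = a *: trless Z + trless W.
  rewrite /trless linearD/= linearZ/= scalerBr mulrDl raddfD opprD addrACA -mulrA; congr (_ - _ + _).
  by rewrite scale_scalar_mx.
have tlT (Z : 'M[R]_n) : nuv (trless Z^T) = nuv (trless Z).
  have -> : trless Z^T = (trless Z)^T by rewrite /trless [RHS]linearB/= tr_scalar_mx mxtrace_tr.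
  exact: nuv_tr.
have uu : orthoframe e := @orthoframe_std R n.
have ttr z w : \sum_m tform (e m) (e m) z w = 0.
  rewrite /tform -dotp_suml -mulmx_sumr -linear_sum (_ : \sum_m _ = 0) ?linear0 ?mulmx0 ?dotp0l//.
  have -> : \sum_m trless (e m *m (e m)^T) = trless (\sum_m e m *m (e m)^T).
    rewrite /trless sumrB; congr (_ - _); rewrite [in RHS]linear_sum/= mulr_suml.
    by rewrite (raddf_sum (@scalar_mx R n)).
  have -> : \sum_m e m *m (e m)^T = 1%:M :> 'M[R]_n.
    apply: (frame_mx_ext uu) => b; rewrite mul1mx mulmx_suml (bigD1 b)//= big1 ?addr0 => [|a ab].
      by rewrite dyad_mul uu eqxx scale1r.
    by rewrite dyad_mul uu (negbTE ab) scale0r.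
  by rewrite /trless mxtrace1 divff// subrr.
have tl0 : trless 0 = 0 by rewrite /trless mxtrace0 mul0r raddf0 subr0.
have [| | | | | |E [ET EF]] := @skew_form_trace R n tform _ _ _ _ _ _ hn ttr.
- by move=> a x x' y z w; rewrite /tform mulmxDl -scalemxAl tl_lin linearD linearZ/= mulmxDr -scalemxAr dotpDl dotpZl.
- by move=> a x y z z' w; rewrite /tform mulmxDl -scalemxAl tl_lin [nuv (_ *: _ + _)]linearP dotpDr dotpZr.
- by move=> x y z w; rewrite /tform -(tlT (x *m _)) trmx_mul trmxK.
- by move=> x y z w; rewrite /tform -(tlT (z *m _)) trmx_mul trmxK.
- by move=> x y z w; rewrite /tform dotp_skew// dotpC.
- by move=> u m j l; exact: normalizer_diag.
pose sy (X : 'M[R]_n) := X + X^T; pose M (X : 'M[R]_n) := E *m X - X *m E.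
have syD a (X Y : 'M[R]_n) : sy (a *: X + Y) = a *: sy X + sy Y.
  by rewrite /sy linearD linearZ/= scalerDr addrACA.
have MD a (X Y : 'M[R]_n) : M (a *: X + Y) = a *: M X + M Y.
  by rewrite /M mulmxDr mulmxDl -scalemxAr -scalemxAl opprD addrACA scalerBr.
have sy0 : sy 0 = 0 by rewrite /sy trmx0 addr0.
have M0 : M 0 = 0 by rewrite /M mulmx0 mul0mx subrr.
have main X Y : dotp (T *m nuv (trless X)) (nuv (trless Y)) = 2^-1 * \tr (sy Y *m M (sy X)).
  move: X Y.
  have [||W WP] := @vspace_of_pred R 'M[R]_n (fun X => forall Y, dotp (T *m nuv (trless X)) (nuv (trless Y)) =
      2^-1 * \tr (sy Y *m M (sy X))).
  - by move=> Y; rewrite tl0 linear0 mulmx0 dotp0l sy0 M0 mulmx0 mxtrace0 mulr0.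
  - move=> a X1 X2 H1 H2 Y; rewrite tl_lin linearD linearZ/= mulmxDr -scalemxAr dotpDl dotpZl H1 H2 syD MD.
    by move: (sy Y) (M (sy X1)) (M (sy X2)) => Z1 Z2 Z3; rewrite mulmxDr -scalemxAr linearD linearZ/=; ring.
  move=> X; apply/WP; rewrite [X]matrix_sum_delta; apply: memv_suml => i _; apply: memv_suml => j _; apply: memvZ; apply/WP => Y.
  have [||W' W'P] := @vspace_of_pred R 'M[R]_n (fun Y => dotp (T *m nuv (trless (delta_mx i j))) (nuv (trless Y)) =
      2^-1 * \tr (sy Y *m M (sy (delta_mx i j)))).
  - by rewrite tl0 linear0 dotp0r sy0 mul0mx mxtrace0 mulr0.
  - move=> a X1 X2 H1 H2; rewrite tl_lin [nuv (_ *: _ + _)]linearP dotpDr dotpZr H1 H2 syD.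
    by move: (M _) (sy X1) (sy X2) => Z1 Z2 Z3; rewrite mulmxDl -scalemxAl linearD linearZ/=; ring.
  apply/W'P; rewrite [Y]matrix_sum_delta; apply: memv_suml => k' _; apply: memv_suml => l _; apply: memvZ; apply/W'P.
  by rewrite !deltaE -EF.
have MS X : Sim0 X -> Sim0 (M X).
  move=> [XT X0]; split; last by rewrite /M linearB/= mxtrace_mulC subrr.
  by rewrite /M linearB/= !trmx_mul XT ET mulNmx mulmxN opprK addrC.
have cn : cQ != 0 by rewrite gt_eqF// cQ_gt0.
(* The 2 comes from [sy], which doubles symmetric matrices on both sides of the factor 1/2 in
   [main]; [cQ] comes from inverting [nuv]. *)
exists ((2 / cQ) *: E); split=> [|xi]; first by rewrite linearZ/= ET scalerN.
rewrite -scalemxAl -scalemxAr -scalerBr -/(M (shape0 xi)).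
have xS := shape0_sim0 xi; have tS := shape0_sim0 (T *m xi); have mS := MS _ xS.
have syE X : Sim0 X -> sy X = 2 *: X by move=> [XT _]; rewrite /sy XT -mulr2n scaler_nat.
have MZ a X : M (a *: X) = a *: M X by rewrite -[a *: X]addr0 MD M0 addr0.
have key Y : Sim0 Y -> \tr (Y *m (shape0 (T *m xi) - (2 / cQ) *: M (shape0 xi))) = 0.
  move=> YS; have [_ Y0] := YS; rewrite mulmxBr linearB/= (tr_shape0 _ Y0).
  have := main (shape0 xi) Y; rewrite (trless_id xS.2) (trless_id Y0) nuv_shape0 -scalemxAr dotpZl.
  rewrite !syE// MZ -scalemxAl -!scalemxAr !linearZ/= dotpC => H.
  by apply: (mulfI cn); rewrite scalerN -[_ *: _]/((2 / cQ) * _) mulrBr H mulr0; field.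
apply/eqP; rewrite -subr_eq0; apply/eqP; apply: tr_sim0_eq0; last apply: key.
all: split; first by rewrite linearB/= linearZ/= tS.1 mS.1.
all: by rewrite linearB/= linearZ/= tS.2 mS.2 mulr0 subr0.
Qed.

End normalizer.

Lemma shape_summary : exists c : R, [/\ 0 < c, forall S, Sim0 S -> shape0 (nuv S) = c *: S,
  forall xi, nuv (shape0 xi) = c *: xi,
  forall Z W, \tr Z = 0 -> \tr W = 0 -> dotp (nuv Z) (nuv W) = c * (\tr (Z *m W) + \tr (Z *m W^T)) / 2 &
  forall T : 'M[R]_k, T^T = - T -> (forall S, S \in g -> T *m S - S *m T \in g) ->
    exists E, E^T = - E /\ forall xi, shape0 (T *m xi) = E *m shape0 xi - shape0 xi *m E].
Proof.
exists cQ; split; [exact: cQ_gt0|exact: shape0_nuv|exact: nuv_shape0|exact: nuv_dotT|exact: normalizer_shape].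
Qed.

End second_fundamental_form.
End irreducible_algebras.

(** * The equations of Gauss and Codazzi *)

Section codazzi.
Variables (R : realType) (n : nat).
Hypothesis hn : (2 < n)%N.

Let e (i : 'I_n) : 'cV[R]_n := delta_mx i 0.

(** [B] will be the difference between the rotation induced by the normal connection and the tangent
    connection, and [H] the derivative of the mean curvature. The Codazzi symmetry in [i] and [j]
    leaves no room for them, as comparing entries shows; a third index is available since 2 < n. *)
Lemma codazzi_zero (B H : 'I_n -> 'M[R]_n) : (forall i, (B i)^T = - B i) ->
  (forall i j z, let S v := e v *m z^T + z *m (e v)^T in
    B i *m S j - S j *m B i + dotp (e j) z *: H i = B j *m S i - S i *m B j + dotp (e i) z *: H j) ->
  forall i, B i = 0 /\ H i = 0.
Proof.
move=> BT HB; have uu : orthoframe e := @orthoframe_std R n.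
pose b i l m := dotp (e l) (B i *m e m); pose hh i l m := dotp (e l) (H i *m e m).
have bT i l m : b i l m = - b i m l by rewrite /b dotp_mulmxr BT mulNmx dotpNl dotpC.
pose d (i j : 'I_n) : R := (i == j)%:R.
have E i j k l m : d k m * b i l j + d j m * b i l k - d l j * b i k m - d l k * b i j m + d j k * hh i l m =
    d k m * b j l i + d i m * b j l k - d l i * b j k m - d l k * b j i m + d i k * hh j l m.
  have Sv i0 v : (e i0 *m (e k)^T + e k *m (e i0)^T) *m v = dotp (e k) v *: e i0 + dotp (e i0) v *: e k.
    by rewrite mulmxDl !dyad_mul.
  have bl i0 j0 : dotp (e l) ((B i0 *m (e j0 *m (e k)^T + e k *m (e j0)^T) - (e j0 *m (e k)^T + e k *m (e j0)^T) *m B i0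
      + dotp (e j0) (e k) *: H i0) *m e m) = d k m * b i0 l j0 + d j0 m * b i0 l k - d l j0 * b i0 k m - d l k * b i0 j0 m + d j0 k * hh i0 l m.
    rewrite mulmxDl mulmxBl -!mulmxA !Sv -scalemxAl mulmxDr -!scalemxAr !(dotpBr, dotpDr, dotpZr, dotpNr) !uu -/(b _ _ _) -/(hh _ _ _).
    by rewrite -/(d _ _) /b /hh /d; ring.
  by have := congr1 (fun Z => dotp (e l) (Z *m e m)) (HB i j (e k)); rewrite !bl.
have dii i : d i i = 1 by rewrite /d eqxx.
have dij i j : i != j -> d i j = 0 by move=> /negbTE ij; rewrite /d ij.
have sy (i j : 'I_n) : i != j -> j != i by rewrite eq_sym.
have third i j : exists l : 'I_n, l != i /\ l != j.
  apply: contrapT => Hl; have : (#|'I_n| <= #|pred2 i j|)%N.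
    by apply/subset_leq_card/fintype.subsetP => l _; rewrite !inE; apply/negPn/negP => /norP[li lj]; apply: Hl; exists l.
  by rewrite card_ord card2 leqNgt; case: (i != j); rewrite ?hn//= ltnW.
have bd i l : b i l l = 0 by have := bT i l l; lra.
have b1 i j k : i != j -> i != k -> j != k -> b i j k = 0.
  move=> ij ik jk; have := E i j k j j.
  rewrite !dii !(dij _ _ ij) !(dij _ _ jk) !(dij _ _ (sy _ _ jk)) !(dij _ _ (sy _ _ ij)) !(dij _ _ ik).
  have := bT i j k; lra.
have h1 i l : l != i -> hh i l l = 0.
  move=> li; have [j [ji jl]] := third i l; have := E i j j l l.
  rewrite !dii !(dij _ _ jl) !(dij _ _ (sy _ _ jl)) !(dij _ _ (sy _ _ li)) !(dij _ _ li) !(dij _ _ (sy _ _ ji)); lra.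
have b2 i j : i != j -> b j j i = 0.
  move=> ij; have := E i j j j j; rewrite !dii !(dij _ _ ij) !(dij _ _ (sy _ _ ij)) (h1 _ _ (sy _ _ ij)).
  have := bT j j i; lra.
have b0 i l m : b i l m = 0.
  have [->|lm] := eqVneq l m; first exact: bd.
  have [->|li] := eqVneq i l; first by apply: b2; rewrite eq_sym.
  have [->|mi] := eqVneq i m; first by rewrite bT b2// oppr0.
  exact: b1.
have zero (Z : 'M[R]_n) : (forall l m, dotp (e l) (Z *m e m) = 0) -> Z = 0.
  by move=> Zlm; apply: (frame_mx_ext uu) => m; apply: (orthoframe_ext uu) => l; rewrite mul0mx dotp0r.
move=> i; split; apply: zero => l m; first exact: b0.
have [j [ji _]] := third i i; have := E i j j l m; rewrite !b0 dii (dij _ _ (sy _ _ ji)).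
by rewrite -/(hh i l m); lra.
Qed.

End codazzi.

(** * Structure equations and the isometry with traceless symmetric matrices *)

Section gauss_codazzi.
Variables (R : realType) (N n k : nat) (h : {vspace 'M[R]_N}) (p : 'cV[R]_N).
Variables (e : 'M[R]_(N, n)) (F : 'M[R]_(N, k)) (g : {vspace 'M[R]_k}).
Hypothesis hn : (2 < n)%N.
Hypothesis hk : k.+1 = (n * n.+1)./2.
Hypothesis hh : lie_so h.
Hypothesis pp : dotp p p = 1.
Hypothesis ee : e^T *m e = 1%:M.
Hypothesis FF : F^T *m F = 1%:M.
Hypothesis ep : e^T *m p = 0.
Hypothesis Fp : F^T *m p = 0.
Hypothesis Fe : F^T *m e = 0.
Hypothesis res : p *m p^T + e *m e^T + F *m F^T = 1%:M.
Hypothesis tan : forall X, X \in h -> F^T *m (X *m p) = 0.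
Hypothesis onto : forall x, exists2 X, X \in h & X *m p = e *m x.
Hypothesis gs : lie_so g.
Hypothesis gc : forall X Y, X \in h -> Y \in h -> ncurv F X Y \in g.
Hypothesis ga : forall X T, X \in h -> T \in g -> nu F X *m T - T *m nu F X \in g.
Hypothesis gz : (forall X Y, X \in h -> Y \in h -> ncurv F X Y = 0) -> g = 0%VS.
Hypothesis irr : forall W : {vspace 'cV[R]_k},
  (forall T x, T \in g -> x \in W -> T *m x \in W) -> W = 0%VS \/ W = fullv.
Hypothesis ntr : forall v : 'cV[R]_k, v != 0 ->
  exists2 eta, (forall c : R, eta != c *: v) & forall T, T \in g -> dotp eta (T *m v) = 0.

(** In the splitting into the line of [p], the tangent space and the normal space, [tau], [tt] and
    [a] are blocks of an element of [h]; the normal block is [nu F]. *)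
Let tau X := e^T *m (X *m p).
Let tt X := e^T *m X *m e.
Let a X := F^T *m X *m e.

Let hT X : X \in h -> X^T = - X. Proof. by move=> /hh.1. Qed.

Let Xp X : X \in h -> X *m p = e *m tau X.
Proof.
move=> Xh; rewrite -{1}[X *m p]mul1mx -res !mulmxDl -!mulmxA (tan Xh) mulmx0 addr0.
have -> : p^T *m (X *m p) = 0.
  by apply/matrixP => i j; rewrite !ord1 [RHS]mxE -[LHS]/(dotp p (X *m p)) dotpC dotp_skew0// hT.
by rewrite mulmx0 add0r.
Qed.

Let Xe X : X \in h -> X *m e = - (p *m (tau X)^T) + e *m tt X + F *m a X.
Proof.
move=> Xh; rewrite -{1}[X *m e]mul1mx -res !mulmxDl -!mulmxA /tt /a !mulmxA; congr (_ + _ + _).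
rewrite -!mulmxA; have -> : p^T *m (X *m e) = - (tau X)^T; last by rewrite mulmxN.
have H : (p^T *m (X *m e))^T = - tau X by rewrite trmx_mul trmxK trmx_mul hT// mulmxN mulNmx -mulmxA.
by rewrite -[LHS]trmxK H linearN.
Qed.

Let aT X : X \in h -> (a X)^T = - (e^T *m (X *m F)).
Proof. by move=> Xh; rewrite trmx_mul trmx_mul trmxK hT// mulNmx mulmxN. Qed.

Let XF X : X \in h -> X *m F = - (e *m (a X)^T) + F *m nu F X.
Proof.
move=> Xh; rewrite -{1}[X *m F]mul1mx -res !mulmxDl -!mulmxA.
have -> : p^T *m (X *m F) = 0.
  by apply: trmx_inj; rewrite !trmx_mul trmxK hT// mulmxN mulNmx -mulmxA tan// oppr0 trmx0.
by rewrite mulmx0 add0r aT// mulmxN opprK /nu !mulmxA.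
Qed.

Let ttT X : X \in h -> (tt X)^T = - tt X.
Proof. by move=> Xh; rewrite /tt !trmx_mul trmxK hT// mulNmx mulmxN mulmxA. Qed.

(** The symmetry of the second fundamental form: the bracket of [X] and [Y] is again tangent at
    [p]. *)
Let a_sym X Y : X \in h -> Y \in h -> a X *m tau Y = a Y *m tau X.
Proof.
move=> Xh Yh; have := tan (hh.2 _ _ Xh Yh); rewrite mulmxBl -!mulmxA !Xp// mulmxBr !mulmxA => /eqP.
by rewrite subr_eq0 /a => /eqP.
Qed.

Let basis : exists xb : 'I_n -> 'M[R]_N, forall i, xb i \in h /\ tau (xb i) = delta_mx i 0.
Proof.
have H i : exists X, X \in h /\ tau X = delta_mx i 0.
  by have [X Xh XE] := onto (delta_mx i 0); exists X; rewrite /tau XE mulmxA ee mul1mx.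
by have /choice[xb xbP] := H; exists xb.
Qed.

Let dotE m (y : 'cV[R]_m) i : y i 0 = dotp (delta_mx i 0) y.
Proof.
rewrite dotpE (bigD1 i)//= big1 ?addr0 => [|l li]; rewrite mxE ?eqxx ?mul1r//.
by rewrite (negbTE li) mul0r.
Qed.

(** [nv] extends the second fundamental form to matrices and [A] is the shape operator. The Codazzi
    equation identifies the action of the normal connection with that of the tangent one and makes
    the mean curvature vanish; the constant [c] results from computing one curvature by Gauss and by
    Ricci. *)
Lemma gauss_codazzi : exists (nv : {linear 'M[R]_n -> 'cV[R]_k}) (A : 'cV[R]_k -> 'M[R]_n),
  let c : R := n%:R / n.+1%:R in
  [/\ forall X, X \in h -> (forall z, F^T *m X *m e *m z = nv (e^T *m (X *m p) *m z^T)) /\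
       (forall xi, (F^T *m X *m e)^T *m xi = A xi *m (e^T *m (X *m p))),
     nv 1%:M = 0 /\ forall X, nv X^T = nv X,
     forall S, Sim0 S -> A (nv S) = c *: S,
     forall Z W, dotp (nv Z) (nv W) = c * ((\tr (Z *m W) + \tr (Z *m W^T)) / 2 - \tr Z * \tr W / n%:R) &
     (forall xi, Sim0 (A xi) /\ nv (A xi) = c *: xi) /\
     forall X, X \in h -> forall S, Sim0 S -> nu F X *m nv S = nv (e^T *m X *m e *m S - S *m (e^T *m X *m e))].
Proof.
have [xb xbP] := basis; have xbh i := (xbP i).1; have xbt i := (xbP i).2.
have [Al AlE] : exists Al : {linear 'cV[R]_k -> 'M[R]_n}, forall xi i j, Al xi i j = ((a (xb i))^T *m xi) j 0.
  pose A0 (xi : 'cV[R]_k) : 'M[R]_n := \matrix_(i, j) ((a (xb i))^T *m xi) j 0.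
  have A0lin : linear A0.
    by move=> s x y; apply/matrixP => i j; rewrite [LHS]mxE mulmxDr -scalemxAr !mxE.
  pose A := GRing.isLinear.Build R 'cV[R]_k 'M[R]_n _ A0 A0lin.
  by exists (HB.pack A0 A : {linear 'cV[R]_k -> 'M[R]_n}) => xi i j; rewrite /= mxE.
have AP X xi : X \in h -> Al xi *m tau X = (a X)^T *m xi.
  move=> Xh; apply/matrixP => i j; rewrite ord1 !dotE.
  transitivity (dotp ((a (xb i))^T *m xi) (tau X)).
    by rewrite -dotE dotpE mxE; apply: eq_bigr => l _; rewrite AlE.
  by rewrite dotpC !dotp_mulmxr !trmxK (a_sym (xbh i) Xh) xbt.
have AT xi : (Al xi)^T = Al xi.
  apply/matrixP => i j; rewrite mxE !AlE !dotE !dotp_mulmxr !trmxK -(xbt i) -(xbt j).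
  by rewrite (a_sym (xbh i) (xbh j)).
have ncE X Y : X \in h -> Y \in h -> ncurv F X Y = a X *m (a Y)^T - a Y *m (a X)^T.
  have E X' Y' : X' \in h -> Y' \in h -> nu F (X' *m Y') = - (a X' *m (a Y')^T) + nu F X' *m nu F Y'.
    by move=> Xh Yh; rewrite {1}/nu -!mulmxA XF// !mulmxDr !mulmxN !mulmxA.
  move=> Xh Yh; rewrite /ncurv nuB !E//; move: (nu F X *m _) (nu F Y *m _) (a X *m _) (a Y *m _) => *.
  by apply/matrixP => i j; rewrite !mxE; ring.
have ncdot X Y xi eta : X \in h -> Y \in h -> dotp eta (ncurv F X Y *m xi) =
    dotp (Al eta *m tau X) (Al xi *m tau Y) - dotp (Al eta *m tau Y) (Al xi *m tau X).
  move=> Xh Yh; rewrite ncE// mulmxBl dotpBr -(mulmxA (a X)) -(mulmxA (a Y)) !AP//.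
  by congr (_ - _); exact: dotp_mulmxr.
have brE i j xi eta : dotp (Al eta *m delta_mx i 0) (Al xi *m delta_mx j 0) - dotp (Al eta *m delta_mx j 0) (Al xi *m delta_mx i 0)
    = (Al eta *m Al xi - Al xi *m Al eta) i j.
  rewrite dotp_mulmxl AT [X in _ - X]dotpC [X in _ - X]dotp_mulmxl AT.
  by rewrite !mulmxA -!dotE -!colE !mxE.
have hR B : exists2 T, T \in g & forall xi eta, dotp eta (T *m xi) = \tr (B^T *m (Al eta *m Al xi - Al xi *m Al eta)).
  exists (\sum_i \sum_j B i j *: ncurv F (xb i) (xb j)).
    by apply: memv_suml => i _; apply: memv_suml => j _; apply: memvZ; exact: gc.
  move=> xi eta; rewrite mulmx_suml dotp_sumr /mxtrace.
  under [RHS]eq_bigr do rewrite mxE.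
  rewrite [RHS]exchange_big; apply: eq_bigr => i _; rewrite mulmx_suml dotp_sumr; apply: eq_bigr => j _.
  by rewrite -scalemxAl dotpZr ncdot// !xbt brE [B^T _ _]mxE.
(* Otherwise the normal curvature and [g] vanish, and every line would be stable although 1 < k. *)
have noncomm : exists xi eta, Al xi *m Al eta - Al eta *m Al xi <> 0.
  apply: contrapT => H; have com xi eta : Al xi *m Al eta = Al eta *m Al xi.
    by apply/eqP; rewrite -subr_eq0; apply/eqP; apply: contrapT => H'; apply: H; exists xi, eta.
  have g0 : g = 0%VS.
    apply: gz => X Y Xh Yh; apply: mx_ext => xi; rewrite mul0mx; apply: dotp_ext => eta.
    rewrite dotp0l dotpC ncdot// dotp_mulmxl AT mulmxA com -mulmxA -[in X in X - _]AT -dotp_mulmxl.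
    by rewrite [X in X - _]dotpC subrr.
  have k1 : (1 < k)%N.
    have : (6 <= k.+1)%N; last by case: (k) => [|[|]].
    by rewrite hk; apply: (@half_leq (3 * 4)); exact: leq_mul.
  pose d0 : 'cV[R]_k := delta_mx (Ordinal (ltnW k1)) 0.
  have [T x|W0|Wf] := irr (W := <[d0]>%VS).
  - by rewrite g0 memv0 => /eqP -> _; rewrite mul0mx mem0v.
  - have : d0 \in 0%VS by rewrite -W0 memv_line.
    rewrite memv0 => /eqP/matrixP/(_ (Ordinal (ltnW k1)) 0)/eqP.
    by rewrite !mxE !eqxx oner_eq0.
  - have := congr1 (fun W => \dim W) Wf; rewrite dim_vline dimvf /dim/= muln1 => E.
    by have := k1; rewrite -[X in (_ < X)%N]E; case: (_ != _).
have [c [c0 LN NL NN nrm]] := shape_summary gs irr ntr AT hR noncomm hk hn.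
have faith := shape_faithful gs irr ntr AT hR noncomm.
have n0 : n%:R != 0 :> R by rewrite pnatr_eq0 -lt0n (ltn_trans _ hn).
have cn : c != 0 by rewrite gt_eqF.
pose L := shape0 Al.
have Ls xi : Sim0 (L xi) by apply: shape0_sim0.
have nD X Y : nuv Al (X + Y) = nuv Al X + nuv Al Y by rewrite linearD.
have nB X Y : nuv Al (X - Y) = nuv Al X - nuv Al Y by rewrite linearB.
have nZ s X : nuv Al (s *: X) = s *: nuv Al X by rewrite linearZ.
have nT X : nuv Al X^T = nuv Al X by apply: nuv_tr.
have nS X : nuv Al (X + X^T) = 2 *: nuv Al X by rewrite nD nT -mulr2n scaler_nat.
have nI S S' : Sim0 S -> Sim0 S' -> nuv Al S = nuv Al S' -> S = S'.
  by move=> SS SS' E; apply: (scalerI cn); rewrite -!LN// E.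
have da X z : X \in h -> a X *m z = nuv Al (tau X *m z^T).
  move=> Xh; apply: dotp_ext => w; rewrite nuvP tr_dyad AP//; exact: dotp_mulmxl.
pose H1 := nuv Al 1%:M.
have SM (E S : 'M[R]_n) : E^T = - E -> Sim0 S -> Sim0 (E *m S - S *m E).
  move=> ET [ST S0]; split; last by rewrite linearB/= mxtrace_mulC subrr.
  by rewrite linearB/= !trmx_mul ST ET mulNmx mulmxN opprK addrC.
have Sadd (S S' : 'M[R]_n) : Sim0 S -> Sim0 S' -> Sim0 (S + S').
  by move=> [ST S0] [ST' S0']; split; rewrite linearD/= ?ST ?ST'// S0 S0' addr0.
have Ssc s (S : 'M[R]_n) : Sim0 S -> Sim0 (s *: S).
  by move=> [ST S0]; split; rewrite linearZ/= ?ST// S0 mulr0.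
have nE X E : X \in h -> (forall xi, L (nu F X *m xi) = E *m L xi - L xi *m E) ->
    forall S, Sim0 S -> nu F X *m nuv Al S = nuv Al (E *m S - S *m E).
  move=> Xh XE S SS; apply: (scalerI cn); rewrite -NL -/(L _) XE /L LN//.
  by rewrite -scalemxAr -scalemxAl -scalerBr nZ.
pose sy (y z : 'cV[R]_n) := y *m z^T + z *m y^T.
have syT y z : (sy y z)^T = sy y z by rewrite /sy linearD/= !trmx_mul !trmxK addrC.
have trd (y z : 'cV[R]_n) : \tr (y *m z^T) = dotp z y.
  by rewrite -[y *m _]mulmx1 tr_dyad mul1mx.
have sytr y z : \tr (sy y z) = 2 * dotp y z.
  by rewrite /sy linearD/= !trd (dotpC z); ring.
have nsy y z : nuv Al (sy y z) = 2 *: nuv Al (y *m z^T).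
  by rewrite -nS trmx_mul trmxK.
(* Encodes the derivative [nu F X *m H1] of the trace of the second fundamental form as a traceless
   symmetric matrix, so that the Codazzi equation can be written between such matrices. *)
pose hX X := (2 / (n%:R * c)) *: L (nu F X *m H1).
have hXs X : Sim0 (hX X) by apply: Ssc.
have hXn X : nuv Al (hX X) = (2 / n%:R) *: (nu F X *m H1).
  by rewrite nZ NL scalerA; congr (_ *: _); field; apply/andP.
have nuE X E y z : X \in h -> (forall xi, L (nu F X *m xi) = E *m L xi - L xi *m E) ->
    2 *: (nu F X *m nuv Al (y *m z^T)) = nuv Al (E *m sy y z - sy y z *m E + dotp y z *: hX X).
  move=> Xh XE; rewrite scalemxAr -nsy.
  have {1}-> : sy y z = trless (sy y z) + (2 * dotp y z / n%:R) *: 1%:M.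
    by rewrite /trless sytr scalemx1 subrK.
  rewrite nD nZ mulmxDr (nE _ _ Xh XE); last exact: trless_sim0.
  rewrite -/H1 [RHS]nD nZ hXn -scalemxAr scalerA /trless sytr mulmxBl mulmxBr mul_mx_scalar mul_scalar_mx.
  congr (nuv Al _ + _ *: _); last by rewrite mulrCA mulrA.
  by move: (E *m sy y z) (sy y z *m E) => Z1 Z2; apply/matrixP => i j; rewrite !mxE; ring.
(* The Codazzi equation, read off the normal-tangent block of the bracket of [X] and [Y]. *)
have cod X Y z : X \in h -> Y \in h ->
    nu F X *m nuv Al (tau Y *m z^T) - nuv Al (tt X *m tau Y *m z^T) - nuv Al (tau Y *m (tt X *m z)^T) =
    nu F Y *m nuv Al (tau X *m z^T) - nuv Al (tt Y *m tau X *m z^T) - nuv Al (tau X *m (tt Y *m z)^T).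
  move=> Xh Yh; have XYh := hh.2 _ _ Xh Yh.
  have E1 X' Y' : X' \in h -> Y' \in h -> F^T *m (X' *m (Y' *m e)) = a X' *m tt Y' + nu F X' *m a Y'.
    move=> Xh' Yh'; rewrite Xe// !mulmxDr mulmxN mulmxN !mulmxA -(mulmxA F^T X' p) tan// mul0mx oppr0 add0r.
    by [].
  have E2 : a (X *m Y - Y *m X) = a X *m tt Y + nu F X *m a Y - (a Y *m tt X + nu F Y *m a X).
    by rewrite -!E1// /a mulmxBr mulmxBl !mulmxA.
  have E3 : tau (X *m Y - Y *m X) = tt X *m tau Y - tt Y *m tau X.
    by rewrite {1}/tau mulmxBl mulmxBr -!mulmxA !Xp// /tt !mulmxA.
  have := da _ z XYh; rewrite E2 E3.
  have -> : (a X *m tt Y + nu F X *m a Y - (a Y *m tt X + nu F Y *m a X)) *m z =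
      nuv Al (tau X *m (tt Y *m z)^T) + nu F X *m nuv Al (tau Y *m z^T) -
      (nuv Al (tau Y *m (tt X *m z)^T) + nu F Y *m nuv Al (tau X *m z^T)).
    rewrite -!da//; move: (a X) (a Y) (tt X) (tt Y) (nu F X) (nu F Y) => a1 a2 t1 t2 v1 v2.
    by rewrite mulmxBl !mulmxDl !mulmxA.
  rewrite mulmxBl nB.
  move: (nu F X *m nuv Al (tau Y *m z^T)) (nu F Y *m nuv Al (tau X *m z^T)) (nuv Al (tau X *m (tt Y *m z)^T))
    (nuv Al (tau Y *m (tt X *m z)^T)) (nuv Al (tt X *m tau Y *m z^T)) (nuv Al (tt Y *m tau X *m z^T)) => u1 u2 u3 u4 u5 u6.
  move=> /eqP; rewrite -subr_eq0 => /eqP H; apply/eqP; rewrite -subr_eq0 -H; apply/eqP.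
  by apply/matrixP => i j; rewrite !mxE; ring.
have CZ X Y E E' z : X \in h -> Y \in h -> E^T = - E -> E'^T = - E' ->
    (forall xi, L (nu F X *m xi) = E *m L xi - L xi *m E) ->
    (forall xi, L (nu F Y *m xi) = E' *m L xi - L xi *m E') ->
    (E - tt X) *m sy (tau Y) z - sy (tau Y) z *m (E - tt X) + dotp (tau Y) z *: hX X =
    (E' - tt Y) *m sy (tau X) z - sy (tau X) z *m (E' - tt Y) + dotp (tau X) z *: hX Y.
  move=> Xh Yh ET ET' XE YE.
  have dec X' y E0 : X' \in h -> E0^T = - E0 -> (forall xi, L (nu F X' *m xi) = E0 *m L xi - L xi *m E0) ->
      nuv Al ((E0 - tt X') *m sy y z - sy y z *m (E0 - tt X') + dotp y z *: hX X') =
      2 *: (nu F X' *m nuv Al (y *m z^T) - nuv Al (tt X' *m y *m z^T) - nuv Al (y *m (tt X' *m z)^T)).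
    move=> Xh' E0T XE'; rewrite !scalerBr (nuE _ _ y z Xh' XE') -!nS -!nB; congr (nuv Al _).
    have TT := ttT Xh'; move: (tt X') TT => T TT.
    rewrite !trmx_mul !trmxK TT /sy !(mulmxBl, mulmxBr, mulmxDl, mulmxDr, mulmxN, mulNmx) !mulmxA.
    move: (dotp y z *: hX X') => D; move: y z => y z.
    move: (E0 *m y *m z^T) (E0 *m z *m y^T) (T *m y *m z^T) (T *m z *m y^T) (y *m z^T *m E0) (z *m y^T *m E0) (y *m z^T *m T) (z *m y^T *m T) => *.
    by apply/matrixP => i j; rewrite !mxE; ring.
  have sk X' E0 : X' \in h -> E0^T = - E0 -> (E0 - tt X')^T = - (E0 - tt X').
    by move=> Xh' E0T; rewrite linearB/= E0T ttT// opprB opprK addrC.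
  have sm X' y E0 : X' \in h -> E0^T = - E0 ->
      Sim0 ((E0 - tt X') *m sy y z - sy y z *m (E0 - tt X') + dotp y z *: hX X').
    move=> Xh' E0T; apply: Sadd; last exact: Ssc.
    have S0 := trless_sim0 hn (syT y z); have := SM _ _ (sk _ _ Xh' E0T) S0.
    move: (E0 - tt X') (sy y z) => Z1 Z2; rewrite /trless mulmxBr mulmxBl mul_mx_scalar mul_scalar_mx.
    by rewrite opprB addrA subrK.
  apply: nI; [exact: sm|exact: sm|].
  rewrite (dec X (tau Y) E Xh ET XE) (dec Y (tau X) E' Yh ET' YE); congr (_ *: _).
  exact: (cod X Y z Xh Yh).
have Eex X : X \in h -> exists E, E^T = - E /\ forall xi, L (nu F X *m xi) = E *m L xi - L xi *m E.
  by move=> Xh; apply: nrm; [exact: (nu_skew hh F Xh)|move=> S; exact: ga].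
have /choice[Eb EbP] := fun i => Eex _ (xbh i).
have skb X E : X \in h -> E^T = - E -> (E - tt X)^T = - (E - tt X).
  by move=> Xh ET; rewrite linearB/= ET ttT// opprB opprK addrC.
have Bz := @codazzi_zero R n hn (fun i => Eb i - tt (xb i)) (fun i => hX (xb i)).
have {}Bz i : Eb i - tt (xb i) = 0 /\ hX (xb i) = 0.
  apply: Bz => [j|i' j z]; first by apply: skb => //; case: (EbP j).
  have [E1 E2] := EbP i'; have [E3 E4] := EbP j.
  by have := CZ _ _ _ _ z (xbh i') (xbh j) E1 E3 E2 E4; rewrite !xbt.
(* The terms of the basis vectors being zero, [codazzi_zero] is applied once more, to constant
   families made from [X]. *)
have Xall X : X \in h -> (forall xi, L (nu F X *m xi) = tt X *m L xi - L xi *m tt X) /\ nu F X *m H1 = 0.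
  move=> Xh; have [E [ET XE]] := Eex _ Xh.
  have [||B0 h0] := @codazzi_zero R n hn (fun=> E - tt X) (fun=> hX X) _ _ (Ordinal (ltnW (ltnW hn))).
  - by move=> _; exact: skb.
  - have Z j z : (E - tt X) *m sy (delta_mx j 0) z - sy (delta_mx j 0) z *m (E - tt X) + dotp (delta_mx j 0) z *: hX X = 0.
      have [E3 E4] := EbP j; have [b0 h0] := Bz j.
      have := CZ _ _ _ _ z Xh (xbh j) ET E3 XE E4; rewrite xbt b0 h0 => ->.
      by rewrite mul0mx mulmx0 scaler0 subrr addr0.
    by move=> i j z; exact: etrans (Z j z) (esym (Z i z)).
  - split.
      by move/eqP: B0; rewrite subr_eq0 => /eqP <-.
    have := hXn X; rewrite h0 linear0 => /esym/eqP; rewrite scaler_eq0 => /orP[|/eqP//].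
    by rewrite mulf_eq0 invr_eq0 (negbTE n0) orbF pnatr_eq0.
(* A vector killed by every [nu F X] is killed by the normal curvature; by Ricci its shape operator
   commutes with all the others, and [faith] applies. *)
have H10 : H1 = 0.
  apply: faith => eta; apply/eqP; rewrite -subr_eq0; apply/eqP/matrixP => i j.
  have kill : ncurv F (xb i) (xb j) *m H1 = 0.
    have [ki kj] := ((Xall _ (xbh i)).2, (Xall _ (xbh j)).2).
    have kij := (Xall _ (hh.2 _ _ (xbh i) (xbh j))).2.
    rewrite /ncurv; move: (nu F (xb i)) (nu F (xb j)) (nu F (_ - _)) ki kj kij => Z1 Z2 Z3 ki kj kij.
    by rewrite !mulmxBl kij -!mulmxA ki kj !mulmx0 subrr subr0.
  have := ncdot _ _ H1 eta (xbh i) (xbh j); rewrite kill dotp0r !xbt brE => /esym H.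
  by rewrite -opprB mxE H oppr0 mxE.
have n1 : nuv Al 1%:M = 0 by exact: H10.
have AL xi : L xi = Al xi.
  by rewrite /L /shape0 trless_id// -[Al xi]mul1mx -nuvP n1 dotp0l.
have dotg Z W : dotp (nuv Al Z) (nuv Al W) = c * ((\tr (Z *m W) + \tr (Z *m W^T)) / 2 - \tr Z * \tr W / n%:R).
  have ntl X : nuv Al X = nuv Al (trless X) by rewrite /trless nB -scalemx1 nZ n1 scaler0 subr0.
  have tl0 X : \tr (trless X : 'M[R]_n) = 0 by rewrite /trless linearB/= mxtrace_scalar -[_ *+ n]mulr_natr mulfVK// subrr.
  have tl2 X Y : \tr (trless X *m trless Y : 'M[R]_n) = \tr (X *m Y) - \tr X * \tr Y / n%:R.
    rewrite {1}/trless mulmxBl linearB/= mul_scalar_mx linearZ/= tl0 mulr0 subr0.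
    by rewrite /trless mulmxBr linearB/= mul_mx_scalar linearZ/=; congr (_ - _); field.
  have tlT X : (trless X)^T = trless X^T :> 'M[R]_n by rewrite /trless [LHS]linearB/= tr_scalar_mx mxtrace_tr.
  by rewrite ntl [nuv Al W]ntl NN// tlT !tl2 mxtrace_tr; field.
pose i0 : 'I_n := Ordinal (ltnW (ltnW hn)); pose i1 : 'I_n := Ordinal (ltnW hn).
have uu := @orthoframe_std R n; pose e0 : 'cV[R]_n := delta_mx i0 0; pose e1 : 'cV[R]_n := delta_mx i1 0.
have [u00 u11 u01 u10] : [/\ dotp e0 e0 = 1, dotp e1 e1 = 1, dotp e0 e1 = 0 & dotp e1 e0 = 0].
  by rewrite /e0 /e1 !uu.
have aTa X Y : X \in h -> Y \in h -> (a X)^T *m a Y =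
    (c / 2) *: (tau Y *m (tau X)^T) + (c / 2 * dotp (tau X) (tau Y)) *: 1%:M - (c / n%:R) *: (tau X *m (tau Y)^T).
  move=> Xh Yh; apply: (frame_mx_ext uu) => m; apply: (orthoframe_ext uu) => l.
  move: (delta_mx m 0) (delta_mx l 0) => v u; rewrite -mulmxA dotp_mulmxr trmxK !da// dotg.
  rewrite trmx_mul trmxK !tr_dyad !dyad_mul !trd !dotpZr.
  move: (tau X) (tau Y) => x y; rewrite mulmxBl mulmxDl -!scalemxAl mul1mx !dyad_mul !(dotpBr, dotpDr, dotpZr).
  by rewrite (dotpC u v) (dotpC v x) (dotpC u y) (dotpC y x) (dotpC u x) (dotpC v y); field.
have ttM X Y : X \in h -> Y \in h -> tt (X *m Y) = - (tau X *m (tau Y)^T) + tt X *m tt Y - (a X)^T *m a Y.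
  move=> Xh Yh; rewrite {1}/tt -!mulmxA Xe// aT// mulNmx opprK !mulmxDr !mulmxN /tau /tt !mulmxA.
  by [].
have cE : c = n%:R / n.+1%:R.
  pose X := xb i0; pose Y := xb i1; pose S := e0 *m e0^T - e1 *m e1^T; pose G := sy e0 e1.
  have [Xh Yh] : X \in h /\ Y \in h by split; exact: xbh.
  have [tX tY] : tau X = e0 /\ tau Y = e1 by rewrite /X /Y !xbt.
  have SS : Sim0 S.
    by split; rewrite /S linearB/= ?trmx_mul ?trmxK ?trmx_mul ?trmxK// !trd u00 u11 subrr.
  have GS : Sim0 G by split; [exact: syT|rewrite sytr u01 mulr0].
  have XYh := hh.2 _ _ Xh Yh.
  pose Om := tt X *m tt Y - tt Y *m tt X - tt (X *m Y - Y *m X).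
  (* The sectional curvature of [M] given by Gauss. The Ricci computation makes it c / 2, and 1 = c
     / 2 + c (n + 2) / (2 n) gives the value of [c]. *)
  pose kap := 1 - c * (n%:R + 2) / (2 * n%:R).
  have OmE : Om = kap *: (e0 *m e1^T - e1 *m e0^T).
    rewrite /Om; have -> : tt (X *m Y - Y *m X) = tt (X *m Y) - tt (Y *m X) by rewrite /tt mulmxBr mulmxBl.
    rewrite !ttM// !aTa// !tX !tY u01 u10; move: (tt X *m _) (tt Y *m _) (e0 *m _) (e1 *m _) => Z1 Z2 Z3 Z4.
    by apply/matrixP => i j; rewrite !mxE /kap; field.
  have L1 : L (ncurv F X Y *m nuv Al S) = c *: (Om *m S - S *m Om).
    have XS T U : T \in h -> U \in h -> nu F T *m (nu F U *m nuv Al S) =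
        nuv Al (tt T *m (tt U *m S - S *m tt U) - (tt U *m S - S *m tt U) *m tt T).
      move=> Th Uh; rewrite (nE _ _ Uh (Xall _ Uh).1)// (nE _ _ Th (Xall _ Th).1)//.
      by apply: SM => //; exact: ttT.
    have -> v : ncurv F X Y *m v = nu F X *m (nu F Y *m v) - nu F Y *m (nu F X *m v) - nu F (X *m Y - Y *m X) *m v.
      by rewrite /ncurv; move: (nu F X) (nu F Y) (nu F (_ - _)) => Z1 Z2 Z3; rewrite !mulmxBl -!mulmxA.
    rewrite (XS _ _ Xh Yh) (XS _ _ Yh Xh) (nE _ _ XYh (Xall _ XYh).1 _ SS) -!nB /L.
    have -> : tt X *m (tt Y *m S - S *m tt Y) - (tt Y *m S - S *m tt Y) *m tt X
        - (tt Y *m (tt X *m S - S *m tt X) - (tt X *m S - S *m tt X) *m tt Y)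
        - (tt (X *m Y - Y *m X) *m S - S *m tt (X *m Y - Y *m X)) = Om *m S - S *m Om.
      rewrite /Om; move: (tt X) (tt Y) (tt _) (S) => Z1 Z2 Z3 Z4; rewrite !(mulmxBr, mulmxBl) !mulmxA.
      move: (Z1 *m Z2 *m Z4) (Z1 *m Z4 *m Z2) (Z2 *m Z4 *m Z1) (Z4 *m Z2 *m Z1) (Z2 *m Z1 *m Z4) (Z4 *m Z1 *m Z2) (Z3 *m Z4) (Z4 *m Z3) => *.
      by apply/matrixP => i j; rewrite !mxE; ring.
    apply: LN; apply: SM => //; rewrite OmE linearZ/= linearB/= !trmx_mul !trmxK.
    by rewrite -scalerN opprB.
  have L2 : L (ncurv F X Y *m nuv Al S) = - (c ^+ 2) *: G.
    rewrite ncE// mulmxBl -(mulmxA (a X)) -(mulmxA (a Y)) -!AP// -AL /L LN//.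
    have [S1 S0] : S *m e1 = - e1 /\ S *m e0 = e0.
      by rewrite /S !mulmxBl !dyad_mul u00 u11 u01 u10 !scale1r !scale0r sub0r subr0.
    rewrite tX tY -!scalemxAl S1 S0 -!scalemxAr mulmxN scalerN !da// tX tY -opprD -scalerDr.
    have -> : nuv Al (e0 *m e1^T) + nuv Al (e1 *m e0^T) = nuv Al G by rewrite /G /sy nD.
    by rewrite -scaleNr -nZ LN; [rewrite scalerA expr2; congr (_ *: _); ring|exact: Ssc].
  have : c *: (Om *m S - S *m Om) = - (c ^+ 2) *: G by rewrite -L1.
  have -> : Om *m S - S *m Om = (- 2 * kap) *: G.
    have dd (x y z w : 'cV[R]_n) : x *m y^T *m (z *m w^T) = dotp y z *: (x *m w^T) by rewrite mulmxA dyad_mul scalemxAl.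
    rewrite OmE -scalemxAl -scalemxAr -scalerBr /S /G /sy !(mulmxBl, mulmxBr) !dd u00 u11 u01 u10 !scale1r !scale0r.
    by move: (e0 *m e1^T) (e1 *m e0^T) => Z1 Z2; apply/matrixP => i j; rewrite !mxE; ring.
  move=> /(congr1 (fun Z => dotp e0 (Z *m e1))).
  rewrite scalerA -!scalemxAl !dotpZr /G /sy mulmxDl !dyad_mul u11 u01 scale1r scale0r addr0 u00 !mulr1 => H.
  have : kap = c / 2 by apply: (mulfI cn); lra.
  rewrite /kap => /eqP; rewrite subr_eq => /eqP H2.
  have n1' : n.+1%:R != 0 :> R by rewrite pnatr_eq0.
  apply: (mulIf n1'); rewrite mulfVK// -natr1.
  transitivity (n%:R * (c / 2 + c * (n%:R + 2) / (2 * n%:R))); first by field.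
  by rewrite -H2 mulr1.
exists (nuv Al : {linear 'M[R]_n -> 'cV[R]_k}), Al; rewrite -cE; split=> //.
- move=> X Xh; split=> [z|xi]; first exact: da.
  by rewrite AP.
- by move=> S SS; rewrite -AL; exact: LN.
- split=> [xi|X Xh S SS]; first by rewrite -AL; split; [exact: Ls|exact: NL].
  exact: nE (Xall _ Xh).1 _ SS.
Qed.

Variable M : set 'cV[R]_N.
Hypothesis MP : forall x, M x <-> exists2 w, word_in h w & x = gword w *m p.

(** A traceless symmetric matrix of size n + 1 splits into a corner, a column and a block, which
    [phi] sends to the line of [p], the tangent space and the normal space. It intertwines [X] with
    the commutator by the skew matrix [hat X]. Words in the [hat X] are transitive on unit vectors,
    so [M] is the image of a whole Veronese orbit. *)
Lemma orbit_is_veronese : veronese n M /\ full M.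
Proof.
have [nv [A [HX [n1 nT] AN dotg [AS NX]]]] := gauss_codazzi.
set c : R := _ / _ in HX AN dotg AS NX.
have n0 : n%:R != 0 :> R by rewrite pnatr_eq0 -lt0n (ltn_trans _ hn).
have n1' : n.+1%:R != 0 :> R by rewrite pnatr_eq0.
have n10 : n%:R + 1 != 0 :> R by rewrite natr1.
have c0 : 0 < c by rewrite divr_gt0// ltr0n (ltn_trans _ hn).
have cn : c != 0 by rewrite gt_eqF.
have cE : c = n%:R / (n%:R + 1) by rewrite /c natr1.
(* The column occurs twice in the trace form, so beta^2 = 2 c makes [phi] a homothety; the equation
   beta r = c then fixes the scale [r] of the column of [hat X]. *)
pose beta : R := Num.sqrt (2 * c).
have bb : beta * beta = 2 * c by rewrite -expr2 sqr_sqrtr// mulr_ge0// ltW.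
have b0 : beta != 0 by rewrite sqrtr_eq0 -ltNge mulr_gt0.
pose r := beta / 2.
have br : beta * r = c by rewrite /r mulrA bb; field.
have r0 : r != 0 by rewrite mulf_neq0// invr_eq0.
pose phi0 (S : 'M[R]_(1 + n)) : 'cV[R]_N := ulsubmx S 0 0 *: p + beta *: (e *m dlsubmx S) + F *m nv (drsubmx S).
have phi_lin : linear phi0.
  move=> s x y; rewrite /phi0.
  have -> : ulsubmx (s *: x + y) 0 0 = s * ulsubmx x 0 0 + ulsubmx y 0 0 by rewrite !mxE.
  have -> : dlsubmx (s *: x + y) = s *: dlsubmx x + dlsubmx y by apply/matrixP => i j; rewrite !mxE.
  have -> : drsubmx (s *: x + y) = s *: drsubmx x + drsubmx y by apply/matrixP => i j; rewrite !mxE.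
  rewrite [nv _]linearP !mulmxDr -!scalemxAr.
  move: (e *m _) (e *m _) (F *m _) (F *m _) (ulsubmx x 0 0) (ulsubmx y 0 0) => Z1 Z2 Z3 Z4 x0 y0.
  by apply/matrixP => i j; rewrite !mxE; ring.
have [phi phiE] : exists phi : {linear 'M[R]_n.+1 -> 'cV[R]_N}, forall S, phi S = phi0 S.
  pose m := GRing.isLinear.Build R 'M[R]_n.+1 'cV[R]_N _ (phi0 : 'M[R]_n.+1 -> 'cV[R]_N) phi_lin.
  by exists (HB.pack (phi0 : 'M[R]_n.+1 -> 'cV[R]_N) m : {linear 'M[R]_n.+1 -> 'cV[R]_N}).
have phiG (x : 'M[R]_1) (y' : 'rV[R]_n) (y : 'cV[R]_n) (D : 'M[R]_n) :
    phi (block_mx x y' y D) = x 0 0 *: p + beta *: (e *m y) + F *m nv D.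
  by rewrite phiE /phi0 block_mxKul block_mxKdl block_mxKdr.
have mB (a1 : 'M[R]_1) (a2 : 'rV[R]_n) (a3 : 'cV[R]_n) (a4 : 'M[R]_n) (b1 : 'M[R]_1) (b2 : 'rV[R]_n) (b3 : 'cV[R]_n) (b4 : 'M[R]_n) :
    @mulmx R n.+1 n.+1 n.+1 (block_mx a1 a2 a3 a4) (block_mx b1 b2 b3 b4) =
    block_mx (a1 *m b1 + a2 *m b3) (a1 *m b2 + a2 *m b4) (a3 *m b1 + a4 *m b3) (a3 *m b2 + a4 *m b4).
  exact: (@mulmx_block R 1 n 1 n 1 n).
have mBc (a1 : 'M[R]_1) (a2 : 'rV[R]_n) (a3 : 'cV[R]_n) (a4 : 'M[R]_n) (b1 : 'M[R]_1) (b3 : 'cV[R]_n) :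
    @mulmx R n.+1 n.+1 1 (block_mx a1 a2 a3 a4) (col_mx b1 b3) = col_mx (a1 *m b1 + a2 *m b3) (a3 *m b1 + a4 *m b3).
  exact: (@mul_block_col R 1 n 1 n 1).
have trB (a1 : 'M[R]_1) (a2 : 'rV[R]_n) (a3 : 'cV[R]_n) (a4 : 'M[R]_n) :
    @mxtrace R n.+1 (block_mx a1 a2 a3 a4) = \tr a1 + \tr a4.
  exact: (@mxtrace_block R 1 n).
have trT (a1 : 'M[R]_1) (a2 : 'rV[R]_n) (a3 : 'cV[R]_n) (a4 : 'M[R]_n) :
    @trmx R n.+1 n.+1 (block_mx a1 a2 a3 a4) = block_mx a1^T a3^T a2^T a4^T.
  exact: (@tr_block_mx R 1 n 1 n).
have oB (a1 : 'M[R]_1) (a2 : 'rV[R]_n) (a3 : 'cV[R]_n) (a4 : 'M[R]_n) :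
    - (block_mx a1 a2 a3 a4 : 'M[R]_n.+1) = block_mx (- a1) (- a2) (- a3) (- a4).
  exact: (@opp_block_mx R 1 n 1 n).
have aB (a1 : 'M[R]_1) (a2 : 'rV[R]_n) (a3 : 'cV[R]_n) (a4 : 'M[R]_n) (b1 : 'M[R]_1) (b2 : 'rV[R]_n) (b3 : 'cV[R]_n) (b4 : 'M[R]_n) :
    (block_mx a1 a2 a3 a4 : 'M[R]_n.+1) + (block_mx b1 b2 b3 b4 : 'M[R]_n.+1) = block_mx (a1 + b1) (a2 + b2) (a3 + b3) (a4 + b4).
  exact: (@add_block_mx R 1 n 1 n).
have Sblock (S : 'M[R]_n.+1) : Sim0 S -> exists s (y : 'cV[R]_n) D, [/\ S = block_mx s%:M y^T y D, D^T = D & \tr D = - s].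
  move=> [ST S0]; pose S' : 'M[R]_(1 + n) := S; exists (ulsubmx S' 0 0), (dlsubmx S'), (drsubmx S').
  have E : S = block_mx (ulsubmx S' 0 0)%:M (dlsubmx S')^T (dlsubmx S') (drsubmx S').
    rewrite -mx11_scalar; have -> : (dlsubmx S')^T = ursubmx S' by apply/matrixP => i j; rewrite !mxE /S' -{1}ST mxE.
    by rewrite submxK.
  split=> //; first by apply/matrixP => i j; rewrite !mxE /S' -{1}ST mxE.
  move: S0; rewrite {1}E trB mxtrace_scalar => /eqP.
  by rewrite addrC addr_eq0 => /eqP.
have [pe eP pF FP] : [/\ forall y, dotp p (e *m y) = 0, forall y, dotp (e *m y) p = 0,
    forall y, dotp p (F *m y) = 0 & forall y, dotp (F *m y) p = 0].
  have H1 y : dotp p (e *m y) = 0 by rewrite dotp_mulmxr ep dotp0l.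
  have H2 y : dotp p (F *m y) = 0 by rewrite dotp_mulmxr Fp dotp0l.
  by split=> // y; rewrite dotpC.
have eF y z : dotp (e *m y) (F *m z) = 0 by rewrite dotp_mulmxr mulmxA Fe mul0mx dotp0l.
have tr11 (x : 'M[R]_1) : \tr x = x 0 0 by rewrite /mxtrace big_ord1.
have trd (y z : 'cV[R]_n) : \tr (y *m z^T) = dotp z y by rewrite -[y *m _]mulmx1 tr_dyad mul1mx.
have phi_dot S S' : Sim0 S -> Sim0 S' -> dotp (phi S) (phi S') = c * \tr (S *m S').
  move=> /Sblock[s [y [D [-> DT D0]]]] /Sblock[s' [y' [D' [-> DT' D0']]]].
  rewrite !phiG !mxE !eqxx !mulr1n !(dotpDl, dotpDr, dotpZl, dotpZr) pp pe eP pF FP eF [dotp (F *m _) (e *m _)]dotpC eF.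
  rewrite (dotp_orth _ _ ee) (dotp_orth _ _ FF) dotg DT' D0 D0'.
  rewrite mB trB !mxtraceD trd -scalar_mxM mxtrace_scalar.
  rewrite tr11 -[(y^T *m y') 0 0]/(dotp y y') (dotpC y' y) mulr1n.
  have -> : beta * (s' * 0 + beta * dotp y y' + 0) = 2 * c * dotp y y' by rewrite -bb; ring.
  by rewrite cE; field; apply/andP.
pose hat X : 'M[R]_(1 + n) := block_mx 0 (- (r *: (tau X)^T)) (r *: tau X) (tt X).
have hatT X : X \in h -> (hat X)^T = - hat X.
  move=> Xh; rewrite /hat tr_block_mx opp_block_mx trmx0 oppr0 opprK ttT// linearN/= !linearZ/= trmxK.
  by [].
have inter X S : X \in h -> Sim0 S -> X *m phi S = phi (hat X *m S - S *m hat X).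
  move=> Xh SS; have [s [y [D [SE DT D0]]]] := Sblock _ SS.
  have D0S : Sim0 (trless D) by apply: trless_sim0.
  have nvD : nv D = nv (trless D) by rewrite /trless linearB/= -scalemx1 linearZ/= n1 scaler0 subr0.
  have E1 : X *m (F *m nv D) = - (c *: (e *m (D *m tau X)) + (c * s / n%:R) *: (e *m tau X)) +
      F *m nv (tt X *m D - D *m tt X).
    have H1 := (HX _ Xh).2 (nv D); rewrite -/(a X) -/(tau X) in H1.
    have H2 := NX _ Xh _ D0S; rewrite -/(tt X) in H2.
    rewrite (mulmxA X F) XF// mulmxDl mulNmx -(mulmxA e) -(mulmxA F) H1 nvD (AN _ D0S) H2.
    rewrite /trless D0 mulNr raddfN opprK.
    congr (- _ + F *m nv _).
      by rewrite -scalemxAl -scalemxAr mulmxDl mul_scalar_mx mulmxDr scalerDr -scalemxAr scalerA mulrA.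
    by move: (tt X) => T; rewrite mulmxDr mulmxDl mul_scalar_mx mul_mx_scalar opprD addrACA subrr addr0.
  have E2 : X *m (e *m y) = - (dotp (tau X) y *: p) + e *m (tt X *m y) + F *m nv (tau X *m y^T).
    have H1 := (HX _ Xh).1 y; rewrite -/(a X) -/(tau X) in H1.
    rewrite (mulmxA X e) Xe// -H1; move: (tau X) (tt X) (a X) => x T a'.
    by rewrite !mulmxDl mulNmx -(mulmxA p) (mx11_scalar (x^T *m y)) mul_mx_scalar !mulmxA.
  rewrite {1}SE phiG !mulmxDr -!scalemxAr E1 E2 (Xp Xh) mxE eqxx mulr1n.
  rewrite SE /hat !mB oB aB phiG.
  move: (tau X) (tt X) => x T.
  have -> : (0 *m s%:M + - (r *: x^T) *m y - (s%:M *m 0 + y^T *m (r *: x))) 0 0 = - (beta * dotp x y).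
    rewrite mul0mx mulmx0 !add0r mulNmx -scalemxAl -scalemxAr.
    have -> : y^T *m x = x^T *m y by rewrite (mx11_scalar (y^T *m x)) (mx11_scalar (x^T *m y)) -[(y^T *m x) 0 0]/(dotp y x) dotpC.
    by rewrite /dotp /r; move: (x^T *m y) => Z; rewrite !mxE; field.
  have -> : r *: x *m s%:M + T *m y - (y *m 0 + D *m (r *: x)) = (r * s) *: x + T *m y - r *: (D *m x).
    by rewrite mulmx0 add0r mul_mx_scalar scalerA -scalemxAr mulrC.
  have -> : nv (r *: x *m y^T + T *m D - (y *m - (r *: x^T) + D *m T)) = (2 * r) *: nv (x *m y^T) + nv (T *m D - D *m T).
    rewrite mulmxN -scalemxAl -scalemxAr.
    have -> : r *: (x *m y^T) + T *m D - (- (r *: (y *m x^T)) + D *m T) = r *: (x *m y^T) + r *: (x *m y^T)^T + (T *m D - D *m T).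
      by rewrite trmx_mul trmxK; move: (x *m y^T) (y *m x^T) (T *m D) (D *m T) => *; apply/matrixP => i j; rewrite !mxE; ring.
    by rewrite [LHS]linearD [X in X + _]linearD !linearZ/= nT -scalerDl; congr (_ *: _ + _); ring.
  have -> : 2 * r = beta by rewrite /r; field.
  rewrite !mulmxDr !mulmxN -!scalemxAr.
  move: (e *m x) (e *m (T *m y)) (e *m (D *m x)) (F *m nv (x *m y^T)) (F *m nv (_ - _)) => Z1 Z2 Z3 Z4 Z5.
  apply/matrixP => i j; rewrite !mxE.
  have cs : s - c * s / n%:R = beta * (r * s) by rewrite mulrA br cE; field; apply/andP.
  have br' z : beta * (r * z) = c * z by rewrite mulrA br.
  have -> : s * Z1 i j = beta * (r * s) * Z1 i j + c * s / n%:R * Z1 i j by rewrite -mulrDl -cs; ring.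
  have -> : c * Z3 i j = beta * (r * Z3 i j) by rewrite br'.
  by ring.
pose hatw w : seq (R * 'M[R]_n.+1) := [seq (x.1, hat x.2) | x <- w].
have hatS X S : X \in h -> Sim0 S -> Sim0 (hat X *m S - S *m hat X : 'M[R]_n.+1).
  move=> Xh [ST S0]; split; last by rewrite linearB/= mxtrace_mulC subrr.
  by rewrite linearB/= !trmx_mul ST hatT// mulNmx mulmxN opprK addrC.
have conjS (Q S : 'M[R]_n.+1) : Q^T *m Q = 1%:M -> Sim0 S -> Sim0 (Q *m S *m Q^T).
  move=> QQ [ST S0]; split; first by rewrite !trmx_mul trmxK ST mulmxA.
  by rewrite mxtrace_mulC mulmxA QQ mul1mx.
have one t X S : X \in h -> Sim0 S -> expmx (t *: X) *m phi S =
    phi (expmx (t *: (hat X : 'M[R]_n.+1)) *m S *m (expmx (t *: (hat X : 'M[R]_n.+1)))^T).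
  move=> Xh SS; have HT : (hat X : 'M[R]_n.+1)^T = - hat X by exact: hatT.
  pose f u := phi (expmx (u *: (hat X : 'M[R]_n.+1)) *m S *m (expmx (u *: (hat X : 'M[R]_n.+1)))^T).
  have f0 : f 0 = phi S by rewrite /f scale0r expmx0 trmx1 mulmx1 mul1mx.
  rewrite -f0 -/(f t); apply/esym; apply: expmx_ode => u.
  have d1 := is_derive_expmx (hat X : 'M[R]_n.+1) u.
  have := is_derive_linear phi (is_derive_mulmx (is_derive_mulcst S d1) (is_derive_trmx d1)).
  move=> H; apply: is_derive_eq H _; rewrite /f inter//; last by apply: conjS => //; exact: orth_expmx.
  congr (phi _); rewrite trmx_mul HT !mulmxN !mulmxA; congr (_ - _).
have worda w S : word_in h w -> Sim0 S -> gword w *m phi S = phi (gword (hatw w) *m S *m (gword (hatw w))^T) /\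
    (gword (hatw w))^T *m gword (hatw w) = 1%:M.
  elim: w S => [|[t X] w IH] S wh SS.
    by rewrite /= !gword_nil !trmx1 mul1mx !mulmx1 mul1mx.
  have Xh : X \in h by have := wh (t, X); rewrite inE eqxx; exact.
  have wh' : word_in h w by move=> x xw; apply: wh; rewrite inE xw orbT.
  have [E1 E2] := IH S wh' SS; have OX := orth_expmx t (hatT _ Xh : (hat X : 'M[R]_n.+1)^T = - hat X).
  rewrite /= !gword_cons -mulmxA E1 /= one//; last exact: conjS.
  move: OX E2; move: (expmx _) (gword (hatw w)) => Q V OX E2; split.
    by rewrite trmx_mul !mulmxA.
  by rewrite trmx_mul -!mulmxA (mulmxA Q^T) OX mul1mx.
pose e0 : 'cV[R]_(1 + n) := col_mx 1%:M 0.
have dcol (u1 v1 : 'cV[R]_1) (u2 v2 : 'cV[R]_n) : dotp (col_mx u1 u2) (col_mx v1 v2) = u1 0 0 * v1 0 0 + dotp u2 v2.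
  rewrite {1}/dotp tr_col_mx mul_row_col mxE; congr (_ + _).
  by rewrite mxE big_ord1 mxE.
have e00 : dotp e0 e0 = 1 by rewrite dcol dotp0l mxE eqxx mulr1 addr0.
(* Normalised to have corner entry 1 at [e0], so that [phi] sends [Sq e0] to [p]. *)
pose Sq (q : 'cV[R]_n.+1) : 'M[R]_n.+1 := (1 + n%:R^-1) *: (q *m q^T) - (n%:R^-1)%:M.
have SqS q : dotp q q = 1 -> Sim0 (Sq q).
  move=> qq; split; first by rewrite /Sq linearB/= linearZ/= trmx_mul trmxK tr_scalar_mx.
  have trd' : \tr (q *m q^T) = 1 by rewrite mxtrace_mulC tr11.
  rewrite /Sq linearB/= linearZ/= mxtrace_scalar trd' -[_ *+ n.+1]mulr_natr -natr1 mulr1; field.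
  by [].
have Sqc (Q : 'M[R]_n.+1) q : Q *m Q^T = 1%:M -> Q *m Sq q *m Q^T = Sq (Q *m q).
  move=> QQ; rewrite /Sq mulmxBr mulmxBl -scalemxAr -scalemxAl trmx_mul !mulmxA mul_mx_scalar -scalemxAl QQ.
  by rewrite scalemx1.
have eeB : @mulmx R n.+1 1 n.+1 e0 e0^T = block_mx (1%:M : 'M[R]_1) 0 0 (0 : 'M[R]_n).
  rewrite [LHS](_ : _ = (col_mx 1%:M 0 : 'cV[R]_(1 + n)) *m (col_mx 1%:M 0 : 'cV[R]_(1 + n))^T)//.
  by rewrite tr_col_mx trmx1 trmx0 mul_col_row !mul1mx !mulmx0 mul0mx.
have sB (z : R) : (z%:M : 'M[R]_n.+1) = block_mx (z%:M : 'M[R]_1) 0 0 (z%:M : 'M[R]_n) by exact: (@scalar_mx_block R 1 n).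
have zB z (a1 : 'M[R]_1) (a2 : 'rV[R]_n) (a3 : 'cV[R]_n) (a4 : 'M[R]_n) :
    z *: (block_mx a1 a2 a3 a4 : 'M[R]_n.+1) = block_mx (z *: a1) (z *: a2) (z *: a3) (z *: a4).
  exact: (@scale_block_mx R 1 n 1 n).
have rB (a1 : 'M[R]_1) (a4 : 'M[R]_n) : @mxrank R n.+1 n.+1 (block_mx a1 0 0 a4) = (\rank a1 + \rank a4)%N.
  exact: (@rank_diag_block_mx R 1 1 n n).
have Sq0 : Sq e0 = block_mx (1%:M : 'M[R]_1) 0 0 ((- n%:R^-1)%:M : 'M[R]_n).
  rewrite /Sq [e0 *m _]eeB sB zB oB aB !scaler0 !subr0 raddfN /= add0r.
  have -> : (1 + n%:R^-1) *: 1%:M - (n%:R^-1)%:M = 1%:M :> 'M[R]_1 by rewrite scalemx1 -raddfB/= addrK.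
  by [].
have pE : p = phi (Sq e0).
  by rewrite Sq0 phiG !mxE eqxx mulr1n scale1r mulmx0 scaler0 addr0 -scalemx1 linearZ/= n1 scaler0 mulmx0 addr0.
pose G : set 'M[R]_n.+1 := [set g1 | exists2 w, word_in h w & g1 = gword (hatw w)].
have reach q : dotp q q = 1 -> exists2 g1, G g1 & q = g1 *m (e0 : 'cV[R]_n.+1).
  apply: orbit_sphere => //.
  - by rewrite ltnS (ltn_trans _ hn).
  - by exists [::]; rewrite //= gword_nil.
  - move=> g1 g2 [w1 h1 ->] [w2 h2 ->]; exists (w1 ++ w2); last by rewrite /hatw map_cat gword_cat.
    by move=> x; rewrite mem_cat => /orP[/h1|/h2].
  - by move=> g1 [w1 h1 ->]; have [] := worda w1 (Sq e0) h1 (SqS _ e00).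
  - move=> eta; rewrite -[eta](@vsubmxK R 1 n 1); move: (usubmx _) (dsubmx _) => a1 a2.
    rewrite dcol dotp0l addr0 mxE eqxx mul1r => a10 HB.
    have a2z : a2 = 0.
      apply/eqP; rewrite -dotp_eq0; apply/eqP; have [X Xh XE] := onto a2.
      have tX : tau X = a2 by rewrite /tau XE mulmxA ee mul1mx.
      have HT : (hat X : 'M[R]_n.+1)^T = - hat X by exact: hatT.
      have := HB (hat X) _ HT; rewrite /hat tX mBc dcol a10 mulr0 add0r.
      rewrite mulmx1 mulmx0 addr0 dotpZl => /(_ _)/eqP; rewrite mulf_eq0 (negbTE r0) /= => H; apply/eqP; apply: H.
      exists (fun t : R => expmx (t *: (hat X : 'M[R]_n.+1))); split.
      + by move: (sdiff0_expmx (hat X : 'M[R]_n.+1)); rewrite /hat tX.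
      + by rewrite scale0r expmx0.
      + move=> t; exists [:: (t, X)]; first by move=> x; rewrite inE => /eqP ->.
        by rewrite /= gword_cons gword_nil mulmx1.
    have a1z : a1 = 0 by rewrite (mx11_scalar a1) a10 raddf0.
    by rewrite a2z a1z; exact: (@col_mx0 R 1 n 1).
have Mq q : dotp q q = 1 -> M (phi (Sq q)).
  move=> /reach[_ [w wh ->] ->]; apply/MP; exists w => //; have [E1 E2] := worda w _ wh (SqS _ e00).
  by rewrite {1}pE E1 Sqc//; exact: mulmx1C.
have qM x : M x -> exists w, [/\ word_in h w, (gword (hatw w))^T *m gword (hatw w) = 1%:M &
    x = phi (gword (hatw w) *m Sq e0 *m (gword (hatw w))^T)].
  by move=> /MP[w wh ->]; have [E1 E2] := worda w _ wh (SqS _ e00); exists w; split=> //; rewrite {1}pE.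
have detg w : word_in h w -> \det (gword (hatw w)) = 1.
  elim: w => [|[t X] w IH] wh; first by rewrite /= gword_nil det1.
  have Xh : X \in h by have := wh (t, X); rewrite inE eqxx; exact.
  rewrite /= gword_cons det_mulmx IH => [|x xw]; last by apply: wh; rewrite inE xw orbT.
  (* The square root at time t / 2 is orthogonal, which excludes determinant -1. *)
  rewrite mulr1 /=; have -> : t = t / 2 + t / 2 by field.
  rewrite expmxD det_mulmx -{1}[expmx _]trmxK det_tr -det_mulmx.
  by rewrite (orth_expmx _ (hatT _ Xh : (hat X : 'M[R]_n.+1)^T = - hat X)) det1.
split.
  exists (Sq e0), c, phi, 0; split=> //; last first.
  - apply/seteqP; split=> x /=.
      move=> /qM[w [wh E2 ->]]; exists (gword (hatw w) *m Sq e0 *m (gword (hatw w))^T); last by rewrite addr0.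
      by exists (gword (hatw w)) => //=; split; [exact: mulmx1C|exact: detg].
    move=> [_ [Q [QQ _] <-] <-]; rewrite addr0 Sqc//; apply: Mq.
    by rewrite (dotp_orth _ _ (mulmx1C QQ)).
  - split; first exact: SqS; exists 1, (- n%:R^-1).
    have ab : 1 != - n%:R^-1 :> R.
      rewrite -subr_eq0 opprK; apply/eqP => /(congr1 (fun z => z * n%:R)).
      by rewrite mulrDl mul1r mulVf// mul0r => /eqP; rewrite (negbTE n10).
    have rk x : \rank (Sq e0 - x%:M) = ((x != 1%R) + (x != - n%:R^-1) * n)%N.
      have sr m (z : R) : \rank (z%:M : 'M[R]_m) = ((z != 0%R) * m)%N.
        have [->|z0] := eqVneq z 0; first by rewrite raddf0 mxrank0.
        by rewrite mul1n -scalemx1 mxrank_scale_nz// mxrank1.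
      rewrite Sq0 sB oB aB !subr0 rB -!raddfB/= !sr muln1.
      by rewrite !subr_eq0 ![_ == x]eq_sym.
    have rke x : \rank (eigenspace (Sq e0) x) = ((x == 1%R) + (x == - n%:R^-1) * n)%N.
      rewrite /eigenspace mxrank_ker rk; have [->|x1] := eqVneq x 1.
        by rewrite (negbTE ab) /= mul0n !mul1n add0n addn0 subSn// subnn.
      by case: (x == _); rewrite /= ?mul0n ?mul1n ?addn0 ?add0n ?subn1 ?subnn.
    split=> //.
    + move=> x; rewrite /eigenvalue -mxrank_eq0 rke; case: (x == 1) => //=; case: (x == _) => //=.
      by rewrite mul1n add0n -lt0n (ltn_trans _ hn).
    + by rewrite rke eqxx (negbTE ab).
    + by rewrite rke eqxx eq_sym (negbTE ab) mul1n.
(* A vector orthogonal to [W] is [phi S] for an [S] whose quadratic form is constant on the unit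
   sphere; hence [S] is scalar and, being traceless, zero. *)
move=> W a0 HW; apply: perp_full => w Hw.
pose y := beta^-1 *: (e^T *m w).
pose S1 : 'M[R]_n.+1 := block_mx (0 : 'M[R]_1) y^T y 0.
pose S2 : 'M[R]_n.+1 := block_mx (0 : 'M[R]_1) 0 0 (c^-1 *: A (F^T *m w)).
have [AT A00] := (AS (F^T *m w)).1.
have S1S : Sim0 S1.
  by split; [rewrite trT !trmx0 trmxK|rewrite trB !mxtrace0 addr0].
have S2S : Sim0 S2.
  split; first by rewrite trT !trmx0 linearZ/= AT.
  by rewrite trB mxtrace0 add0r linearZ/= A00 mulr0.
pose S := dotp p w *: Sq e0 + S1 + S2.
have SS : Sim0 S.
  have Sad (Z1 Z2 : 'M[R]_n.+1) : Sim0 Z1 -> Sim0 Z2 -> Sim0 (Z1 + Z2).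
    by move=> [T1 T10] [T2 T20]; split; rewrite linearD/= ?T1 ?T2// T10 T20 addr0.
  apply: (Sad) => //; apply: (Sad) => //; have [T1 T10] := SqS _ e00.
  by split; rewrite linearZ/= ?T1// T10 mulr0.
have E1 : phi S1 = e *m (e^T *m w).
  by rewrite phiG mxE scale0r add0r raddf0 mulmx0 addr0 /y -scalemxAr scalerA divff// scale1r.
have E2 : phi S2 = F *m (F^T *m w).
  by rewrite phiG mxE scale0r add0r !mulmx0 scaler0 add0r linearZ/= (AS _).2 scalerA mulVf// scale1r.
have wE : w = phi S.
  have -> : phi S = dotp p w *: p + phi S1 + phi S2 by rewrite /S raddfD/= raddfD/= linearZ/= -pE.
  rewrite E1 E2 -{1}[w]mul1mx -res !mulmxDl -!mulmxA; congr (_ + _ + _).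
  by rewrite (mx11_scalar (p^T *m w)) mul_mx_scalar.
have const q : dotp q q = 1 -> dotp q (S *m q) = (dotp w a0 / c) / (1 + n%:R^-1).
  move=> qq; have := Hw _ (HW _ (Mq _ qq)); rewrite dotpBl dotpC => /eqP; rewrite subr_eq0 => /eqP.
  rewrite [in X in X = _]wE phi_dot//; last exact: SqS.
  have -> : \tr (S *m Sq q) = (1 + n%:R^-1) * dotp q (S *m q).
    move: (S) SS.2 => Z Z0; rewrite /Sq mulmxBr raddfB/= mul_mx_scalar [\tr (_ *: Z)]linearZ/= Z0 mulr0 subr0.
    by rewrite -scalemxAr [\tr _]linearZ/= mxtrace_mulC tr_dyad.
  move=> E.
  rewrite [dotp w a0]dotpC -E; field.
  by rewrite n0 cn n10.
have kap : exists kp, forall q, dotp q q = 1 -> dotp q (S *m q) = kp by exists (dotp w a0 / c / (1 + n%:R^-1)).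
have [kp kpE] := kap.
have uu := @orthoframe_std R n.+1.
have Sij i j : dotp (delta_mx i 0) (S *m delta_mx j 0) = S i j.
  rewrite -colE dotpE (bigD1 i)//= big1 ?addr0 => [|l li]; rewrite [X in X * _]mxE ?eqxx ?mul1r ?mxE//.
  by rewrite (negbTE li) mul0r.
have dg i : S i i = kp by rewrite -Sij kpE// uu eqxx.
have SC i j : S i j = S j i by rewrite -{1}SS.1 mxE.
have od i j : i != j -> S i j = 0.
  move=> ij; pose q : 'cV[R]_n.+1 := (3 / 5) *: delta_mx i 0 + (4 / 5) *: delta_mx j 0.
  have qq : dotp q q = 1.
    rewrite !(dotpDl, dotpDr, dotpZl, dotpZr) !uu !eqxx [j == i]eq_sym (negbTE ij) mulr1n mulr0n; by field.
  have := kpE _ qq; rewrite /q mulmxDr -!scalemxAr !(dotpDl, dotpDr, dotpZl, dotpZr) !Sij !dg (SC j i); lra.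
have SE : S = kp%:M.
  apply/matrixP => i j; rewrite [RHS]mxE; have [->|ij] := eqVneq i j; first by rewrite dg mulr1n.
  by rewrite od.
have kp0 : kp = 0.
  have := SS.2; rewrite SE mxtrace_scalar -mulr_natr => /eqP; rewrite mulf_eq0 (negbTE n1') orbF => /eqP//.
by rewrite wE SE kp0 raddf0 linear0.
Qed.

End gauss_codazzi.

(** * Veronese orbits *)

Section skew_words.
Variable R : realType.

Lemma skew_space m : exists sk : {vspace 'M[R]_m}, lie_so sk /\ forall E, E^T = - E -> E \in sk.
Proof.
have [||sk skP] := @vspace_of_pred R 'M[R]_m (fun E => E^T = - E).
- by rewrite trmx0 oppr0.
- by move=> a x y xT yT; rewrite linearP/= xT yT scalerN opprD.
exists sk; split=> [|E /skP//]; split=> [A /skP//|A B /skP AT /skP BT].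
by apply/skP; rewrite linearB/= !trmx_mul AT BT !mulmxN !mulNmx !opprK opprB.
Qed.

Lemma word_in_consP N (h : {vspace 'M[R]_N}) t X w : word_in h ((t, X) :: w) <-> X \in h /\ word_in h w.
Proof.
split=> [H|[Xh wh] x]; last by rewrite inE => /orP[/eqP->|/wh].
by split=> [|x xw]; [apply: (H (t, X)); rewrite inE eqxx|apply: H; rewrite inE xw orbT].
Qed.

Lemma det_gword_skew m (sk : {vspace 'M[R]_m}) w : lie_so sk -> word_in sk w -> \det (gword w) = 1.
Proof.
move=> skl; elim: w => [|[t X] w IH]; first by rewrite gword_nil det1.
move=> /word_in_consP[Xh wh]; rewrite gword_cons det_mulmx IH// mulr1 /=.
have -> : t = t / 2 + t / 2 by field.
by rewrite expmxD det_mulmx -{1}[expmx _]trmxK det_tr -det_mulmx (orth_expmx _ (skl.1 _ Xh)) det1.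
Qed.

(** The skew matrix [eta *m q0^T - q0 *m eta^T] sends [q0] to [eta], so the infinitesimal condition
    of [orbit_sphere] is immediate. *)
Lemma skew_words_transitive m (sk : {vspace 'M[R]_m}) (q0 q : 'cV[R]_m) : (1 < m)%N -> lie_so sk ->
  (forall E, E^T = - E -> E \in sk) -> dotp q0 q0 = 1 -> dotp q q = 1 ->
  exists2 w, word_in sk w & q = gword w *m q0.
Proof.
move=> m1 skl skP q00 qq; pose G : set 'M[R]_m := [set g | exists2 w, word_in sk w & g = gword w].
suff [_ [w wh ->] qE] : exists2 g, G g & q = g *m q0 by exists w.
apply: orbit_sphere qq => //.
- by exists [::]; rewrite ?gword_nil.
- move=> g1 g2 [w1 h1 ->] [w2 h2 ->]; exists (w1 ++ w2); last by rewrite gword_cat.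
  by move=> x; rewrite mem_cat => /orP[/h1|/h2].
- by move=> g1 [w1 h1 ->]; have [] := normalizes_gword skl h1.
move=> eta eta0 H; pose B := eta *m q0^T - q0 *m eta^T.
have BT : B^T = - B by rewrite /B linearB/= !trmx_mul !trmxK opprB.
have Bq : B *m q0 = eta.
  by rewrite /B mulmxBl !dyad_mul q00 scale1r dotpC eta0 scale0r subr0.
apply/eqP; rewrite -dotp_eq0 -{1}Bq; apply/eqP; apply: H => //.
exists (fun t : R => expmx (t *: B)); split; [exact: sdiff0_expmx|by rewrite scale0r expmx0|].
move=> t; exists [:: (t, B)]; last by rewrite gword_cons gword_nil mulmx1.
by apply/word_in_consP; split=> //; exact: skP.
Qed.

(** Even at an end of the segment there are other points of it arbitrarily near [t], and they
    determine the two-sided derivative. *)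
Lemma zero_derivative_segment (V : normedModType R) (f : R -> V) (a b t : R) v : a < b -> a <= t <= b ->
  is_derive t 1 f v -> (forall s, a <= s <= b -> f s = 0) -> v = 0.
Proof.
move=> ab /andP[at_ tb] df f0; apply/eqP; rewrite -normr_eq0; apply/eqP; apply: contrapT => /eqP v0.
have vp : 0 < `|v| by rewrite lt_neqAle eq_sym v0 normr_ge0.
have [d d0 H] := is_derive_dist df (divr_gt0 vp (ltr0n R 2)).
have [s [sab st sd]] : exists s, [/\ a <= s <= b, s != t & `|s - t| < d].
  have [tb'|bt] := ltP t b.
    exists (Num.min b (t + d / 2)); have d2 : 0 < d / 2 by rewrite divr_gt0.
    have h1 : t < Num.min b (t + d / 2) by rewrite lt_min tb' ltrDl.
    rewrite (gt_eqF h1) ge_min lexx (le_trans at_ (ltW h1)); split=> //.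
    rewrite ger0_norm ?subr_ge0 ?(ltW h1)// ltrBlDl; apply: (@le_lt_trans _ _ (t + d / 2)).
      by rewrite ge_min lexx orbT.
    by rewrite ltrD2l gtr_pMr// invf_lt1// ltr1n.
  exists (Num.max a (t - d / 2)); have d2 : 0 < d / 2 by rewrite divr_gt0.
  have h1 : Num.max a (t - d / 2) < t by rewrite gt_max (lt_le_trans ab bt) ltrBlDr ltrDl.
  rewrite (lt_eqF h1) le_max lexx (le_trans (ltW h1) tb); split=> //.
  rewrite distrC ger0_norm ?subr_ge0 ?(ltW h1)// ltrBlDr -ltrBlDl; apply: (@lt_le_trans _ _ (t - d / 2)).
    by rewrite ltrD2l ltrN2 gtr_pMr// invf_lt1// ltr1n.
  by rewrite le_max lexx orbT.
have := H s sd; rewrite !f0 ?at_// subr0 sub0r normrN normrZ mulrC ler_pM2r ?normr_gt0 ?subr_eq0//.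
move=> hh; have h2 : `|v| / 2 < `|v| by rewrite gtr_pMr// invf_lt1// ltr1n.
by move: (le_lt_trans hh h2); rewrite ltxx.
Qed.

(* Polarization gives [K ^ 3 = 0]. *)
Lemma sym_isotropic_image m (K : 'M[R]_m) : K^T = K ->
  (forall x : 'cV[R]_m, dotp (K *m x) (K *m (K *m x)) = 0) -> K = 0.
Proof.
move=> KT H; have KK (x : 'cV[R]_m) : K *m (K *m (K *m x)) = 0.
  apply: dotp_ext => y; rewrite dotp0l.
  have := H (x + y); rewrite !mulmxDr !dotpDl !dotpDr !H.
  have -> : dotp (K *m x) (K *m (K *m y)) = dotp (K *m (K *m (K *m x))) y by rewrite !dotp_mulmxr !KT.
  have -> : dotp (K *m y) (K *m (K *m x)) = dotp (K *m (K *m (K *m x))) y by rewrite dotp_mulmxl KT dotpC.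
  lra.
have z (y : 'cV[R]_m) : K *m (K *m y) = 0 -> K *m y = 0.
  move=> Hy; apply/eqP; rewrite -dotp_eq0; apply/eqP; rewrite dotp_mulmxl KT Hy dotp0r.
  by [].
by apply: mx_ext => x; rewrite mul0mx; apply: (z); apply: (z); exact: KK.
Qed.

(** Subtracting an eigenvalue from D' gives [D2] with a kernel in the orthogonal of [q]. For a unit
    vector [u] of this kernel, the hypothesis on rotations makes [D2] vanish on the image of
    [D - dotp u (D *m u) *: P]. If [D2] is nonzero the Rayleigh quotient is the same for all such
    [u], so the image is isotropic for this symmetric operator, which is therefore zero. *)
Lemma commuting_sym m (q : 'cV[R]_m) (D D' : 'M[R]_m) : (1 < m)%N -> dotp q q = 1 ->
  D^T = D -> D'^T = D' -> D *m q = 0 -> D' *m q = 0 -> D *m D' = D' *m D ->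
  (forall x y : 'cV[R]_m, dotp x q = 0 -> dotp y q = 0 -> let C := y *m x^T - x *m y^T in
     (C *m D - D *m C) *m D' = D' *m (C *m D - D *m C)) ->
  exists c : R, D = c *: (1%:M - q *m q^T) \/ D' = c *: (1%:M - q *m q^T).
Proof.
move=> m1 qq DT DT' Dq D'q com H.
have [V VP] := perp_exists (<[q]>)%VS.
have Vq x : x \in V <-> dotp x q = 0.
  rewrite VP; split=> [/(_ q (memv_line q))|xq u /vlineP[a ->]]; first by rewrite dotpC.
  by rewrite dotpZl dotpC xq mulr0.
have [G [GG GP]] := orthonormal_basis V.
have dV : (0 < \dim V)%N.
  rewrite lt0n dimv_eq0; apply/eqP => V0.
  have all x : x = dotp x q *: q.
    apply/eqP; rewrite -subr_eq0 -memv0 -V0; apply/Vq; by rewrite dotpBl dotpZl qq mulr1 subrr.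
  pose i0 : 'I_m := Ordinal (ltnW m1); pose i1 : 'I_m := Ordinal m1.
  have uu := @orthoframe_std R m; have := uu i0 i1; rewrite (all (delta_mx i0 0)) (all (delta_mx i1 0)) dotpZl dotpZr qq mulr1.
  have n0 i : dotp (delta_mx i 0 : 'cV[R]_m) q != 0.
    apply/eqP => z; have := uu i i; rewrite (all (delta_mx i 0)) z scale0r dotp0l eqxx => /esym/eqP.
    by rewrite oner_eq0.
  by move=> /eqP; rewrite mulf_eq0 (negbTE (n0 _)) (negbTE (n0 _)).
pose P : 'M[R]_m := 1%:M - q *m q^T.
have Pv v : P *m v = v - dotp q v *: q by rewrite /P mulmxBl mul1mx dyad_mul.
have PT : P^T = P by rewrite /P linearB/= trmx1 trmx_mul trmxK.
have D'V v : D' *m v \in V by apply/Vq; rewrite dotp_mulmxl DT' D'q dotp0r.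
have DV v : D *m v \in V by apply/Vq; rewrite dotp_mulmxl DT Dq dotp0r.
have BT : (G^T *m D' *m G)^T = G^T *m D' *m G by rewrite !trmx_mul trmxK DT' mulmxA.
have [lam [v [v0 vE]]] := sym_eigen dV BT.
pose D2 := D' - lam *: P.
have D2T : D2^T = D2 by rewrite /D2 linearB/= linearZ/= DT' PT.
have D2v x : x \in V -> D2 *m x = D' *m x - lam *: x.
  by move=> /Vq xq; rewrite /D2 mulmxBl -scalemxAl Pv dotpC xq scale0r subr0.
have Pq : P *m q = 0 by rewrite Pv qq scale1r subrr.
have D2q : D2 *m q = 0 by rewrite /D2 mulmxBl -scalemxAl D'q Pq scaler0 subrr.
have PD : P *m D = D by apply: mx_ext => x; rewrite -mulmxA Pv dotpC (Vq _).1// scale0r subr0.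
have DP : D *m P = D by rewrite -[D *m P]trmxK trmx_mul DT PT PD DT.
have PD2 : P *m D2 = D2.
  have PD' : P *m D' = D' by apply: mx_ext => x; rewrite -mulmxA Pv dotpC (Vq _).1// scale0r subr0.
  have PP : P *m P = P by apply: mx_ext => x; rewrite -mulmxA Pv dotp_mulmxr PT Pq dotp0l scale0r subr0.
  by rewrite /D2 mulmxBr -scalemxAr PD' PP.
have D2P : D2 *m P = D2 by rewrite -[D2 *m P]trmxK trmx_mul D2T PT PD2 D2T.
have comD : D2 *m D = D *m D2 by rewrite /D2 mulmxBl mulmxBr -scalemxAl -scalemxAr PD DP com.
have main u : u \in V -> dotp u u = 1 -> D2 *m u = 0 -> D2 *m (D - dotp u (D *m u) *: P) = 0.
  move=> uV uu D2u; set dl := dotp u _; have uq := (Vq u).1 uV.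
  have onz z : z \in V -> dotp z u = 0 -> D2 *m (D *m z - dl *: z) = 0.
    move=> zV zu; have zq := (Vq z).1 zV.
    have := H u z uq zq; set C := _ - _ => /(congr1 (fun X => X *m u)) E.
    have Cv x : C *m x = dotp u x *: z - dotp z x *: u by rewrite /C mulmxBl !dyad_mul.
    have Cu : C *m u = z by rewrite Cv uu scale1r zu scale0r subr0.
    have D'u : D' *m u = lam *: u by apply/eqP; rewrite -subr_eq0 -D2v// D2u.
    have XE : (C *m D - D *m C) *m u = dotp u (D *m u) *: z - dotp z (D *m u) *: u - D *m z.
      by rewrite mulmxBl -!mulmxA Cu Cv.
    have XV : (C *m D - D *m C) *m u \in V by rewrite XE memvB// memvB// memvZ.
    move: E; rewrite -!mulmxA D'u -scalemxAr => E.
    have : D2 *m ((C *m D - D *m C) *m u) = 0 by rewrite D2v// -E subrr.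
    rewrite XE -/dl; move: (D2) D2u => T Tu; rewrite !mulmxBr -!scalemxAr Tu scaler0 subr0 => E'.
    by rewrite -[RHS]oppr0 -E' opprB.
  apply: mx_ext => x; rewrite mul0mx -mulmxA.
  have -> : (D - dl *: P) *m x = D *m x - dl *: (P *m x) by rewrite mulmxBl -scalemxAl.
  pose z := P *m x - dotp u x *: u.
  have PxV : P *m x \in V by apply/Vq; rewrite dotp_mulmxl PT Pq dotp0r.
  have uPx : dotp u (P *m x) = dotp u x by rewrite dotp_mulmxr PT Pv [dotp q u]dotpC uq scale0r subr0.
  have zV : z \in V by rewrite memvB// memvZ.
  have zu : dotp z u = 0 by rewrite dotpC /z dotpBr dotpZr uu mulr1 uPx subrr.
  have PxE : P *m x = z + dotp u x *: u by rewrite /z subrK.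
  have DxE : D *m x = D *m z + dotp u x *: (D *m u) by rewrite -{1}DP -mulmxA PxE mulmxDr -scalemxAr.
  have Ez := onz _ zV zu; rewrite DxE PxE; clearbody z; move: (D2) D2u comD Ez => T Tu TD Tz.
  have TDu : T *m (D *m u) = 0 by rewrite mulmxA TD -mulmxA Tu mulmx0.
  move: Tz; rewrite !mulmxBr mulmxDr -!scalemxAr [T *m (z + _)]mulmxDr -scalemxAr Tu TDu !scaler0 !addr0 => Tz.
  by rewrite Tz.
have [u [uV uu D2u]] : exists u, [/\ u \in V, dotp u u = 1 & D2 *m u = 0].
  pose s := Num.sqrt (dotp v v); have vv : 0 < dotp v v by rewrite dotp_gt0.
  have s0 : s != 0 by rewrite sqrtr_eq0 -ltNge.
  have ss : s * s = dotp v v by rewrite -expr2 sqr_sqrtr// ltW.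
  have GV y : G *m y \in V by rewrite GP (mulmxA G^T) GG mul1mx.
  exists (s^-1 *: (G *m v)); split; first exact: memvZ.
    by rewrite dotpZl dotpZr (dotp_orth _ _ GG) -ss; field.
  rewrite -scalemxAr D2v//; have := D'V (G *m v); rewrite GP => /eqP <-.
  have -> : G^T *m (D' *m (G *m v)) = lam *: v by rewrite !mulmxA vE.
  by rewrite -scalemxAr subrr scaler0.
pose dl := dotp u (D *m u); have Hu := main u uV uu D2u.
have [D20|D2n] := eqVneq D2 0.
  by exists lam; right; apply/eqP; rewrite -subr_eq0; apply/eqP.
exists dl; left; apply/eqP; rewrite -subr_eq0; apply/eqP; apply: sym_isotropic_image.
  by rewrite linearB/= linearZ/= DT PT.
rewrite -/P => x; set K := D - dl *: P; set w := K *m x.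
have wV : w \in V.
  rewrite /w /K mulmxBl -scalemxAl memvB// memvZ//; apply/Vq.
  by rewrite dotp_mulmxl PT Pq dotp0r.
have D2w : D2 *m w = 0 by rewrite /w mulmxA Hu mul0mx.
have [w0|w0] := eqVneq w 0; first by rewrite w0 dotp0l.
pose s := Num.sqrt (dotp w w); have ww : 0 < dotp w w by rewrite dotp_gt0.
have s0 : s != 0 by rewrite sqrtr_eq0 -ltNge.
have ss : s * s = dotp w w by rewrite -expr2 sqr_sqrtr// ltW.
pose u' := s^-1 *: w.
have u'u : dotp u' u' = 1 by rewrite dotpZl dotpZr -ss; field.
have Hu' := main u' (memvZ _ wV) u'u ltac:(by rewrite -scalemxAr D2w scaler0).
have dd : dotp u' (D *m u') = dl.
  have : (dl - dotp u' (D *m u')) *: D2 = 0.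
    rewrite -{1}D2P scalemxAr scalerBl; have -> : dl *: P - dotp u' (D *m u') *: P = (D - dotp u' (D *m u') *: P) - (D - dl *: P).
      by move: (dl *: P) (_ *: P) => X Y; apply/matrixP => i j; rewrite !mxE; ring.
    by rewrite mulmxBr Hu Hu' subrr.
  by move=> /eqP; rewrite scaler_eq0 (negbTE D2n) orbF subr_eq0 => /eqP.
have : dotp w (D *m w) = dl * dotp w w.
  rewrite -ss -dd /u' -scalemxAr dotpZl dotpZr; field.
  by [].
rewrite -/w /K mulmxBl -scalemxAl dotpBr dotpZr => ->.
by rewrite Pv dotpC [dotp q w]dotpC (Vq w).1// scale0r subr0 subrr.
Qed.

End skew_words.

(** * Veronese orbits parametrised by unit vectors *)

Section veronese_vectors.
Variables (R : realType) (m : nat).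
Implicit Types (q v : 'cV[R]_m) (X Q : 'M[R]_m).

(** A multiple of the projection on the line of [q], made traceless for unit [q]; the factor [t]
    absorbs the eigenvalues of the given orbit. *)
Definition Sq (t : R) q : 'M[R]_m := t *: (q *m q^T - m%:R^-1 *: 1%:M).

Lemma normalize_vec N (u : 'cV[R]_N) : u != 0 -> exists2 s, s != 0 & dotp (s *: u) (s *: u) = 1.
Proof.
move=> u0; have uu : 0 < dotp u u by rewrite dotp_gt0.
have s0 : Num.sqrt (dotp u u) != 0 by rewrite sqrtr_eq0 -ltNge.
exists (Num.sqrt (dotp u u))^-1; first by rewrite invr_eq0.
have ss : dotp u u = Num.sqrt (dotp u u) * Num.sqrt (dotp u u) by rewrite -expr2 sqr_sqrtr// ltW.
by rewrite dotpZl dotpZr {3}ss; field.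
Qed.

Lemma unit_dyad q : dotp q q = 1 -> q^T *m q = 1%:M.
Proof. by move=> qq; rewrite (mx11_scalar (q^T *m q)) -[(q^T *m q) 0 0]/(dotp q q) qq. Qed.

Lemma tr_Sq t q X : \tr (Sq t q *m X) = t * (dotp q (X *m q) - m%:R^-1 * \tr X).
Proof.
by rewrite /Sq -scalemxAl [\tr _]linearZ/= mulmxBl raddfB/= tr_dyad -scalemxAl mul1mx [\tr (_ *: X)]linearZ.
Qed.

Lemma Sq_sim0 t q : (0 < m)%N -> dotp q q = 1 -> Sim0 (Sq t q).
Proof.
move=> m0 qq; have mm : m%:R != 0 :> R by rewrite pnatr_eq0 -lt0n.
split; first by rewrite /Sq linearZ/= linearB/= linearZ/= trmx1 trmx_mul trmxK.
by rewrite -[Sq t q]mulmx1 tr_Sq mul1mx qq mxtrace1 mulVf// subrr mulr0.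
Qed.

Lemma Sq_mul t q : dotp q q = 1 -> Sq t q *m q = (t * (1 - m%:R^-1)) *: q.
Proof.
by move=> qq; rewrite /Sq -scalemxAl mulmxBl dyad_mul qq -scalemxAl mul1mx -scalerBl scalerA.
Qed.

Lemma Sq_conj t Q q : Q *m Q^T = 1%:M -> Q *m Sq t q *m Q^T = Sq t (Q *m q).
Proof.
move=> QQ; rewrite /Sq -scalemxAr -scalemxAl mulmxBr mulmxBl -scalemxAr -scalemxAl mulmx1 QQ trmx_mul.
by rewrite !mulmxA.
Qed.

Lemma Sq_sqr t q : (0 < m)%N -> dotp q q = 1 -> \tr (Sq t q *m Sq t q) = t * (t * (1 - m%:R^-1)).
Proof. by move=> m0 qq; rewrite tr_Sq Sq_mul// dotpZr qq (Sq_sim0 _ m0 qq).2 mulr0 subr0 mulr1. Qed.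

End veronese_vectors.

(** [S] minus its eigenvalue of multiplicity [n] is symmetric of rank one, hence a multiple of
    [v *m v^T]; the trace fixes the remaining constant. *)
Lemma veronese_type_dyad (R : realType) n (S : 'M[R]_n.+1) : veronese_type S ->
  exists v t, [/\ dotp v v = 1, t != 0 & S = Sq t v].
Proof.
move=> [[ST S0] [a [b [ab eig ra rb]]]].
pose K := S - b%:M.
have rK : \rank K = 1%N.
  move: rb; rewrite /eigenspace mxrank_ker -/K => h.
  by have r1 := rank_leq_row K; move: r1 h; move: (\rank K) => d; lia.
have /eigenvalueP[r rS r0] : eigenvalue S a by rewrite eig eqxx.
have [s s0 vv] : exists2 s, s != 0 & dotp (s *: r^T) (s *: r^T) = 1.
  apply: normalize_vec; apply: contra_neq r0 => /(congr1 trmx); by rewrite trmxK trmx0.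
set v := s *: r^T in vv; pose t := a - b.
have t0 : t != 0 by rewrite subr_eq0.
have KT : K^T = K by rewrite /K linearB/= tr_scalar_mx ST.
have Kv : K *m v = t *: v.
  rewrite /v -scalemxAr; have -> : K *m r^T = t *: r^T.
    by rewrite -{1}KT -trmx_mul /K mulmxBr rS mul_mx_scalar -scalerBl linearZ.
  by rewrite !scalerA mulrC.
have v0 : v^T != 0.
  apply/eqP => /(congr1 trmx); rewrite trmxK trmx0 => v0; move: vv; rewrite v0 dotp0l => /esym/eqP.
  by rewrite oner_eq0.
clearbody v.
have sub : (v^T <= K)%MS.
  apply/submxP; exists (t^-1 *: v^T); rewrite -scalemxAl -{1}KT -trmx_mul Kv linearZ/= scalerA mulVf// scale1r.
  by [].
have [_] := mxrank_leqif_sup sub; rewrite rK rank_rV v0 eqxx => /esym/submxP[D DE].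
have DE' : D = t *: v by rewrite -Kv DE -mulmxA unit_dyad// mulmx1.
have SE : S = t *: (v *m v^T) + b%:M by rewrite scalemxAl -DE' -DE subrK.
have n0 : n.+1%:R != 0 :> R by rewrite pnatr_eq0.
have bE : b = - (t * n.+1%:R^-1).
  move: S0; rewrite SE mxtraceD mxtrace_scalar [\tr (_ *: _)]linearZ/= -[v *m v^T]mulmx1 tr_dyad mul1mx vv.
  rewrite mulr1 -[b *+ _]mulr_natr => /eqP; rewrite addrC addr_eq0 => /eqP E.
  by apply: (mulIf n0); rewrite E mulNr mulfVK.
exists v, t; split=> //; rewrite {1}SE /Sq scalerBr bE; congr (_ + _).
by apply/matrixP => i j; rewrite !mxE; case: (i == j); rewrite ?mulr1n ?mulr0n; ring.
Qed.

(** The congruence may include a translation [b]. As [M] lies on the unit sphere and the linear part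
    has constant norm, the product with [b] is constant on [M], so fullness forces [b] to vanish.
    Fullness also makes [phi] onto. *)
Lemma veronese_normal_form (R : realType) N n (M : set 'cV[R]_N) : (0 < n)%N ->
  veronese n M -> full M -> (forall x, M x -> dotp x x = 1) ->
  exists (phi : {linear 'M[R]_n.+1 -> 'cV[R]_N}) (c t : R),
    [/\ 0 < c /\ t != 0,
        forall A B, Sim0 A -> Sim0 B -> dotp (phi A) (phi B) = c * \tr (A *m B),
        forall x, exists2 A, Sim0 A & phi A = x &
        forall x, M x <-> exists2 q, dotp q q = 1 & x = phi (Sq t q)].
Proof.
move=> n0 [S [c [phi [b [SV c0 dot ME]]]]] fM Msph.
have [v [t [vv t0 SE]]] := veronese_type_dyad SV.
have orb x : M x <-> exists2 q, dotp q q = 1 & x = phi (Sq t q) + b.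
  rewrite ME; split=> [[A [Q [QQ dQ] <-] <-]|[q qq ->]].
    exists (Q *m v); last by rewrite SE Sq_conj.
    by rewrite dotp_mulmxl mulmxA (mulmx1C QQ) mul1mx.
  have [sk [skl skP]] := skew_space R n.+1.
  have [w wh qE] := @skew_words_transitive R n.+1 sk v q n0 skl skP vv qq.
  have [gg _] := normalizes_gword skl wh.
  exists (Sq t q) => //; exists (gword w); first by split; [exact: mulmx1C|exact: det_gword_skew wh].
  by rewrite SE Sq_conj ?qE//; exact: mulmx1C.
have sim (q : 'cV[R]_n.+1) : dotp q q = 1 -> Sim0 (Sq t q) by move=> qq; exact: Sq_sim0.
have b0 : b = 0.
  apply/eqP; rewrite -dotp_eq0; apply/eqP.
  pose k0 := (1 + dotp b b - c * (t * (t * (1 - n.+1%:R^-1)))) / 2.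
  have kE x : M x -> dotp x b = k0.
    move=> Mx; have := Msph _ Mx; case/orb: Mx => q qq ->.
    rewrite !(dotpDl, dotpDr) (dot _ _ (sim _ qq) (sim _ qq)) Sq_sqr// [dotp b (phi _)]dotpC /k0.
    by move: (dotp _ _) (dotp _ _) (c * _) => x1 x2 x3 E; lra.
  have [W WP] := perp_exists (<[b]>)%VS.
  have Wb x : x \in W <-> dotp b x = 0.
    rewrite WP; split=> [/(_ b (memv_line b))//|bx u /vlineP[a ->]]; by rewrite dotpZl bx mulr0.
  have [bb0|bb] := eqVneq (dotp b b) 0; first by [].
  have WT : W = fullv.
    apply: (fM W ((k0 / dotp b b) *: b)) => x Mx; apply/Wb.
    by rewrite dotpBr dotpZr dotpC kE// divfK// subrr.
  by apply/Wb; rewrite WT memvf.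
exists phi, c, t; split=> // [x|x]; last by rewrite orb b0; split=> -[q qq ->]; exists q; rewrite ?addr0.
have [||W WP] := @vspace_of_pred R 'cV[R]_N (fun y => exists2 A : 'M[R]_n.+1, Sim0 A & phi A = y).
- by exists 0; [split; rewrite ?trmx0 ?mxtrace0|rewrite raddf0].
- move=> a _ _ [A [AT A0] <-] [B [BT B0] <-]; exists (a *: A + B); last by rewrite linearP.
  by split; [rewrite linearP/= AT BT|rewrite mxtraceD [\tr _]linearZ/= A0 B0 mulr0 addr0].
apply/WP; have -> : W = fullv; last exact: memvf.
apply: (fM W 0) => y /orb[q qq ->]; rewrite subr0 b0 addr0; apply/WP; exists (Sq t q) => //.
exact: sim.
Qed.

Lemma tangent_orthogonal (R : realType) k (G : set 'M[R]_k) B (w y : 'cV[R]_k) : tangent_at_1 G B ->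
  (forall g, G g -> dotp w (g^T *m y) = 0) -> dotp w (B^T *m y) = 0.
Proof.
move=> [f [sf f0 fG]] H; pose C := k%:R * `|w| * (k%:R * `|y|); set a := dotp _ _.
have C0 : 0 <= C by rewrite !mulr_ge0.
have C1 : 0 < C + 1 by rewrite ltr_wpDl.
have bd e : 0 < e -> `|a| <= C * e.
  move=> e0; have [r r0 Hr] := sf e e0; pose s := r / 2.
  have s0 : 0 < s by rewrite divr_gt0.
  have sr : `|s| < r by rewrite gtr0_norm// gtr_pMr// invf_lt1// ltr1n.
  have := Hr s 0 sr; rewrite normr0 => /(_ r0); rewrite scale0r !subr0; set A := _ - _ => HA.
  have : dotp w (A^T *m y) = - (s * a).
    rewrite /A 2!linearB/= 2!mulmxBl 2!dotpBr (H _ (fG s)) (H _ (fG 0)).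
    by rewrite linearZ/= -scalemxAl dotpZr subrr sub0r.
  move=> /(congr1 Num.norm); rewrite normrN normrM gtr0_norm// => E.
  rewrite -(ler_pM2l s0) -E (le_trans (dotp_le_norm _ _))//.
  have : `|A^T *m y| <= k%:R * `|y| * (e * s).
    rewrite (le_trans (norm_mulmx _ _))// norm_trmx mulrAC ler_wpM2l ?mulr_ge0//.
    by move: HA; rewrite (gtr0_norm s0).
  move=> h; rewrite (le_trans (ler_wpM2l _ h)) ?mulr_ge0// /C.
  by rewrite le_eqVlt; apply/orP; left; apply/eqP; ring.
apply/eqP; apply: contrapT => /negP a0; have ap : 0 < `|a| by rewrite normr_gt0.
have := bd (`|a| / 2 / (C + 1)) ltac:(by rewrite !divr_gt0).
have -> : C * (`|a| / 2 / (C + 1)) = `|a| / 2 * (C / (C + 1)) by ring.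
have h1 : C / (C + 1) <= 1 by rewrite ler_pdivrMr// mul1r lerDl.
have : `|a| / 2 * (C / (C + 1)) <= `|a| / 2 by rewrite ler_piMr// divr_ge0.
lra.
Qed.

(** Loops act through [m^T], so the subspace given to [word_holonomy_curv] consists of the matrices
    whose transpose preserves [W]. *)
Lemma holonomy_invariant_curv (R : realType) N (h : {vspace 'M[R]_N}) (p : 'cV[R]_N) (M : set 'cV[R]_N)
    k (F : 'M[R]_(N, k)) (W : {vspace 'cV[R]_N}) X Y y : lie_so h ->
  (forall x, M x <-> exists2 w, word_in h w & x = gword w *m p) -> F^T *m F = 1%:M ->
  (forall x, sphere_normal M p x <-> F *m (F^T *m x) = x) ->
  (forall tau x, restricted_holonomy M p tau -> x \in W -> tau x \in W) ->
  X \in h -> Y \in h -> F *m y \in W -> F *m (ncurv F X Y *m y) \in W.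
Proof.
move=> hh MP FF FV Winv Xh Yh yW.
have [||W' W'P] := @vspace_of_pred R 'cV[R]_k (fun z => F *m z \in W).
- by rewrite mulmx0 mem0v.
- by move=> a u v uW vW; rewrite mulmxDr -scalemxAr memvD// memvZ.
have [||S SP] := @vspace_of_pred R 'M[R]_k (fun T => forall z, z \in W' -> T^T *m z \in W').
- by move=> z _; rewrite trmx0 mul0mx mem0v.
- by move=> a T U HT HU z zW; rewrite linearP/= mulmxDl -scalemxAl memvD ?memvZ ?HT ?HU.
have tS B : tangent_at_1 (word_holonomy h F) B -> B^T = - B -> B \in S.
  move=> HB _; apply/SP => z zW; apply: vspace_orthP => w wW.
  apply: tangent_orthogonal HB _ => g gh; apply: wW; apply/W'P.
  have := Winv _ (F *m z) (word_holonomyP hh MP FF FV gh) ltac:(by apply/W'P).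
  by rewrite (mulmxA F^T) FF mul1mx.
have := @word_holonomy_curv R N h hh k F S [::] X Y tS (fun a H => False_ind _ (notF H)) Xh Yh.
rewrite /= gword_nil trmx1 mulmx1 mul1mx => /SP/(_ y ltac:(by apply/W'P)).
have -> : (ncurv F X Y)^T = - ncurv F X Y.
  have := nu_skew hh F (hh.2 _ _ Xh Yh); have := nu_skew hh F Xh; have := nu_skew hh F Yh.
  rewrite /ncurv; move: (nu F X) (nu F Y) (nu F (X *m Y - Y *m X)) => A B C BT AT CT.
  rewrite !linearB/= !trmx_mul AT BT CT !mulmxN !mulNmx !opprK.
  by apply/matrixP => i j; rewrite !mxE; ring.
by rewrite mulNmx memvN => /W'P.
Qed.

(** * Normal holonomy of a Veronese orbit *)

Section veronese_orbit.
Variables (R : realType) (N n : nat) (phi : {linear 'M[R]_n.+1 -> 'cV[R]_N}) (c t0 : R).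
Variables (M : set 'cV[R]_N) (q0 : 'cV[R]_n.+1).
Implicit Types (q : 'cV[R]_n.+1) (A B E S : 'M[R]_n.+1) (X Y : 'M[R]_N) (x y : 'cV[R]_N).
Hypothesis hn : (2 < n)%N.
Hypothesis c0 : 0 < c.
Hypothesis t00 : t0 != 0.
Hypothesis dot : forall A B, Sim0 A -> Sim0 B -> dotp (phi A) (phi B) = c * \tr (A *m B).
Hypothesis onto : forall x, exists2 A, Sim0 A & phi A = x.
Hypothesis ME : forall x, M x <-> exists2 q, dotp q q = 1 & x = phi (Sq t0 q).
Hypothesis qq0 : dotp q0 q0 = 1.
Let p := phi (Sq t0 q0).
Let cn : c != 0. Proof. by rewrite gt_eqF. Qed.

Let SqS q : dotp q q = 1 -> Sim0 (Sq t0 q). Proof. exact: Sq_sim0. Qed.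

Let Mq q : dotp q q = 1 -> M (phi (Sq t0 q)). Proof. by move=> qq; apply/ME; exists q. Qed.

Let Sim0P a A B : Sim0 A -> Sim0 B -> Sim0 (a *: A + B : 'M[R]_n.+1).
Proof.
move=> [AT A0] [BT B0]; split; first by rewrite linearP/= AT BT.
by rewrite mxtraceD [\tr _]linearZ/= A0 B0 mulr0 addr0.
Qed.

Let thetaP : exists theta : {linear 'cV[R]_N -> 'M[R]_n.+1},
  [/\ forall x, Sim0 (theta x), forall x, phi (theta x) = x & forall A, Sim0 A -> theta (phi A) = A].
Proof.
pose Z (j : 'I_N) := projT1 (cid2 (onto (delta_mx j 0))).
have ZS j : Sim0 (Z j) by rewrite /Z; case: cid2.
have Zphi j : phi (Z j) = delta_mx j 0 by rewrite /Z; case: cid2.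
pose th x : 'M[R]_n.+1 := \sum_j x j 0 *: Z j.
have thS x : Sim0 (th x).
  rewrite /th; elim/big_rec: _ => [|j A _ AS]; last exact: Sim0P.
  by split; rewrite ?trmx0 ?mxtrace0.
have thlin : linear th.
  move=> a x y; rewrite /th scaler_sumr -big_split/=; apply: eq_bigr => j _.
  by rewrite !mxE scalerDl scalerA.
have thK x : phi (th x) = x.
  rewrite /th raddf_sum/=; under eq_bigr do rewrite linearZ/= Zphi.
  apply/matrixP => i k; rewrite ord1 summxE (bigD1 i)//= big1 ?addr0 => [|j ji]; rewrite !mxE ?eqxx ?mulr1//.
  by rewrite eq_sym (negbTE ji) mulr0.
pose mm := GRing.isLinear.Build R 'cV[R]_N 'M[R]_n.+1 _ (th : 'cV[R]_N -> 'M[R]_n.+1) thlin.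
exists (HB.pack (th : 'cV[R]_N -> 'M[R]_n.+1) mm : {linear 'cV[R]_N -> 'M[R]_n.+1}); split=> //= A AS.
have BS : Sim0 (th (phi A) - A) by rewrite -[th _ - A]addrC -scaleN1r; exact: Sim0P.
apply/eqP; rewrite -subr_eq0; apply/eqP; apply: trmul_eq0; rewrite BS.1.
apply: (mulfI cn); rewrite -dot// mulr0; apply/eqP; rewrite dotp_eq0 raddfB/= thK subrr.
by [].
Qed.

Let theta := projT1 (cid thetaP).
Let thS x : Sim0 (theta x). Proof. by rewrite /theta; case: cid => ? []. Qed.
Let thK x : phi (theta x) = x. Proof. by rewrite /theta; case: cid => ? []. Qed.
Let phiK A : Sim0 A -> theta (phi A) = A. Proof. by rewrite /theta; case: cid => th [? ? H]; exact: H. Qed.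

Let dotth x y : dotp x y = c * \tr (theta x *m theta y).
Proof. by rewrite -{1}(thK x) -{1}(thK y) dot; try exact: thS. Qed.

Let rep X E := forall S, Sim0 S -> X *m phi S = phi (E *m S - S *m E).

Let Sim0_br E S : E^T = - E -> Sim0 S -> Sim0 (E *m S - S *m E : 'M[R]_n.+1).
Proof.
move=> ET [ST _]; split; last by rewrite raddfB/= mxtrace_mulC subrr.
by rewrite linearB/= !trmx_mul ET ST mulmxN mulNmx opprK addrC.
Qed.

Let tr_br (E A B : 'M[R]_n.+1) : \tr ((E *m A - A *m E) *m B) = - \tr (A *m (E *m B - B *m E)).
Proof.
have trB (U V : 'M[R]_n.+1) : \tr (U - V) = \tr U - \tr V by rewrite raddfB.
by rewrite mulmxBl mulmxBr !trB opprB -!mulmxA [\tr (E *m _)]mxtrace_mulC -mulmxA.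
Qed.

Let rep_skew X E : E^T = - E -> rep X E -> X^T = - X.
Proof.
move=> ET XE; apply: mx_ext => x; apply: dotp_ext => y.
rewrite -(thK x) -(thK y); move: (theta x) (theta y) (thS x) (thS y) => A B AS BS.
rewrite mulNmx dotpNl dotp_mulmxl trmxK !XE//.
have [EA EB] := (Sim0_br ET AS, Sim0_br ET BS).
by rewrite !dot// tr_br mulrN opprK.
Qed.

Let rep_exists E : exists X, rep X E.
Proof.
pose f := phi \o (mulmx E \- mulmxr E) \o theta.
pose L := lin1_mx ((@trmx R N 1) \o f \o (@trmx R 1 N)).
exists L^T => S SS; apply: trmx_inj; rewrite trmx_mul trmxK /L mul_rV_lin1 /= trmxK phiK//.
Qed.

Let h0P : exists h0 : {vspace 'M[R]_N}, forall X, X \in h0 <-> exists2 E, E^T = - E & rep X E.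
Proof.
apply: vspace_of_pred.
  by exists 0 => [|S SS]; rewrite ?trmx0 ?oppr0// mul0mx mul0mx mulmx0 subrr raddf0.
move=> a X Y [E ET XE] [E' ET' YE]; exists (a *: E + E'); first by rewrite linearP/= ET ET' opprD scalerN.
move=> S SS; rewrite mulmxDl -scalemxAl XE// YE// -linearP/= mulmxDl mulmxDr -scalemxAl -scalemxAr scalerBr.
by congr (phi _); rewrite opprD addrACA.
Qed.

(** The algebra of skew matrices of size n + 1 acting on R^N by commutators; presenting [M] as its
    orbit makes the results on words available. *)
Let h0 := projT1 (cid h0P).
Let h0E X : X \in h0 <-> exists2 E, E^T = - E & rep X E.
Proof. by rewrite /h0; case: cid. Qed.

Let rep_br X Y E E' : E^T = - E -> E'^T = - E' -> rep X E -> rep Y E' ->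
  rep (X *m Y - Y *m X) (E *m E' - E' *m E).
Proof.
move=> ET ET' AE BE S SS; rewrite mulmxBl -!mulmxA AE// BE// AE ?BE; try exact: Sim0_br.
rewrite -raddfB/=; congr (phi _); rewrite !(mulmxBl, mulmxBr) !mulmxA.
move: (E *m E' *m S) (E' *m E *m S) (S *m E *m E') (S *m E' *m E) (E *m S *m E') (E' *m S *m E) => *.
by apply/matrixP => i j; rewrite !mxE; ring.
Qed.

Let h0_lie : lie_so h0.
Proof.
split=> [A /h0E[E ET AE]|A B /h0E[E ET AE] /h0E[E' ET' BE]]; first exact: rep_skew AE.
apply/h0E; exists (E *m E' - E' *m E); last exact: rep_br.
by rewrite linearB/= !trmx_mul ET ET' !mulmxN !mulNmx !opprK opprB.
Qed.

Let conjS (g S : 'M[R]_n.+1) : g^T *m g = 1%:M -> Sim0 S -> Sim0 (g *m S *m g^T).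
Proof.
move=> gg [ST S0]; split; first by rewrite !trmx_mul trmxK ST mulmxA.
by rewrite mxtrace_mulC mulmxA gg mul1mx.
Qed.

Let one t X E S : E^T = - E -> rep X E -> Sim0 S ->
  expmx (t *: X) *m phi S = phi (expmx (t *: E) *m S *m (expmx (t *: E))^T).
Proof.
move=> ET XE SS; pose f u := phi (expmx (u *: E) *m S *m (expmx (u *: E))^T).
have f0 : f 0 = phi S by rewrite /f scale0r expmx0 trmx1 mulmx1 mul1mx.
rewrite -f0 -/(f t); apply/esym; apply: expmx_ode => u.
have d1 := is_derive_expmx E u.
have := is_derive_linear phi (is_derive_mulmx (is_derive_mulcst S d1) (is_derive_trmx d1)).
move=> H; apply: is_derive_eq H _; rewrite /f XE//; last by apply: conjS => //; exact: orth_expmx.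
by congr (phi _); rewrite trmx_mul ET !mulmxN !mulmxA.
Qed.

Let gword_rep w' : word_in h0 w' -> exists2 g, g^T *m g = 1%:M & forall S, Sim0 S ->
  gword w' *m phi S = phi (g *m S *m g^T).
Proof.
elim: w' => [_|[t X] w' IH /word_in_consP[/h0E[E ET XE] /IH[g gg H]]].
  by exists 1%:M => [|S SS]; rewrite ?trmx1 ?mulmx1// gword_nil !mul1mx.
have ee := orth_expmx t ET; exists (expmx (t *: E) *m g).
  by rewrite trmx_mul mulmxA -(mulmxA g^T) ee mulmx1.
move=> S SS; rewrite gword_cons -mulmxA H// (one _ ET XE)//; last exact: conjS.
by rewrite trmx_mul !mulmxA.
Qed.

Let word_rep w : (forall a, a \in w -> a.2^T = - a.2) -> exists2 w', word_in h0 w' &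
  forall S : 'M[R]_n.+1, Sim0 S -> gword w' *m phi S = phi (gword w *m S *m (gword w)^T).
Proof.
elim: w => [_|[t E] w IH H]; first by exists [::] => // S SS; rewrite !gword_nil !mul1mx trmx1 mulmx1.
have [w' wh' Hw] := IH (fun a aw => H a (mem_behead (s := (t, E) :: w) aw)).
have ET : E^T = - E by apply: (H (t, E)); rewrite inE eqxx.
have ww : (gword w)^T *m gword w = 1%:M.
  have [sk [skl skP]] := skew_space R n.+1.
  by have [] : normalizes sk (gword w); [apply: normalizes_gword skl _ => a aw; apply: skP; apply: H; rewrite inE aw orbT|].
have [X XE] := rep_exists E; exists ((t, X) :: w').
  by apply/word_in_consP; split=> //; apply/h0E; exists E.
move=> S SS; rewrite !gword_cons -mulmxA Hw// (one _ ET XE)//; last exact: conjS.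
by rewrite trmx_mul !mulmxA.
Qed.

Let MP x : M x <-> exists2 w, word_in h0 w & x = gword w *m p.
Proof.
rewrite ME; split=> [[q qq ->]|[w wh ->]].
  have [sk [skl skP]] := skew_space R n.+1.
  have [w wh qE] := @skew_words_transitive R n.+1 sk q0 q (ltnW (ltnW hn)) skl skP qq0 qq.
  have [a aw|w' wh' H] := @word_rep w; first exact/skl.1/wh.
  exists w' => //; rewrite H; last exact: SqS.
  have [gg _] := normalizes_gword skl wh.
  by rewrite Sq_conj ?qE//; exact: mulmx1C.
have [g gg H] := gword_rep wh; exists (g *m q0); first by rewrite dotp_orth.
by rewrite /p H; [rewrite Sq_conj//; exact: mulmx1C|exact: SqS].
Qed.

(** Tangent vectors at [q] come from commutators with [v *m q^T - q *m v^T]; testing with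
    [v = theta x *m q] turns the pairing into a multiple of a squared norm. *)
Let normalP q x : dotp q q = 1 -> sphere_normal M (phi (Sq t0 q)) x <-> theta x *m q = 0.
Proof.
move=> qq; rewrite (orbit_sphere_normal h0_lie MP); last exact: Mq.
have [YT Y0] := thS x; have SS := SqS qq.
have E1 : dotp (phi (Sq t0 q)) x = c * (t0 * dotp q (theta x *m q)).
  by rewrite -{1}(thK x) dot; try exact: thS; rewrite ?tr_Sq ?Y0 ?mulr0 ?subr0.
have E2 E : E^T = - E -> c * \tr ((E *m Sq t0 q - Sq t0 q *m E) *m theta x) = 2 * c * t0 * dotp (E *m q) (theta x *m q).
  move=> ET; rewrite tr_br tr_Sq (Sim0_br ET (thS x)).2 mulr0 subr0 mulmxBl dotpBr -!mulmxA.
  rewrite [dotp q (E *m _)]dotp_mulmxr ET mulNmx dotpNl [dotp q (theta x *m (E *m q))]dotp_mulmxr YT.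
  by rewrite [dotp (theta x *m q) _]dotpC; ring.
split=> [[H1 H2]|Yq].
  set v := theta x *m q; have qv : dotp q v = 0.
    apply: (mulfI t00); apply: (mulfI cn); by rewrite !mulr0 -E1.
  pose E := v *m q^T - q *m v^T.
  have ET : E^T = - E by rewrite /E linearB/= !trmx_mul !trmxK opprB.
  have Eq : E *m q = v by rewrite /E mulmxBl !dyad_mul qq scale1r dotpC qv scale0r subr0.
  have [X XE] := rep_exists E.
  have := H2 X ltac:(by apply/h0E; exists E); rewrite XE// -{1}(thK x) dot; [|exact: Sim0_br|exact: thS].
  rewrite E2// Eq => /eqP; rewrite !mulf_eq0 (negbTE cn) (negbTE t00) pnatr_eq0/= dotp_eq0 => /eqP.
  by [].
split; first by rewrite E1 Yq dotp0r !mulr0.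
move=> X /h0E[E ET XE]; rewrite XE// -{1}(thK x) dot; [|exact: Sim0_br|exact: thS].
by rewrite E2// Yq dotp0r mulr0.
Qed.

Let tr_skew A B (a b : 'cV[R]_n.+1) : A^T = A -> B^T = B -> let E := a *m b^T - b *m a^T in
  \tr ((E *m A - A *m E) *m B) = - (2 * dotp a ((A *m B - B *m A) *m b)).
Proof.
move=> AT BT E; have trB (U V : 'M[R]_n.+1) : \tr (U - V) = \tr U - \tr V by rewrite raddfB.
have trE (Z : 'M[R]_n.+1) : \tr ((Z *m A - A *m Z) *m B) = \tr (Z *m (A *m B - B *m A)).
  by rewrite mulmxBl mulmxBr !trB !mulmxA -(mulmxA A Z B) [\tr (A *m _)]mxtrace_mulC.
rewrite trE.
have KT : (A *m B - B *m A)^T = - (A *m B - B *m A) by rewrite linearB/= !trmx_mul AT BT opprB.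
move: (A *m B - B *m A) KT => K KT; rewrite /E mulmxBl trB !tr_dyad [dotp b _]dotp_mulmxr KT mulNmx dotpNl.
by rewrite [dotp (K *m b) a]dotpC; ring.
Qed.

Let VP : exists (k : nat) (F : 'M[R]_(N, k)), F^T *m F = 1%:M /\
  forall x, sphere_normal M p x <-> F *m (F^T *m x) = x.
Proof.
have [||V HV] := @vspace_of_pred R 'cV[R]_N (sphere_normal M p).
- by apply/(normalP _ qq0); rewrite raddf0 mul0mx.
- move=> a x y /(normalP _ qq0) Hx /(normalP _ qq0) Hy; apply/(normalP _ qq0).
  by rewrite linearP/= mulmxDl -scalemxAl Hx Hy scaler0 addr0.
have [F [FF HF]] := orthonormal_basis V; exists (\dim V), F; split=> // x.
by rewrite -HV HF; split=> [/eqP|->].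
Qed.

Let normalA A : Sim0 A -> sphere_normal M p (phi A) <-> A *m q0 = 0.
Proof. by move=> AS; rewrite /p (normalP _ qq0) phiK. Qed.

Let frame_at : exists2 u : 'I_n.+1 -> 'cV[R]_n.+1, orthoframe u & u ord0 = q0.
Proof.
have [sk [skl skP]] := skew_space R n.+1; have uu := @orthoframe_std R n.+1.
have d0 : dotp (delta_mx (ord0 : 'I_n.+1) 0 : 'cV[R]_n.+1) (delta_mx ord0 0) = 1 by rewrite uu eqxx.
have [w wh qE] := @skew_words_transitive R n.+1 sk _ q0 (ltnW (ltnW hn)) skl skP d0 qq0.
have [gg _] := normalizes_gword skl wh.
by exists (fun i => gword w *m delta_mx i 0) => // i j; rewrite dotp_orth.
Qed.

Let cubic : exists Y : 'M[R]_n.+1, [/\ Sim0 Y, Y *m q0 = 0 & \tr (Y *m (Y *m Y)) = - 6].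
Proof.
have [u uo u0] := frame_at.
have h1 : (1 < n.+1)%N by rewrite ltnS (ltn_trans _ hn).
have h2 : (2 < n.+1)%N by rewrite ltnS (ltn_trans _ hn).
pose i1 := Ordinal h1; pose i2 := Ordinal h2; pose i3 : 'I_n.+1 := Ordinal (hn : (3 < n.+1)%N).
(* Eigenvalues 1, 1, -2 on three directions orthogonal to [q0], available as 2 < n: the trace is 0
   and the cubes sum to -6. *)
pose Y : 'M[R]_n.+1 := u i1 *m (u i1)^T + u i2 *m (u i2)^T - 2 *: (u i3 *m (u i3)^T).
have Yx (x : 'cV[R]_n.+1) : Y *m x = dotp (u i1) x *: u i1 + dotp (u i2) x *: u i2 - (2 * dotp (u i3) x) *: u i3.
  by rewrite /Y mulmxBl mulmxDl -scalemxAl !dyad_mul scalerA.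
have Yt (X : 'M[R]_n.+1) : \tr (Y *m X) = dotp (u i1) (X *m u i1) + dotp (u i2) (X *m u i2) - 2 * dotp (u i3) (X *m u i3).
  by rewrite /Y mulmxBl raddfB/= mulmxDl mxtraceD -scalemxAl [\tr (2 *: _)]linearZ/= !tr_dyad.
have o12 : dotp (u i1) (u i2) = 0 := uo i1 i2.
have o13 : dotp (u i1) (u i3) = 0 := uo i1 i3.
have o23 : dotp (u i2) (u i3) = 0 := uo i2 i3.
have o11 : dotp (u i1) (u i1) = 1 := uo i1 i1.
have o22 : dotp (u i2) (u i2) = 1 := uo i2 i2.
have o33 : dotp (u i3) (u i3) = 1 := uo i3 i3.
have o10 : dotp (u i1) q0 = 0 by rewrite -u0; exact: (uo i1 ord0).
have o20 : dotp (u i2) q0 = 0 by rewrite -u0; exact: (uo i2 ord0).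
have o30 : dotp (u i3) q0 = 0 by rewrite -u0; exact: (uo i3 ord0).
have oo := (o12, o13, o23, o11, o22, o33, o10, o20, o30, dotpC (u i2) (u i1), dotpC (u i3) (u i1), dotpC (u i3) (u i2)).
have Y1 : Y *m u i1 = u i1 by rewrite Yx !oo ?(scale1r, scale0r, mulr0, addr0, subr0).
have Y2 : Y *m u i2 = u i2 by rewrite Yx !oo ?(scale1r, scale0r, mulr0, addr0, add0r, subr0).
have Y3 : Y *m u i3 = - (2 *: u i3) by rewrite Yx !oo ?(scale1r, scale0r, mulr1, addr0, add0r, sub0r).
exists Y; split.
- split; first by rewrite /Y linearB/= linearD/= linearZ/= !trmx_mul !trmxK.
  by rewrite -[Y]mulmx1 Yt !mul1mx !oo; ring.
- by rewrite Yx !oo ?(scale0r, mulr0, addr0, subr0).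
rewrite Yt -!mulmxA Y1 Y2 Y3 mulmxN -scalemxAr Y3 scalerN opprK scalerA Y1 Y2 dotpZr !oo; ring.
Qed.

(** The generators [x *m q0^T - q0 *m x^T] have zero [nu], so the normal curvature is minus [nu] of
    their bracket and provides all rotations orthogonal to [q0]. If [D] is in a stable [W] and [D']
    is orthogonal to [W], then [D'] is orthogonal to all the rotated [D], which says that the two
    commute. By [commuting_sym] one of them is scalar on the orthogonal of [q0], hence zero by its
    trace. *)
Lemma veronese_irreducible : acts_irreducibly (restricted_holonomy M p) (sphere_normal M p).
Proof.
split.
  have [Y [YS Yq Y3]] := cubic; exists (phi Y); first exact/normalA.
  apply/eqP => Y0; have YZ : Y = 0 by rewrite -(phiK YS) Y0 raddf0.
  move: Y3; rewrite YZ mul0mx raddf0 => /eqP.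
  by rewrite eq_sym oppr_eq0 pnatr_eq0.
move=> W Wn Winv; have [k [F [FF FV]]] := VP.
have skE (x y : 'cV[R]_n.+1) : (x *m y^T - y *m x^T)^T = - (x *m y^T - y *m x^T).
  by rewrite linearB/= !trmx_mul !trmxK opprB.
have nuX (x : 'cV[R]_n.+1) X : rep X (x *m q0^T - q0 *m x^T) -> nu F X = 0.
  move=> XE; apply: mx_ext => y; rewrite mul0mx /nu -!mulmxA; apply: dotp_ext => w; rewrite dotp0l.
  rewrite -dotp_mulmxr; have Ay := (normalP _ qq0).1 (frame_normal FF FV y); have Aw := (normalP _ qq0).1 (frame_normal FF FV w).
  rewrite -(thK (F *m y)) -(thK (F *m w)); move: (theta _) (theta _) (thS (F *m y)) (thS (F *m w)) Ay Aw => A B AS BS Aq Bq.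
  rewrite XE// dot//; last exact: Sim0_br.
  by rewrite tr_skew ?AS.1 ?BS.1// mulmxBl -!mulmxA Aq Bq !mulmx0 subr0 dotp0r mulr0 oppr0 mulr0.
have brW D (x y : 'cV[R]_n.+1) : Sim0 D -> D *m q0 = 0 -> phi D \in W -> dotp x q0 = 0 -> dotp y q0 = 0 ->
    let C := y *m x^T - x *m y^T in
    [/\ Sim0 (C *m D - D *m C), (C *m D - D *m C) *m q0 = 0 & phi (C *m D - D *m C) \in W].
  move=> DS Dq DW xq yq C; have CT : C^T = - C := skE y x.
  have BS := Sim0_br CT DS.
  have Bq : (C *m D - D *m C) *m q0 = 0.
    by rewrite mulmxBl -!mulmxA Dq mulmx0 /C mulmxBl !dyad_mul xq yq !scale0r subrr mulmx0 subr0.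
  split=> //; have [X XE] := rep_exists (x *m q0^T - q0 *m x^T); have [Y YE] := rep_exists (y *m q0^T - q0 *m y^T).
  have Xh : X \in h0 by apply/h0E; exists (x *m q0^T - q0 *m x^T).
  have Yh : Y \in h0 by apply/h0E; exists (y *m q0^T - q0 *m y^T).
  have FD : F *m (F^T *m phi D) = phi D by apply/FV/normalA.
  have := @holonomy_invariant_curv R N h0 p M k F W X Y (F^T *m phi D) h0_lie MP FF FV Winv Xh Yh.
  rewrite FD => /(_ DW); rewrite /ncurv (nuX _ _ XE) (nuX _ _ YE) mul0mx subrr sub0r mulNmx /nu -!mulmxA FD.
  have EC : (x *m q0^T - q0 *m x^T) *m (y *m q0^T - q0 *m y^T) - (y *m q0^T - q0 *m y^T) *m (x *m q0^T - q0 *m x^T) = C.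
    apply: mx_ext => z; rewrite mulmxBl -!mulmxA /C !mulmxBl !dyad_mul !(dotpBr, dotpZr) qq0.
    rewrite [dotp q0 x]dotpC [dotp q0 y]dotpC xq yq [dotp y x]dotpC.
    move: (dotp x y) (dotp x z) (dotp y z) (dotp q0 z) => r1 r2 r3 r4.
    by apply/matrixP => i j; rewrite !mxE; ring.
  have := rep_br (skE x q0) (skE y q0) XE YE; rewrite EC => -> //.
  by rewrite mulmxN memvN; have/FV-> : sphere_normal M p (phi (C *m D - D *m C)) by apply/normalA.
have com D D' : Sim0 D -> D *m q0 = 0 -> phi D \in W -> Sim0 D' -> D' *m q0 = 0 ->
    (forall y, y \in W -> dotp y (phi D') = 0) -> D *m D' = D' *m D.
  move=> DS Dq DW DS' Dq' DW'; apply/eqP; rewrite -subr_eq0; apply/eqP.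
  have KT : (D *m D' - D' *m D)^T = - (D *m D' - D' *m D) by rewrite linearB/= !trmx_mul DS.1 DS'.1 opprB.
  have Kq : (D *m D' - D' *m D) *m q0 = 0 by rewrite mulmxBl -!mulmxA Dq Dq' !mulmx0 subr0.
  have K0 (x y : 'cV[R]_n.+1) : dotp x q0 = 0 -> dotp y q0 = 0 -> dotp y ((D *m D' - D' *m D) *m x) = 0.
    move=> xq yq; have [BS _ BW] := brW D x y DS Dq DW xq yq.
    have := DW' _ BW; rewrite dot// tr_skew ?DS.1 ?DS'.1// => /eqP.
    by rewrite mulf_eq0 (negbTE cn) oppr_eq0 mulf_eq0 pnatr_eq0 => /eqP.
  move: (D *m D' - D' *m D) KT Kq K0 => K KT Kq K0.
  have pr (x : 'cV[R]_n.+1) : dotp (x - dotp x q0 *: q0) q0 = 0 by rewrite dotpBl dotpZl qq0 mulr1 subrr.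
  apply: mx_ext => x; apply: dotp_ext => y; rewrite mul0mx dotp0l dotpC.
  have := K0 _ _ (pr x) (pr y); rewrite mulmxBr -scalemxAr Kq scaler0 subr0 dotpBl dotpZl.
  by rewrite [dotp q0 _]dotp_mulmxr KT mulNmx Kq oppr0 dotp0l mulr0 subr0.
have key D D' : Sim0 D -> D *m q0 = 0 -> phi D \in W -> Sim0 D' -> D' *m q0 = 0 ->
    (forall y, y \in W -> dotp y (phi D') = 0) -> D = 0 \/ D' = 0.
  move=> DS Dq DW DS' Dq' DW'.
  have tr0 (c' : R) (T : 'M[R]_n.+1) : \tr T = 0 -> T = c' *: (1%:M - q0 *m q0^T) -> T = 0.
    move=> T0 TE; move: T0; rewrite TE [\tr _]linearZ/= raddfB/= mxtrace1 -[q0 *m q0^T]mulmx1 tr_dyad mul1mx qq0.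
    rewrite -natr1 addrK => /eqP; rewrite mulf_eq0 pnatr_eq0 => /orP[/eqP->|/eqP nz]; first by rewrite scale0r.
    by exfalso; move: hn; rewrite nz.
  have [] := @commuting_sym R n.+1 q0 D D' (ltnW (ltnW hn)) qq0 DS.1 DS'.1 Dq Dq' (com _ _ DS Dq DW DS' Dq' DW').
    move=> x y xq yq C; have [BS Bq BW] := brW D x y DS Dq DW xq yq.
    exact: com.
  by move=> c' [/(tr0 _ _ DS.2)|/(tr0 _ _ DS'.2)]; [left|right].
have [[y0 yW y0n]|W0] := pselect (exists2 y, y \in W & y != 0); last first.
  left; apply/eqP; rewrite -subv0; apply/subvP => x xW; rewrite memv0; apply: contrapT => /negP x0.
  by apply: W0; exists x.
right=> x Vx; apply: vspace_orthP => w wW; pose w' := F *m (F^T *m w).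
have sw u v : dotp u (F *m (F^T *m v)) = dotp (F *m (F^T *m u)) v by rewrite !dotp_mulmxr trmxK.
have w0 : w' = 0.
  rewrite -(thK w'); have nw : theta w' *m q0 = 0 by apply: (normalP _ qq0).1; exact: frame_normal.
  have ny : theta y0 *m q0 = 0 by apply: (normalP _ qq0).1; exact: Wn.
  have yW' : phi (theta y0) \in W by rewrite thK.
  have pw y : y \in W -> dotp y (phi (theta w')) = 0.
    by move=> yW1; rewrite thK /w' sw dotpC; have /FV -> := Wn _ yW1; exact: wW.
  have [y00|->] := key _ _ (thS _) ny yW' (thS _) nw pw; last by rewrite raddf0.
  by move: y0n; rewrite -(thK y0) y00 raddf0 eqxx.
by have /FV <- := Vx; rewrite sw -/w' w0 dotp0l.
Qed.

Let cube x := \tr (theta x *m (theta x *m theta x)).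

Let derive_const (f : R -> 'M[R]_n.+1) (K df : 'M[R]_n.+1) (t : R) : is_derive t 1 f df ->
  is_derive t 1 (fun s => f s + K) df.
Proof. by move=> H; have := is_deriveD H (is_derive_cst K t 1); rewrite addr0. Qed.

(** The derivative is three times the trace of [Y *m Y] against Y'. The traceless part [Z] of
    [Y *m Y] on the orthogonal of [q] is normal, so parallelism disposes of it; the rest is a
    multiple of [1%:M - P], whose product with Y' has zero trace. *)
Let cube_piece (g zeta : R -> 'cV[R]_N) (a b : R) : smooth_curve g -> smooth_curve zeta -> a < b ->
  (forall t, a <= t <= b -> [/\ M (g t), sphere_normal M (g t) (zeta t) &
     forall eta, sphere_normal M (g t) eta -> dotp eta (derive1 zeta t) = 0]) ->
  cube (zeta a) = cube (zeta b).
Proof.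
move=> gs zs ab H.
have der (f : R -> 'cV[R]_N) (t : R) : smooth_curve f -> is_derive t 1 f (derive1 f t).
  by move=> fs; split; [exact: (fs 0%N)|rewrite derive1E].
have n0 : n%:R != 0 :> R by rewrite pnatr_eq0 -lt0n (ltn_trans _ hn).
(* Adding [K] turns [theta (g s)] into [t0] times a projection of rank one, whose equations can be
   differentiated. *)
pose K : 'M[R]_n.+1 := (t0 / n.+1%:R)%:M.
have Q q : Sq t0 q + K = t0 *: (q *m q^T).
  by rewrite /Sq scalerBr scalerA scalemx1 subrK.
apply: (const_on_segment (f := fun s => cube (zeta s)) (ltW ab)) => t tab e e0.
have dT := is_derive_linear theta (der g t gs); have dY := is_derive_linear theta (der zeta t zs).
have [/ME[q qq gE] Yn par] := H t tab.
have Yq : theta (zeta t) *m q = 0 by apply: (normalP _ qq).1; rewrite -gE.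
set Y := theta (zeta t) in Yq; set T' := theta (derive1 g t) in dT; set Y' := theta (derive1 zeta t) in dY.
have YT : Y^T = Y := (thS _).1; have YT' : Y'^T = Y' := (thS _).1.
have nz s : a <= s <= b -> exists2 r : 'cV[R]_n.+1, dotp r r = 1 &
    theta (g s) + K = t0 *: (r *m r^T) /\ theta (zeta s) *m r = 0.
  move=> sab; have [/ME[r rr rE] sn _] := H s sab; exists r => //; split.
    by rewrite rE phiK ?Q//; exact: SqS.
  by apply: (normalP _ rr).1; rewrite -rE.
have dTK := derive_const K dT; have dTK' := derive_const (K - t0%:M) dT.
(* The relations differentiated say that the normal field annihilates [q] and, for z2, that the
   projection is idempotent. *)
have z1 := zero_derivative_segment ab tab (is_derive_mulmx dY dTK) _.
have {}z1 : Y' *m (theta (g t) + K) + Y *m T' = 0.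
  apply: z1 => s sab; have [r rr [-> Yr]] := nz s sab.
  by rewrite -scalemxAr mulmxA Yr mul0mx scaler0.
have z2 : T' *m (theta (g t) + (K - t0%:M)) + (theta (g t) + K) *m T' = 0.
  apply: (zero_derivative_segment ab tab (is_derive_mulmx dTK dTK')) => s sab.
  have [r rr [rE _]] := nz s sab; rewrite addrA rE mulmxBr mul_mx_scalar -scalemxAl -scalemxAr.
  by rewrite mulmxA -(mulmxA r) (unit_dyad rr) mulmx1 subrr.
have TE : theta (g t) + K = t0 *: (q *m q^T) by rewrite gE phiK ?Q//; exact: SqS.
move: z1 z2; rewrite addrA TE.
set P := q *m q^T => z1 z2.
have YP : Y *m P = 0 by rewrite /P mulmxA Yq mul0mx.
have PT : P^T = P by rewrite /P trmx_mul trmxK.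
have PY : P *m Y = 0 by rewrite -[P *m Y]trmxK trmx_mul YT PT YP trmx0.
have trB (U V : 'M[R]_n.+1) : \tr (U - V) = \tr U - \tr V by rewrite raddfB.
have tYT : \tr (Y *m T') = 0.
  have := congr1 (fun Z => \tr (Y *m Z)) z2; rewrite mulmx0 mxtrace0 mulmxDr mxtraceD.
  rewrite -scalemxAl -scalemxAr (mulmxA Y P) YP mul0mx scaler0 mxtrace0 addr0 mulmxBr mulmxBr trB mul_mx_scalar.
  rewrite -!scalemxAr [\tr (_ *: (Y *m (T' *m P)))]linearZ/= mulmxA mxtrace_mulC mulmxA PY mul0mx mxtrace0 mulr0 sub0r.
  by rewrite [\tr _]linearZ/= => /eqP; rewrite oppr_eq0 mulf_eq0 (negbTE t00) => /eqP.
have tYP : \tr (Y' *m P) = 0.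
  have := congr1 (@mxtrace R n.+1) z1; rewrite mxtrace0 mxtraceD tYT addr0 -scalemxAr [\tr _]linearZ/=.
  by move=> /eqP; rewrite mulf_eq0 (negbTE t00) => /eqP.
pose kp := \tr (Y *m Y) / n%:R; pose Z := Y *m Y - kp *: (1%:M - P).
have trP : \tr P = 1 by rewrite /P -[q *m q^T]mulmx1 tr_dyad mul1mx qq.
have ZS : Sim0 Z.
  split; first by rewrite /Z linearB/= linearZ/= linearB/= trmx_mul YT trmx1 /P trmx_mul trmxK.
  by rewrite /Z trB [\tr (_ *: _)]linearZ/= trB mxtrace1 trP -natr1 addrK /kp divfK// subrr.
have Pq : P *m q = q by rewrite /P dyad_mul qq scale1r.
have Zq : Z *m q = 0 by rewrite /Z mulmxBl -mulmxA Yq mulmx0 -scalemxAl mulmxBl mul1mx Pq subrr scaler0 subr0.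
have tZ : \tr (Z *m Y') = 0.
  have nZ : sphere_normal M (g t) (phi Z) by rewrite gE; apply: (normalP _ qq).2; rewrite (phiK ZS).
  by move: (par _ nZ); rewrite dotth (phiK ZS) -/Y' => /eqP; rewrite mulf_eq0 (negbTE cn) orFb => /eqP.
have main : \tr (Y' *m (Y *m Y)) = 0.
  move: tZ; rewrite /Z mulmxBl trB -scalemxAl [\tr (_ *: _)]linearZ/= mulmxBl mul1mx trB (thS _).2.
  by rewrite [\tr (P *m _)]mxtrace_mulC tYP subrr mulr0 subr0 mxtrace_mulC.
have dC := is_derive_linear (@mxtrace R n.+1 : {linear 'M[R]_n.+1 -> R^o}) (is_derive_mulmx dY (is_derive_mulmx dY dY)).
have E0 : \tr (Y' *m (Y *m Y) + Y *m (Y' *m Y + Y *m Y')) = 0.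
  rewrite mxtraceD mulmxDr mxtraceD main add0r [\tr (Y *m (Y' *m Y))]mxtrace_mulC -mulmxA main add0r.
  by rewrite mulmxA mxtrace_mulC main.
have [d d0 Hd] := is_derive_dist dC e0; exists d => // s _ sd; move: (Hd s sd).
rewrite [X in (s - t) *: X](_ : _ = 0); last exact: E0.
by rewrite scaler0 subr0.
Qed.

Let cube_transport (cv xi : R -> 'cV[R]_N) : (forall t : R, t \in `[0, 1] -> M (cv t)) ->
  piecewise_smooth cv -> parallel_normal M cv xi -> cube (xi 0) = cube (xi 1).
Proof.
move=> Mc [sc scP cS] [xiN [sx sxP xS]]; pose Rel (a b : R) := cube (xi a) = cube (xi b).
have Rt (x y z : R) : x <= y -> y <= z -> Rel x y -> Rel y z -> Rel x z by rewrite /Rel => _ _ -> ->.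
have Rr (x : R) : Rel x x by [].
suff : Rel 0 1 by [].
apply: (partition_chain_in scP Rt Rr (lexx _) ler01 (lexx _)) => i x y isz ix xy yi ax yb.
apply: (partition_chain_in sxP Rt Rr ax xy yb) => l x' y' lsz lx xy' yl xx' yy'.
have [g gs gE] := cS _ isz; have [zeta zs zE] := xS _ lsz.
have cg t : x' <= t <= y' -> cv t = g t.
  by move=> /andP[t1 t2]; apply: gE; rewrite in_itv/= (le_trans ix) ?(le_trans xx')// (le_trans t2)// (le_trans yy').
have {}zE t : x' <= t <= y' -> xi t = zeta t /\ forall eta, sphere_normal M (cv t) eta -> dotp eta (derive1 zeta t) = 0.
  by move=> /andP[t1 t2]; apply: zE; rewrite in_itv/= (le_trans lx)// (le_trans t2).
move: xy'; rewrite le_eqVlt => /orP[/eqP<-//|xy'].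
have I t : x' <= t <= y' -> t \in `[0, 1].
  by move=> /andP[t1 t2]; rewrite in_itv/= (le_trans ax) ?(le_trans xx')//= (le_trans t2)// (le_trans yy').
have [xI yI] : (x' <= x' <= y') /\ (x' <= y' <= y') by split; rewrite lexx ltW.
rewrite /Rel (zE _ xI).1 (zE _ yI).1; apply: (cube_piece gs zs xy') => t tab.
have [xE H] := zE t tab; rewrite -cg//; split=> //; first exact/Mc/I.
by rewrite -xE; exact/xiN/I.
Qed.

(** A unit normal vector with nonzero cubic invariant and its opposite have opposite invariants. *)
Lemma veronese_not_transitive :
  ~ acts_transitively_on_unit_sphere (restricted_holonomy M p) (sphere_normal M p).
Proof.
move=> H; have [Y [YS Yq Y3]] := cubic.
have Y0 : phi Y != 0.
  apply/eqP => Y0; have YZ : Y = 0 by rewrite -(phiK YS) Y0 raddf0.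
  by move: Y3; rewrite YZ mul0mx raddf0 => /eqP; rewrite eq_sym oppr_eq0 pnatr_eq0.
have [s s0 ss] := normalize_vec Y0.
have sS (r : R) : Sim0 (r *: Y) by rewrite -[r *: Y]addr0; apply: Sim0P => //; split; rewrite ?trmx0 ?mxtrace0.
have nr (r : R) : sphere_normal M p (r *: phi Y).
  by rewrite -linearZ/=; apply/normalA => //; rewrite -scalemxAl Yq scaler0.
have cr (r : R) : cube (r *: phi Y) = - 6 * r ^+ 3.
  rewrite /cube -linearZ/= phiK// -!scalemxAr -!scalemxAl -!scalemxAr !scalerA [\tr _]linearZ/= Y3; ring.
have [|tau [cv [cs Mc c0' c1' _] Ht] tE] := H (s *: phi Y) (- s *: phi Y) (nr _) (nr _) ss.
  by rewrite scaleNr dotpNl dotpNr opprK.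
have [xi [xp x0 x1]] := Ht _ (nr s).
have := cube_transport Mc cs xp; rewrite x0 x1 tE !cr => E.
have : s ^+ 3 = 0 by move: E; rewrite exprNn; lra.
by move=> /eqP; rewrite expf_eq0/= (negbTE s0).
Qed.

End veronese_orbit.

(** * From holonomy algebras to the two implications *)

Lemma word_holonomy_word (R : realType) N (h : {vspace 'M[R]_N}) k (F : 'M[R]_(N, k)) m :
  word_holonomy h F m -> exists2 w, word_in h w & m = gword [seq (a.1, nu F a.2) | a <- w].
Proof.
move=> [lam [_ Hl _] ->]; elim: lam Hl => [_|f lam IH /= [[_ fh _] /IH[w wh wE]]].
  by exists [::] => //=; rewrite /wprod big_nil gword_nil.
exists ((1, f 1) :: w); first exact/word_in_consP.
by rewrite wprod_cons wE /= gword_cons /= scale1r.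
Qed.

(** [G] consists of transposes because loops act through [m^T]. A vector orthogonal to the
    velocities of [v] under all tangent directions is orthogonal to [g0 v] by minimality of [g0]. *)
Lemma holonomy_unit_sphere (R : realType) N (h : {vspace 'M[R]_N}) k (F : 'M[R]_(N, k)) (g0 : {vspace 'M[R]_k}) (v : 'cV[R]_k) : (1 < k)%N -> lie_so h ->
  (forall S : {vspace 'M[R]_k}, (forall w X Y, word_in h w -> X \in h -> Y \in h ->
     gword [seq (a.1, nu F a.2) | a <- w] *m ncurv F X Y *m (gword [seq (a.1, nu F a.2) | a <- w])^T \in S) ->
     (g0 <= S)%VS) ->
  dotp v v = 1 ->
  (forall eta, dotp v eta = 0 -> (forall T, T \in g0 -> dotp eta (T *m v) = 0) -> eta = 0) ->
  forall y, dotp y y = 1 -> exists2 m, word_holonomy h F m & y = m^T *m v.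
Proof.
move=> k1 hh gmin vv Hv y yy; pose G : set 'M[R]_k := [set g | word_holonomy h F g^T].
suff [g Gg gE] : exists2 g, G g & y = g *m v by exists g^T; rewrite ?trmxK.
apply: orbit_sphere yy => //.
- by rewrite /G/= trmx1; exact: word_holonomy1.
- by move=> g1 g2 G1 G2; rewrite /G/= trmx_mul; exact: word_holonomyM.
- by move=> g Gg; have := word_holonomy_orth hh Gg; rewrite trmxK => /mulmx1C.
move=> eta ve Ht; apply: Hv => // T Tg.
have [||S SP] := @vspace_of_pred R 'M[R]_k (fun T => dotp eta (T *m v) = 0).
- by rewrite mul0mx dotp0r.
- by move=> a x z Hx Hz; rewrite mulmxDl -scalemxAl dotpDr dotpZr Hx Hz mulr0 addr0.
apply/SP; apply: (subvP (gmin S _)) Tg => w X Y wh Xh Yh.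
apply: (word_holonomy_curv hh) => // B [f [sf f0 fG]] BT; apply/SP.
have BT' : (B^T)^T = - B^T by rewrite BT linearN/= BT.
have := Ht B^T _ BT'; rewrite BT mulNmx dotpNl dotpC => H; apply/eqP; rewrite -oppr_eq0; apply/eqP/H.
exists (fun t => (f t)^T); split; [|by rewrite f0 trmx1|by move=> t; rewrite /G/= trmxK; exact: fG].
move=> e e0; have [r r0 Hr] := sf e e0; exists r => // s t sr tr.
rewrite -BT; have -> : (f s)^T - (f t)^T - (s *: B^T - t *: B^T) = (f s - f t - (s *: B - t *: B))^T.
  by apply/matrixP => i j; rewrite !mxE.
by rewrite norm_trmx; exact: Hr.
Qed.

(** The infinitesimal condition is given at the single vector [v]. A holonomy element relating [v]
    to the coordinates of [x] conjugates [g0] into itself, so the condition also holds there, and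
    the orbit of [x] fills the sphere. *)
Lemma holonomy_transitive (R : realType) N (h : {vspace 'M[R]_N}) (p : 'cV[R]_N) (M : set 'cV[R]_N)
    k (F : 'M[R]_(N, k)) (g0 : {vspace 'M[R]_k}) (v : 'cV[R]_k) : (1 < k)%N -> lie_so h ->
  (forall x, M x <-> exists2 w, word_in h w & x = gword w *m p) -> F^T *m F = 1%:M ->
  (forall x, sphere_normal M p x <-> F *m (F^T *m x) = x) ->
  (forall w T, word_in h w -> T \in g0 ->
     gword [seq (a.1, nu F a.2) | a <- w] *m T *m (gword [seq (a.1, nu F a.2) | a <- w])^T \in g0) ->
  (forall S : {vspace 'M[R]_k}, (forall w X Y, word_in h w -> X \in h -> Y \in h ->
     gword [seq (a.1, nu F a.2) | a <- w] *m ncurv F X Y *m (gword [seq (a.1, nu F a.2) | a <- w])^T \in S) ->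
     (g0 <= S)%VS) ->
  dotp v v = 1 ->
  (forall eta, dotp v eta = 0 -> (forall T, T \in g0 -> dotp eta (T *m v) = 0) -> eta = 0) ->
  acts_transitively_on_unit_sphere (restricted_holonomy M p) (sphere_normal M p).
Proof.
move=> k1 hh MP FF FV gj gmin vv Hv x y /FV Vx /FV Vy xx yy.
have un z : F *m (F^T *m z) = z -> dotp (F^T *m z) (F^T *m z) = dotp z z.
  by move=> zE; rewrite -(dotp_orth _ _ FF) !zE.
have [m mh xE] := holonomy_unit_sphere k1 hh gmin vv Hv (etrans (un _ Vx) xx).
have mm := word_holonomy_orth hh mh; have mm' := mulmx1C mm.
have [w wh wE] := word_holonomy_word mh.
have mv : m *m (F^T *m x) = v by rewrite xE mulmxA mm' mul1mx.
have [] := holonomy_unit_sphere k1 hh gmin (etrans (un _ Vx) xx) _ (etrans (un _ Vy) yy).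
  move=> eta xe Ht; have me0 : m *m eta = 0; last by rewrite -[eta]mul1mx -mm -mulmxA me0 mulmx0.
  apply: Hv => [|T Tg]; first by rewrite -mv dotp_orth.
  have [w' wh' wE'] := @nuword_inv R N h hh k F w wh.
  have := gj _ _ wh' Tg; rewrite wE' -wE trmxK => /Ht.
  by rewrite -!mulmxA mv -dotp_mulmxl.
move=> m' mh' yE; exists (fun z => F *m (m'^T *m (F^T *m z))); first exact: (word_holonomyP hh MP FF FV mh').
by rewrite -yE.
Qed.

Lemma homogeneous_words (R : realType) N (M : set 'cV[R]_N) p : homogeneous M -> M p ->
  exists2 h : {vspace 'M[R]_N}, lie_so h & forall x, M x <-> exists2 w, word_in h w & x = gword w *m p.
Proof.
move=> [H [v [[h [hT hB HE]] ME]]] Mp; have hh : lie_so h by split.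
exists h => //; apply: (orbit_change hh _ Mp) => x; rewrite ME HE; split.
  move=> [_ [s sh ->] <-]; exists [seq (1, A) | A <- s].
    by move=> a /mapP[A As ->]; exact: sh.
  by rewrite /gword big_map; under [in RHS]eq_bigr do rewrite /= scale1r.
move=> [w wh ->]; exists (gword w) => //; exists [seq a.1 *: a.2 | a <- w].
  by move=> A /mapP[a aw ->]; apply: memvZ; exact: wh.
by rewrite /gword big_map.
Qed.

(** The image under [F] of a subspace stable under [g0] is preserved by the holonomy, by
    [holonomy_preserves] with the chart that [orbit_plaque] supplies. *)
Lemma holonomy_irreducible (R : realType) N (h : {vspace 'M[R]_N}) (p : 'cV[R]_N) (M : set 'cV[R]_N)
    k (F : 'M[R]_(N, k)) (g0 : {vspace 'M[R]_k}) : lie_so h ->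
  (forall x, M x <-> exists2 w, word_in h w & x = gword w *m p) -> F^T *m F = 1%:M ->
  (forall x, sphere_normal M p x <-> F *m (F^T *m x) = x) -> lie_so g0 ->
  (forall X Y, X \in h -> Y \in h -> ncurv F X Y \in g0) ->
  (forall X T, X \in h -> T \in g0 -> nu F X *m T - T *m nu F X \in g0) ->
  (forall w T, word_in h w -> T \in g0 -> mword F w *m T *m (mword F w)^T \in g0) ->
  acts_irreducibly (restricted_holonomy M p) (sphere_normal M p) ->
  forall W : {vspace 'cV[R]_k}, (forall T x, T \in g0 -> x \in W -> T *m x \in W) -> W = 0%VS \/ W = fullv.
Proof.
move=> hh MP FF FV gs gc ga gj [_ irr] W Wg.
have [B [BB WB]] := orthonormal_basis W.
have BW y : B *m y \in W by rewrite WB (mulmxA B^T) BB mul1mx.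
have Bg T : T \in g0 -> T *m B = B *m (B^T *m T *m B).
  move=> Tg; apply: mx_ext => y; have := Wg _ _ Tg (BW y); rewrite WB => /eqP E.
  by rewrite -!mulmxA E.
have [d [X [rho [K [beta [Xh [rho0 K0] b0 betaL plq]]]]]] := @orbit_plaque R N h p hh.
have [||U UP] := @vspace_of_pred R 'cV[R]_N (fun x => sphere_normal M p x /\ F^T *m x \in W).
- by split; rewrite ?mulmx0 ?mem0v//; apply/FV; rewrite !mulmx0.
- move=> a x y [/FV Hx xW] [/FV Hy yW]; split; last by rewrite mulmxDr -scalemxAr memvD// memvZ.
  by apply/FV; rewrite mulmxDr -scalemxAr mulmxDr -scalemxAr Hx Hy.
have PW y : (1%:M - B *m B^T) *m y = 0 <-> y \in W.
  rewrite mulmxBl mul1mx -mulmxA WB; split=> [/eqP|/eqP->]; last by rewrite subrr.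
  by rewrite subr_eq0 eq_sym.
have [||U0|UV] := irr U.
- by move=> x /UP[].
- move=> tau x taux /UP[Vx xW]; apply/UP; split.
    have [c [_ _ _ c1 _] Ht] := taux; have [xi [[xiN _] _ <-]] := Ht _ Vx.
    by rewrite -c1; apply: xiN; rewrite in_itv/= ler01 lexx.
  have := holonomy_preserves hh MP FF FV gs gc ga gj Xh rho0 K0 b0 betaL plq BB Bg taux ((PW _).2 xW).
  by move=> /PW; have /FV -> := Vx.
- left; apply/eqP; rewrite -subv0; apply/subvP => y yW; rewrite memv0.
  have : F *m y \in U.
    by apply/UP; split; [exact: frame_normal|rewrite mulmxA FF mul1mx].
  rewrite U0 memv0 => /eqP Fy; apply/eqP; by rewrite -[y]mul1mx -FF -mulmxA Fy mulmx0.
right; apply/vspaceP => y; rewrite memvf.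
have /UP[_] := UV _ (frame_normal FF FV y); rewrite mulmxA FF mul1mx => ->.
by [].
Qed.

Lemma irreducible_intransitive_veronese (R : realType) N n (M : set 'cV[R]_N) (p : 'cV[R]_N) :
  (2 < n)%N -> N = (n + (n * n.+1)./2)%N -> homogeneous M -> has_dim M n ->
  (forall x, M x -> dotp x x = 1) -> M p ->
  acts_irreducibly (restricted_holonomy M p) (sphere_normal M p) ->
  ~ acts_transitively_on_unit_sphere (restricted_holonomy M p) (sphere_normal M p) ->
  veronese n M /\ full M.
Proof.
move=> hn hN homM dimM sph Mp irrH ntrH.
have [h hh MP] := homogeneous_words homM Mp; have pp := sph _ Mp.
have [T [dT TP]] := dimM _ Mp.
have [e [ee eP]] : exists e : 'M[R]_(N, n), e^T *m e = 1%:M /\ forall u, (u \in T) = (e *m (e^T *m u) == u).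
  by move: (orthonormal_basis T); rewrite dT.
have Th u : u \in T <-> exists2 Y, Y \in h & u = Y *m p by rewrite -TP; exact: (orbit_tangent hh MP).
have NP x : sphere_normal M p x <-> dotp p x = 0 /\ forall Y, Y \in h -> dotp (Y *m p) x = 0.
  exact: (orbit_sphere_normal hh MP).
have [||V VP] := @vspace_of_pred R 'cV[R]_N (sphere_normal M p).
- by apply/NP; split=> [|Y _]; rewrite dotp0r.
- move=> a x y /NP[x1 x2] /NP[y1 y2]; apply/NP; split=> [|Y Yh].
    by rewrite dotpDr dotpZr x1 y1 mulr0 addr0.
  by rewrite dotpDr dotpZr x2// y2// mulr0 addr0.
have [F [FF HF]] := orthonormal_basis V; move: (\dim V) F FF HF => k F FF HF.
have FV x : sphere_normal M p x <-> F *m (F^T *m x) = x by rewrite -VP HF; split=> [/eqP|->].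
have eT y : e *m y \in T by rewrite eP (mulmxA e^T) ee mul1mx.
have Fn y := (NP _).1 (frame_normal FF FV y).
have skp Y : Y \in h -> dotp (Y *m p) p = 0 by move=> Yh; apply: dotp_skew0; exact: hh.1.
have ep : e^T *m p = 0.
  by apply: trmul0_dotp => y; have /Th[Y Yh ->] := eT y; exact: skp.
have Fp : F^T *m p = 0 by apply: trmul0_dotp => y; rewrite dotpC; have [] := Fn y.
have FY Y : Y \in h -> F^T *m (Y *m p) = 0.
  by move=> Yh; apply: trmul0_dotp => y; rewrite dotpC; have [_] := Fn y; apply.
have Fe : F^T *m e = 0.
  by apply: mx_ext => y; rewrite mul0mx -mulmxA; have /Th[Y Yh ->] := eT y; exact: FY.
have eF : e^T *m F = 0 by rewrite -[e^T *m F]trmxK trmx_mul trmxK Fe trmx0.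
have res : p *m p^T + e *m e^T + F *m F^T = 1%:M.
  apply: mx_ext => x; rewrite mul1mx !mulmxDl dyad_mul -!mulmxA.
  pose z := x - dotp p x *: p - e *m (e^T *m x).
  have ez : e^T *m z = 0.
    by rewrite /z !mulmxBr -scalemxAr ep scaler0 subr0 (mulmxA e^T e) ee mul1mx subrr.
  have Fz : F^T *m z = F^T *m x.
    by rewrite /z !mulmxBr -scalemxAr Fp scaler0 subr0 (mulmxA F^T e) Fe mul0mx subr0.
  have : sphere_normal M p z.
    apply/NP; split.
      by rewrite /z !dotpBr dotpZr pp mulr1 subrr dotp_mulmxr ep dotp0l subrr.
    move=> Y Yh; have : Y *m p \in T by apply/Th; exists Y.
    by rewrite eP => /eqP <-; rewrite dotp_mulmxl ez dotp0r.
  move=> /FV; rewrite Fz => ->; rewrite /z; move: (dotp p x *: p) (e *m _) => a b.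
  by apply/matrixP => i j; rewrite !mxE; ring.
(* Traces in the splitting [res] count dimensions: 1 + n + k is the ambient dimension. *)
have hk : k.+1 = (n * n.+1)./2.
  have /eqP := congr1 (@mxtrace R N) res; rewrite !mxtraceD mxtrace1.
  rewrite mxtrace_mulC [\tr (e *m _)]mxtrace_mulC [\tr (F *m _)]mxtrace_mulC ee FF !mxtrace1 unit_dyad// mxtrace1.
  by rewrite -!natrD eqr_nat => /eqP; rewrite hN; move: (_./2) => b; lia.
have k1 : (1 < k)%N.
  have : (6 <= (n * n.+1)./2)%N by apply: (@half_leq 12); exact: (@leq_mul 3 4).
  by rewrite -hk; lia.
have onto x : exists2 X, X \in h & X *m p = e *m x.
  by have /Th[Y Yh ->] := eT x; exists Y.
have [g0 [gs gc ga gj gmin]] := curvature_algebra hh F.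
have gz : (forall X Y, X \in h -> Y \in h -> ncurv F X Y = 0) -> g0 = 0%VS.
  move=> nz; apply/eqP; rewrite -subv0; apply: gmin => w X Y _ Xh Yh.
  by rewrite nz// mulmx0 mul0mx mem0v.
have irr := holonomy_irreducible hh MP FF FV gs gc ga gj irrH.
(* If at some nonzero [v] only multiples of [v] were orthogonal to [g0 v], the holonomy would be
   transitive. *)
have ntr (v : 'cV[R]_k) : v != 0 ->
    exists2 eta, (forall c : R, eta != c *: v) & forall T, T \in g0 -> dotp eta (T *m v) = 0.
  move=> v0; apply: contrapT => H; apply: ntrH; have [s s0 ss] := normalize_vec v0.
  apply: (holonomy_transitive k1 hh MP FF FV gj gmin ss) => eta ve Ht; apply: contrapT => eta0; apply: H.
  exists eta => [c|S Sg].
    apply/eqP => etaE; move: ve; rewrite etaE dotpZl dotpZr => /eqP.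
    rewrite !mulf_eq0 (negbTE s0) dotp_eq0 (negbTE v0) orbF/= => /eqP c0.
    by apply: eta0; rewrite etaE c0 scale0r.
  have := Ht _ Sg; rewrite -scalemxAr dotpZr => /eqP; rewrite mulf_eq0 (negbTE s0) => /eqP.
  by [].
exact: (orbit_is_veronese hn hk hh pp ee FF ep Fp Fe res FY onto gs gc ga gz irr ntr MP).
Qed.

Lemma veronese_irreducible_intransitive (R : realType) N n (M : set 'cV[R]_N) (p : 'cV[R]_N) :
  (2 < n)%N -> (forall x, M x -> dotp x x = 1) -> M p -> veronese n M -> full M ->
  acts_irreducibly (restricted_holonomy M p) (sphere_normal M p) /\
  ~ acts_transitively_on_unit_sphere (restricted_holonomy M p) (sphere_normal M p).
Proof.
move=> hn sph Mp vM fM; have n0 : (0 < n)%N by exact: ltn_trans hn.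
have [phi [c [t [[c0 t0] dot onto ME]]]] := veronese_normal_form n0 vM fM sph.
have /ME[q qq ->] := Mp; split.
  exact: (veronese_irreducible hn c0 t0 dot onto ME qq).
exact: (veronese_not_transitive hn c0 t0 dot onto ME qq).
Qed.

Theorem theoremA (R : realType) (n : nat) (hn : (3 <= n)%N)
    (M : set 'cV[R]_(n + (n * n.+1)./2)%N)
    (M_homogeneous : homogeneous M)
    (M_dim : has_dim M n)
    (M_sphere : forall x, M x -> dotp x x = 1)
    (p : 'cV[R]_(n + (n * n.+1)./2)%N) (hp : M p) :
  (veronese n M /\ full M) <->
  (acts_irreducibly (restricted_holonomy M p) (sphere_normal M p) /\
   ~ acts_transitively_on_unit_sphere
       (restricted_holonomy M p) (sphere_normal M p)).
Proof.
split=> [[vM fM]|[irr ntr]]; first exact: (veronese_irreducible_intransitive hn M_sphere hp vM fM).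
exact: (irreducible_intransitive_veronese hn erefl M_homogeneous M_dim M_sphere hp irr ntr).
Qed.
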